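(* Let $\kappa>0$ be a real number and $\alpha=1/\kappa$. There is a real number $\sigma_\kappa\in(0,1]$ such that $\zeta_\kappa(s)$ extends meromorphically to $\Re(s)>-\sigma_\kappa$, its only singularities there being simple poles at $s=\alpha,\alpha-1,\dots,\alpha+1-\lceil\alpha\rceil$, with residues $$\operatorname*{Res}_{s=\alpha-h}\zeta_\kappa(s)=\frac{\Gamma(\alpha+1)}{(h+1)!\,\Gamma(\alpha-h)},\qquad h=0,1,\dots,\lceil\alpha\rceil-1.$$ Furthermore, for any $\varepsilon>0$ and all $s$ with $\Re(s)\ge\varepsilon-\sigma_\kappa$ and $|\Im(s)|\ge1$, $$\zeta_\kappa(s)\ll_{\varepsilon}|s|(|s|+1)^{\lfloor\alpha\rfloor+1}$$ (the implied constant may also depend on $\kappa$). Moreover, $$\zeta_\kappa(0)=-\frac{\mathbf 1_{\alpha\notin\mathbb N}}{2}-\frac{\mathbf 1_{\alpha\in\mathbb N}}{1+\kappa},$$ and $$\zeta_\kappa'(0)=\begin{cases}\displaystyle\sum_{0\le h<\alpha}\binom{\alpha}{h}\zeta'(-h), & \alpha\in\mathbb N,\\[2ex] \displaystyle\sum_{1\le h\le\lceil\alpha\rceil}\frac{\zeta(h-\alpha)-1}{h}+\sum_{n\ge2}\log\left(\frac{E_0(1/n)^{\widetilde B_1(n^\alpha)+\mathbf 1_{n^\alpha\in\mathbb N}}}{E_{\lceil\alpha\rceil}(1/n)^{n^\alpha}}\right), & \alpha\notin\mathbb N.\end{cases}$$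
   Context: $\mathbb N=\{1,2,\dots\}$; $\zeta$ is the Riemann zeta function; $\mathbf 1$ denotes an indicator; $\{x\}$ is the fractional part of $x$. The Piatetski-Shapiro zeta function is $\zeta_\kappa(s)=\sum_{n\ge1}\lfloor n^\kappa\rfloor^{-s}$ for $\Re(s)>\alpha=1/\kappa$. Also $\widetilde B_1(x)=\{x\}-1/2$, $E_0(z)=1-z$, and $E_h(z)=(1-z)\exp\left(\sum_{1\le j\le h}z^j/j\right)$ for $h\ge1$. The infinite series over $n\ge2$ is summed in increasing order of $n$ (limit of partial sums). *)

(* Defs.v *)
From Stdlib Require Export Reals ZArith ClassicalEpsilon.
From Coquelicot Require Export Coquelicot.
Open Scope R_scope.

Definition Cexp (z : C) : C :=
  (RtoC (exp (Re z)) * (cos (Im z), sin (Im z)))%C.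

(* The principal power x^s of a positive real base x. *)
Definition cpow (x : R) (s : C) : C := Cexp (s * RtoC (ln x))%C.

Definition complex_differentiable (f : C -> C) (z : C) : Prop :=
  ex_derive (K := C_AbsRing) (V := C_NormedModule) f z.

(* As a predicate on total functions this is meant for open sets [D]. *)
Definition holomorphic_on (D : C -> Prop) (f : C -> C) : Prop :=
  forall z, D z -> complex_differentiable f z.

Definition holomorphic_at (f : C -> C) (p : C) : Prop :=
  locally (T := C_UniformSpace) p (complex_differentiable f).

(* [f] has a simple pole at [p] with residue [r]: on a punctured neighbourhood
   of [p] the Laurent expansion of [f] has principal part r / (z - p), with
   r <> 0.  The value [f p] is irrelevant. *)
Definition simple_pole_residue (f : C -> C) (p r : C) : Prop :=
  r <> RtoC 0 /\
  exists g : C -> C,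
    holomorphic_at g p /\
    locally' (T := C_UniformSpace) p
      (fun z => f z = (r / (z - p) + g z)%C).

Definition is_Cseries (a : nat -> C) (l : C) : Prop :=
  is_series (K := C_AbsRing) (V := C_NormedModule) a l.

Definition is_riemann_zeta (f : C -> C) : Prop :=
  (forall s : C, 1 < Re s ->
     is_Cseries (fun k => cpow (INR (S k)) (- s)%C) (f s)) /\
  holomorphic_on (fun s => s <> RtoC 1) f.

(* The Riemann zeta function is the analytic continuation of its Dirichlet
   series to C \ {1}.  That continuation exists and is unique off s = 1, so the
   choice made here only concerns the (meaningless) value at s = 1. *)
Definition zeta : C -> C := epsilon (inhabits (fun _ : C => RtoC 0)) is_riemann_zeta.

(* l = sum_{n >= 1} floor(n^kappa)^(-s); all bases are >= 1 when kappa > 0. *)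
Definition is_PS_zeta (kappa : R) (s l : C) : Prop :=
  is_Cseries
    (fun k => cpow (IZR (Zfloor (Rpower (INR (S k)) kappa))) (- s)%C) l.

(* Euler's integral; it converges for x > 0, the only range in which it is used. *)
Definition Gamma (x : R) : R :=
  RInt_gen (fun t => Rpower t (x - 1) * exp (- t))
           (at_right 0) (Rbar_locally p_infty).

Definition in_N (x : R) : Prop := exists n : nat, (1 <= n)%nat /\ x = INR n.

Definition indicator (P : Prop) : R :=
  if excluded_middle_informative P then 1 else 0.

Definition B1 (x : R) : R := frac_part x - 1 / 2.

Definition Eprim (h : nat) (z : R) : R :=
  match h with
  | O => 1 - z
  | S _ => (1 - z) * exp (sum_n_m (fun j => z ^ j / INR j) 1 h)
  end.

Definition ceiln (x : R) : nat := Z.to_nat (Zceil x).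

Definition floorn (x : R) : nat := Z.to_nat (Zfloor x).

Definition log_term (alpha : R) (n : nat) : R :=
  let na := Rpower (INR n) alpha in
  ln (Rpower (Eprim 0 (1 / INR n)) (B1 na + indicator (in_N na))
      / Rpower (Eprim (ceiln alpha) (1 / INR n)) na).

(* Main.v *)
Require Import Defs.
From Stdlib Require Import Lra Lia.

(** With c(m) the ceiling of m^alpha, exactly c(m+1) - c(m) integers n satisfy
    floor(n^kappa) = m; summing by parts, for Re s > alpha,
      zeta_kappa(s) = -1 + sum_{n >= 2} c(n) ((n-1)^-s - n^-s).
    Write c(n) = n^alpha + 1/2 - psi(n).  The part with n^alpha is continued by
    expanding (1 - 1/n)^-s in a binomial series, which produces shifted values
    of zeta and hence the poles.  If alpha is an integer, psi = 1/2 and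
    everything reduces to the finite sum over h < alpha of C(alpha,h) zeta(s-h).
    Otherwise Weyl differencing down to the Kusmin-Landau inequality, together
    with Fejer's kernel, saves a power of M in sum_{n <= M} psi(n), and a second
    summation by parts makes the part with psi converge for Re s > -delta.

    The function (w-1) zeta(w) is made entire by solving the binomial expansion of
    sum_m ((m+1)^(1-w) - m^(1-w)) = -1 recursively for zeta(w).  Termwise
    differentiation, removable singularities and the uniqueness of the
    continuation all rest on Cauchy's formula for squares, which follows from
    Goursat's theorem because derivatives are only assumed to exist. *)

(** * Complex differentiability *)

(** The part with psi fixes the shape of the proof. As psi is merely bounded, sum psi(n) ((n-1)^-s -
    n^-s) converges absolutely only for Re s > 0, whereas the claims at s = 0 need a neighbourhood
    of 0. Some power saving in the partial sums of psi is therefore indispensable, but its size is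
    free, because sigma_kappa is only asserted to exist; the exponents in the estimates of
    exponential sums are chosen for convenience. When k < alpha < k+1, the difference of order k+1
    of n^alpha is the first one that tends to 0, and its slow decay is what Kusmin-Landau needs
    after k differencing steps.

    The strip has a second limit: the binomial series is cut after ceil(alpha) terms, and the
    remainder converges for Re s > alpha - ceil(alpha). For non-integer alpha, sigma_kappa is the
    smaller of the two widths.

    At s = 0 every term except the constant -1 + 1/2 vanishes, whence zeta_kappa(0) = -1/2 for
    non-integer alpha. Differentiating the vanishing terms at 0 turns binomial coefficients into the
    coefficients 1/j of the logarithm, which is how E_0 and E_ceil(alpha) appear. *)

Lemma im_le_Cmod (c : C) : Rabs (Im c) <= Cmod c.
Proof.
  generalize (Rmax_Cmod c); intro H.
  eapply Rle_trans; [apply Rmax_r | exact H].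
Qed.

Lemma Cmod_le_abs (c : C) : Cmod c <= Rabs (Re c) + Rabs (Im c).
Proof.
  replace c with (RtoC (Re c) + Ci * RtoC (Im c))%C at 1
    by (destruct c; apply injective_projections; simpl; ring).
  eapply Rle_trans; [apply Cmod_triangle|].
  rewrite Cmod_mult, Cmod_Ci, !Cmod_R; lra.
Qed.

Lemma Cmod_minus_sym (a b : C) : Cmod (a - b) = Cmod (b - a).
Proof. rewrite <- Cmod_opp; f_equal; ring. Qed.

Lemma Cmod_triangle_inv (a b : C) : Cmod a - Cmod b <= Cmod (a - b).
Proof.
  generalize (Cmod_triangle (a - b) b).
  replace (a - b + b)%C with a by ring; lra.
Qed.

(** Common ground between two normed module structures on C: [complex_differentiable] is stated for
    [C_NormedModule], while the product and identity rules used below live in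
    [AbsRing_NormedModule C_AbsRing]. *)
Definition cder (f : C -> C) (z l : C) : Prop :=
  forall eps, 0 < eps -> exists d, 0 < d /\
    forall w, Cmod (w - z) < d ->
      Cmod (f w - f z - (w - z) * l) <= eps * Cmod (w - z).

Lemma cder_is_derive (f : C -> C) (z l : C) :
  cder f z l <-> is_derive (K := C_AbsRing) (V := C_NormedModule) f z l.
Proof.
  split; intro H.
  - split.
    + apply is_linear_scal_l.
    + intros x Hx eps.
      assert (E : z = x).
      { apply (is_filter_lim_locally_unique (K := C_AbsRing) (V := AbsRing_NormedModule C_AbsRing)) in Hx; exact Hx. }
      subst x.
      destruct (H eps (cond_pos eps)) as [d [Hd H']].
      exists (mkposreal d Hd); intros w Hw.
      apply (H' w), Hw.
  - intros eps Heps.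
    destruct H as [_ H].
    specialize (H z (fun P HP => HP) (mkposreal eps Heps)).
    destruct H as [d H].
    exists d; split; [apply cond_pos|].
    intros w Hw; apply (H w), Hw.
Qed.

Lemma cder_is_derive_ring (f : C -> C) (z l : C) :
  cder f z l <-> is_derive (K := C_AbsRing) (V := AbsRing_NormedModule C_AbsRing) f z l.
Proof.
  split; intro H.
  - split.
    + exact (is_linear_scal_l (K := C_AbsRing) (V := AbsRing_NormedModule C_AbsRing) l).
    + intros x Hx eps.
      assert (E : z = x).
      { apply (is_filter_lim_locally_unique (K := C_AbsRing) (V := AbsRing_NormedModule C_AbsRing)) in Hx; exact Hx. }
      subst x.
      destruct (H eps (cond_pos eps)) as [d [Hd H']].
      exists (mkposreal d Hd); intros w Hw.
      apply (H' w), Hw.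
  - intros eps Heps.
    destruct H as [_ H].
    specialize (H z (fun P HP => HP) (mkposreal eps Heps)).
    destruct H as [d H].
    exists d; split; [apply cond_pos|].
    intros w Hw; apply (H w), Hw.
Qed.

Lemma cder_differentiable (f : C -> C) (z : C) :
  complex_differentiable f z <-> exists l, cder f z l.
Proof.
  split; intros [l H]; exists l; apply cder_is_derive, H.
Qed.

Lemma cder_const (a z : C) : cder (fun _ => a) z (RtoC 0).
Proof.
  apply cder_is_derive, (is_derive_const (K := C_AbsRing) (V := C_NormedModule) a z).
Qed.

Lemma cder_id (z : C) : cder (fun w => w) z (RtoC 1).
Proof. apply cder_is_derive_ring, (is_derive_id (K := C_AbsRing) z). Qed.

Lemma cder_plus (f g : C -> C) (z l m : C) :
  cder f z l -> cder g z m -> cder (fun w => f w + g w)%C z (l + m)%C.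
Proof.
  intros Hf Hg; apply cder_is_derive in Hf; apply cder_is_derive in Hg.
  apply cder_is_derive.
  exact (is_derive_plus (K := C_AbsRing) (V := C_NormedModule) f g z l m Hf Hg).
Qed.

Lemma cder_mult (f g : C -> C) (z l m : C) :
  cder f z l -> cder g z m -> cder (fun w => f w * g w)%C z (l * g z + f z * m)%C.
Proof.
  intros Hf Hg; apply cder_is_derive_ring in Hf; apply cder_is_derive_ring in Hg.
  apply cder_is_derive_ring.
  exact (is_derive_mult (K := C_AbsRing) f g z l m Hf Hg Cmult_comm).
Qed.

Lemma cder_comp (f g : C -> C) (z l m : C) :
  cder f (g z) l -> cder g z m -> cder (fun w => f (g w)) z (l * m)%C.
Proof.
  intros Hf Hg; apply cder_is_derive in Hf; apply cder_is_derive_ring in Hg.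
  apply cder_is_derive.
  replace (l * m)%C with (m * l)%C by ring.
  exact (is_derive_comp (K := C_AbsRing) (V := C_NormedModule) f g z l m Hf Hg).
Qed.

Lemma cder_ext_loc (f g : C -> C) (z l : C) (r : R) :
  0 < r -> (forall w, Cmod (w - z) < r -> f w = g w) -> cder f z l -> cder g z l.
Proof.
  intros Hr E H eps Heps.
  destruct (H eps Heps) as [d [Hd H']].
  exists (Rmin d r); split; [apply Rmin_glb_lt; lra|].
  intros w Hw.
  rewrite <- (E w), <- (E z).
  - apply H'; eapply Rlt_le_trans; [exact Hw | apply Rmin_l].
  - replace (z - z)%C with (RtoC 0) by ring; rewrite Cmod_0; lra.
  - eapply Rlt_le_trans; [exact Hw | apply Rmin_r].
Qed.

Lemma cder_ext (f g : C -> C) (z l : C) :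
  (forall w, f w = g w) -> cder f z l -> cder g z l.
Proof. intros E; apply (cder_ext_loc f g z l 1); [lra | intros w _; apply E]. Qed.

Lemma cder_scal (a : C) (f : C -> C) (z l : C) :
  cder f z l -> cder (fun w => a * f w)%C z (a * l)%C.
Proof.
  intro H; replace (a * l)%C with (RtoC 0 * f z + a * l)%C by ring.
  apply (cder_mult (fun _ => a) f); [apply cder_const | exact H].
Qed.

Lemma cder_opp (f : C -> C) (z l : C) : cder f z l -> cder (fun w => - f w)%C z (- l)%C.
Proof.
  intro H.
  replace (- l)%C with (- RtoC 1 * l)%C by ring.
  apply cder_ext with (fun w => - RtoC 1 * f w)%C; [intro w; ring|].
  apply cder_scal, H.
Qed.

Lemma cder_minus (f g : C -> C) (z l m : C) :
  cder f z l -> cder g z m -> cder (fun w => f w - g w)%C z (l - m)%C.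
Proof. intros Hf Hg; apply (cder_plus f (fun w => - g w)%C); [exact Hf | apply cder_opp, Hg]. Qed.

Lemma cder_eq (f : C -> C) (z l m : C) : l = m -> cder f z l -> cder f z m.
Proof. intros ->; auto. Qed.

Definition ccont (f : C -> C) (z : C) : Prop :=
  forall eps, 0 < eps -> exists d, 0 < d /\
    forall w, Cmod (w - z) < d -> Cmod (f w - f z) < eps.

Lemma cder_ccont (f : C -> C) (z l : C) : cder f z l -> ccont f z.
Proof.
  intros H eps Heps.
  destruct (H 1 Rlt_0_1) as [d [Hd H']].
  assert (Hl : 0 < 2 + Cmod l) by (generalize (Cmod_ge_0 l); lra).
  exists (Rmin d (eps / (2 + Cmod l))); split.
  { apply Rmin_glb_lt; [exact Hd | apply Rdiv_lt_0_compat; lra]. }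
  intros w Hw.
  assert (H1 : Cmod (w - z) < d) by (eapply Rlt_le_trans; [exact Hw | apply Rmin_l]).
  assert (H2 : Cmod (w - z) < eps / (2 + Cmod l)) by (eapply Rlt_le_trans; [exact Hw | apply Rmin_r]).
  specialize (H' w H1).
  replace (f w - f z)%C with ((f w - f z - (w - z) * l) + (w - z) * l)%C by ring.
  eapply Rle_lt_trans; [apply Cmod_triangle|].
  rewrite Cmod_mult.
  apply Rle_lt_trans with (Cmod (w - z) * (2 + Cmod l)).
  { generalize (Cmod_ge_0 (w - z)); nra. }
  apply Rlt_le_trans with (eps / (2 + Cmod l) * (2 + Cmod l)); [|right; field; lra].
  apply Rmult_lt_compat_r; lra.
Qed.

Lemma cder_inv (z : C) : z <> RtoC 0 -> cder Cinv z (- / (z * z))%C.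
Proof.
  intros Hz eps Heps.
  assert (Hm : 0 < Cmod z) by (apply Cmod_gt_0, Hz).
  set (m := Cmod z) in *.
  (* The first bound gives |w| >= m/2; with it the second bounds |w - z| / (m^2 |w|) by eps/2. *)
  exists (Rmin (m / 2) (eps * (m * m * m) / 4)); split.
  { apply Rmin_glb_lt; [lra|]. apply Rdiv_lt_0_compat; [|lra].
    repeat apply Rmult_lt_0_compat; lra. }
  intros w Hw.
  assert (H1 : Cmod (w - z) < m / 2) by (eapply Rlt_le_trans; [exact Hw | apply Rmin_l]).
  assert (H2 : Cmod (w - z) < eps * (m * m * m) / 4) by (eapply Rlt_le_trans; [exact Hw | apply Rmin_r]).
  assert (Hwm : m / 2 <= Cmod w).
  { generalize (Cmod_triangle_inv z w); rewrite Cmod_minus_sym; unfold m in *; lra. }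
  assert (Hw0 : w <> RtoC 0) by (apply Cmod_gt_0; lra).
  replace (/ w - / z - (w - z) * - / (z * z))%C
    with ((w - z) * ((w - z) / (z * z * w)))%C by (field; split; assumption).
  rewrite Cmod_mult, Rmult_comm.
  apply Rmult_le_compat_r; [apply Cmod_ge_0|].
  rewrite Cmod_div by (repeat apply Cmult_neq_0; assumption).
  rewrite !Cmod_mult; fold m.
  apply Rle_div_l; [repeat apply Rmult_lt_0_compat; lra|].
  assert (0 < m * m) by nra.
  assert (m * m * (m / 2) <= m * m * Cmod w) by (apply Rmult_le_compat_l; lra).
  assert (eps * (m * m * (m/2)) <= eps * (m * m * Cmod w)) by (apply Rmult_le_compat_l; lra).
  replace (eps * (m * m * m) / 4) with (eps * (m * m * (m/2)) / 2) in H2 by field.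
  assert (0 < eps * (m * m * (m / 2))) by (repeat apply Rmult_lt_0_compat; lra).
  lra.
Qed.

Lemma cder_inv_comp (f : C -> C) (z l : C) : f z <> RtoC 0 ->
  cder f z l -> cder (fun w => / f w)%C z (- l / (f z * f z))%C.
Proof.
  intros Hz H.
  eapply cder_eq; [|apply (cder_comp Cinv f); [apply cder_inv, Hz | exact H]].
  field; exact Hz.
Qed.

Definition cdiff (f : C -> C) (z : C) : Prop := exists l, cder f z l.

Lemma cdiff_const (a z : C) : cdiff (fun _ => a) z.
Proof. eexists; apply cder_const. Qed.
Lemma cdiff_id (z : C) : cdiff (fun w => w) z.
Proof. eexists; apply cder_id. Qed.
Lemma cdiff_plus (f g : C -> C) (z : C) :
  cdiff f z -> cdiff g z -> cdiff (fun w => f w + g w)%C z.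
Proof. intros [l Hl] [m Hm]; eexists; apply cder_plus; eassumption. Qed.
Lemma cdiff_opp (f : C -> C) (z : C) : cdiff f z -> cdiff (fun w => - f w)%C z.
Proof. intros [l Hl]; eexists; apply cder_opp; eassumption. Qed.
Lemma cdiff_minus (f g : C -> C) (z : C) :
  cdiff f z -> cdiff g z -> cdiff (fun w => f w - g w)%C z.
Proof. intros [l Hl] [m Hm]; eexists; apply cder_minus; eassumption. Qed.
Lemma cdiff_mult (f g : C -> C) (z : C) :
  cdiff f z -> cdiff g z -> cdiff (fun w => f w * g w)%C z.
Proof. intros [l Hl] [m Hm]; eexists; apply cder_mult; eassumption. Qed.
Lemma cdiff_comp (f g : C -> C) (z : C) :
  cdiff f (g z) -> cdiff g z -> cdiff (fun w => f (g w)) z.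
Proof. intros [l Hl] [m Hm]; eexists; apply cder_comp; eassumption. Qed.
Lemma cdiff_inv (f : C -> C) (z : C) :
  f z <> RtoC 0 -> cdiff f z -> cdiff (fun w => / f w)%C z.
Proof. intros Hz [l Hl]; eexists; apply cder_inv_comp; eassumption. Qed.
Lemma cdiff_div (f g : C -> C) (z : C) :
  g z <> RtoC 0 -> cdiff f z -> cdiff g z -> cdiff (fun w => f w / g w)%C z.
Proof. intros Hz Hf Hg; apply (cdiff_mult f (fun w => / g w)%C); [exact Hf | apply cdiff_inv; assumption]. Qed.
Lemma cdiff_ext_loc (f g : C -> C) (z : C) (r : R) :
  0 < r -> (forall w, Cmod (w - z) < r -> f w = g w) -> cdiff f z -> cdiff g z.
Proof. intros Hr E [l Hl]; exists l; eapply cder_ext_loc; eassumption. Qed.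
Lemma cdiff_ccont (f : C -> C) (z : C) : cdiff f z -> ccont f z.
Proof. intros [l Hl]; eapply cder_ccont; eassumption. Qed.

Lemma ccont_plus (f g : C -> C) (z : C) :
  ccont f z -> ccont g z -> ccont (fun w => f w + g w)%C z.
Proof.
  intros Hf Hg eps Heps.
  destruct (Hf (eps / 2)) as [d1 [Hd1 H1]]; [lra|].
  destruct (Hg (eps / 2)) as [d2 [Hd2 H2]]; [lra|].
  exists (Rmin d1 d2); split; [apply Rmin_glb_lt; lra|].
  intros w Hw.
  assert (Ha := H1 w (Rlt_le_trans _ _ _ Hw (Rmin_l _ _))).
  assert (Hb := H2 w (Rlt_le_trans _ _ _ Hw (Rmin_r _ _))).
  replace (f w + g w - (f z + g z))%C with ((f w - f z) + (g w - g z))%C by ring.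
  eapply Rle_lt_trans; [apply Cmod_triangle | lra].
Qed.

Lemma ccont_mult (f g : C -> C) (z : C) :
  ccont f z -> ccont g z -> ccont (fun w => f w * g w)%C z.
Proof.
  intros Hf Hg eps Heps.
  assert (Hfz := Cmod_ge_0 (f z)). assert (Hgz := Cmod_ge_0 (g z)).
  set (e := Rmin 1 (eps / (Cmod (f z) + Cmod (g z) + 2))).
  assert (He : 0 < e) by (apply Rmin_glb_lt; [lra | apply Rdiv_lt_0_compat; lra]).
  destruct (Hf e He) as [d1 [Hd1 H1]].
  destruct (Hg e He) as [d2 [Hd2 H2]].
  exists (Rmin d1 d2); split; [apply Rmin_glb_lt; lra|].
  intros w Hw.
  assert (Ha := H1 w (Rlt_le_trans _ _ _ Hw (Rmin_l _ _))).
  assert (Hb := H2 w (Rlt_le_trans _ _ _ Hw (Rmin_r _ _))).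
  replace (f w * g w - f z * g z)%C
    with ((f w - f z) * (g w - g z) + (f w - f z) * g z + f z * (g w - g z))%C by ring.
  assert (Ha0 := Cmod_ge_0 (f w - f z)). assert (Hb0 := Cmod_ge_0 (g w - g z)).
  eapply Rle_lt_trans; [apply Cmod_triangle|].
  eapply Rle_lt_trans; [apply Rplus_le_compat_r, Cmod_triangle|].
  rewrite !Cmod_mult.
  assert (He1 : e <= 1) by apply Rmin_l.
  assert (He2 : e * (Cmod (f z) + Cmod (g z) + 2) <= eps).
  { apply Rle_trans with (eps / (Cmod (f z) + Cmod (g z) + 2) * (Cmod (f z) + Cmod (g z) + 2)).
    - apply Rmult_le_compat_r; [lra | apply Rmin_r].
    - right; field; lra. }
  nra.
Qed.

(** * Integrals along the sides of rectangles *)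

Definition rcont (phi : R -> C) (t : R) : Prop :=
  forall eps, 0 < eps -> exists d, 0 < d /\
    forall u, Rabs (u - t) < d -> Cmod (phi u - phi t) < eps.

Lemma rcont_Re (phi : R -> C) (t : R) :
  rcont phi t -> continuous (fun u => Re (phi u)) t.
Proof.
  intros H P [eps HP].
  destruct (H eps (cond_pos eps)) as [d [Hd H']].
  exists (mkposreal d Hd); intros u Hu; apply HP.
  change (Rabs (Re (phi u) - Re (phi t)) < eps).
  eapply Rle_lt_trans; [|apply (H' u Hu)].
  change (Re (phi u) - Re (phi t)) with (Re (phi u - phi t)%C).
  apply re_le_Cmod.
Qed.

Lemma rcont_Im (phi : R -> C) (t : R) :
  rcont phi t -> continuous (fun u => Im (phi u)) t.
Proof.
  intros H P [eps HP].
  destruct (H eps (cond_pos eps)) as [d [Hd H']].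
  exists (mkposreal d Hd); intros u Hu; apply HP.
  change (Rabs (Im (phi u) - Im (phi t)) < eps).
  eapply Rle_lt_trans; [|apply (H' u Hu)].
  change (Im (phi u) - Im (phi t)) with (Im (phi u - phi t)%C).
  apply im_le_Cmod.
Qed.

Definition rcont_on (phi : R -> C) (a b : R) := forall t, a <= t <= b -> rcont phi t.

Lemma rcont_on_sub (phi : R -> C) (a b a' b' : R) :
  a <= a' -> b' <= b -> rcont_on phi a b -> rcont_on phi a' b'.
Proof. intros H1 H2 H t Ht; apply H; lra. Qed.

Lemma ex_RInt_Re (phi : R -> C) (a b : R) : a <= b -> rcont_on phi a b ->
  ex_RInt (fun t => Re (phi t)) a b.
Proof.
  intros Hab H; apply (ex_RInt_continuous (V := R_CompleteNormedModule)).
  rewrite Rmin_left, Rmax_right by lra; intros t Ht; apply rcont_Re, H, Ht.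
Qed.

Lemma ex_RInt_Im (phi : R -> C) (a b : R) : a <= b -> rcont_on phi a b ->
  ex_RInt (fun t => Im (phi t)) a b.
Proof.
  intros Hab H; apply (ex_RInt_continuous (V := R_CompleteNormedModule)).
  rewrite Rmin_left, Rmax_right by lra; intros t Ht; apply rcont_Im, H, Ht.
Qed.

Definition CInt (phi : R -> C) (a b : R) : C :=
  (RInt (fun t => Re (phi t)) a b, RInt (fun t => Im (phi t)) a b).

Lemma CInt_ext (phi psi : R -> C) (a b : R) : a <= b ->
  (forall t, a <= t <= b -> phi t = psi t) -> CInt phi a b = CInt psi a b.
Proof.
  intros Hab E; unfold CInt; f_equal; apply RInt_ext;
    rewrite Rmin_left, Rmax_right by lra; intros t Ht; rewrite E by lra; reflexivity.
Qed.

Lemma CInt_Chasles (phi : R -> C) (a m b : R) : a <= m <= b -> rcont_on phi a b ->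
  CInt phi a b = (CInt phi a m + CInt phi m b)%C.
Proof.
  intros Hm H.
  assert (rcont_on phi a m) by (apply rcont_on_sub with a b; [lra|lra|exact H]).
  assert (rcont_on phi m b) by (apply rcont_on_sub with a b; [lra|lra|exact H]).
  unfold CInt, Cplus; cbn [fst snd]; f_equal; symmetry.
  - apply (RInt_Chasles (V := R_CompleteNormedModule) (fun t => Re (phi t)) a m b);
      apply ex_RInt_Re; solve [lra | assumption].
  - apply (RInt_Chasles (V := R_CompleteNormedModule) (fun t => Im (phi t)) a m b);
      apply ex_RInt_Im; solve [lra | assumption].
Qed.

Lemma CInt_plus (phi psi : R -> C) (a b : R) : a <= b ->
  rcont_on phi a b -> rcont_on psi a b ->
  CInt (fun t => phi t + psi t)%C a b = (CInt phi a b + CInt psi a b)%C.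
Proof.
  intros Hab H1 H2; unfold CInt, Cplus at 3; cbn [fst snd]; f_equal.
  - apply (RInt_plus (V := R_CompleteNormedModule) (fun t => Re (phi t)) (fun t => Re (psi t)));
      apply ex_RInt_Re; assumption.
  - apply (RInt_plus (V := R_CompleteNormedModule) (fun t => Im (phi t)) (fun t => Im (psi t)));
      apply ex_RInt_Im; assumption.
Qed.

Lemma CInt_scal (k : C) (phi : R -> C) (a b : R) : a <= b ->
  rcont_on phi a b ->
  CInt (fun t => k * phi t)%C a b = (k * CInt phi a b)%C.
Proof.
  intros Hab H.
  assert (H1 := ex_RInt_Re phi a b Hab H). assert (H2 := ex_RInt_Im phi a b Hab H).
  assert (S1 : forall (l : R) f, ex_RInt f a b -> RInt (fun t => l * f t) a b = l * RInt f a b).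
  { intros l f Hf; apply (RInt_scal (V := R_CompleteNormedModule) f a b l Hf). }
  assert (E1 : forall (l : R) f, ex_RInt f a b -> ex_RInt (fun t => l * f t) a b).
  { intros l f Hf; apply (ex_RInt_scal (V := R_CompleteNormedModule) f a b l Hf). }
  apply injective_projections; simpl.
  - rewrite <- !S1 by assumption.
    apply (RInt_minus (V := R_CompleteNormedModule) (fun t => fst k * Re (phi t)) (fun t => snd k * Im (phi t))); apply E1; assumption.
  - rewrite <- !S1 by assumption.
    apply (RInt_plus (V := R_CompleteNormedModule) (fun t => fst k * Im (phi t)) (fun t => snd k * Re (phi t))); apply E1; assumption.
Qed.

(** The factor 2 comes from bounding the real and imaginary parts separately. *)
Lemma CInt_bound (phi : R -> C) (a b M : R) : a <= b -> rcont_on phi a b ->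
  (forall t, a <= t <= b -> Cmod (phi t) <= M) ->
  Cmod (CInt phi a b) <= 2 * M * (b - a).
Proof.
  intros Hab H HM.
  eapply Rle_trans; [apply Cmod_le_abs|].
  assert (Rabs (Re (CInt phi a b)) <= (b - a) * M).
  { apply abs_RInt_le_const; [exact Hab | apply ex_RInt_Re; assumption|].
    intros t Ht; eapply Rle_trans; [apply re_le_Cmod | apply HM, Ht]. }
  assert (Rabs (Im (CInt phi a b)) <= (b - a) * M).
  { apply abs_RInt_le_const; [exact Hab | apply ex_RInt_Im; assumption|].
    intros t Ht; eapply Rle_trans; [apply im_le_Cmod | apply HM, Ht]. }
  lra.
Qed.

Lemma RInt_affine (u v a b : R) :
  RInt (fun t => u + v * t) a b = u * (b - a) + v * (b * b - a * a) / 2.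
Proof.
  set (F := fun t : R => u * t + v * (t * t) / 2).
  assert (H : is_RInt (V := R_NormedModule) (fun t => u + v * t) a b (minus (F b) (F a))).
  { apply (is_RInt_derive (V := R_CompleteNormedModule) F); unfold F.
    - intros x _; auto_derive; [exact I | field].
    - intros x _; apply (ex_derive_continuous (V := R_NormedModule)); auto_derive; exact I. }
  rewrite (is_RInt_unique _ _ _ _ H); unfold minus, plus, opp, F; simpl; field.
Qed.

Lemma CInt_affine (u v : C) (a b : R) :
  CInt (fun t => u + v * RtoC t)%C a b
  = (u * RtoC (b - a) + v * RtoC ((b * b - a * a) / 2))%C.
Proof.
  apply injective_projections; simpl.
  - rewrite (RInt_ext _ (fun t => fst u + fst v * t)) by (intros; simpl; ring).
    rewrite RInt_affine; field.
  - rewrite (RInt_ext _ (fun t => snd u + snd v * t)) by (intros; simpl; ring).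
    rewrite RInt_affine; field.
Qed.

(** Contour integral over the boundary, counterclockwise: bottom, right, top, left, with dz = i dy
    on the vertical sides. *)
Definition rect (f : C -> C) (a b c d : R) : C :=
  (CInt (fun x => f (x, c)) a b + Ci * CInt (fun y => f (b, y)) c d
   - CInt (fun x => f (x, d)) a b - Ci * CInt (fun y => f (a, y)) c d)%C.

Definition on_edges (a b c d : R) (z : C) : Prop :=
  (a <= Re z <= b /\ (Im z = c \/ Im z = d)) \/ (c <= Im z <= d /\ (Re z = a \/ Re z = b)).

Lemma Cmod_horiz (x x' y : R) : Cmod ((x, y) - (x', y))%C = Rabs (x - x').
Proof.
  replace ((x, y) - (x', y))%C with (RtoC (x - x'))
    by (apply injective_projections; simpl; ring).
  apply Cmod_R.
Qed.

Lemma Cmod_vert (x y y' : R) : Cmod ((x, y) - (x, y'))%C = Rabs (y - y').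
Proof.
  replace ((x, y) - (x, y'))%C with (Ci * RtoC (y - y'))%C
    by (apply injective_projections; simpl; ring).
  rewrite Cmod_mult, Cmod_Ci, Cmod_R; ring.
Qed.

Lemma ccont_horiz (f : C -> C) (y a b : R) :
  (forall x, a <= x <= b -> ccont f (x, y)) -> rcont_on (fun x => f (x, y)) a b.
Proof.
  intros H x Hx eps Heps.
  destruct (H x Hx eps Heps) as [d [Hd H']].
  exists d; split; [exact Hd|]; intros u Hu; apply H'.
  rewrite Cmod_horiz; exact Hu.
Qed.

Lemma ccont_vert (f : C -> C) (x a b : R) :
  (forall y, a <= y <= b -> ccont f (x, y)) -> rcont_on (fun y => f (x, y)) a b.
Proof.
  intros H y Hy eps Heps.
  destruct (H y Hy eps Heps) as [d [Hd H']].
  exists d; split; [exact Hd|]; intros u Hu; apply H'.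
  rewrite Cmod_vert; exact Hu.
Qed.

Lemma edges_cont (f : C -> C) (a b c d : R) : a <= b -> c <= d ->
  (forall z, on_edges a b c d z -> ccont f z) ->
  rcont_on (fun x => f (x, c)) a b /\ rcont_on (fun y => f (b, y)) c d /\
  rcont_on (fun x => f (x, d)) a b /\ rcont_on (fun y => f (a, y)) c d.
Proof.
  intros Hab Hcd H; repeat split.
  1,3: apply ccont_horiz. 3,4: apply ccont_vert.
  all: intros t Ht; apply H; unfold on_edges; simpl; auto.
Qed.

Lemma rect_ext (f g : C -> C) (a b c d : R) : a <= b -> c <= d ->
  (forall z, on_edges a b c d z -> f z = g z) -> rect f a b c d = rect g a b c d.
Proof.
  intros Hab Hcd E; unfold rect.
  rewrite (CInt_ext (fun x => f (x, c)) (fun x => g (x, c))),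
    (CInt_ext (fun x => f (x, d)) (fun x => g (x, d))),
    (CInt_ext (fun y => f (a, y)) (fun y => g (a, y))),
    (CInt_ext (fun y => f (b, y)) (fun y => g (b, y))); try assumption; try reflexivity;
  intros t Ht; apply E; unfold on_edges; simpl; auto.
Qed.

Lemma rect_plus (f g : C -> C) (a b c d : R) : a <= b -> c <= d ->
  (forall z, on_edges a b c d z -> ccont f z) ->
  (forall z, on_edges a b c d z -> ccont g z) ->
  rect (fun z => f z + g z)%C a b c d = (rect f a b c d + rect g a b c d)%C.
Proof.
  intros Hab Hcd Hf Hg.
  destruct (edges_cont f a b c d Hab Hcd Hf) as [F1 [F2 [F3 F4]]].
  destruct (edges_cont g a b c d Hab Hcd Hg) as [G1 [G2 [G3 G4]]].
  unfold rect; rewrite !CInt_plus by assumption; ring.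
Qed.

Lemma rect_scal (k : C) (f : C -> C) (a b c d : R) : a <= b -> c <= d ->
  (forall z, on_edges a b c d z -> ccont f z) ->
  rect (fun z => k * f z)%C a b c d = (k * rect f a b c d)%C.
Proof.
  intros Hab Hcd Hf.
  destruct (edges_cont f a b c d Hab Hcd Hf) as [F1 [F2 [F3 F4]]].
  unfold rect; rewrite !CInt_scal by assumption; ring.
Qed.

Lemma rect_bound (f : C -> C) (a b c d M : R) : a <= b -> c <= d ->
  (forall z, on_edges a b c d z -> ccont f z) ->
  (forall z, on_edges a b c d z -> Cmod (f z) <= M) ->
  Cmod (rect f a b c d) <= 4 * M * ((b - a) + (d - c)).
Proof.
  intros Hab Hcd Hf HM.
  destruct (edges_cont f a b c d Hab Hcd Hf) as [F1 [F2 [F3 F4]]].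
  assert (H1 := CInt_bound _ a b M Hab F1).
  assert (H2 := CInt_bound _ c d M Hcd F2).
  assert (H3 := CInt_bound _ a b M Hab F3).
  assert (H4 := CInt_bound _ c d M Hcd F4).
  unfold rect, Cminus.
  eapply Rle_trans; [apply Cmod_triangle|].
  eapply Rle_trans; [apply Rplus_le_compat_r, Cmod_triangle|].
  eapply Rle_trans; [apply Rplus_le_compat_r, Rplus_le_compat_r, Cmod_triangle|].
  rewrite !Cmod_opp, !Cmod_mult, Cmod_Ci.
  assert (K1 := H1 (fun t Ht => HM (t, c) (or_introl (conj Ht (or_introl eq_refl))))).
  assert (K2 := H2 (fun t Ht => HM (b, t) (or_intror (conj Ht (or_intror eq_refl))))).
  assert (K3 := H3 (fun t Ht => HM (t, d) (or_introl (conj Ht (or_intror eq_refl))))).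
  assert (K4 := H4 (fun t Ht => HM (a, t) (or_intror (conj Ht (or_introl eq_refl))))).
  lra.
Qed.

Lemma rect_split_x (f : C -> C) (a m b c d : R) : a <= m <= b -> c <= d ->
  (forall z, on_edges a m c d z -> ccont f z) ->
  (forall z, on_edges m b c d z -> ccont f z) ->
  rect f a b c d = (rect f a m c d + rect f m b c d)%C.
Proof.
  intros Hm Hcd Hf Hg; unfold rect.
  rewrite (CInt_Chasles (fun x => f (x, c)) a m b), (CInt_Chasles (fun x => f (x, d)) a m b).
  - ring.
  - exact Hm.
  - apply ccont_horiz; intros x Hx; destruct (Rle_dec x m);
      [apply Hf | apply Hg]; left; simpl; lra.
  - exact Hm.
  - apply ccont_horiz; intros x Hx; destruct (Rle_dec x m);
      [apply Hf | apply Hg]; left; simpl; lra.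
Qed.

Lemma rect_split_y (f : C -> C) (a b c m d : R) : a <= b -> c <= m <= d ->
  (forall z, on_edges a b c m z -> ccont f z) ->
  (forall z, on_edges a b m d z -> ccont f z) ->
  rect f a b c d = (rect f a b c m + rect f a b m d)%C.
Proof.
  intros Hab Hm Hf Hg; unfold rect.
  rewrite (CInt_Chasles (fun y => f (a, y)) c m d), (CInt_Chasles (fun y => f (b, y)) c m d).
  - ring.
  - exact Hm.
  - apply ccont_vert; intros x Hx; destruct (Rle_dec x m);
      [apply Hf | apply Hg]; right; simpl; lra.
  - exact Hm.
  - apply ccont_vert; intros x Hx; destruct (Rle_dec x m);
      [apply Hf | apply Hg]; right; simpl; lra.
Qed.

(** The case of Goursat's theorem that can be computed by hand; it disposes of the linearisation of
    f in [goursat_box]. *)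
Lemma rect_affine (u v : C) (a b c d : R) :
  a <= b -> c <= d -> rect (fun z => u + v * z)%C a b c d = RtoC 0.
Proof.
  intros Hab Hcd; unfold rect.
  rewrite (CInt_ext (fun x => u + v * (x, c))%C (fun x => (u + v * (Ci * RtoC c)) + v * RtoC x)%C a b),
    (CInt_ext (fun x => u + v * (x, d))%C (fun x => (u + v * (Ci * RtoC d)) + v * RtoC x)%C a b),
    (CInt_ext (fun y => u + v * (a, y))%C (fun y => (u + v * RtoC a) + (v * Ci) * RtoC y)%C c d),
    (CInt_ext (fun y => u + v * (b, y))%C (fun y => (u + v * RtoC b) + (v * Ci) * RtoC y)%C c d);
    try assumption;
    try (intros t _; apply injective_projections; simpl; ring).
  rewrite !CInt_affine.
  apply injective_projections; simpl; field.
Qed.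

(** * Goursat's theorem *)

Definition in_rect (a b c d : R) (z : C) : Prop := a <= Re z <= b /\ c <= Im z <= d.

Lemma on_edges_in_rect (a b c d : R) (z : C) : a <= b -> c <= d ->
  on_edges a b c d z -> in_rect a b c d z.
Proof. unfold on_edges, in_rect; intuition lra. Qed.

Record box := Box { bl : R; br : R; bb : R; bt : R }.

Definition brect (f : C -> C) (q : box) := rect f (bl q) (br q) (bb q) (bt q).

(** Bisection step of Goursat's argument, made a function by testing the quarters in turn. The last
    one needs no test, because the four moduli add up to at least the modulus for [q]. *)
Definition quarter (f : C -> C) (q : box) : box :=
  let m := (bl q + br q) / 2 in
  let n := (bb q + bt q) / 2 in
  let q1 := Box (bl q) m (bb q) n in
  let q2 := Box m (br q) (bb q) n in
  let q3 := Box (bl q) m n (bt q) in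
  let q4 := Box m (br q) n (bt q) in
  let t := Cmod (brect f q) / 4 in
  if Rle_dec t (Cmod (brect f q1)) then q1 else
  if Rle_dec t (Cmod (brect f q2)) then q2 else
  if Rle_dec t (Cmod (brect f q3)) then q3 else q4.

Definition bin (q : box) (z : C) := in_rect (bl q) (br q) (bb q) (bt q) z.

Lemma quarter_spec (f : C -> C) (q : box) :
  bl q <= br q -> bb q <= bt q -> (forall z, bin q z -> ccont f z) ->
  let q' := quarter f q in
  bl q <= bl q' /\ br q' <= br q /\ bb q <= bb q' /\ bt q' <= bt q /\
  br q' - bl q' = (br q - bl q) / 2 /\ bt q' - bb q' = (bt q - bb q) / 2 /\
  Cmod (brect f q) / 4 <= Cmod (brect f q').
Proof.
  intros Hx Hy Hf; unfold quarter.
  set (m := (bl q + br q) / 2). set (n := (bb q + bt q) / 2).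
  assert (Hm : bl q <= m <= br q) by (unfold m; lra).
  assert (Hn : bb q <= n <= bt q) by (unfold n; lra).
  assert (E : brect f q = (brect f (Box (bl q) m (bb q) n) + brect f (Box m (br q) (bb q) n)
    + (brect f (Box (bl q) m n (bt q)) + brect f (Box m (br q) n (bt q))))%C).
  { unfold brect; simpl.
    rewrite (rect_split_y f (bl q) (br q) (bb q) n (bt q)); [|lra|lra| |];
      [rewrite (rect_split_x f (bl q) m (br q) (bb q) n), (rect_split_x f (bl q) m (br q) n (bt q)); [reflexivity|..]|..];
      try lra;
      intros z Hz; apply on_edges_in_rect in Hz; try lra; apply Hf; destruct Hz; split; lra. }
  assert (T : Cmod (brect f q) <= Cmod (brect f (Box (bl q) m (bb q) n)) + Cmod (brect f (Box m (br q) (bb q) n))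
    + (Cmod (brect f (Box (bl q) m n (bt q))) + Cmod (brect f (Box m (br q) n (bt q))))).
  { rewrite E; eapply Rle_trans; [apply Cmod_triangle|];
    apply Rplus_le_compat; apply Cmod_triangle. }
  destruct (Rle_dec _ _); [|destruct (Rle_dec _ _); [|destruct (Rle_dec _ _)]];
    cbn [bl br bb bt]; unfold m, n in *; repeat split; lra.
Qed.

Section Goursat.
Variables (f : C -> C) (q0 : box).
Hypotheses (Hx : bl q0 <= br q0) (Hy : bb q0 <= bt q0)
  (Hd : forall z, bin q0 z -> cdiff f z).

Let Q (n : nat) : box := Nat.iter n (quarter f) q0.

Lemma goursat_iter (n : nat) :
  bl q0 <= bl (Q n) /\ br (Q n) <= br q0 /\ bb q0 <= bb (Q n) /\ bt (Q n) <= bt q0 /\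
  br (Q n) - bl (Q n) = (br q0 - bl q0) / 2 ^ n /\
  bt (Q n) - bb (Q n) = (bt q0 - bb q0) / 2 ^ n /\
  Cmod (brect f q0) / 4 ^ n <= Cmod (brect f (Q n)).
Proof.
  induction n as [|n IH].
  - unfold Q; simpl; repeat split; lra.
  - destruct IH as [I1 [I2 [I3 [I4 [I5 [I6 I7]]]]]].
    assert (P2 : 0 < 2 ^ n) by (apply pow_lt; lra).
    assert (0 <= (br q0 - bl q0) / 2 ^ n) by (apply Rdiv_le_0_compat; lra).
    assert (0 <= (bt q0 - bb q0) / 2 ^ n) by (apply Rdiv_le_0_compat; lra).
    destruct (quarter_spec f (Q n)) as [J1 [J2 [J3 [J4 [J5 [J6 J7]]]]]]; try lra.
    { intros z [Hz1 Hz2]; apply cdiff_ccont, Hd; split; lra. }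
    change (Q (S n)) with (quarter f (Q n)).
    assert (P4 : 0 < 4 ^ n) by (apply pow_lt; lra).
    repeat split; try lra.
    + rewrite J5, I5; simpl; field; lra.
    + rewrite J6, I6; simpl; field; lra.
    + eapply Rle_trans; [|exact J7].
      simpl; replace (Cmod (brect f q0) / (4 * 4 ^ n)) with (Cmod (brect f q0) / 4 ^ n / 4) by (field; lra).
      lra.
Qed.

Lemma goursat_nested (n k : nat) :
  bl (Q n) <= bl (Q (k + n)) /\ br (Q (k + n)) <= br (Q n) /\
  bb (Q n) <= bb (Q (k + n)) /\ bt (Q (k + n)) <= bt (Q n).
Proof.
  induction k as [|k IH]; simpl; [lra|].
  destruct (goursat_iter (k + n)) as [I1 [I2 [I3 [I4 [I5 [I6 I7]]]]]].
  assert (P2 : 0 < 2 ^ (k + n)) by (apply pow_lt; lra).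
  assert (0 <= (br q0 - bl q0) / 2 ^ (k + n)) by (apply Rdiv_le_0_compat; lra).
  assert (0 <= (bt q0 - bb q0) / 2 ^ (k + n)) by (apply Rdiv_le_0_compat; lra).
  destruct (quarter_spec f (Q (k + n))) as [J1 [J2 [J3 [J4 _]]]]; try lra.
  { intros z [Hz1 Hz2]; apply cdiff_ccont, Hd; split; lra. }
Qed.

Lemma goursat_ordered (n : nat) : bl (Q n) <= br (Q n) /\ bb (Q n) <= bt (Q n).
Proof.
  destruct (goursat_iter n) as [I1 [I2 [I3 [I4 [I5 [I6 I7]]]]]].
  assert (P2 : 0 < 2 ^ n) by (apply pow_lt; lra).
  assert (0 <= (br q0 - bl q0) / 2 ^ n) by (apply Rdiv_le_0_compat; lra).
  assert (0 <= (bt q0 - bb q0) / 2 ^ n) by (apply Rdiv_le_0_compat; lra).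
  lra.
Qed.

Lemma goursat_cross (n m : nat) : bl (Q n) <= br (Q m) /\ bb (Q n) <= bt (Q m).
Proof.
  destruct (goursat_nested n m) as [A1 [A2 [A3 A4]]].
  destruct (goursat_nested m n) as [B1 [B2 [B3 B4]]].
  replace (n + m)%nat with (m + n)%nat in * by lia.
  destruct (goursat_ordered (m + n)); lra.
Qed.

(** By [goursat_cross] every left edge lies to the left of every right edge, so the supremum of the
    left edges belongs to all boxes; likewise vertically. *)
Lemma goursat_point : exists p, forall n, bin (Q n) p.
Proof.
  destruct (completeness (fun x => exists n, x = bl (Q n))) as [x [X1 X2]].
  { exists (br q0); intros t [n ->]; exact (proj1 (goursat_cross n 0)). }
  { exists (bl q0), 0%nat; reflexivity. }
  destruct (completeness (fun x => exists n, x = bb (Q n))) as [y [Y1 Y2]].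
  { exists (bt q0); intros t [n ->]; exact (proj2 (goursat_cross n 0)). }
  { exists (bb q0), 0%nat; reflexivity. }
  exists (x, y); intro n; repeat split; simpl.
  - apply X1; eauto.
  - apply X2; intros t [k ->]; apply goursat_cross.
  - apply Y1; eauto.
  - apply Y2; intros t [k ->]; apply goursat_cross.
Qed.

(** Near the common point p the function differs from an affine one by at most eps |z - p|. Affine
    functions integrate to 0, so the integral over the N-th box is O(eps / 4^N), while bisection
    keeps it at least eta / 4^N. *)
Lemma goursat_box : brect f q0 = RtoC 0.
Proof.
  apply Cmod_eq_0.
  destruct (Rle_lt_or_eq_dec 0 _ (Cmod_ge_0 (brect f q0))) as [Hpos|]; [exfalso|congruence].
  destruct goursat_point as [p Hp].
  destruct (Hd p (Hp 0%nat)) as [l Hl].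
  set (s := (br q0 - bl q0) + (bt q0 - bb q0)).
  set (eta := Cmod (brect f q0)) in *.
  assert (Hs : 0 <= s) by (unfold s; lra).
  (* The final comparison reads eta <= 4 eps s^2, which this choice contradicts. *)
  set (eps := eta / (8 * (s * s + 1))).
  assert (Heps : 0 < eps) by (apply Rdiv_lt_0_compat; nra).
  destruct (Hl eps Heps) as [del [Hdel H]].
  destruct (pow_lt_1_zero (1/2)) with (y := del / (s + 1)) as [N HN].
  { rewrite Rabs_pos_eq; lra. }
  { apply Rdiv_lt_0_compat; lra. }
  specialize (HN N (le_n N)).
  rewrite Rabs_pos_eq in HN by (apply pow_le; lra).
  replace ((1/2) ^ N) with (/ 2 ^ N) in HN
    by (unfold Rdiv; rewrite Rmult_1_l, pow_inv; reflexivity).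
  assert (P2 : 0 < 2 ^ N) by (apply pow_lt; lra).
  assert (Hsn : s / 2 ^ N < del).
  { apply (Rmult_lt_compat_l (s + 1)) in HN; [|lra].
    replace ((s + 1) * (del / (s + 1))) with del in HN by (field; lra).
    assert (0 < / 2 ^ N) by (apply Rinv_0_lt_compat, P2).
    unfold Rdiv; lra. }
  destruct (goursat_iter N) as [I1 [I2 [I3 [I4 [I5 [I6 I7]]]]]].
  destruct (goursat_ordered N) as [O1 O2].
  destruct (Hp N) as [Hp1 Hp2].
  assert (Hz : forall z, bin (Q N) z -> Cmod (z - p) <= s / 2 ^ N).
  { intros z [Hz1 Hz2]; eapply Rle_trans; [apply Cmod_le_abs|].
    change (Rabs (Re z - Re p) + Rabs (Im z - Im p) <= s / 2 ^ N).
    replace (s / 2 ^ N) with ((br (Q N) - bl (Q N)) + (bt (Q N) - bb (Q N)))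
      by (rewrite I5, I6; unfold s; field; lra).
    apply Rplus_le_compat; apply Rabs_le; lra. }
  set (r := fun z => (f z - f p - (z - p) * l)%C).
  set (aff := fun z : C => ((f p - p * l) + l * z)%C).
  assert (Hr : forall z, on_edges (bl (Q N)) (br (Q N)) (bb (Q N)) (bt (Q N)) z -> ccont r z).
  { intros z Hz'; apply on_edges_in_rect in Hz'; try lra.
    apply cdiff_ccont; unfold r.
    repeat first [apply cdiff_minus | apply cdiff_mult | apply cdiff_const | apply cdiff_id].
    apply Hd; destruct Hz'; split; lra. }
  assert (E : brect f (Q N) = brect r (Q N)).
  { unfold brect at 1.
    rewrite (rect_ext f (fun z => aff z + r z)%C); try lra.
    2:{ intros z _; unfold aff, r; ring. }
    rewrite rect_plus; try lra; [|intros z _|exact Hr].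
    - unfold aff; rewrite rect_affine by lra; unfold brect; ring.
    - apply cdiff_ccont; unfold aff; apply cdiff_plus; [apply cdiff_const|].
      apply cdiff_mult; [apply cdiff_const | apply cdiff_id]. }
  assert (B : Cmod (brect r (Q N)) <= 4 * (eps * (s / 2 ^ N)) * (s / 2 ^ N)).
  { replace (s / 2 ^ N) with ((br (Q N) - bl (Q N)) + (bt (Q N) - bb (Q N))) at 2
      by (rewrite I5, I6; unfold s; field; lra).
    apply (rect_bound r (bl (Q N)) (br (Q N)) (bb (Q N)) (bt (Q N))); [exact O1 | exact O2 | exact Hr |].
    intros z Hz'; apply on_edges_in_rect in Hz'; try lra.
    eapply Rle_trans; [apply H|].
    - eapply Rle_lt_trans; [apply Hz, Hz' | exact Hsn].
    - apply Rmult_le_compat_l; [lra | apply Hz, Hz']. }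
  rewrite <- E in B.
  fold eta in I7.
  assert (B2 : eta / 4 ^ N <= 4 * (eps * (s / 2 ^ N)) * (s / 2 ^ N)) by (eapply Rle_trans; [exact I7 | exact B]).
  replace (4 ^ N) with (2 ^ N * 2 ^ N) in B2 by (rewrite <- Rpow_mult_distr; f_equal; lra).
  replace (4 * (eps * (s / 2 ^ N)) * (s / 2 ^ N)) with ((4 * eps * (s * s)) / (2 ^ N * 2 ^ N)) in B2 by (field; lra).
  apply Rmult_le_reg_r in B2; [|apply Rinv_0_lt_compat; nra].
  assert (eps * (8 * (s * s + 1)) = eta) by (unfold eps; field; nra).
  nra.
Qed.

End Goursat.

Lemma goursat (f : C -> C) (a b c d : R) : a <= b -> c <= d ->
  (forall z, in_rect a b c d z -> cdiff f z) -> rect f a b c d = RtoC 0.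
Proof. intros Hab Hcd H; exact (goursat_box f (Box a b c d) Hab Hcd H). Qed.

(** * Cauchy's integral formula *)

Lemma ccont_inv_sub (w z : C) : z <> w -> ccont (fun z => / (z - w))%C z.
Proof.
  intro H; apply cdiff_ccont, cdiff_inv; [apply Cminus_eq_contra, H|].
  apply cdiff_minus; [apply cdiff_id | apply cdiff_const].
Qed.

Lemma neq_Re (z w : C) : Re z <> Re w -> z <> w.
Proof. intros H ->; auto. Qed.
Lemma neq_Im (z w : C) : Im z <> Im w -> z <> w.
Proof. intros H ->; auto. Qed.

Lemma RInt_atan (x l : R) : 0 < l ->
  RInt (fun t => 2 * l / ((t - x) * (t - x) + l * l)) (x - l) (x + l) = PI.
Proof.
  intro Hl.
  set (F := fun t : R => 2 * atan ((t - x) / l)).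
  assert (Hp : forall t, 0 < (t - x) * (t - x) + l * l).
  { intro t; assert (0 <= (t - x) * (t - x)) by apply Rle_0_sqr; nra. }
  assert (H : is_RInt (V := R_NormedModule) (fun t => 2 * l / ((t - x) * (t - x) + l * l))
    (x - l) (x + l) (minus (F (x + l)) (F (x - l)))).
  { apply (is_RInt_derive (V := R_CompleteNormedModule) F); unfold F.
    - intros t _; auto_derive; [exact I|].
      specialize (Hp t); field; repeat split; try lra.
    - intros t _; apply (ex_derive_continuous (V := R_NormedModule)).
      specialize (Hp t); auto_derive; lra. }
  rewrite (is_RInt_unique _ _ _ _ H); unfold minus, plus, opp, F; simpl.
  replace ((x + l - x) / l) with 1 by (field; lra).
  replace ((x - l - x) / l) with (- (1)) by (field; lra).
  rewrite atan_opp, atan_1; lra.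
Qed.

Lemma CInt_minus (phi psi : R -> C) (a b : R) : a <= b ->
  rcont_on phi a b -> rcont_on psi a b ->
  CInt (fun t => phi t - psi t)%C a b = (CInt phi a b - CInt psi a b)%C.
Proof.
  intros Hab H1 H2; unfold CInt, Cminus, Cplus, Copp; cbn [fst snd]; f_equal.
  - apply (RInt_minus (V := R_CompleteNormedModule) (fun t => Re (phi t)) (fun t => Re (psi t)));
      apply ex_RInt_Re; assumption.
  - apply (RInt_minus (V := R_CompleteNormedModule) (fun t => Im (phi t)) (fun t => Im (psi t)));
      apply ex_RInt_Im; assumption.
Qed.

Lemma CInt_imag (g : R -> R) (a b : R) :
  CInt (fun t => (0, g t)) a b = (0, RInt g a b).
Proof.
  unfold CInt; f_equal; simpl.
  rewrite RInt_const; unfold scal; simpl; unfold mult; simpl; ring.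
Qed.

Definition sq_edges (x y l : R) := on_edges (x - l) (x + l) (y - l) (y + l).

Lemma sq_edges_dist (x y l : R) (z : C) : 0 < l -> sq_edges x y l z ->
  l <= Cmod (z - (x, y)) <= 2 * l.
Proof.
  intros Hl Hz; split.
  - assert (H1 := re_le_Cmod (z - (x, y))%C). assert (H2 := im_le_Cmod (z - (x, y))%C).
    change (Re (z - (x, y))%C) with (Re z - x) in H1.
    change (Im (z - (x, y))%C) with (Im z - y) in H2.
    unfold Rabs in *; destruct (Rcase_abs _); destruct (Rcase_abs _);
    unfold sq_edges, on_edges in Hz; lra.
  - eapply Rle_trans; [apply Cmod_le_abs|].
    change (Rabs (Re z - x) + Rabs (Im z - y) <= 2 * l).
    apply on_edges_in_rect in Hz; try lra; destruct Hz.
    replace (2 * l) with (l + l) by ring; apply Rplus_le_compat; apply Rabs_le; lra.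
Qed.

Lemma sq_edges_neq (x y l : R) (z : C) : 0 < l -> sq_edges x y l z -> z <> (x, y).
Proof.
  intros Hl Hz E; apply sq_edges_dist in Hz; [|exact Hl].
  rewrite E in Hz; replace ((x, y) - (x, y))%C with (RtoC 0) in Hz by ring.
  rewrite Cmod_0 in Hz; lra.
Qed.

(** Opposite sides are paired: one component of 1/(z - w) cancels pointwise and the other doubles to
    2l/((t-x)^2 + l^2), whose integral is pi by [RInt_atan]. Two pairs give 2 pi i. *)
Lemma rect_inv_center (x y l : R) : 0 < l ->
  rect (fun z => / (z - (x, y)))%C (x - l) (x + l) (y - l) (y + l) = (2 * Ci * RtoC PI)%C.
Proof.
  intro Hl.
  set (f := fun z : C => (/ (z - (x, y)))%C).
  destruct (edges_cont f (x - l) (x + l) (y - l) (y + l)) as [F1 [F2 [F3 F4]]]; try lra.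
  { intros z Hz; apply ccont_inv_sub; eapply sq_edges_neq; eassumption. }
  unfold rect.
  transitivity ((CInt (fun x => f (x, (y - l)%R)) (x - l) (x + l) - CInt (fun x => f (x, (y + l)%R)) (x - l) (x + l))
   + Ci * (CInt (fun y => f ((x + l)%R, y)) (y - l) (y + l) - CInt (fun y => f ((x - l)%R, y)) (y - l) (y + l)))%C; [ring|].
  rewrite <- !CInt_minus by (assumption || lra).
  assert (Hp : forall u v, 0 < (u - v) * (u - v) + l * l).
  { intros u v; assert (0 <= (u - v) * (u - v)) by apply Rle_0_sqr; nra. }
  rewrite (CInt_ext _ (fun t => (0, 2 * l / ((t - x) * (t - x) + l * l)))); [|lra|].
  2:{ intros t _; specialize (Hp t x); unfold f, Cinv, Cminus, Cplus, Copp; cbn [fst snd].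
      f_equal; field; nra. }
  rewrite (CInt_ext (fun t => f ((x + l)%R, t) - f ((x - l)%R, t))%C
    (fun t => (RtoC (2 * l / ((t - y) * (t - y) + l * l)))) (y - l)); [|lra|].
  2:{ intros t _; specialize (Hp t y); unfold f, Cinv, Cminus, Cplus, Copp, RtoC; cbn [fst snd].
      f_equal; field; nra. }
  rewrite CInt_imag, RInt_atan by exact Hl.
  unfold CInt; simpl.
  rewrite RInt_atan by exact Hl.
  rewrite RInt_const; unfold scal; simpl; unfold mult; simpl.
  apply injective_projections; simpl; ring.
Qed.

(** Two horizontal and two vertical cuts isolate the inner square; the four rectangles left over
    avoid (x, y), so [goursat] applies to them. *)
Lemma rect_annulus (f : C -> C) (a b c d x y l : R) : 0 < l ->
  a <= x - l -> x + l <= b -> c <= y - l -> y + l <= d ->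
  (forall z, in_rect a b c d z -> z <> (x, y) -> cdiff f z) ->
  rect f a b c d = rect f (x - l) (x + l) (y - l) (y + l).
Proof.
  intros Hl Ha Hb Hc Hd Hf.
  rewrite (rect_split_y f a b c (y - l) d), (rect_split_y f a b (y - l) (y + l) d),
    (rect_split_x f a (x - l) b (y - l) (y + l)), (rect_split_x f (x - l) (x + l) b (y - l) (y + l)),
    (goursat f a b c (y - l)), (goursat f a b (y + l) d),
    (goursat f a (x - l) (y - l) (y + l)), (goursat f (x + l) b (y - l) (y + l));
  try lra; try ring;
  try (intros z [Hz1 Hz2]; apply Hf; [split; lra|];
    first [apply neq_Re; simpl; lra | apply neq_Im; simpl; lra]);
  intros z Hz; apply cdiff_ccont, Hf;
  try (apply on_edges_in_rect in Hz; [destruct Hz; split; lra | lra | lra]);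
  destruct Hz as [[Hz1 [Hz2|Hz2]]|[Hz1 [Hz2|Hz2]]];
  first [apply neq_Re; simpl; lra | apply neq_Im; simpl; lra].
Qed.

Definition in_open_rect (a b c d : R) (z : C) : Prop := a < Re z < b /\ c < Im z < d.

(* The integral is unchanged when the rectangle shrinks to a small square around w,
   where f is nearly the constant f w. *)
Lemma cauchy_formula (f : C -> C) (a b c d : R) (w : C) :
  in_open_rect a b c d w -> (forall z, in_rect a b c d z -> cdiff f z) ->
  rect (fun z => f z / (z - w))%C a b c d = (2 * Ci * RtoC PI * f w)%C.
Proof.
  intros Hw Hf; destruct w as [x y]; destruct Hw as [[Hx1 Hx2] [Hy1 Hy2]]; simpl in *.
  apply Ceq_minus, Cmod_eq_0.
  set (I := rect (fun z => f z / (z - (x, y)))%C a b c d).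
  set (D := Cmod (I - 2 * Ci * RtoC PI * f (x, y))%C).
  destruct (Rle_lt_or_eq_dec 0 D (Cmod_ge_0 _)) as [Hpos|]; [exfalso|congruence].
  assert (Cf : cdiff f (x, y)) by (apply Hf; split; simpl; lra).
  (* On the edges of the square of half-side l this gives |g| <= D/(32 l), and [rect_bound] turns it
     into D <= D/2. *)
  destruct (cdiff_ccont _ _ Cf (D / 32)) as [del [Hdel Hc]]; [lra|].
  set (l := Rmin (del / 4) (Rmin (Rmin (x - a) (b - x)) (Rmin (y - c) (d - y)))).
  assert (L1 : l <= del / 4) by apply Rmin_l.
  assert (L2 : l <= x - a /\ l <= b - x /\ l <= y - c /\ l <= d - y).
  { unfold l, Rmin; repeat destruct (Rle_dec _ _); lra. }
  assert (Hl : 0 < l).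
  { unfold l; repeat apply Rmin_glb_lt; lra. }
  clearbody l.
  assert (Hdiv : forall z, in_rect a b c d z -> z <> (x, y) -> cdiff (fun z => f z / (z - (x, y)))%C z).
  { intros z Hz Hn; apply cdiff_div; [apply Cminus_eq_contra, Hn | apply Hf, Hz|].
    apply cdiff_minus; [apply cdiff_id | apply cdiff_const]. }
  assert (E : I = rect (fun z => f z / (z - (x, y)))%C (x - l) (x + l) (y - l) (y + l)).
  { apply rect_annulus; [exact Hl | lra | lra | lra | lra | exact Hdiv]. }
  assert (Hin : forall z, sq_edges x y l z -> in_rect a b c d z).
  { intros z Hz; apply on_edges_in_rect in Hz; try lra; destruct Hz; split; lra. }
  set (g := fun z => ((f z - f (x, y)) / (z - (x, y)))%C).
  assert (Hg : forall z, sq_edges x y l z -> ccont g z).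
  { intros z Hz; apply cdiff_ccont; unfold g; apply cdiff_div.
    - apply Cminus_eq_contra; eapply sq_edges_neq; eassumption.
    - apply cdiff_minus; [apply Hf, Hin, Hz | apply cdiff_const].
    - apply cdiff_minus; [apply cdiff_id | apply cdiff_const]. }
  assert (Hi : forall z, sq_edges x y l z -> ccont (fun z => / (z - (x, y)))%C z).
  { intros z Hz; apply ccont_inv_sub; eapply sq_edges_neq; eassumption. }
  assert (E2 : I = (rect g (x - l) (x + l) (y - l) (y + l) + f (x, y) * (2 * Ci * RtoC PI))%C).
  { rewrite <- (rect_inv_center x y l Hl), <- rect_scal; try lra; [|exact Hi].
    rewrite <- rect_plus; try lra; [|exact Hg|].
    - rewrite E; apply rect_ext; try lra.
      intros z Hz; unfold g; field; apply Cminus_eq_contra; eapply sq_edges_neq; eassumption.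
    - intros z Hz; apply ccont_mult; [apply cdiff_ccont, cdiff_const | apply Hi, Hz]. }
  assert (B : D <= 4 * (D / 32 / l) * ((x + l - (x - l)) + (y + l - (y - l)))).
  { unfold D at 1; rewrite E2.
    replace (rect g (x - l) (x + l) (y - l) (y + l) + f (x, y) * (2 * Ci * RtoC PI) -
      2 * Ci * RtoC PI * f (x, y))%C with (rect g (x - l) (x + l) (y - l) (y + l)) by ring.
    apply rect_bound; [lra | lra | exact Hg |].
    intros z Hz; unfold g.
    destruct (sq_edges_dist x y l z Hl Hz) as [K1 K2].
    rewrite Cmod_div by (apply Cminus_eq_contra; eapply sq_edges_neq; eassumption).
    apply Rmult_le_compat; [apply Cmod_ge_0 | | |].
    - apply Rlt_le, Rinv_0_lt_compat; lra.
    - apply Rlt_le, Hc; lra.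
    - apply Rinv_le_contravar; lra. }
  replace (4 * (D / 32 / l) * ((x + l - (x - l)) + (y + l - (y - l)))) with (D / 2) in B by (field; lra).
  lra.
Qed.

Lemma rcont_on_bounded (phi : R -> C) (a b : R) : a <= b -> rcont_on phi a b ->
  exists M, forall t, a <= t <= b -> Cmod (phi t) <= M.
Proof.
  intros Hab H.
  destruct (continuity_ab_maj (fun t => Cmod (phi t)) a b Hab) as [m [Hm _]].
  - intros t Ht eps Heps.
    destruct (H t Ht eps Heps) as [d [Hd H']].
    exists d; split; [exact Hd|]; intros u [_ Hu].
    unfold dist in *; simpl in *; unfold Rdist in *.
    apply Rle_lt_trans with (Cmod (phi u - phi t)); [|apply H', Hu].
    apply Rabs_le; split.
    + generalize (Cmod_triangle_inv (phi t) (phi u)); rewrite Cmod_minus_sym; lra.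
    + apply Cmod_triangle_inv.
  - exists (Cmod (phi m)); exact Hm.
Qed.

Lemma edges_bounded (f : C -> C) (a b c d : R) : a <= b -> c <= d ->
  (forall z, on_edges a b c d z -> ccont f z) ->
  exists M, 0 <= M /\ forall z, on_edges a b c d z -> Cmod (f z) <= M.
Proof.
  intros Hab Hcd H.
  destruct (edges_cont f a b c d Hab Hcd H) as [F1 [F2 [F3 F4]]].
  destruct (rcont_on_bounded _ a b Hab F1) as [M1 H1].
  destruct (rcont_on_bounded _ c d Hcd F2) as [M2 H2].
  destruct (rcont_on_bounded _ a b Hab F3) as [M3 H3].
  destruct (rcont_on_bounded _ c d Hcd F4) as [M4 H4].
  exists (Rmax 0 (Rmax (Rmax M1 M2) (Rmax M3 M4))).
  assert (K1 := Rmax_l 0 (Rmax (Rmax M1 M2) (Rmax M3 M4))).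
  assert (K2 := Rmax_r 0 (Rmax (Rmax M1 M2) (Rmax M3 M4))).
  assert (K3 := Rmax_l (Rmax M1 M2) (Rmax M3 M4)).
  assert (K4 := Rmax_r (Rmax M1 M2) (Rmax M3 M4)).
  assert (K5 := Rmax_l M1 M2). assert (K6 := Rmax_r M1 M2).
  assert (K7 := Rmax_l M3 M4). assert (K8 := Rmax_r M3 M4).
  split; [exact K1|].
  intros [x y] [[Hx [Hy|Hy]]|[Hy [Hx|Hx]]]; simpl in Hx, Hy; subst.
  - specialize (H1 x Hx); lra.
  - specialize (H3 x Hx); lra.
  - specialize (H4 y Hy); lra.
  - specialize (H2 y Hy); lra.
Qed.

(** Differentiation under the integral sign with an explicit quadratic error, from 1/(z-w-h) -
    1/(z-w) - h/(z-w)^2 = h^2/((z-w)^2 (z-w-h)). Only continuity of [phi] on the edges is assumed,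
    so that it also serves in [divided_difference]. *)
Lemma cauchy_type_taylor (phi : C -> C) (a b c d M r : R) (w h : C) :
  a <= b -> c <= d -> 0 < r ->
  (forall z, on_edges a b c d z -> ccont phi z) ->
  (forall z, on_edges a b c d z -> Cmod (phi z) <= M) ->
  (forall z, on_edges a b c d z -> r <= Cmod (z - w)) ->
  Cmod h <= r / 2 ->
  Cmod (rect (fun z => phi z / (z - (w + h))) a b c d - rect (fun z => phi z / (z - w)) a b c d
        - h * rect (fun z => phi z / ((z - w) * (z - w))) a b c d)%C
  <= 8 * M * (Cmod h * Cmod h) / (r * r * r) * ((b - a) + (d - c)).
Proof.
  intros Hab Hcd Hr Hc HM Hdist Hh.
  assert (N1 : forall z, on_edges a b c d z -> (z - w)%C <> RtoC 0).
  { intros z Hz; apply Cmod_gt_0; specialize (Hdist z Hz); lra. }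
  assert (D2 : forall z, on_edges a b c d z -> r / 2 <= Cmod (z - (w + h))).
  { intros z Hz; specialize (Hdist z Hz).
    generalize (Cmod_triangle_inv (z - w) h).
    replace (z - w - h)%C with (z - (w + h))%C by ring; lra. }
  assert (N2 : forall z, on_edges a b c d z -> (z - (w + h))%C <> RtoC 0).
  { intros z Hz; apply Cmod_gt_0; specialize (D2 z Hz); lra. }
  assert (I1 : forall v z, (z - v)%C <> RtoC 0 -> ccont (fun z => / (z - v))%C z).
  { intros v z Hz; apply cdiff_ccont, cdiff_inv; [exact Hz|].
    apply cdiff_minus; [apply cdiff_id | apply cdiff_const]. }
  assert (C1 : forall z, on_edges a b c d z -> ccont (fun z => phi z / (z - w))%C z).
  { intros z Hz; apply ccont_mult; [apply Hc, Hz | apply I1, N1, Hz]. }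
  assert (C2 : forall z, on_edges a b c d z -> ccont (fun z => phi z / (z - (w + h)))%C z).
  { intros z Hz; apply ccont_mult; [apply Hc, Hz | apply I1, N2, Hz]. }
  assert (C3 : forall z, on_edges a b c d z -> ccont (fun z => phi z / ((z - w) * (z - w)))%C z).
  { intros z Hz; apply ccont_mult; [apply Hc, Hz|].
    apply cdiff_ccont, cdiff_inv; [apply Cmult_neq_0; apply N1, Hz|].
    apply cdiff_mult; apply cdiff_minus; solve [apply cdiff_id | apply cdiff_const]. }
  assert (C0 : forall k f z, ccont f z -> ccont (fun z => k * f z)%C z).
  { intros k f z Hf; apply (ccont_mult (fun _ => k) f); [apply cdiff_ccont, cdiff_const | exact Hf]. }
  set (g := fun z => (phi z / (z - (w + h)) + (- RtoC 1 * (phi z / (z - w))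
    + - h * (phi z / ((z - w) * (z - w)))))%C).
  assert (E : (rect (fun z => phi z / (z - (w + h))) a b c d - rect (fun z => phi z / (z - w)) a b c d
        - h * rect (fun z => phi z / ((z - w) * (z - w))) a b c d)%C = rect g a b c d).
  { unfold g; rewrite !rect_plus, !rect_scal; try assumption; try ring;
    intros z Hz; try (apply ccont_plus); apply C0; auto. }
  rewrite E.
  replace (8 * M * (Cmod h * Cmod h) / (r * r * r) * (b - a + (d - c)))
    with (4 * (M * (Cmod h * Cmod h) * 2 / (r * r * r)) * (b - a + (d - c))) by (field; lra).
  apply rect_bound; try assumption.
  { intros z Hz; unfold g; apply ccont_plus; [apply C2, Hz | apply ccont_plus; apply C0; auto]. }
  intros z Hz.
  assert (E2 : g z = (phi z * (h * h) / ((z - w) * (z - w) * (z - (w + h))))%C).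
  { unfold g; field; split; auto. }
  rewrite E2, Cmod_div by (repeat apply Cmult_neq_0; auto).
  rewrite !Cmod_mult.
  specialize (Hdist z Hz); specialize (D2 z Hz); specialize (HM z Hz).
  assert (0 <= Cmod h * Cmod h) by (generalize (Cmod_ge_0 h); nra).
  replace (M * (Cmod h * Cmod h) * 2 / (r * r * r)) with (M * (Cmod h * Cmod h) * / (r * r * (r / 2))) by (field; lra).
  apply Rmult_le_compat.
  - apply Rmult_le_pos; [apply Cmod_ge_0 | assumption].
  - apply Rlt_le, Rinv_0_lt_compat; repeat apply Rmult_lt_0_compat; lra.
  - apply Rmult_le_compat_r; assumption.
  - apply Rinv_le_contravar; [repeat apply Rmult_lt_0_compat; lra|].
    apply Rmult_le_compat; try lra; nra.
Qed.

Lemma quadratic_cder (f : C -> C) (z l : C) (K r : R) : 0 < r ->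
  (forall h, Cmod h <= r -> Cmod (f (z + h) - f z - h * l)%C <= K * (Cmod h * Cmod h)) ->
  cder f z l.
Proof.
  intros Hr H eps Heps.
  assert (HK : 0 <= Rabs K) by apply Rabs_pos.
  exists (Rmin r (eps / (Rabs K + 1))); split.
  { apply Rmin_glb_lt; [exact Hr | apply Rdiv_lt_0_compat; lra]. }
  intros w Hw.
  assert (H1 : Cmod (w - z) < r) by (eapply Rlt_le_trans; [exact Hw | apply Rmin_l]).
  assert (H2 : Cmod (w - z) < eps / (Rabs K + 1)) by (eapply Rlt_le_trans; [exact Hw | apply Rmin_r]).
  specialize (H (w - z)%C (Rlt_le _ _ H1)).
  replace (z + (w - z))%C with w in H by ring.
  eapply Rle_trans; [exact H|].
  rewrite <- Rmult_assoc; apply Rmult_le_compat_r; [apply Cmod_ge_0|].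
  assert (K <= Rabs K) by apply RRle_abs.
  assert (0 <= Cmod (w - z)) by apply Cmod_ge_0.
  apply Rle_trans with ((Rabs K + 1) * Cmod (w - z)); [nra|].
  apply Rle_trans with ((Rabs K + 1) * (eps / (Rabs K + 1))); [|right; field; lra].
  apply Rmult_le_compat_l; lra.
Qed.

Definition in_sq (w : C) (r : R) (z : C) : Prop :=
  in_rect (Re w - r) (Re w + r) (Im w - r) (Im w + r) z.

Lemma in_sq_dist (w z : C) (r : R) : Cmod (z - w) <= r -> in_sq w r z.
Proof.
  intro H.
  assert (H1 := re_le_Cmod (z - w)%C). assert (H2 := im_le_Cmod (z - w)%C).
  change (Re (z - w)%C) with (Re z - Re w) in H1.
  change (Im (z - w)%C) with (Im z - Im w) in H2.
  apply Rabs_le_between in H1; apply Rabs_le_between in H2; split; lra.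
Qed.

Lemma in_sq_Cmod (w z : C) (r : R) : in_sq w r z -> Cmod (z - w) <= 2 * r.
Proof.
  intros [H1 H2]; eapply Rle_trans; [apply Cmod_le_abs|].
  change (Rabs (Re z - Re w) + Rabs (Im z - Im w) <= 2 * r).
  replace (2 * r) with (r + r) by ring; apply Rplus_le_compat; apply Rabs_le; lra.
Qed.

Lemma two_pi_i_neq : (2 * Ci * RtoC PI)%C <> RtoC 0.
Proof.
  apply Cmod_gt_0; rewrite !Cmod_mult, Cmod_Ci, !Cmod_R, !Rabs_pos_eq; generalize PI_RGT_0; lra.
Qed.

Lemma Cmod_two_pi_i : 1 <= Cmod (2 * Ci * RtoC PI)%C.
Proof.
  generalize PI2_1, PI_RGT_0; intros H1 H2.
  rewrite !Cmod_mult, Cmod_Ci, !Cmod_R, !Rabs_pos_eq; lra.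
Qed.

(** That f has a derivative is already assumed; the point is uniformity. The derivative and the
    quadratic error are bounded by M and r alone, which is what allows summation over a series in
    [weierstrass_M_test]. *)
Lemma cauchy_estimates (f : C -> C) (w : C) (r M : R) : 0 < r ->
  (forall z, in_sq w r z -> cdiff f z) ->
  (forall z, in_sq w r z -> Cmod (f z) <= M) ->
  exists l, cder f w l /\ Cmod l <= 16 * M / r /\
    forall h, Cmod h <= r / 2 ->
      Cmod (f (w + h) - f w - h * l)%C <= 32 * M / (r * r) * (Cmod h * Cmod h).
Proof.
  intros Hr Hf HM.
  set (a := Re w - r) in *. set (b := Re w + r) in *.
  set (c := Im w - r) in *. set (d := Im w + r) in *.
  assert (Hab : a <= b) by (unfold a, b; lra). assert (Hcd : c <= d) by (unfold c, d; lra).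
  assert (Hed : forall z, on_edges a b c d z -> in_sq w r z).
  { intros z Hz; apply on_edges_in_rect; assumption. }
  assert (Hc : forall z, on_edges a b c d z -> ccont f z).
  { intros z Hz; apply cdiff_ccont, Hf, Hed, Hz. }
  assert (HM' : forall z, on_edges a b c d z -> Cmod (f z) <= M) by auto.
  assert (Hdist : forall z, on_edges a b c d z -> r <= Cmod (z - w)).
  { intros z Hz; rewrite (surjective_pairing w).
    apply (sq_edges_dist (Re w) (Im w) r z Hr Hz). }
  set (k := (2 * Ci * RtoC PI)%C).
  assert (Hk := two_pi_i_neq). fold k in Hk.
  assert (Hk1 := Cmod_two_pi_i). fold k in Hk1.
  set (D := rect (fun z => f z / ((z - w) * (z - w)))%C a b c d).
  assert (HM0 : 0 <= M).
  { eapply Rle_trans; [apply Cmod_ge_0 | apply (HM w)].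
    apply in_sq_dist; replace (w - w)%C with (RtoC 0) by ring; rewrite Cmod_0; lra. }
  assert (T : forall h, Cmod h <= r / 2 ->
    Cmod (f (w + h) - f w - h * (D / k))%C <= 32 * M / (r * r) * (Cmod h * Cmod h)).
  { intros h Hh.
    assert (H := cauchy_type_taylor f a b c d M r w h Hab Hcd Hr Hc HM' Hdist Hh).
    assert (Hwh : in_open_rect a b c d (w + h)).
    { assert (H1 := re_le_Cmod h). assert (H2 := im_le_Cmod h).
      apply Rabs_le_between in H1; apply Rabs_le_between in H2.
      unfold in_open_rect, a, b, c, d. 
      change (Re (w + h)) with (Re w + Re h). change (Im (w + h)) with (Im w + Im h). lra. }
    assert (Hw : in_open_rect a b c d w) by (unfold in_open_rect, a, b, c, d; lra).
    rewrite (cauchy_formula f a b c d (w + h) Hwh Hf), (cauchy_formula f a b c d w Hw Hf) in H.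
    fold k in H; fold D in H.
    replace (k * f (w + h) - k * f w - h * D)%C with (k * (f (w + h) - f w - h * (D / k)))%C in H
      by (field; exact Hk).
    rewrite Cmod_mult in H.
    replace (8 * M * (Cmod h * Cmod h) / (r * r * r) * (b - a + (d - c)))
      with (32 * M / (r * r) * (Cmod h * Cmod h)) in H by (unfold a, b, c, d; field; lra).
    generalize (Cmod_ge_0 (f (w + h)%C - f w - h * (D / k))); nra. }
  exists (D / k)%C; split; [|split].
  - eapply quadratic_cder; [|exact T]; lra.
  - rewrite Cmod_div by exact Hk.
    apply Rle_trans with (Cmod D).
    { apply Rle_div_l; [lra|]. generalize (Cmod_ge_0 D); nra. }
    apply Rle_trans with (4 * (M / (r * r)) * ((b - a) + (d - c))).
    2:{ right; unfold a, b, c, d; field; lra. }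
    assert (Hn : forall z, on_edges a b c d z -> (z - w)%C <> RtoC 0).
    { intros z Hz; apply Cmod_gt_0; specialize (Hdist z Hz); lra. }
    apply rect_bound; try assumption.
    + intros z Hz; apply ccont_mult; [apply Hc, Hz|].
      apply cdiff_ccont, cdiff_inv; [apply Cmult_neq_0; apply Hn, Hz|].
      apply cdiff_mult; apply cdiff_minus; solve [apply cdiff_id | apply cdiff_const].
    + intros z Hz; rewrite Cmod_div by (apply Cmult_neq_0; apply Hn, Hz).
      rewrite Cmod_mult; specialize (Hdist z Hz); specialize (HM' z Hz).
      apply Rmult_le_compat; [apply Cmod_ge_0| |exact HM'|].
      * apply Rlt_le, Rinv_0_lt_compat; nra.
      * apply Rinv_le_contravar; nra.
  - exact T.
Qed.

(** Removability of the singularity of (f w - f p)/(w - p) at p: the quotient equals the Cauchy-type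
    integral of f z/(z - p), which is differentiable at p as anywhere else in the disc. *)
Lemma divided_difference (f : C -> C) (p : C) (r : R) : 0 < r ->
  (forall z, in_sq p r z -> cdiff f z) ->
  exists q : C -> C, (forall w, Cmod (w - p) < r -> cdiff q w) /\
    (forall w, Cmod (w - p) < r -> f w = (f p + (w - p) * q w)%C).
Proof.
  intros Hr Hf.
  set (a := Re p - r). set (b := Re p + r). set (c := Im p - r). set (d := Im p + r).
  assert (Hab : a <= b) by (unfold a, b; lra). assert (Hcd : c <= d) by (unfold c, d; lra).
  set (k := (2 * Ci * RtoC PI)%C).
  assert (Hk := two_pi_i_neq). fold k in Hk.
  set (phi := fun z => (f z / (z - p))%C).
  assert (Hdist : forall z, on_edges a b c d z -> r <= Cmod (z - p)).
  { intros z Hz; rewrite (surjective_pairing p).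
    apply (sq_edges_dist (Re p) (Im p) r z Hr Hz). }
  assert (Hfe : forall z, on_edges a b c d z -> cdiff f z).
  { intros z Hz; apply Hf, on_edges_in_rect; assumption. }
  assert (Hn : forall z w, on_edges a b c d z -> Cmod (w - p) < r -> (z - w)%C <> RtoC 0).
  { intros z w Hz Hw; apply Cmod_gt_0; specialize (Hdist z Hz).
    generalize (Cmod_triangle_inv (z - p) (w - p)).
    replace (z - p - (w - p))%C with (z - w)%C by ring; lra. }
  assert (Hp : Cmod (p - p) < r).
  { replace (p - p)%C with (RtoC 0) by ring; rewrite Cmod_0; exact Hr. }
  assert (Hcd' : forall z w, on_edges a b c d z -> Cmod (w - p) < r -> cdiff (fun z => / (z - w))%C z).
  { intros z w Hz Hw; apply cdiff_inv; [apply Hn; assumption|].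
    apply cdiff_minus; [apply cdiff_id | apply cdiff_const]. }
  assert (Hphi : forall z, on_edges a b c d z -> cdiff phi z).
  { intros z Hz; unfold phi; apply (cdiff_mult f (fun z => / (z - p))%C); auto. }
  destruct (edges_bounded phi a b c d Hab Hcd) as [M [HM0 HM]].
  { intros z Hz; apply cdiff_ccont, Hphi, Hz. }
  exists (fun w => / k * rect (fun z => phi z / (z - w)) a b c d)%C; split.
  - intros w Hw; apply (cdiff_mult (fun _ => / k)%C); [apply cdiff_const|].
    set (s := r - Cmod (w - p)). assert (Hs : 0 < s) by (unfold s; lra).
    exists (rect (fun z => phi z / ((z - w) * (z - w)))%C a b c d).
    apply quadratic_cder with (8 * M / (s * s * s) * ((b - a) + (d - c))) (s / 2); [lra|].
    intros h Hh.
    replace (8 * M / (s * s * s) * (b - a + (d - c)) * (Cmod h * Cmod h))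
      with (8 * M * (Cmod h * Cmod h) / (s * s * s) * (b - a + (d - c))) by (field; lra).
    apply cauchy_type_taylor; try assumption.
    + intros z Hz; apply cdiff_ccont, Hphi, Hz.
    + intros z Hz; specialize (Hdist z Hz); unfold s.
      generalize (Cmod_triangle_inv (z - p) (w - p)).
      replace (z - p - (w - p))%C with (z - w)%C by ring; lra.
  - intros w Hw.
    assert (Hopen : forall w, Cmod (w - p) < r -> in_open_rect a b c d w).
    { clear; intros w Hw.
      assert (H1 := re_le_Cmod (w - p)%C). assert (H2 := im_le_Cmod (w - p)%C).
      change (Re (w - p)%C) with (Re w - Re p) in H1.
      change (Im (w - p)%C) with (Im w - Im p) in H2.
      apply Rabs_le_between in H1; apply Rabs_le_between in H2.
      unfold in_open_rect, a, b, c, d; lra. }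
    assert (E1 := cauchy_formula f a b c d w (Hopen w Hw) Hf).
    assert (E2 := cauchy_formula f a b c d p (Hopen p Hp) Hf).
    fold k in E1, E2.
    assert (E : (k * f w = k * f p + (w - p) * rect (fun z => phi z / (z - w)) a b c d)%C).
    { rewrite <- E1, <- E2, <- rect_scal, <- rect_plus; try assumption.
      - apply rect_ext; try assumption; intros z Hz; unfold phi; field; split; apply Hn; assumption.
      - intros z Hz; apply cdiff_ccont; apply (cdiff_mult f (fun z => / (z - p))%C); auto.
      - intros z Hz; apply cdiff_ccont, (cdiff_mult (fun _ => (w - p)%C)); [apply cdiff_const|].
        apply (cdiff_mult phi (fun z => / (z - w))%C); auto.
      - intros z Hz; apply cdiff_ccont, (cdiff_mult phi (fun z => / (z - w))%C); auto. }
    replace (f w) with (/ k * (k * f w))%C by (field; exact Hk).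
    rewrite E; field; exact Hk.
Qed.

(** * Series of complex numbers and of holomorphic functions *)

Fixpoint csum (a : nat -> C) (n : nat) : C :=
  match n with O => RtoC 0 | S k => (csum a k + a k)%C end.

Fixpoint rsum (a : nat -> R) (n : nat) : R :=
  match n with O => 0 | S k => rsum a k + a k end.

Definition Ccv (u : nat -> C) (l : C) : Prop :=
  forall eps, 0 < eps -> exists N, forall n, (N <= n)%nat -> Cmod (u n - l) < eps.

Lemma csum_ext (a b : nat -> C) (n : nat) :
  (forall k, (k < n)%nat -> a k = b k) -> csum a n = csum b n.
Proof.
  induction n as [|n IH]; intro E; simpl; [reflexivity|].
  rewrite IH by (intros; apply E; lia); rewrite E by lia; reflexivity.
Qed.

Lemma csum_plus (a b : nat -> C) (n : nat) :
  csum (fun k => a k + b k)%C n = (csum a n + csum b n)%C.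
Proof. induction n as [|n IH]; simpl; [ring | rewrite IH; ring]. Qed.

Lemma csum_scal (c : C) (a : nat -> C) (n : nat) :
  csum (fun k => c * a k)%C n = (c * csum a n)%C.
Proof. induction n as [|n IH]; simpl; [ring | rewrite IH; ring]. Qed.

Lemma csum_shift (a : nat -> C) (n : nat) :
  csum a (S n) = (a 0%nat + csum (fun k => a (S k)) n)%C.
Proof.
  induction n as [|n IH]; [simpl; ring|].
  change (csum a (S (S n))) with (csum a (S n) + a (S n))%C; rewrite IH; simpl; ring.
Qed.

Lemma csum_add (a : nat -> C) (n m : nat) :
  csum a (n + m) = (csum a n + csum (fun k => a (n + k)%nat) m)%C.
Proof.
  induction m as [|m IH]; [rewrite Nat.add_0_r; simpl; ring|].
  rewrite Nat.add_succ_r; simpl; rewrite IH; ring.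
Qed.

Lemma csum_zero (n : nat) : csum (fun _ => RtoC 0) n = RtoC 0.
Proof. induction n as [|n IH]; simpl; [reflexivity | rewrite IH; ring]. Qed.

Lemma csum_Cmod (a : nat -> C) (b : nat -> R) (n : nat) :
  (forall k, (k < n)%nat -> Cmod (a k) <= b k) -> Cmod (csum a n) <= rsum b n.
Proof.
  induction n as [|n IH]; intro H; simpl; [rewrite Cmod_0; lra|].
  eapply Rle_trans; [apply Cmod_triangle|].
  apply Rplus_le_compat; [apply IH; intros; apply H; lia | apply H; lia].
Qed.

Lemma rsum_ext (a b : nat -> R) (n : nat) :
  (forall k, (k < n)%nat -> a k = b k) -> rsum a n = rsum b n.
Proof.
  induction n as [|n IH]; intro E; simpl; [reflexivity|].
  rewrite IH by (intros; apply E; lia); rewrite E by lia; reflexivity.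
Qed.

Lemma rsum_plus (a b : nat -> R) (n : nat) :
  rsum (fun k => a k + b k) n = rsum a n + rsum b n.
Proof. induction n as [|n IH]; simpl; [ring | rewrite IH; ring]. Qed.

Lemma rsum_scal (c : R) (a : nat -> R) (n : nat) :
  rsum (fun k => c * a k) n = c * rsum a n.
Proof. induction n as [|n IH]; simpl; [ring | rewrite IH; ring]. Qed.

Lemma rsum_le (a b : nat -> R) (n : nat) :
  (forall k, (k < n)%nat -> a k <= b k) -> rsum a n <= rsum b n.
Proof.
  induction n as [|n IH]; intro H; simpl; [lra|].
  apply Rplus_le_compat; [apply IH; intros; apply H; lia | apply H; lia].
Qed.

Lemma rsum_const (c : R) (n : nat) : rsum (fun _ => c) n = INR n * c.
Proof.
  induction n as [|n IH]; [simpl; ring|].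
  rewrite S_INR; simpl; rewrite IH; ring.
Qed.

Lemma rsum_sum_n (a : nat -> R) (n : nat) : sum_n a n = rsum a (S n).
Proof.
  induction n as [|n IH].
  - rewrite sum_O; simpl; ring.
  - rewrite sum_Sn, IH; reflexivity.
Qed.

Lemma csum_sum_n (a : nat -> C) (n : nat) :
  sum_n (G := C_AbelianMonoid) a n = csum a (S n).
Proof.
  induction n as [|n IH].
  - rewrite sum_O; simpl; ring.
  - rewrite sum_Sn, IH; reflexivity.
Qed.

Lemma Re_csum (a : nat -> C) (n : nat) : Re (csum a n) = rsum (fun k => Re (a k)) n.
Proof.
  induction n as [|n IH]; [reflexivity|].
  simpl csum; rewrite re_plus, IH; reflexivity.
Qed.

Lemma Im_csum (a : nat -> C) (n : nat) : Im (csum a n) = rsum (fun k => Im (a k)) n.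
Proof.
  induction n as [|n IH]; [reflexivity|].
  simpl rsum; rewrite <- IH; reflexivity.
Qed.

Lemma is_Cseries_csum (a : nat -> C) (l : C) : Ccv (csum a) l -> is_Cseries a l.
Proof.
  intros H P [eps HP].
  destruct (H eps (cond_pos eps)) as [N HN].
  exists N; intros n Hn; apply HP.
  apply (C_NormedModule_mixin_compat1 l).
  change (Cmod (sum_n (G := C_AbelianMonoid) a n - l)%C < eps).
  rewrite csum_sum_n; apply HN; lia.
Qed.

Lemma csum_is_Cseries (a : nat -> C) (l : C) : is_Cseries a l -> Ccv (csum a) l.
Proof.
  intros H eps Heps.
  (* Balls of [C_UniformSpace] are products of intervals; passing from them to [Cmod] costs the
     factor sqrt 2. *)
  assert (Hs : 0 < sqrt 2) by (apply sqrt_lt_R0; lra).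
  assert (He : 0 < eps / sqrt 2) by (apply Rdiv_lt_0_compat; assumption).
  destruct (H (ball (M := C_UniformSpace) l (mkposreal _ He))) as [N HN].
  { exists (mkposreal _ He); auto. }
  exists (S N); intros [|n] Hn; [lia|].
  specialize (HN n ltac:(lia)).
  rewrite <- csum_sum_n.
  apply C_NormedModule_mixin_compat2 in HN; simpl in HN.
  replace (sqrt 2 * (eps / sqrt 2)) with eps in HN by (field; lra).
  exact HN.
Qed.

Lemma Ccv_unique (u : nat -> C) (l m : C) : Ccv u l -> Ccv u m -> l = m.
Proof.
  intros Hl Hm; apply Ceq_minus, Cmod_eq_0.
  destruct (Rle_lt_or_eq_dec 0 _ (Cmod_ge_0 (l - m))) as [Hpos|]; [exfalso|congruence].
  destruct (Hl (Cmod (l - m) / 2)) as [N1 H1]; [lra|].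
  destruct (Hm (Cmod (l - m) / 2)) as [N2 H2]; [lra|].
  specialize (H1 (N1 + N2)%nat ltac:(lia)). specialize (H2 (N1 + N2)%nat ltac:(lia)).
  assert (T := Cmod_triangle (l - u (N1 + N2)%nat) (u (N1 + N2)%nat - m)).
  replace (l - u (N1 + N2)%nat + (u (N1 + N2)%nat - m))%C with (l - m)%C in T by ring.
  rewrite (Cmod_minus_sym l (u (N1 + N2)%nat)) in T; lra.
Qed.

Lemma Ccv_ext (u v : nat -> C) (l : C) : (forall n, u n = v n) -> Ccv u l -> Ccv v l.
Proof.
  intros E H eps Heps; destruct (H eps Heps) as [N HN].
  exists N; intros n Hn; rewrite <- E; auto.
Qed.

Lemma Ccv_const (l : C) : Ccv (fun _ => l) l.
Proof.
  intros eps Heps; exists 0%nat; intros n _.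
  replace (l - l)%C with (RtoC 0) by ring; rewrite Cmod_0; exact Heps.
Qed.

Lemma Ccv_plus (u v : nat -> C) (l m : C) :
  Ccv u l -> Ccv v m -> Ccv (fun n => u n + v n)%C (l + m)%C.
Proof.
  intros Hu Hv eps Heps.
  destruct (Hu (eps / 2)) as [N1 H1]; [lra|].
  destruct (Hv (eps / 2)) as [N2 H2]; [lra|].
  exists (N1 + N2)%nat; intros n Hn.
  specialize (H1 n ltac:(lia)). specialize (H2 n ltac:(lia)).
  replace (u n + v n - (l + m))%C with ((u n - l) + (v n - m))%C by ring.
  eapply Rle_lt_trans; [apply Cmod_triangle | lra].
Qed.

Lemma Ccv_scal (c : C) (u : nat -> C) (l : C) :
  Ccv u l -> Ccv (fun n => c * u n)%C (c * l)%C.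
Proof.
  intros Hu eps Heps.
  assert (Hc : 0 < Cmod c + 1) by (generalize (Cmod_ge_0 c); lra).
  destruct (Hu (eps / (Cmod c + 1))) as [N HN]; [apply Rdiv_lt_0_compat; lra|].
  exists N; intros n Hn; specialize (HN n Hn).
  replace (c * u n - c * l)%C with (c * (u n - l))%C by ring.
  rewrite Cmod_mult.
  apply Rle_lt_trans with ((Cmod c + 1) * Cmod (u n - l)).
  { generalize (Cmod_ge_0 (u n - l)); nra. }
  apply (Rmult_lt_compat_l (Cmod c + 1)) in HN; [|exact Hc].
  replace ((Cmod c + 1) * (eps / (Cmod c + 1))) with eps in HN by (field; lra).
  exact HN.
Qed.

Lemma Ccv_minus (u v : nat -> C) (l m : C) :
  Ccv u l -> Ccv v m -> Ccv (fun n => u n - v n)%C (l - m)%C.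
Proof.
  intros Hu Hv; apply Ccv_ext with (fun n => u n + (- RtoC 1) * v n)%C; [intro; ring|].
  replace (l - m)%C with (l + (- RtoC 1) * m)%C by ring.
  apply Ccv_plus; [exact Hu | apply Ccv_scal, Hv].
Qed.

Lemma Ccv_shift (u : nat -> C) (l : C) (k : nat) :
  Ccv (fun n => u (n + k)%nat) l <-> Ccv u l.
Proof.
  split; intros H eps Heps; destruct (H eps Heps) as [N HN].
  - exists (N + k)%nat; intros n Hn.
    replace n with ((n - k) + k)%nat by lia; apply HN; lia.
  - exists N; intros n Hn; apply HN; lia.
Qed.

Lemma Ccv_bound (u : nat -> C) (l : C) (B : R) :
  Ccv u l -> (forall n, Cmod (u n) <= B) -> Cmod l <= B.
Proof.
  intros H HB; apply Rnot_lt_le; intro Hlt.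
  destruct (H (Cmod l - B)) as [N HN]; [lra|].
  specialize (HN N (le_n N)); specialize (HB N).
  generalize (Cmod_triangle_inv l (u N)); rewrite Cmod_minus_sym; lra.
Qed.

Lemma Ccv_squeeze (u : nat -> C) (l : C) (b : nat -> R) :
  (forall n, Cmod (u n - l) <= b n) -> is_lim_seq b 0 -> Ccv u l.
Proof.
  intros H Hb eps Heps.
  apply is_lim_seq_spec in Hb; destruct (Hb (mkposreal eps Heps)) as [N HN].
  exists N; intros n Hn; specialize (HN n Hn); simpl in HN.
  rewrite Rminus_0_r in HN.
  eapply Rle_lt_trans; [apply H|]; eapply Rle_lt_trans; [apply RRle_abs | exact HN].
Qed.

(** A total function; its value is meaningful where the series converges, as under
    [CSeries_dominated]. *)
Definition CSeries (a : nat -> C) : C :=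
  (Series (fun n => Re (a n)), Series (fun n => Im (a n))).

Lemma is_series_rsum (a : nat -> R) (l : R) : is_series a l -> is_lim_seq (rsum a) l.
Proof.
  intro H; apply is_lim_seq_incr_1.
  apply is_lim_seq_ext with (sum_n a); [intro n; apply rsum_sum_n | exact H].
Qed.

Lemma rsum_le_Series (a : nat -> R) (n : nat) :
  (forall k, 0 <= a k) -> ex_series a -> rsum a n <= Series a.
Proof.
  intros Ha Hs.
  assert (H := is_series_rsum _ _ (Series_correct _ Hs)).
  apply (is_lim_seq_incr_compare _ _ H); intro k; simpl; specialize (Ha k); lra.
Qed.

Lemma Ccv_components (u : nat -> C) (l : C) :
  is_lim_seq (fun n => Re (u n)) (Re l) -> is_lim_seq (fun n => Im (u n)) (Im l) -> Ccv u l.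
Proof.
  intros H1 H2.
  apply Ccv_squeeze with (fun n => Rabs (Re (u n) - Re l) + Rabs (Im (u n) - Im l)).
  - intro n; apply (Cmod_le_abs (u n - l)%C).
  - replace (Finite 0) with (Finite (Rabs (Re l - Re l) + Rabs (Im l - Im l))).
    2:{ rewrite !Rminus_diag, Rabs_R0; f_equal; ring. }
    apply is_lim_seq_plus'.
    + apply (is_lim_seq_abs _ (Finite (Re l - Re l))), is_lim_seq_minus'; [exact H1 | apply is_lim_seq_const].
    + apply (is_lim_seq_abs _ (Finite (Im l - Im l))), is_lim_seq_minus'; [exact H2 | apply is_lim_seq_const].
Qed.

Lemma CSeries_dominated (a : nat -> C) (M : nat -> R) :
  (forall n, Cmod (a n) <= M n) -> ex_series M ->
  Ccv (csum a) (CSeries a) /\ Cmod (CSeries a) <= Series M.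
Proof.
  intros H HM.
  assert (Cc : Ccv (csum a) (CSeries a)).
  { apply Ccv_components; simpl.
    - apply is_lim_seq_ext with (rsum (fun k => Re (a k))); [intro; symmetry; apply Re_csum|].
      apply is_series_rsum, Series_correct.
      apply (ex_series_le (K := R_AbsRing) (V := R_CompleteNormedModule) _ M); [|exact HM].
      intro n; eapply Rle_trans; [apply re_le_Cmod | apply H].
    - apply is_lim_seq_ext with (rsum (fun k => Im (a k))); [intro; symmetry; apply Im_csum|].
      apply is_series_rsum, Series_correct.
      apply (ex_series_le (K := R_AbsRing) (V := R_CompleteNormedModule) _ M); [|exact HM].
      intro n; eapply Rle_trans; [apply im_le_Cmod | apply H]. }
  split; [exact Cc|].
  apply (Ccv_bound _ _ _ Cc); intro n.
  eapply Rle_trans; [apply (csum_Cmod a M); auto|].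
  apply rsum_le_Series; [|exact HM].
  intro k; eapply Rle_trans; [apply Cmod_ge_0 | apply H].
Qed.

Lemma cder_C_derive (f : C -> C) (z l : C) : cder f z l -> C_derive f z = l.
Proof. intro H; apply is_C_derive_unique, cder_is_derive, H. Qed.

(** The Cauchy estimates bound each derivative and each quadratic error by a constant multiple of
    [M n]; summing the errors yields a quadratic error for the sum, hence its derivative. *)
Lemma weierstrass_M_test (u : nat -> C -> C) (w : C) (r : R) (M : nat -> R) :
  0 < r -> (forall n z, in_sq w r z -> cdiff (u n) z) ->
  (forall n z, in_sq w r z -> Cmod (u n z) <= M n) -> ex_series M ->
  let d := fun n => C_derive (u n) w in
  (forall n, cder (u n) w (d n)) /\ Ccv (csum d) (CSeries d) /\
  cder (fun z => CSeries (fun n => u n z)) w (CSeries d).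
Proof.
  intros Hr Hd HM Hs d.
  assert (Hw : in_sq w r w).
  { apply in_sq_dist; replace (w - w)%C with (RtoC 0) by ring; rewrite Cmod_0; lra. }
  assert (HM0 : forall n, 0 <= M n).
  { intro n; eapply Rle_trans; [apply Cmod_ge_0 | apply (HM n w Hw)]. }
  assert (E : forall n, cder (u n) w (d n) /\ Cmod (d n) <= 16 / r * M n /\
    forall h, Cmod h <= r / 2 ->
      Cmod (u n (w + h) - u n w - h * d n)%C <= 32 / (r * r) * (Cmod h * Cmod h) * M n).
  { intro n; destruct (cauchy_estimates (u n) w r (M n) Hr (Hd n) (HM n)) as [l [H1 [H2 H3]]].
    unfold d; rewrite (cder_C_derive _ _ _ H1); split; [exact H1|]; split.
    - eapply Rle_trans; [exact H2|]; right; field; lra.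
    - intros h Hh; eapply Rle_trans; [apply H3, Hh|]; right; field; lra. }
  assert (Cd : Ccv (csum d) (CSeries d)).
  { apply (CSeries_dominated d (fun n => 16 / r * M n)); [intro n; apply E|].
    apply (ex_series_scal (K := R_AbsRing) (V := R_NormedModule) (16 / r) M Hs). }
  split; [intro n; apply E|]; split; [exact Cd|].
  apply quadratic_cder with (32 / (r * r) * Series M) (r / 2); [lra|].
  intros h Hh.
  assert (Hwh : in_sq w r (w + h)).
  { apply in_sq_dist; replace (w + h - w)%C with h by ring; lra. }
  assert (Cu : forall z, in_sq w r z -> Ccv (csum (fun n => u n z)) (CSeries (fun n => u n z))).
  { intros z Hz; apply (CSeries_dominated _ M); [intro n; apply HM, Hz | exact Hs]. }
  assert (L := Ccv_minus _ _ _ _ (Ccv_minus _ _ _ _ (Cu _ Hwh) (Cu _ Hw)) (Ccv_scal h _ _ Cd)).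
  apply (Ccv_bound _ _ _ L); intro n; simpl.
  replace (csum (fun n => u n (w + h)%C) n - csum (fun n => u n w) n - h * csum d n)%C
    with (csum (fun n => u n (w + h) - u n w - h * d n)%C n).
  2:{ clear; induction n as [|n IH]; simpl; [ring | rewrite IH; ring]. }
  eapply Rle_trans; [apply (csum_Cmod _ (fun n => 32 / (r * r) * (Cmod h * Cmod h) * M n))|].
  { intros k _; apply E, Hh. }
  rewrite rsum_scal.
  replace (32 / (r * r) * Series M * (Cmod h * Cmod h)) with (32 / (r * r) * (Cmod h * Cmod h) * Series M) by ring.
  apply Rmult_le_compat_l; [|apply rsum_le_Series; assumption].
  apply Rmult_le_pos; [apply Rdiv_le_0_compat; nra | generalize (Cmod_ge_0 h); nra].
Qed.

(** * Analytic continuation in the upper half-plane *)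

Lemma cdiff_pow (f : C -> C) (z : C) (n : nat) : cdiff f z -> cdiff (fun w => (f w) ^ n)%C z.
Proof.
  intro H; induction n as [|n IH]; simpl; [apply cdiff_const|].
  apply (cdiff_mult f (fun w => (f w) ^ n)%C); assumption.
Qed.

Lemma geometric_zero (x C q : R) : 0 <= x -> 0 <= q < 1 -> (forall n, x <= C * q ^ n) -> x = 0.
Proof.
  intros Hx Hq H.
  destruct (Rle_lt_or_eq_dec 0 x Hx) as [Hpos|]; [exfalso|congruence].
  assert (HC : 0 < C) by (specialize (H 0%nat); simpl in H; lra).
  destruct (pow_lt_1_zero q) with (y := x / C) as [N HN].
  { rewrite Rabs_pos_eq; lra. }
  { apply Rdiv_lt_0_compat; assumption. }
  specialize (HN N (le_n N)); specialize (H N).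
  rewrite Rabs_pos_eq in HN by (apply pow_le; lra).
  apply (Rmult_lt_compat_l C) in HN; [|exact HC].
  replace (C * (x / C)) with x in HN by (field; lra).
  lra.
Qed.

(* The square centred at 2 + i t with half-side slightly less than t stays in the
   upper half-plane and, for t large, contains any prescribed point w; since h
   vanishes near the centre a, Cauchy's formula applies to h(z) / (z - a)^n. *)
Lemma identity_upper_half_plane (h : C -> C) :
  (forall z, 0 < Im z -> cdiff h z) -> (forall z, 1 < Re z -> h z = RtoC 0) ->
  forall z, 0 < Im z -> h z = RtoC 0.
Proof.
  intros Hd H0 w Hw.
  set (X := Re w - 2). set (y := Im w) in *.
  (* With t y = X^2 + y^2 one gets |w - a|^2 = X^2 + (y - t)^2 = t^2 - t y < t^2, so w lies within
     distance t of the centre. *)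
  set (t := (X * X + y * y) / y).
  assert (Ht : 0 < t) by (apply Rdiv_lt_0_compat; nra).
  assert (Hty : t * y = X * X + y * y) by (unfold t; field; lra).
  set (a := (2, t) : C).
  set (rho := Cmod (w - a)).
  assert (Hrho0 : 0 <= rho) by apply Cmod_ge_0.
  assert (Hrho2 : rho ^ 2 = X * X + (y - t) * (y - t)).
  { unfold rho; rewrite Cmod2_alt.
    change (Re (w - a)%C) with X. change (Im (w - a)%C) with (y - t). ring. }
  assert (Hrho : rho < t) by (simpl in Hrho2; nra).
  destruct (Rle_lt_or_eq_dec 0 rho Hrho0) as [Hrp|Hr0].
  2:{ apply H0. assert (E : (w - a)%C = RtoC 0) by (apply Cmod_eq_0; auto).
      assert (E2 : Re (w - a)%C = 0) by (rewrite E; reflexivity).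
      change (Re w - 2 = 0) in E2; lra. }
  set (l := (rho + t) / 2).
  assert (Hl : rho < l < t) by (unfold l; lra).
  clearbody l.
  assert (Hin : forall z, in_sq a l z -> 0 < Im z).
  { intros z [_ Hz]; simpl in Hz; lra. }
  assert (Hed : forall z, on_edges (2 - l) (2 + l) (t - l) (t + l) z -> in_sq a l z).
  { intros z Hz; apply on_edges_in_rect in Hz; [exact Hz | lra | lra]. }
  destruct (edges_bounded h (2 - l) (2 + l) (t - l) (t + l)) as [M [HM0 HM]]; [lra | lra | |].
  { intros z Hz; apply cdiff_ccont, Hd, Hin, Hed, Hz. }
  assert (Hda : forall z, on_edges (2 - l) (2 + l) (t - l) (t + l) z -> l <= Cmod (z - a)).
  { intros z Hz; apply (sq_edges_dist 2 t l z); [lra | exact Hz]. }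
  assert (Hdw : forall z, on_edges (2 - l) (2 + l) (t - l) (t + l) z -> l - rho <= Cmod (z - w)).
  { intros z Hz; specialize (Hda z Hz).
    generalize (Cmod_triangle_inv (z - a) (w - a)); fold rho.
    replace (z - a - (w - a))%C with (z - w)%C by ring; lra. }
  assert (Hwo : in_open_rect (2 - l) (2 + l) (t - l) (t + l) w).
  { assert (H1 := re_le_Cmod (w - a)%C). assert (H2 := im_le_Cmod (w - a)%C).
    fold rho in H1, H2.
    change (Re (w - a)%C) with (Re w - 2) in H1.
    change (Im (w - a)%C) with (Im w - t) in H2.
    apply Rabs_le_between in H1; apply Rabs_le_between in H2.
    unfold in_open_rect; lra. }
  apply Cmod_eq_0, geometric_zero with (16 * M * l / (l - rho)) (rho / l); [apply Cmod_ge_0| |].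
  { split; [apply Rdiv_le_0_compat; lra|]. apply Rlt_div_l; lra. }
  intro n.
  (* The edges stay at distance at least l > rho from a, so Cauchy's formula for u at w gives |h w|
     <= K (rho/l)^n with K independent of n. *)
  set (u := fun z => (h z * / ((z - a) ^ n))%C).
  assert (Hu : forall z, in_sq a l z -> cdiff u z).
  { intros z Hz.
    destruct (Rlt_dec (Cmod (z - a)) 1) as [Hz1|Hz1].
    - apply cdiff_ext_loc with (fun _ => RtoC 0) (1 - Cmod (z - a)); [lra| |apply cdiff_const].
      intros v Hv; unfold u; rewrite H0; [ring|].
      assert (T := Cmod_triangle (v - z) (z - a)).
      replace (v - z + (z - a))%C with (v - a)%C in T by ring.
      assert (H1 := re_le_Cmod (v - a)%C).
      change (Re (v - a)%C) with (Re v - 2) in H1.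
      apply Rabs_le_between in H1; lra.
    - apply (cdiff_mult h); [apply Hd, Hin, Hz|].
      apply cdiff_inv.
      + apply Cpow_nz, Cmod_gt_0; lra.
      + apply cdiff_pow, cdiff_minus; [apply cdiff_id | apply cdiff_const]. }
  assert (Cf := cauchy_formula u _ _ _ _ w Hwo Hu).
  assert (Nz : forall z, on_edges (2 - l) (2 + l) (t - l) (t + l) z -> (z - w)%C <> RtoC 0).
  { intros z Hz; apply Cmod_gt_0; specialize (Hdw z Hz); lra. }
  assert (B : Cmod (rect (fun z => u z / (z - w))%C (2 - l) (2 + l) (t - l) (t + l))
    <= 4 * (M * / l ^ n * / (l - rho)) * ((2 + l - (2 - l)) + (t + l - (t - l)))).
  { apply rect_bound; [lra | lra | |].
    - intros z Hz; apply cdiff_ccont, cdiff_div; [apply Nz, Hz | apply Hu, Hed, Hz|].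
      apply cdiff_minus; [apply cdiff_id | apply cdiff_const].
    - intros z Hz; rewrite Cmod_div by (apply Nz, Hz).
      specialize (Hda z Hz); specialize (Hdw z Hz); specialize (HM z Hz).
      unfold u; rewrite Cmod_mult, Cmod_inv by (apply Cpow_nz, Cmod_gt_0; lra).
      rewrite Cmod_pow.
      assert (0 < l ^ n) by (apply pow_lt; lra).
      assert (l ^ n <= Cmod (z - a) ^ n) by (apply pow_incr; lra).
      assert (0 < / Cmod (z - a) ^ n) by (apply Rinv_0_lt_compat; lra).
      apply Rmult_le_compat.
      + apply Rmult_le_pos; [apply Cmod_ge_0 | lra].
      + apply Rlt_le, Rinv_0_lt_compat; lra.
      + apply Rmult_le_compat; [apply Cmod_ge_0 | lra | exact HM | apply Rinv_le_contravar; lra].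
      + apply Rinv_le_contravar; lra. }
  rewrite Cf in B; unfold u in B.
  rewrite (Cmod_mult (2 * Ci * RtoC PI)), (Cmod_mult (h w)), Cmod_inv, Cmod_pow in B
    by (apply Cpow_nz, Cmod_gt_0; exact Hrp).
  fold rho in B.
  assert (P := Cmod_two_pi_i).
  assert (Pr : 0 < rho ^ n) by (apply pow_lt; lra).
  assert (Pl : 0 < l ^ n) by (apply pow_lt; lra).
  assert (B2 : Cmod (h w) * / rho ^ n <= 4 * (M * / l ^ n * / (l - rho)) * (4 * l)).
  { eapply Rle_trans; [|eapply Rle_trans; [exact B|right; ring]].
    assert (0 <= Cmod (h w) * / rho ^ n).
    { apply Rmult_le_pos; [apply Cmod_ge_0 | apply Rlt_le, Rinv_0_lt_compat, Pr]. }
    nra. }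
  apply (Rmult_le_compat_r (rho ^ n)) in B2; [|lra].
  replace (Cmod (h w) * / rho ^ n * rho ^ n) with (Cmod (h w)) in B2 by (field; lra).
  eapply Rle_trans; [exact B2|]; right.
  unfold Rdiv; rewrite Rpow_mult_distr, pow_inv; field; split; lra.
Qed.

(** The uniqueness argument works above the real axis only, but the theorem evaluates zeta at real
    points; continuity and differentiability at p carry value and derivative over. *)
Lemma zero_real_boundary (h : C -> C) (p : R) (l : C) :
  (forall z, 0 < Im z -> h z = RtoC 0) -> cder h (RtoC p) l -> h (RtoC p) = RtoC 0 /\ l = RtoC 0.
Proof.
  intros H0 Hl.
  assert (Hz : forall d, 0 < d -> exists t, 0 < t < d /\ Cmod ((p, t) - RtoC p) = t /\ h (p, t) = RtoC 0).
  { intros d Hd; exists (d / 2); split; [lra|]; split.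
    - unfold RtoC; rewrite Cmod_vert, Rminus_0_r, Rabs_pos_eq; lra.
    - apply H0; simpl; lra. }
  assert (E : h (RtoC p) = RtoC 0).
  { apply Cmod_eq_0.
    destruct (Rle_lt_or_eq_dec 0 _ (Cmod_ge_0 (h (RtoC p)))) as [Hpos|]; [exfalso|congruence].
    destruct (cder_ccont _ _ _ Hl _ Hpos) as [d [Hd H]].
    destruct (Hz d Hd) as [t [Ht [T1 T2]]].
    specialize (H (p, t)); rewrite T1, T2 in H.
    replace (RtoC 0 - h (RtoC p))%C with (- h (RtoC p))%C in H by ring.
    rewrite Cmod_opp in H; specialize (H (proj2 Ht)); lra. }
  split; [exact E|].
  apply Cmod_eq_0.
  destruct (Rle_lt_or_eq_dec 0 _ (Cmod_ge_0 l)) as [Hpos|]; [exfalso|congruence].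
  destruct (Hl (Cmod l / 2)) as [d [Hd H]]; [lra|].
  destruct (Hz d Hd) as [t [Ht [T1 T2]]].
  specialize (H (p, t)); rewrite T1, T2, E in H; specialize (H (proj2 Ht)).
  replace (RtoC 0 - RtoC 0 - ((p, t) - RtoC p) * l)%C with (- (((p, t) - RtoC p) * l))%C in H by ring.
  rewrite Cmod_opp, Cmod_mult, T1 in H; nra.
Qed.

(** * Complex powers and binomial remainders *)

Lemma Cexp_add (z w : C) : Cexp (z + w) = (Cexp z * Cexp w)%C.
Proof.
  destruct z as [a b], w as [c d]; unfold Cexp; simpl Re; simpl Im.
  rewrite exp_plus, cos_plus, sin_plus.
  apply injective_projections; simpl; ring.
Qed.

Lemma Cexp_real (x : R) : Cexp (RtoC x) = RtoC (exp x).
Proof.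
  unfold Cexp; simpl Re; simpl Im; rewrite cos_0, sin_0.
  apply injective_projections; simpl; ring.
Qed.

Lemma Cmod_unit (t : R) : Cmod (cos t, sin t) = 1.
Proof.
  assert (H := Cmod2_alt (cos t, sin t)); simpl Re in H; simpl Im in H.
  assert (E := sin2_cos2 t); unfold Rsqr in E.
  assert (P := Cmod_ge_0 (cos t, sin t)).
  assert (Cmod (cos t, sin t) ^ 2 = 1) by (rewrite H; lra).
  nra.
Qed.

Lemma Cmod_Cexp (z : C) : Cmod (Cexp z) = exp (Re z).
Proof.
  unfold Cexp; rewrite Cmod_mult, Cmod_unit, Cmod_R, Rabs_pos_eq; [ring|].
  apply Rlt_le, exp_pos.
Qed.

(** Both sides come from 1 + t <= exp t: with t = x from below, and with t = -x, in the form exp x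
    (1 - x) <= 1, from above. *)
Lemma exp_quadratic (x : R) : Rabs x <= 1 / 2 -> Rabs (exp x - 1 - x) <= 2 * (x * x).
Proof.
  intro H; apply Rabs_le_between in H.
  assert (H1 := exp_ineq1_le x). assert (H2 := exp_ineq1_le (- x)).
  rewrite exp_Ropp in H2.
  assert (P := exp_pos x).
  apply (Rmult_le_compat_r (exp x)) in H2; [|lra].
  rewrite Rinv_l in H2 by lra.
  apply Rabs_le; split; [nra|].
  assert (exp x * (1 - x) <= 1) by lra.
  assert ((exp x - 1 - x) * (1 - x) <= x * x) by nra.
  nra.
Qed.

Lemma cos_quadratic (x : R) : 0 <= 1 - cos x <= x * x / 2.
Proof.
  replace x with (2 * (x / 2)) at 1 2 by field.
  rewrite cos_2a_sin.
  assert (H : Rsqr (sin (x / 2)) <= Rsqr (x / 2)).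
  { apply Rsqr_le_abs_1.
    destruct (Rle_dec 0 (x / 2)) as [Hx|Hx].
    - rewrite (Rabs_pos_eq (x / 2)) by exact Hx.
      apply Rabs_le; split; [|destruct (Rle_lt_or_eq_dec _ _ Hx) as [Hp|<-];
        [left; apply sin_lt_x, Hp | rewrite sin_0; lra]].
      destruct (Rle_lt_or_eq_dec _ _ Hx) as [Hp|<-]; [|rewrite sin_0; lra].
      destruct (Rle_dec (x / 2) PI); [generalize (sin_ge_0 (x / 2)); lra|].
      generalize (SIN_bound (x / 2)), PI2_1; lra.
    - assert (Hn : 0 < - (x / 2)) by lra.
      rewrite <- Rabs_Ropp, <- sin_neg, <- (Rabs_Ropp (x / 2)).
      rewrite (Rabs_pos_eq (- (x / 2))) by lra.
      apply Rabs_le; split; [|left; apply sin_lt_x, Hn].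
      destruct (Rle_dec (- (x / 2)) PI); [generalize (sin_ge_0 (- (x / 2))); lra|].
      generalize (SIN_bound (- (x / 2))), PI2_1; lra. }
  unfold Rsqr in H; assert (0 <= sin (x / 2) * sin (x / 2)) by apply Rle_0_sqr.
  lra.
Qed.

Lemma sin_quadratic (x : R) : Rabs x <= 1 -> Rabs (sin x - x) <= x * x.
Proof.
  intro H.
  destruct (MVT_gen (fun t => sin t - t) 0 x (fun t => cos t - 1)) as [c [Hc E]].
  - intros t _; auto_derive; [exact I | ring].
  - intros t _; apply continuity_pt_filterlim, (ex_derive_continuous (V := R_NormedModule) (fun t => sin t - t)).
    auto_derive; exact I.
  - rewrite sin_0 in E.
    replace (sin x - x) with ((cos c - 1) * (x - 0)) by lra.
    rewrite Rabs_mult, Rminus_0_r.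
    assert (Q := cos_quadratic c).
    assert (Hcx : Rabs c <= Rabs x).
    { unfold Rmin, Rmax in Hc; destruct (Rle_dec 0 x) as [Hx|Hx].
      - rewrite !Rabs_pos_eq; lra.
      - rewrite !Rabs_left1; lra. }
    assert (Q2 : Rabs (cos c - 1) <= Rabs c * Rabs c).
    { rewrite <- Rabs_mult, (Rabs_pos_eq (c * c)) by apply Rle_0_sqr.
      rewrite Rabs_left1 by lra. assert (0 <= c * c) by apply Rle_0_sqr; lra. }
    replace (x * x) with (Rabs x * Rabs x) by (rewrite <- Rabs_mult; apply Rabs_pos_eq, Rle_0_sqr).
    apply Rmult_le_compat_r; [apply Rabs_pos|].
    assert (P := Rabs_pos c). nra.
Qed.

(** The origin is enough, since [Cexp_add] transports the derivative to every point in
    [cder_Cexp]. *)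
Lemma cder_Cexp_0 : cder Cexp (RtoC 0) (RtoC 1).
Proof.
  apply quadratic_cder with 10 (1 / 2); [lra|].
  intros h Hh; destruct h as [a b].
  assert (Ha := re_le_Cmod (a, b)). assert (Hb := im_le_Cmod (a, b)).
  assert (E2 := Cmod2_alt (a, b)).
  simpl Re in *; simpl Im in *.
  set (m := Cmod (a, b)) in *.
  assert (Xa : Rabs (exp a - 1 - a) <= 2 * (a * a)) by (apply exp_quadratic; lra).
  assert (Xb : Rabs (sin b - b) <= b * b) by (apply sin_quadratic; lra).
  assert (Xc := cos_quadratic b).
  assert (Hexp : 0 < exp a <= 2).
  { split; [apply exp_pos|].
    apply Rabs_le_between in Xa. assert (Ha' : Rabs a <= 1 / 2) by lra.
    apply Rabs_le_between in Ha'. nra. }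
  rewrite Cplus_0_l, (Cexp_real 0), exp_0.
  assert (Bre : Rabs (exp a * cos b - 1 - a) <= 2 * (a * a) + b * b).
  { replace (exp a * cos b - 1 - a) with ((exp a - 1 - a) - exp a * (1 - cos b)) by ring.
    apply Rabs_le_between in Xa; apply Rabs_le; split; nra. }
  assert (Hab : Rabs (a * b) <= a * a + b * b) by (apply Rabs_le; split; nra).
  assert (Bim : Rabs (exp a * sin b - b) <= 2 * (b * b) + 2 * (a * a) + 2 * (a * a + b * b)).
  { replace (exp a * sin b - b) with (exp a * (sin b - b) + (exp a - 1 - a) * b + a * b) by ring.
    eapply Rle_trans; [apply Rabs_triang|].
    eapply Rle_trans; [apply Rplus_le_compat_r, Rabs_triang|].
    rewrite !(Rabs_mult (exp a)), (Rabs_mult (exp a - 1 - a)), (Rabs_pos_eq (exp a)) by lra.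
    assert (Rabs b <= 1 / 2) by lra.
    assert (0 <= Rabs b) by apply Rabs_pos.
    assert (0 <= Rabs (sin b - b)) by apply Rabs_pos.
    assert (0 <= Rabs (exp a - 1 - a)) by apply Rabs_pos.
    assert (exp a * Rabs (sin b - b) <= 2 * (b * b)) by nra.
    assert (Rabs (exp a - 1 - a) * Rabs b <= 2 * (a * a)) by nra.
    nra. }
  eapply Rle_trans; [apply Cmod_le_abs|].
  replace (Re (Cexp (a, b) - RtoC 1 - (a, b) * RtoC 1)%C) with (exp a * cos b - 1 - a)
    by (unfold Cexp; simpl; ring).
  replace (Im (Cexp (a, b) - RtoC 1 - (a, b) * RtoC 1)%C) with (exp a * sin b - b)
    by (unfold Cexp; simpl; ring).
  simpl in E2; assert (0 <= a * a) by apply Rle_0_sqr; assert (0 <= b * b) by apply Rle_0_sqr.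
  nra.
Qed.

Lemma cder_Cexp (z : C) : cder Cexp z (Cexp z).
Proof.
  apply cder_ext with (fun w => Cexp z * Cexp (w - z))%C.
  { intro w; rewrite <- Cexp_add; f_equal; ring. }
  eapply cder_eq; [|apply cder_scal, (cder_comp Cexp (fun w => w - z)%C z (RtoC 1) (RtoC 1 - RtoC 0)%C)].
  - ring.
  - replace (z - z)%C with (RtoC 0) by ring; exact cder_Cexp_0.
  - apply cder_minus; [apply cder_id | apply cder_const].
Qed.

Lemma cpow_add (x : R) (s t : C) : cpow x (s + t) = (cpow x s * cpow x t)%C.
Proof. unfold cpow; rewrite <- Cexp_add; f_equal; ring. Qed.

Lemma cpow_mult_base (x y : R) (s : C) : 0 < x -> 0 < y ->
  cpow (x * y) s = (cpow x s * cpow y s)%C.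
Proof.
  intros Hx Hy; unfold cpow; rewrite <- Cexp_add, ln_mult, RtoC_plus by assumption.
  f_equal; ring.
Qed.

Lemma cpow_1 (s : C) : cpow 1 s = RtoC 1.
Proof. unfold cpow; rewrite ln_1, Cmult_0_r, Cexp_real, exp_0; reflexivity. Qed.

Lemma cpow_real (x r : R) : cpow x (RtoC r) = RtoC (Rpower x r).
Proof. unfold cpow, Rpower; rewrite <- RtoC_mult, Cexp_real; reflexivity. Qed.

Lemma cpow_0 (x : R) : cpow x (RtoC 0) = RtoC 1.
Proof. unfold cpow; rewrite Cmult_0_l, Cexp_real, exp_0; reflexivity. Qed.

Lemma Cmod_cpow (x : R) (s : C) : Cmod (cpow x s) = Rpower x (Re s).
Proof. unfold cpow, Rpower; rewrite Cmod_Cexp, re_scal_r; reflexivity. Qed.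

Lemma cder_cpow (x : R) (s : C) : cder (cpow x) s (RtoC (ln x) * cpow x s)%C.
Proof.
  unfold cpow; eapply cder_eq;
    [|apply (cder_comp Cexp (fun s => s * RtoC (ln x))%C s (Cexp (s * RtoC (ln x))) (RtoC 1 * RtoC (ln x) + s * RtoC 0)%C);
      [apply cder_Cexp|]].
  - simpl; ring.
  - apply (cder_mult (fun s => s) (fun _ => RtoC (ln x))); [apply cder_id | apply cder_const].
Qed.

Lemma cdiff_cpow (x : R) (f : C -> C) (s : C) : cdiff f s -> cdiff (fun s => cpow x (f s)) s.
Proof. apply (cdiff_comp (cpow x) f); eexists; apply cder_cpow. Qed.

Definition rder (phi : R -> C) (t : R) (v : C) : Prop :=
  is_derive (fun u => Re (phi u)) t (Re v) /\ is_derive (fun u => Im (phi u)) t (Im v).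

Lemma rder_plus (phi psi : R -> C) (t : R) (v w : C) :
  rder phi t v -> rder psi t w -> rder (fun u => phi u + psi u)%C t (v + w)%C.
Proof.
  intros [H1 H2] [H3 H4]; split.
  - apply (is_derive_plus (V := R_NormedModule) (fun u => Re (phi u)) (fun u => Re (psi u)) t _ _ H1 H3).
  - apply (is_derive_plus (V := R_NormedModule) (fun u => Im (phi u)) (fun u => Im (psi u)) t _ _ H2 H4).
Qed.

Lemma rder_scal (k : C) (phi : R -> C) (t : R) (v : C) :
  rder phi t v -> rder (fun u => k * phi u)%C t (k * v)%C.
Proof.
  intros [H1 H2]; split.
  - apply (is_derive_minus (V := R_NormedModule) (fun u => Re k * Re (phi u)) (fun u => Im k * Im (phi u)));
      apply (is_derive_scal (fun u => _ (phi u))); assumption.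
  - apply (is_derive_plus (V := R_NormedModule) (fun u => Re k * Im (phi u)) (fun u => Im k * Re (phi u)));
      apply (is_derive_scal (fun u => _ (phi u))); assumption.
Qed.

Lemma rder_RtoC (f : R -> R) (t v : R) : is_derive f t v -> rder (fun u => RtoC (f u)) t (RtoC v).
Proof. intro H; split; [exact H | exact (is_derive_const (V := R_NormedModule) 0 t)]. Qed.

Lemma rder_csum (phi : nat -> R -> C) (t : R) (v : nat -> C) (n : nat) :
  (forall k, rder (phi k) t (v k)) -> rder (fun u => csum (fun k => phi k u) n) t (csum v n).
Proof.
  intro H; induction n as [|n IH]; simpl.
  - apply (rder_RtoC (fun _ => 0)); exact (is_derive_const (V := R_NormedModule) 0 t).
  - apply (rder_plus (fun u => csum (fun k => phi k u) n) (phi n)); [exact IH | apply H].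
Qed.

Lemma cpow_minus_1 (x : R) (a : C) : 0 < x -> cpow x (a - 1) = (cpow x a / RtoC x)%C.
Proof.
  intro Hx; unfold Cminus; rewrite cpow_add, <- RtoC_opp, cpow_real.
  unfold Cdiv; f_equal; rewrite Rpower_Ropp, Rpower_1, RtoC_inv by lra; reflexivity.
Qed.

Lemma rder_cpow (a : C) (t : R) : 0 < 1 + t ->
  rder (fun u => cpow (1 + u) a) t (a * cpow (1 + t) (a - 1))%C.
Proof.
  intro Ht; destruct a as [p q].
  assert (Ec : forall u, cpow (1 + u) (p, q)
    = (exp (p * ln (1 + u)) * cos (q * ln (1 + u)), exp (p * ln (1 + u)) * sin (q * ln (1 + u)))).
  { intro u; unfold cpow, Cexp; simpl Re; simpl Im.
    replace (p * ln (1 + u) - q * 0) with (p * ln (1 + u)) by ring.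
    replace (p * 0 + q * ln (1 + u)) with (q * ln (1 + u)) by ring.
    apply injective_projections; simpl; ring. }
  assert (Ed : ((p, q) * cpow (1 + t) ((p, q) - 1))%C
    = ((p * (exp (p * ln (1 + t)) * cos (q * ln (1 + t))) - q * (exp (p * ln (1 + t)) * sin (q * ln (1 + t)))) / (1 + t),
       (p * (exp (p * ln (1 + t)) * sin (q * ln (1 + t))) + q * (exp (p * ln (1 + t)) * cos (q * ln (1 + t)))) / (1 + t))).
  { rewrite cpow_minus_1, Ec by exact Ht.
    unfold Cdiv; rewrite <- RtoC_inv by lra.
    apply injective_projections; simpl; field; lra. }
  rewrite Ed; split; cbn [Re Im fst snd].
  - apply is_derive_ext with (fun u => exp (p * ln (1 + u)) * cos (q * ln (1 + u))).
    { intro u; rewrite Ec; reflexivity. }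
    auto_derive; [lra | field; lra].
  - apply is_derive_ext with (fun u => exp (p * ln (1 + u)) * sin (q * ln (1 + u))).
    { intro u; rewrite Ec; reflexivity. }
    auto_derive; [lra | field; lra].
Qed.

Lemma rder_mvt (phi dphi : R -> C) (x B : R) :
  (forall t, Rmin 0 x <= t <= Rmax 0 x -> rder phi t (dphi t)) ->
  (forall t, Rmin 0 x <= t <= Rmax 0 x -> Cmod (dphi t) <= B) ->
  Cmod (phi x - phi 0) <= 2 * B * Rabs x.
Proof.
  intros Hd HB.
  destruct (MVT_gen (fun u => Re (phi u)) 0 x (fun t => Re (dphi t))) as [c [Hc E]].
  { intros t Ht; apply Hd; lra. }
  { intros t Ht; apply continuity_pt_filterlim, (ex_derive_continuous (V := R_NormedModule) (fun u => Re (phi u))).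
    eexists; apply Hd, Ht. }
  destruct (MVT_gen (fun u => Im (phi u)) 0 x (fun t => Im (dphi t))) as [c' [Hc' E']].
  { intros t Ht; apply Hd; lra. }
  { intros t Ht; apply continuity_pt_filterlim, (ex_derive_continuous (V := R_NormedModule) (fun u => Im (phi u))).
    eexists; apply Hd, Ht. }
  eapply Rle_trans; [apply Cmod_le_abs|].
  change (Rabs (Re (phi x) - Re (phi 0)) + Rabs (Im (phi x) - Im (phi 0)) <= 2 * B * Rabs x).
  rewrite E, E', !Rabs_mult, Rminus_0_r.
  assert (Rabs (Re (dphi c)) <= B) by (eapply Rle_trans; [apply re_le_Cmod | apply HB, Hc]).
  assert (Rabs (Im (dphi c')) <= B) by (eapply Rle_trans; [apply im_le_Cmod | apply HB, Hc']).
  generalize (Rabs_pos x); nra.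
Qed.

(** Falling factorial; [cbin] below is the generalised binomial coefficient. *)
Fixpoint cff (a : C) (n : nat) : C :=
  match n with O => RtoC 1 | S k => (cff a k * (a - RtoC (INR k)))%C end.

Definition cbin (a : C) (n : nat) : C := (cff a n / RtoC (INR (fact n)))%C.

Lemma cff_front (a : C) (n : nat) : cff a (S n) = (a * cff (a - 1) n)%C.
Proof.
  induction n as [|n IH]; [simpl; ring|].
  change (cff a (S (S n))) with (cff a (S n) * (a - RtoC (INR (S n))))%C.
  rewrite IH, S_INR, RtoC_plus; simpl; ring.
Qed.

Lemma fact_neq_C (n : nat) : RtoC (INR (fact n)) <> RtoC 0.
Proof. intro H; apply RtoC_inj in H; apply (INR_fact_neq_0 n H). Qed.

Lemma INR_S_neq_C (n : nat) : RtoC (INR (S n)) <> RtoC 0.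
Proof. intro H; apply RtoC_inj in H; apply (not_0_INR (S n)); [lia | exact H]. Qed.

Lemma cbin_0 (a : C) : cbin a 0 = RtoC 1.
Proof. unfold cbin; simpl; field; exact C1_nz. Qed.

Lemma cbin_S (a : C) (n : nat) :
  (RtoC (INR (S n)) * cbin a (S n))%C = (cbin a n * (a - RtoC (INR n)))%C.
Proof.
  unfold cbin; rewrite fact_simpl, mult_INR, RtoC_mult; simpl cff.
  field; split; [apply fact_neq_C | apply INR_S_neq_C].
Qed.

Lemma cbin_front (a : C) (n : nat) :
  (RtoC (INR (S n)) * cbin a (S n))%C = (a * cbin (a - 1) n)%C.
Proof.
  unfold cbin; rewrite fact_simpl, mult_INR, RtoC_mult, cff_front.
  field; split; [apply fact_neq_C | apply INR_S_neq_C].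
Qed.

(** Remainder of the binomial series of (1 + x)^a after n terms, as a function of x. Every
    continuation below rests on it. *)
Definition rho (n : nat) (a : C) (x : R) : C :=
  (cpow (1 + x) a - csum (fun j => cbin a j * RtoC (x ^ j)) n)%C.

Lemma rho_deriv (n : nat) (a : C) (t : R) : 0 < 1 + t ->
  rder (rho (S n) a) t (a * rho n (a - 1) t)%C.
Proof.
  intro Ht.
  replace (a * rho n (a - 1) t)%C with (a * cpow (1 + t) (a - 1) +
    - RtoC 1 * csum (fun j => cbin a j * RtoC (INR j * t ^ pred j))%C (S n))%C.
  - unfold rho, Cminus.
    assert (H : rder (fun u => cpow (1 + u) a + - RtoC 1 * csum (fun j => cbin a j * RtoC (u ^ j)) (S n))%C t
      (a * cpow (1 + t) (a - 1) + - RtoC 1 * csum (fun j => cbin a j * RtoC (INR j * t ^ pred j))%C (S n))%C).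
    { apply (rder_plus (fun u => cpow (1 + u) a)); [apply rder_cpow, Ht|].
      apply (rder_scal (- RtoC 1)%C (fun u => csum (fun j => cbin a j * RtoC (u ^ j)) (S n))%C).
      apply (rder_csum (fun j u => cbin a j * RtoC (u ^ j))%C).
      intro j; apply (rder_scal (cbin a j) (fun u => RtoC (u ^ j))), rder_RtoC.
      auto_derive; [exact I | ring]. }
    destruct H as [H1 H2]; split; [eapply is_derive_ext; [|exact H1] | eapply is_derive_ext; [|exact H2]];
      intro u; simpl; ring.
  - unfold rho; rewrite csum_shift.
    rewrite (csum_ext _ (fun j => a * (cbin (a - 1) j * RtoC (t ^ j)))%C n).
    + rewrite csum_scal; simpl; rewrite Rmult_0_l; ring.
    + intros j _; simpl pred; rewrite RtoC_mult, !Cmult_assoc, (Cmult_comm (cbin a (S j))), cbin_front.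
      ring.
Qed.

Lemma rho_at_0 (n : nat) (a : C) : rho (S n) a 0 = RtoC 0.
Proof.
  unfold rho; rewrite csum_shift, Rplus_0_r, cpow_1, cbin_0.
  rewrite (csum_ext _ (fun _ => RtoC 0)), csum_zero; [simpl; ring|].
  intros k _; simpl; rewrite Rmult_0_l; ring.
Qed.

(** The power is monotone in t, so it is bounded by the larger of its values at the two ends, one of
    which is 1. *)
Lemma Rpower_between (x t b : R) : 0 < 1 + x -> Rmin 0 x <= t <= Rmax 0 x ->
  Rpower (1 + t) b <= Rmax 1 (Rpower (1 + x) b).
Proof.
  intros Hx Ht.
  assert (Hcase : (0 <= t <= x) \/ (x <= t <= 0)).
  { unfold Rmin, Rmax in Ht; destruct (Rle_dec 0 x); lra. }
  assert (H1 : Rpower 1 b = 1) by (unfold Rpower; rewrite ln_1, Rmult_0_r, exp_0; reflexivity).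
  assert (Hln : forall u v, 0 < u -> u <= v -> ln u <= ln v).
  { intros u v Hu [Huv|<-]; [left; apply ln_increasing; assumption | lra]. }
  assert (Hexp : forall u v, u <= v -> exp u <= exp v).
  { intros u v [Huv|<-]; [left; apply exp_increasing; assumption | lra]. }
  assert (L1 : ln 1 = 0) by apply ln_1.
  destruct (Rle_dec (Rpower (1 + t) b) 1) as [Hle|Hgt].
  { eapply Rle_trans; [exact Hle | apply Rmax_l]. }
  eapply Rle_trans; [|apply Rmax_r].
  unfold Rpower in *; apply Hexp.
  assert (Hb : 0 < b * ln (1 + t)).
  { apply Rnot_le_lt; intro Hn; apply Hgt; apply Rle_trans with (exp 0); [apply Hexp, Hn | rewrite exp_0; lra]. }
  destruct Hcase as [Hc|Hc].
  - assert (0 <= ln (1 + t)) by (rewrite <- L1; apply Hln; lra).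
    assert (ln (1 + t) <= ln (1 + x)) by (apply Hln; lra).
    assert (0 < b) by nra. nra.
  - assert (ln (1 + t) <= 0) by (rewrite <- L1; apply Hln; lra).
    assert (ln (1 + x) <= ln (1 + t)) by (apply Hln; lra).
    assert (b < 0) by nra. nra.
Qed.

(* The factor 2^n arises because the mean value theorem is applied to real and
   imaginary parts separately. *)
Lemma rho_bound (n : nat) : forall (a : C) (x : R), 0 < 1 + x ->
  Cmod (rho n a x) <= 2 ^ n * Cmod (cff a n) * Rabs x ^ n * Rmax 1 (Rpower (1 + x) (Re a - INR n)).
Proof.
  induction n as [|n IH]; intros a x Hx.
  - unfold rho; simpl; rewrite Rminus_0_r, Cmod_1.
    replace (cpow (1 + x) a - RtoC 0)%C with (cpow (1 + x) a) by ring.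
    rewrite Cmod_cpow; generalize (Rmax_r 1 (Rpower (1 + x) (Re a))); lra.
  - replace (rho (S n) a x) with (rho (S n) a x - rho (S n) a 0)%C by (rewrite rho_at_0; ring).
    set (m := Rmax 1 (Rpower (1 + x) (Re a - INR (S n)))).
    replace (2 ^ S n * Cmod (cff a (S n)) * Rabs x ^ S n * m)
      with (2 * (2 ^ n * Cmod (cff a (S n)) * Rabs x ^ n * m) * Rabs x) by (simpl; ring).
    apply rder_mvt with (fun t => a * rho n (a - 1) t)%C.
    + intros t Ht; apply rho_deriv.
      unfold Rmin in Ht; destruct (Rle_dec 0 x); lra.
    + intros t Ht; rewrite Cmod_mult, cff_front, Cmod_mult.
      assert (Ht1 : 0 < 1 + t) by (unfold Rmin in Ht; destruct (Rle_dec 0 x); lra).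
      assert (Htx : Rabs t <= Rabs x).
      { unfold Rmin, Rmax in Ht; destruct (Rle_dec 0 x) as [Hx0|Hx0].
        - rewrite !Rabs_pos_eq; lra.
        - rewrite !Rabs_left1; lra. }
      eapply Rle_trans; [apply Rmult_le_compat_l; [apply Cmod_ge_0 | apply IH, Ht1]|].
      assert (Em : Re (a - 1)%C - INR n = Re a - INR (S n)).
      { rewrite S_INR; replace (Re (a - 1)%C) with (Re a - 1) by (destruct a; simpl; ring); ring. }
      rewrite Em.
      assert (Hm : Rmax 1 (Rpower (1 + t) (Re a - INR (S n))) <= m).
      { apply Rmax_lub; [apply Rmax_l | apply Rpower_between; assumption]. }
      assert (Hp : Rabs t ^ n <= Rabs x ^ n) by (apply pow_incr; split; [apply Rabs_pos | exact Htx]).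
      assert (H2 : 0 <= 2 ^ n) by (apply pow_le; lra).
      assert (H3 := Cmod_ge_0 a). assert (H4 := Cmod_ge_0 (cff (a - 1) n)).
      assert (H5 : 0 <= Rabs t ^ n) by (apply pow_le, Rabs_pos).
      assert (H6 : 1 <= Rmax 1 (Rpower (1 + t) (Re a - INR (S n)))) by apply Rmax_l.
      replace (2 ^ n * (Cmod a * Cmod (cff (a - 1) n)) * Rabs x ^ n * m)
        with (Cmod a * (2 ^ n * Cmod (cff (a - 1) n) * (Rabs x ^ n * m))) by ring.
      rewrite (Rmult_assoc (2 ^ n * Cmod (cff (a - 1) n))).
      apply Rmult_le_compat_l; [exact H3|].
      apply Rmult_le_compat_l; [apply Rmult_le_pos; assumption|].
      apply Rmult_le_compat; lra.
Qed.

(** * Continuation of the Riemann zeta function *)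

Lemma Rpower_1_base (b : R) : Rpower 1 b = 1.
Proof. unfold Rpower; rewrite ln_1, Rmult_0_r, exp_0; reflexivity. Qed.

Lemma Rpower_pos (x b : R) : 0 < Rpower x b.
Proof. apply exp_pos. Qed.

Lemma INR_S_pos (k : nat) : 0 < INR (S k).
Proof. apply lt_0_INR; lia. Qed.

Lemma INR_S_ge_1 (k : nat) : 1 <= INR (S k).
Proof. rewrite S_INR; generalize (pos_INR k); lra. Qed.

Lemma Rpower_le_exp (x b c : R) : 1 <= x -> b <= c -> Rpower x b <= Rpower x c.
Proof.
  intros [Hx|<-] Hbc; [apply Rle_Rpower; lra | rewrite !Rpower_1_base; lra].
Qed.

Lemma Rpower_le_1 (x b : R) : 1 <= x -> b <= 0 -> Rpower x b <= 1.
Proof.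
  intros Hx Hb; eapply Rle_trans; [apply (Rpower_le_exp x b 0 Hx Hb)|].
  unfold Rpower; rewrite Rmult_0_l, exp_0; lra.
Qed.

Lemma Rpower_neg_lim (p : R) : 0 < p ->
  is_lim_seq (fun n => Rpower (INR (S n)) (- p)) 0.
Proof.
  intro Hp; apply is_lim_seq_spec; intro eps.
  destruct (archimed (Rpower (/ eps) (/ p))) as [Ha _].
  set (N := Z.to_nat (up (Rpower (/ eps) (/ p)))).
  exists N; intros n Hn.
  assert (Heps := cond_pos eps).
  assert (Hie : 0 < / eps) by (apply Rinv_0_lt_compat, Heps).
  assert (P0 := Rpower_pos (/ eps) (/ p)).
  assert (HN : Rpower (/ eps) (/ p) < INR (S n)).
  { eapply Rlt_le_trans; [exact Ha|].
    assert (Hz : (0 <= up (Rpower (/ eps) (/ p)))%Z).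
    { apply le_IZR; lra. }
    rewrite <- (Z2Nat.id _ Hz), <- INR_IZR_INZ; fold N; apply le_INR; lia. }
  rewrite Rminus_0_r, Rabs_pos_eq by (apply Rlt_le, Rpower_pos).
  rewrite Rpower_Ropp.
  assert (H : / eps < Rpower (INR (S n)) p).
  { replace (/ eps) with (Rpower (Rpower (/ eps) (/ p)) p).
    - apply Rlt_Rpower_l; [exact Hp | split; assumption].
    - rewrite Rpower_mult, Rinv_l, Rpower_1 by lra; reflexivity. }
  rewrite <- (Rinv_inv eps); apply Rinv_lt_contravar; [|exact H].
  apply Rmult_lt_0_compat; [exact Hie | apply Rpower_pos].
Qed.

Lemma ex_series_bounded (a : nat -> R) (B : R) :
  (forall n, 0 <= a n) -> (forall n, rsum a n <= B) -> ex_series a.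
Proof.
  intros Ha HB.
  destruct (ex_finite_lim_seq_incr (sum_n a) B) as [l Hl].
  - intro n; rewrite sum_Sn; unfold plus; simpl; specialize (Ha (S n)); lra.
  - intro n; rewrite rsum_sum_n; apply HB.
  - exists l; exact Hl.
Qed.

(** Mean value form of the integral test: the right-hand side telescopes in [ex_pseries]. *)
Lemma pseries_telescope (p x : R) : 1 < p -> 0 < x ->
  (p - 1) * Rpower (x + 1) (- p) <= Rpower x (1 - p) - Rpower (x + 1) (1 - p).
Proof.
  intros Hp Hx.
  destruct (MVT_gen (fun t => Rpower t (1 - p)) x (x + 1) (fun t => (1 - p) * Rpower t (- p))) as [c [Hc E]].
  - rewrite Rmin_left, Rmax_right by lra; intros t Ht.
    apply is_derive_Reals; replace (- p) with (1 - p - 1) by ring.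
    apply derivable_pt_lim_power; lra.
  - rewrite Rmin_left, Rmax_right by lra; intros t Ht.
    apply derivable_continuous_pt; exists ((1 - p) * Rpower t (1 - p - 1)).
    apply derivable_pt_lim_power; lra.
  - rewrite Rmin_left, Rmax_right in Hc by lra.
    assert (Rpower (x + 1) (- p) <= Rpower c (- p)).
    { rewrite !Rpower_Ropp; apply Rinv_le_contravar; [apply Rpower_pos|].
      apply Rle_Rpower_l; lra. }
    nra.
Qed.

Lemma ex_pseries (p : R) : 1 < p -> ex_series (fun k => Rpower (INR (S k)) (- p)).
Proof.
  intro Hp; apply ex_series_bounded with (1 + / (p - 1)).
  - intro n; apply Rlt_le, Rpower_pos.
  - assert (H : forall n, rsum (fun k => Rpower (INR (S k)) (- p)) (S n)
      <= 1 + / (p - 1) * (1 - Rpower (INR (S n)) (1 - p))).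
    { induction n as [|n IH].
      - simpl; rewrite !Rpower_1_base; lra.
      - change (rsum (fun k => Rpower (INR (S k)) (- p)) (S n) + Rpower (INR (S (S n))) (- p)
          <= 1 + / (p - 1) * (1 - Rpower (INR (S (S n))) (1 - p))).
        assert (T := pseries_telescope p (INR (S n)) Hp (INR_S_pos n)).
        rewrite <- S_INR in T.
        assert (Hi : 0 < / (p - 1)) by (apply Rinv_0_lt_compat; lra).
        apply (Rmult_le_compat_l (/ (p - 1))) in T; [|lra].
        replace (/ (p - 1) * ((p - 1) * Rpower (INR (S (S n))) (- p)))
          with (Rpower (INR (S (S n))) (- p)) in T by (field; lra).
        lra. }
    assert (Hi : 0 < / (p - 1)) by (apply Rinv_0_lt_compat; lra).
    intros [|n]; [simpl; lra|].
    eapply Rle_trans; [apply H|].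
    assert (0 < Rpower (INR (S n)) (1 - p)) by apply Rpower_pos.
    nra.
Qed.

Lemma cff_bound (a : C) (n : nat) : Cmod (cff a n) <= (Cmod a + INR n) ^ n.
Proof.
  induction n as [|n IH]; [simpl; rewrite Cmod_1; lra|].
  simpl cff; rewrite Cmod_mult, Rmult_comm.
  change ((Cmod a + INR (S n)) ^ S n) with ((Cmod a + INR (S n)) * (Cmod a + INR (S n)) ^ n).
  assert (Ha := Cmod_ge_0 a). assert (Hn := pos_INR n).
  apply Rmult_le_compat; try apply Cmod_ge_0.
  - unfold Cminus; eapply Rle_trans; [apply Cmod_triangle|].
    rewrite Cmod_opp, Cmod_R, Rabs_pos_eq by exact Hn; rewrite S_INR; lra.
  - eapply Rle_trans; [exact IH|]; apply pow_incr; rewrite S_INR; lra.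
Qed.

Lemma cff_growth (n : nat) (w : C) :
  Cmod (cff (1 - w) n) <= INR (S n) ^ n * (1 + Cmod w) ^ n.
Proof.
  eapply Rle_trans; [apply cff_bound|].
  rewrite <- Rpow_mult_distr; apply pow_incr.
  assert (H1 := Cmod_ge_0 w). assert (H2 := pos_INR n). assert (H3 := Cmod_ge_0 (1 - w)).
  assert (Cmod (1 - w) <= 1 + Cmod w).
  { unfold Cminus; eapply Rle_trans; [apply Cmod_triangle|]; rewrite Cmod_opp, Cmod_1; lra. }
  rewrite S_INR; split; [lra | nra].
Qed.

Lemma cdiff_cff (n : nat) (f : C -> C) (z : C) : cdiff f z -> cdiff (fun w => cff (f w) n) z.
Proof.
  intro H; induction n as [|n IH]; simpl; [apply cdiff_const|].
  apply (cdiff_mult (fun w => cff (f w) n)); [exact IH|].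
  apply cdiff_minus; [exact H | apply cdiff_const].
Qed.

Lemma cdiff_cbin (n : nat) (f : C -> C) (z : C) : cdiff f z -> cdiff (fun w => cbin (f w) n) z.
Proof.
  intro H; apply (cdiff_mult (fun w => cff (f w) n)); [apply cdiff_cff, H | apply cdiff_const].
Qed.

Lemma cdiff_csum (u : nat -> C -> C) (n : nat) (z : C) :
  (forall k, (k < n)%nat -> cdiff (u k) z) -> cdiff (fun w => csum (fun k => u k w) n) z.
Proof.
  induction n as [|n IH]; intro H; simpl; [apply cdiff_const|].
  apply (cdiff_plus (fun w => csum (fun k => u k w) n)); [apply IH; intros; apply H; lia | apply H; lia].
Qed.

Lemma cdiff_rho (n : nat) (f : C -> C) (x : R) (z : C) :
  cdiff f z -> cdiff (fun w => rho n (f w) x) z.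
Proof.
  intro H; unfold rho; apply cdiff_minus; [apply cdiff_cpow, H|].
  apply (cdiff_csum (fun j w => cbin (f w) j * RtoC (x ^ j))%C); intros k _.
  apply (cdiff_mult (fun w => cbin (f w) k)); [apply cdiff_cbin, H | apply cdiff_const].
Qed.

(** With m = k + 1 this is (m+1)^(1-w) minus n terms of its expansion in 1/m. It is O(m^(1 - n - Re
    w)), so [Rem n] is holomorphic for Re w > 2 - n. *)
Definition rem_term (n : nat) (w : C) (k : nat) : C :=
  (cpow (INR (S k)) (1 - w) * rho n (1 - w) (/ INR (S k)))%C.

Definition Rem (n : nat) (w : C) : C := CSeries (rem_term n w).

Lemma rem_term_bound (n : nat) (w : C) (b : R) (k : nat) :
  b <= Re w -> 1 - INR n <= Re w ->
  Cmod (rem_term n w k) <= 2 ^ n * Cmod (cff (1 - w) n) * Rpower (INR (S k)) (- (b + INR n - 1)).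
Proof.
  intros Hb Hn; unfold rem_term; rewrite Cmod_mult, Cmod_cpow.
  set (m := INR (S k)).
  assert (Hm : 1 <= m) by apply INR_S_ge_1.
  assert (Him : 0 < / m) by (apply Rinv_0_lt_compat; lra).
  assert (HB := rho_bound n (1 - w) (/ m) ltac:(lra)).
  assert (Ere : Re (1 - w)%C = 1 - Re w) by (destruct w; simpl; ring).
  rewrite Rmax_left in HB by (rewrite Ere; apply Rpower_le_1; lra).
  rewrite Ere, Rmult_1_r, (Rabs_pos_eq (/ m)) in * by lra.
  eapply Rle_trans; [apply Rmult_le_compat_l; [apply Rlt_le, Rpower_pos | exact HB]|].
  replace ((/ m) ^ n) with (Rpower m (- INR n)).
  2:{ rewrite Rpower_Ropp, Rpower_pow, pow_inv by lra; reflexivity. }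
  replace (Rpower m (1 - Re w) * (2 ^ n * Cmod (cff (1 - w) n) * Rpower m (- INR n)))
    with (2 ^ n * Cmod (cff (1 - w) n) * (Rpower m (1 - Re w) * Rpower m (- INR n))) by ring.
  rewrite <- Rpower_plus.
  apply Rmult_le_compat_l.
  - apply Rmult_le_pos; [apply pow_le; lra | apply Cmod_ge_0].
  - apply Rpower_le_exp; [exact Hm | lra].
Qed.

Lemma ex_series_scal_R (c : R) (a : nat -> R) : ex_series a -> ex_series (fun n => c * a n).
Proof. exact (ex_series_scal (K := R_AbsRing) (V := R_NormedModule) c a). Qed.

Lemma Series_scal_R (c : R) (a : nat -> R) : Series (fun n => c * a n) = c * Series a.
Proof. exact (Series_scal_l c a). Qed.

Lemma Rem_correct (n : nat) (w : C) (b : R) : 2 - INR n < b -> b <= Re w ->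
  Ccv (csum (rem_term n w)) (Rem n w) /\
  Cmod (Rem n w) <= 2 ^ n * Cmod (cff (1 - w) n) * Series (fun k => Rpower (INR (S k)) (- (b + INR n - 1))).
Proof.
  intros Hb Hw.
  rewrite <- Series_scal_R.
  apply CSeries_dominated.
  - intro k; apply rem_term_bound; lra.
  - apply ex_series_scal_R, ex_pseries; lra.
Qed.

Lemma in_sq_Re (w z : C) (r : R) : in_sq w r z -> Re w - r <= Re z <= Re w + r.
Proof. intros [H _]; exact H. Qed.

Lemma in_sq_norm (w z : C) (r : R) : in_sq w r z -> Cmod z <= Cmod w + 2 * r.
Proof.
  intro H; apply in_sq_Cmod in H.
  generalize (Cmod_triangle_inv z w); lra.
Qed.

Lemma cdiff_rem_term (n : nat) (k : nat) (w : C) : cdiff (fun z => rem_term n z k) w.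
Proof.
  assert (H : cdiff (fun z => 1 - z)%C w) by (apply cdiff_minus; [apply cdiff_const | apply cdiff_id]).
  apply (cdiff_mult (fun z => cpow (INR (S k)) (1 - z)));
    [apply cdiff_cpow, H | apply (cdiff_rho n (fun z => 1 - z)%C), H].
Qed.

Lemma cdiff_Rem (n : nat) (w : C) : 2 - INR n < Re w -> cdiff (Rem n) w.
Proof.
  intro Hw.
  set (r := (Re w - (2 - INR n)) / 2). assert (Hr : 0 < r) by (unfold r; lra).
  set (b := Re w - r). assert (Hb : 2 - INR n < b) by (unfold b, r; lra).
  eexists; apply (weierstrass_M_test (fun k z => rem_term n z k) w r
    (fun k => 2 ^ n * (INR (S n) ^ n * (1 + (Cmod w + 2 * r)) ^ n) * Rpower (INR (S k)) (- (b + INR n - 1)))).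
  - exact Hr.
  - intros k z _; apply cdiff_rem_term.
  - intros k z Hz.
    assert (Hz1 := in_sq_Re _ _ _ Hz). assert (Hz2 := in_sq_norm _ _ _ Hz).
    eapply Rle_trans; [apply (rem_term_bound n z b); unfold b in *; lra|].
    apply Rmult_le_compat_r; [apply Rlt_le, Rpower_pos|].
    apply Rmult_le_compat_l; [apply pow_le; lra|].
    eapply Rle_trans; [apply cff_growth|].
    apply Rmult_le_compat_l; [apply pow_le, pos_INR|].
    apply pow_incr; generalize (Cmod_ge_0 z); lra.
  - apply ex_series_scal_R, ex_pseries; lra.
Qed.

Definition Dir (v : C) : C := CSeries (fun k => cpow (INR (S k)) (- v)).

Lemma Dir_correct (v : C) : 1 < Re v -> Ccv (csum (fun k => cpow (INR (S k)) (- v))) (Dir v).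
Proof.
  intro Hv; apply (CSeries_dominated _ (fun k => Rpower (INR (S k)) (- Re v))).
  - intro k; rewrite Cmod_cpow; apply Req_le; reflexivity.
  - apply ex_pseries, Hv.
Qed.

Lemma cpow_shift_nat (m : R) (s : C) (n : nat) : 0 < m ->
  (cpow m s * RtoC ((/ m) ^ n))%C = cpow m (s - RtoC (INR n)).
Proof.
  intro Hm; unfold Cminus; rewrite cpow_add, <- RtoC_opp, cpow_real.
  do 2 f_equal; rewrite Rpower_Ropp, Rpower_pow, pow_inv by exact Hm; reflexivity.
Qed.

(** Raising the order removes the term cbin (1-w) n m^(1-w-n), whose sum over m is a value of the
    Dirichlet series. *)
Lemma Rem_step (n : nat) (w : C) : 2 - INR n < Re w ->
  Rem (S n) w = (Rem n w - cbin (1 - w) n * Dir (w + RtoC (INR n) - 1))%C.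
Proof.
  intro Hw.
  apply (Ccv_unique (csum (rem_term (S n) w))).
  - apply (Rem_correct (S n) w (Re w)); [rewrite S_INR|]; lra.
  - apply Ccv_ext with (fun N => csum (rem_term n w) N -
      cbin (1 - w) n * csum (fun k => cpow (INR (S k)) (- (w + RtoC (INR n) - 1))) N)%C.
    + intro N; rewrite <- csum_scal.
      replace (csum (rem_term n w) N - csum _ N)%C with
        (csum (rem_term n w) N + (- RtoC 1) * csum (fun k => cbin (1 - w) n *
           cpow (INR (S k)) (- (w + RtoC (INR n) - 1)))%C N)%C by ring.
      rewrite <- csum_scal, <- csum_plus; apply csum_ext; intros k _.
      unfold rem_term, rho; cbn [csum].
      replace (- (w + RtoC (INR n) - 1))%C with ((1 - w) - RtoC (INR n))%C by ring.
      rewrite <- cpow_shift_nat by apply INR_S_pos; ring.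
    + apply Ccv_minus; [apply (Rem_correct n w (Re w)); lra|].
      apply Ccv_scal, Dir_correct.
      replace (Re (w + RtoC (INR n) - 1)%C) with (Re w + INR n - 1) by (destruct w; simpl; ring).
      lra.
Qed.

(* Expanding the summands of sum_m ((m+1)^(1-w) - m^(1-w)) = -1 in powers of 1/m and
   solving for the leading term; [xik k] is meaningful for Re w > -k. *)
Fixpoint xik (k : nat) (w : C) : C :=
  match k with
  | O => (1 + Rem 2 w)%C
  | S k' => (1 - csum (fun i => cbin (1 - w) (S i) / RtoC (INR (S (S i))) * xik k' (w + RtoC (INR (S i)))) (S k')
             + Rem (k' + 3) w)%C
  end.

(** For Re v > 1 the telescoping sum of (m+1)^(1-v) - m^(1-v) equals -1; its expansion to order 2
    reads -1 = (1 - v) Dir v + Rem 2 v. *)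
Lemma xik_0_Dir (v : C) : 1 < Re v -> xik 0 v = ((v - 1) * Dir v)%C.
Proof.
  intro Hv; simpl.
  assert (E : Rem 2 v = (RtoC 0 - 1 - (1 - v) * Dir v)%C).
  { apply (Ccv_unique (csum (rem_term 2 v))).
    - apply (Rem_correct 2 v (Re v)); simpl; lra.
    - apply Ccv_ext with (fun N => cpow (INR (S N)) (1 - v) - 1
        - (1 - v) * csum (fun k => cpow (INR (S k)) (- v)) N)%C.
      + induction n as [|n IH]; [simpl; rewrite cpow_1; ring|].
        change (csum (rem_term 2 v) (S n)) with (csum (rem_term 2 v) n + rem_term 2 v n)%C.
        rewrite <- IH.
        assert (Hm := INR_S_pos n). set (m := INR (S n)) in *.
        assert (Him : 0 < / m) by (apply Rinv_0_lt_compat, Hm).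
        unfold rem_term; fold m; unfold rho; cbn [csum]; fold m.
        replace (INR (S (S n))) with (m * (1 + / m)).
        2:{ rewrite S_INR; fold m; field; lra. }
        rewrite cpow_mult_base by lra.
        replace (cpow m (- v)) with (cpow m (1 - v) * RtoC (/ m ^ 1))%C.
        2:{ rewrite <- pow_inv, cpow_shift_nat by exact Hm; f_equal; simpl; ring. }
        unfold cbin; cbn [cff fact INR Nat.mul Nat.add pow].
        rewrite !Rmult_1_r; field; exact C1_nz.
      + apply Ccv_minus; [apply Ccv_minus; [|apply Ccv_const] | apply Ccv_scal, Dir_correct, Hv].
        apply Ccv_squeeze with (fun n => Rpower (INR (S n)) (- (Re v - 1))).
        * intro n; replace (cpow (INR (S n)) (1 - v) - RtoC 0)%C with (cpow (INR (S n)) (1 - v)) by ring.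
          rewrite Cmod_cpow; apply Req_le; f_equal; destruct v; simpl; ring.
        * apply Rpower_neg_lim; lra. }
  rewrite E; ring.
Qed.

Lemma Re_plus_nat (w : C) (n : nat) : Re (w + RtoC (INR n))%C = Re w + INR n.
Proof. destruct w; simpl; ring. Qed.

(** Passing from k to k+1 adds one term to the sum and raises the order of [Rem] by one. The new
    term is taken at w + k + 1, where the Dirichlet series converges, and there the two changes
    cancel by [Rem_step]. The induction is strong because of the shifted arguments. *)
Lemma xik_step (k : nat) : forall w, - INR k < Re w -> xik (S k) w = xik k w.
Proof.
  induction k as [k IH] using lt_wf_ind; intros w Hw.
  assert (X0 : forall j v, (j <= k)%nat -> 1 < Re v -> xik j v = ((v - 1) * Dir v)%C).
  { induction j as [|j IHj]; intros v Hj Hv; [apply xik_0_Dir, Hv|].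
    rewrite IH; [apply IHj; [lia | exact Hv] | lia | generalize (pos_INR j); lra]. }
  set (T := fun k' => csum (fun i => cbin (1 - w) (S i) / RtoC (INR (S (S i)))
     * xik k' (w + RtoC (INR (S i))))%C).
  assert (E1 : xik (S k) w = (1 - (T k k + cbin (1 - w) (S k) / RtoC (INR (S (S k)))
     * xik k (w + RtoC (INR (S k)))) + Rem (S (k + 2)) w)%C).
  { replace (S (k + 2)) with (k + 3)%nat by lia; reflexivity. }
  assert (E2 : xik k w = (1 - T k k + Rem (k + 2) w)%C).
  { destruct k as [|k']; [unfold T; cbn [xik csum Nat.add]; ring|].
    transitivity (1 - T k' (S k') + Rem (S k' + 2) w)%C.
    { replace (S k' + 2)%nat with (k' + 3)%nat by lia; reflexivity. }
    replace (T k' (S k')) with (T (S k') (S k')); [reflexivity|].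
    unfold T; apply csum_ext; intros i _; f_equal; apply IH; [lia|].
    rewrite Re_plus_nat; rewrite S_INR in *; generalize (pos_INR i); lra. }
  rewrite E1, E2, Rem_step.
  2:{ rewrite plus_INR; simpl; lra. }
  rewrite X0; [|lia|].
  2:{ rewrite Re_plus_nat, S_INR; lra. }
  replace (w + RtoC (INR (k + 2)) - 1)%C with (w + RtoC (INR (S k)))%C.
  2:{ rewrite plus_INR, S_INR; simpl; rewrite !RtoC_plus; ring. }
  replace (k + 2)%nat with (S (S k)) by lia.
  set (D := Dir _).
  assert (B := cbin_S (1 - w) (S k)).
  assert (N := INR_S_neq_C (S k)).
  replace (cbin (1 - w) (S (S k))) with (cbin (1 - w) (S k) * (1 - w - RtoC (INR (S k))) / RtoC (INR (S (S k))))%C.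
  2:{ rewrite <- B; field; exact N. }
  field; exact N.
Qed.

Lemma xik_mono (k j : nat) (w : C) : - INR k < Re w -> xik (k + j) w = xik k w.
Proof.
  intro Hw; induction j as [|j IH]; [f_equal; lia|].
  rewrite Nat.add_succ_r, xik_step; [exact IH|].
  rewrite plus_INR; generalize (pos_INR j); lra.
Qed.

(* xi w = (w - 1) * zeta w, an entire function. *)
Definition xi (w : C) : C := xik (Z.to_nat (up (- Re w))) w.

Lemma xi_xik (k : nat) (w : C) : - INR k < Re w -> xi w = xik k w.
Proof.
  intro Hw; unfold xi; set (K := Z.to_nat (up (- Re w))).
  assert (HK : - INR K < Re w).
  { destruct (archimed (- Re w)) as [Ha _].
    destruct (Z_le_dec 0 (up (- Re w))) as [Hz|Hz].
    - unfold K; rewrite INR_IZR_INZ, Z2Nat.id by exact Hz; lra.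
    - assert (IZR (up (- Re w)) <= -1) by (apply IZR_le; lia).
      generalize (pos_INR K); lra. }
  rewrite <- (xik_mono K k w HK), <- (xik_mono k K w Hw); f_equal; lia.
Qed.

Lemma xi_rec (k : nat) (w : C) : - INR (S k) < Re w ->
  xi w = (1 - csum (fun i => cbin (1 - w) (S i) / RtoC (INR (S (S i))) * xi (w + RtoC (INR (S i)))) (S k)
             + Rem (k + 3) w)%C.
Proof.
  intro Hw; rewrite (xi_xik (S k) w Hw); cbn [xik]; do 2 f_equal.
  apply csum_ext; intros i Hi; f_equal; symmetry; apply xi_xik.
  rewrite Re_plus_nat; rewrite !S_INR in *; generalize (pos_INR i); lra.
Qed.

Lemma xi_Dir (w : C) : 1 < Re w -> xi w = ((w - 1) * Dir w)%C.
Proof. intro Hw; rewrite (xi_xik 0); [apply xik_0_Dir, Hw | simpl; lra]. Qed.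

(** This is the residue of zeta at 1: for w = 1 the exponent 1 - w is 0 and all remainders
    vanish. *)
Lemma xi_1 : xi (RtoC 1) = RtoC 1.
Proof.
  rewrite (xi_xik 0) by (simpl; lra); simpl.
  assert (E : Rem 2 (RtoC 1) = RtoC 0).
  { apply (Ccv_unique (csum (rem_term 2 (RtoC 1)))).
    - apply (Rem_correct 2 _ 1); simpl; lra.
    - apply Ccv_ext with (fun _ => RtoC 0); [|apply Ccv_const].
      intro n; rewrite (csum_ext _ (fun _ => RtoC 0)), csum_zero; [reflexivity|].
      intros k _; unfold rem_term, rho.
      replace (1 - RtoC 1)%C with (RtoC 0) by ring.
      rewrite !cpow_0; unfold cbin; simpl; field; exact C1_nz. }
  rewrite E; ring.
Qed.

Lemma cdiff_xik (k : nat) : forall w, - INR k < Re w -> cdiff (xik k) w.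
Proof.
  induction k as [|k IH]; intros w Hw.
  - apply (cdiff_plus (fun _ => RtoC 1)); [apply cdiff_const | apply cdiff_Rem; simpl in *; lra].
  - cbn [xik].
    apply (cdiff_plus (fun w => 1 - csum (fun i => cbin (1 - w) (S i) / RtoC (INR (S (S i)))
      * xik k (w + RtoC (INR (S i)))) (S k))%C).
    + apply cdiff_minus; [apply cdiff_const|].
      apply (cdiff_csum (fun i w => cbin (1 - w) (S i) / RtoC (INR (S (S i)))
      * xik k (w + RtoC (INR (S i))))%C); intros i Hi.
      apply (cdiff_mult (fun w => cbin (1 - w) (S i) / RtoC (INR (S (S i))))%C).
      * apply (cdiff_mult (fun w => cbin (1 - w) (S i))); [|apply cdiff_const].
        apply (cdiff_cbin (S i) (fun w => 1 - w)%C), cdiff_minus; [apply cdiff_const | apply cdiff_id].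
      * apply (cdiff_comp (xik k) (fun w => w + RtoC (INR (S i)))%C).
        -- apply IH; rewrite Re_plus_nat, S_INR in *; generalize (pos_INR i); lra.
        -- apply cdiff_plus; [apply cdiff_id | apply cdiff_const].
    + apply cdiff_Rem; rewrite plus_INR; rewrite S_INR in Hw; simpl; lra.
Qed.

Lemma cdiff_xi (w : C) : cdiff xi w.
Proof.
  (* The index inside [xi] varies with the point; this k is large enough for the whole disc of
     radius 1 about w. *)
  destruct (nfloor_ex (Rabs (Re w) + 2)) as [k [_ Hk]]; [generalize (Rabs_pos (Re w)); lra|].
  apply cdiff_ext_loc with (xik k) 1; [lra| |apply cdiff_xik].
  - intros z Hz; symmetry; apply xi_xik.
    assert (H := re_le_Cmod (z - w)%C). change (Re (z - w)%C) with (Re z - Re w) in H.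
    apply Rabs_le_between in H.
    assert (- Rabs (Re w) <= Re w) by (generalize (Rle_abs (- Re w)); rewrite Rabs_Ropp; lra).
    lra.
  - assert (- Rabs (Re w) <= Re w) by (generalize (Rle_abs (- Re w)); rewrite Rabs_Ropp; lra).
    lra.
Qed.

Lemma fact_INR_ge_1 (n : nat) : 1 <= INR (fact n).
Proof. apply (le_INR 1), lt_O_fact. Qed.

Lemma cbin_growth (n : nat) (w : C) :
  Cmod (cbin (1 - w) n) <= INR (S n) ^ n * (1 + Cmod w) ^ n.
Proof.
  unfold cbin; rewrite Cmod_div by apply fact_neq_C.
  assert (H := fact_INR_ge_1 n).
  rewrite Cmod_R, Rabs_pos_eq by lra.
  apply Rle_trans with (Cmod (cff (1 - w) n)); [|apply cff_growth].
  apply Rle_div_l; [lra|]; generalize (Cmod_ge_0 (cff (1 - w) n)); nra.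
Qed.

Lemma one_plus_shift (w : C) (n : nat) : 1 + Cmod (w + RtoC (INR n)) <= INR (S n) * (1 + Cmod w).
Proof.
  assert (H := Cmod_triangle w (RtoC (INR n))).
  rewrite Cmod_R, Rabs_pos_eq in H by apply pos_INR.
  rewrite S_INR; generalize (pos_INR n), (Cmod_ge_0 w); nra.
Qed.

(** In [xi_rec] the coefficient of order n+1 costs n+1 powers of 1 + |w|, while the shift of the
    argument by n+1 saves as many in the bound for [xi]. Hence all terms have the same degree. *)
Lemma xi_growth (k : nat) : forall eps, 0 < eps ->
  exists K, 0 <= K /\ forall w, eps - INR k <= Re w -> Cmod (xi w) <= K * (1 + Cmod w) ^ (k + 2).
Proof.
  induction k as [k IH] using lt_wf_ind; intros eps Heps.
  assert (HRem : exists K, 0 <= K /\ forall w, eps - INR k <= Re w ->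
    Cmod (Rem (k + 2) w) <= K * (1 + Cmod w) ^ (k + 2)).
  { set (n := (k + 2)%nat).
    assert (En : INR n = INR k + 2) by (unfold n; rewrite plus_INR; simpl; ring).
    set (S0 := Series (fun j => Rpower (INR (S j)) (- (eps - INR k + INR n - 1)))).
    assert (HS0 : 0 <= S0).
    { eapply Rle_trans; [|apply (rsum_le_Series _ 0)].
      - simpl; lra.
      - intro j; apply Rlt_le, Rpower_pos.
      - apply ex_pseries; lra. }
    exists (2 ^ n * INR (S n) ^ n * S0); split.
    { repeat apply Rmult_le_pos; [apply pow_le; lra | apply pow_le, pos_INR | exact HS0]. }
    intros w Hw.
    eapply Rle_trans; [apply (Rem_correct n w (eps - INR k)); lra|]; fold S0.
    replace (2 ^ n * INR (S n) ^ n * S0 * (1 + Cmod w) ^ n)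
      with (2 ^ n * (INR (S n) ^ n * (1 + Cmod w) ^ n) * S0) by ring.
    apply Rmult_le_compat_r; [exact HS0|].
    apply Rmult_le_compat_l; [apply pow_le; lra | apply cff_growth]. }
  destruct HRem as [K0 [HK0 HR]].
  destruct k as [|k].
  - exists (1 + K0); split; [lra|]; intros w Hw.
    rewrite (xi_xik 0) by lra; cbn [xik].
    eapply Rle_trans; [apply Cmod_triangle|]; rewrite Cmod_1.
    specialize (HR w Hw); change (0 + 2)%nat with 2%nat in *.
    assert (1 <= (1 + Cmod w) ^ 2) by (apply pow_R1_Rle; generalize (Cmod_ge_0 w); lra).
    lra.
  - assert (HT : forall n, (n <= S k)%nat -> exists K, 0 <= K /\ forall w, eps - INR (S k) <= Re w ->
      Cmod (csum (fun i => cbin (1 - w) (S i) / RtoC (INR (S (S i))) * xi (w + RtoC (INR (S i))))%C n)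
      <= K * (1 + Cmod w) ^ (k + 3)).
    { induction n as [|n IHn]; intro Hn.
      - exists 0; split; [lra|]; intros w _; simpl csum; rewrite Cmod_0; lra.
      - destruct IHn as [K1 [HK1 H1]]; [lia|].
        destruct (IH (k - n)%nat ltac:(lia) eps Heps) as [K2 [HK2 H2]].
        set (A := INR (S (S n)) ^ (S n)). set (B := INR (S (S n)) ^ (k - n + 2)).
        assert (HA : 0 <= A) by apply pow_le, pos_INR.
        assert (HB : 0 <= B) by apply pow_le, pos_INR.
        exists (K1 + A * (K2 * B)); split.
        { apply Rplus_le_le_0_compat; [exact HK1|]; apply Rmult_le_pos; [exact HA | apply Rmult_le_pos; assumption]. }
        intros w Hw.
        change (csum ?f (S n)) with (csum f n + f n)%C.
        eapply Rle_trans; [apply Cmod_triangle|].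
        rewrite (Rmult_plus_distr_r K1); apply Rplus_le_compat; [apply H1, Hw|].
        assert (Hx := Cmod_ge_0 w).
        rewrite Cmod_mult, Cmod_div by apply INR_S_neq_C.
        assert (Hm := INR_S_ge_1 (S n)).
        rewrite Cmod_R, Rabs_pos_eq by lra.
        assert (G1 : Cmod (cbin (1 - w) (S n)) / INR (S (S n)) <= A * (1 + Cmod w) ^ (S n)).
        { apply Rle_trans with (Cmod (cbin (1 - w) (S n))); [|apply cbin_growth].
          apply Rle_div_l; [lra|]; generalize (Cmod_ge_0 (cbin (1 - w) (S n))); nra. }
        assert (G2 : Cmod (xi (w + RtoC (INR (S n)))) <= K2 * (B * (1 + Cmod w) ^ (k - n + 2))).
        { eapply Rle_trans; [apply H2|].
          - rewrite Re_plus_nat, minus_INR by lia; rewrite !S_INR in *; lra.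
          - apply Rmult_le_compat_l; [exact HK2|].
            unfold B; rewrite <- Rpow_mult_distr; apply pow_incr; split.
            + generalize (Cmod_ge_0 (w + RtoC (INR (S n)))); lra.
            + apply one_plus_shift. }
        replace (k + 3)%nat with (S n + (k - n + 2))%nat by lia.
        rewrite pow_add.
        replace (A * (K2 * B) * ((1 + Cmod w) ^ S n * (1 + Cmod w) ^ (k - n + 2)))
          with ((A * (1 + Cmod w) ^ S n) * (K2 * (B * (1 + Cmod w) ^ (k - n + 2)))) by ring.
        apply Rmult_le_compat; try assumption; try apply Cmod_ge_0.
        apply Rdiv_le_0_compat; [apply Cmod_ge_0 | lra]. }
    destruct (HT (S k) (le_n _)) as [K1 [HK1 H1]].
    exists (1 + K1 + K0); split; [lra|]; intros w Hw.
    rewrite (xi_rec k) by lra.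
    specialize (H1 w Hw); specialize (HR w Hw).
    replace (S k + 2)%nat with (k + 3)%nat in * by lia.
    eapply Rle_trans; [apply Cmod_triangle|].
    unfold Cminus; eapply Rle_trans; [apply Rplus_le_compat_r, Cmod_triangle|].
    rewrite Cmod_opp, Cmod_1.
    assert (1 <= (1 + Cmod w) ^ (k + 3)) by (apply pow_R1_Rle; generalize (Cmod_ge_0 w); lra).
    unfold Cminus in H1; lra.
Qed.

Definition zeta0 (w : C) : C := (xi w / (w - 1))%C.

Lemma cdiff_zeta0 (w : C) : w <> RtoC 1 -> cdiff zeta0 w.
Proof.
  intro H; apply cdiff_div; [apply Cminus_eq_contra, H | apply cdiff_xi|].
  apply cdiff_minus; [apply cdiff_id | apply cdiff_const].
Qed.

Lemma zeta0_Dir (w : C) : 1 < Re w -> zeta0 w = Dir w.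
Proof.
  intro Hw; unfold zeta0; rewrite xi_Dir by exact Hw; field.
  apply Cminus_eq_contra; intros ->; simpl in Hw; lra.
Qed.

Lemma zeta0_growth (k : nat) (eps : R) : 0 < eps ->
  exists K, 0 <= K /\ forall w, eps - INR k <= Re w -> 1 <= Rabs (Im w) ->
    Cmod (zeta0 w) <= K * (1 + Cmod w) ^ (k + 1).
Proof.
  intro Heps; destruct (xi_growth k eps Heps) as [K [HK H]].
  exists (3 * K); split; [lra|]; intros w Hw Him; specialize (H w Hw).
  assert (H1 : 1 <= Cmod (w - 1)).
  { eapply Rle_trans; [exact Him|].
    replace (Im w) with (Im (w - 1)%C) by (destruct w; simpl; ring); apply im_le_Cmod. }
  assert (H2 : 1 + Cmod w <= 3 * Cmod (w - 1)).
  { assert (T := Cmod_triangle (w - 1) 1); replace (w - 1 + 1)%C with w in T by ring.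
    rewrite Cmod_1 in T; lra. }
  unfold zeta0; rewrite Cmod_div by (apply Cmod_gt_0; lra).
  apply Rle_div_l; [lra|].
  eapply Rle_trans; [exact H|].
  replace (k + 2)%nat with (S (k + 1)) by lia; simpl.
  assert (0 <= (1 + Cmod w) ^ (k + 1)) by (apply pow_le; generalize (Cmod_ge_0 w); lra).
  assert (0 <= K * (1 + Cmod w) ^ (k + 1)) by (apply Rmult_le_pos; assumption).
  nra.
Qed.

Lemma is_riemann_zeta_zeta0 : is_riemann_zeta zeta0.
Proof.
  split.
  - intros s Hs; apply is_Cseries_csum; rewrite zeta0_Dir by exact Hs; apply Dir_correct, Hs.
  - intros s Hs; apply cder_differentiable, cdiff_zeta0, Hs.
Qed.

Lemma zeta_is_riemann_zeta : is_riemann_zeta zeta.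
Proof. exact (epsilon_spec _ is_riemann_zeta (ex_intro _ zeta0 is_riemann_zeta_zeta0)). Qed.

(** [zeta] is picked by [epsilon], so only its characterisation is known; uniqueness of the
    continuation identifies it with the explicit [zeta0]. Values and derivatives at real points are
    all that the theorem mentions. *)
Lemma zeta_zeta0_real (p : R) : p <> 1 ->
  zeta (RtoC p) = zeta0 (RtoC p) /\ C_derive zeta (RtoC p) = C_derive zeta0 (RtoC p).
Proof.
  intro Hp.
  destruct zeta_is_riemann_zeta as [Z1 Z2].
  assert (Hz : forall z, z <> RtoC 1 -> cdiff zeta z).
  { intros z Hz; apply cder_differentiable, Z2, Hz. }
  set (h := fun z => (zeta z - zeta0 z)%C).
  assert (H0 : forall z, 0 < Im z -> h z = RtoC 0).
  { apply identity_upper_half_plane.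
    - intros z Him.
      assert (z <> RtoC 1) by (intros ->; simpl in Him; lra).
      apply cdiff_minus; [apply Hz | apply cdiff_zeta0]; assumption.
    - intros z Hre; unfold h; apply (proj1 (Ceq_minus _ _)).
      apply (Ccv_unique (csum (fun k => cpow (INR (S k)) (- z)))).
      + apply csum_is_Cseries, Z1, Hre.
      + apply csum_is_Cseries, (proj1 is_riemann_zeta_zeta0), Hre. }
  assert (Hp' : RtoC p <> RtoC 1) by (intro E; apply Hp, RtoC_inj, E).
  destruct (Hz _ Hp') as [l Hl]. destruct (cdiff_zeta0 _ Hp') as [l0 Hl0].
  destruct (zero_real_boundary h p (l - l0)%C H0) as [E1 E2].
  { apply cder_minus; assumption. }
  split; [apply Ceq_minus, E1|].
  rewrite (cder_C_derive _ _ _ Hl), (cder_C_derive _ _ _ Hl0).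
  apply Ceq_minus, E2.
Qed.

(** * Exponential sums *)

Definition expi (x : R) : C := (cos (2 * PI * x), sin (2 * PI * x)).

Lemma expi_plus (x y : R) : expi (x + y) = (expi x * expi y)%C.
Proof.
  unfold expi; replace (2 * PI * (x + y)) with (2 * PI * x + 2 * PI * y) by ring.
  rewrite cos_plus, sin_plus; apply injective_projections; simpl; ring.
Qed.

Lemma Cmod_expi (x : R) : Cmod (expi x) = 1.
Proof. apply Cmod_unit. Qed.

Lemma expi_conj (x : R) : Cconj (expi x) = expi (- x).
Proof.
  unfold expi, Cconj; simpl.
  replace (2 * PI * - x) with (- (2 * PI * x)) by ring.
  rewrite cos_neg, sin_neg; reflexivity.
Qed.

Lemma expi_0 : expi 0 = RtoC 1.
Proof. unfold expi; rewrite Rmult_0_r, cos_0, sin_0; reflexivity. Qed.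

Lemma expi_1 : expi 1 = RtoC 1.
Proof. unfold expi; rewrite Rmult_1_r, cos_2PI, sin_2PI; reflexivity. Qed.

Lemma expi_nat (n : nat) : expi (INR n) = RtoC 1.
Proof.
  induction n as [|n IH]; [apply expi_0|].
  rewrite S_INR, expi_plus, IH, expi_1; ring.
Qed.

Lemma expi_IZR (k : Z) : expi (IZR k) = RtoC 1.
Proof.
  destruct (Z_le_dec 0 k) as [Hk|Hk].
  - rewrite <- (Z2Nat.id k Hk), <- INR_IZR_INZ; apply expi_nat.
  - rewrite <- (Cconj_conj (expi (IZR k))), expi_conj, <- opp_IZR.
    rewrite <- (Z2Nat.id (- k)) by lia; rewrite <- INR_IZR_INZ, expi_nat.
    apply injective_projections; simpl; ring.
Qed.

Lemma Cmod_expi_minus_1 (t : R) : Cmod (expi t - 1) ^ 2 = 2 * (1 - cos (2 * PI * t)).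
Proof.
  rewrite Cmod2_alt.
  replace (Re (expi t - 1)%C) with (cos (2 * PI * t) - 1) by (unfold expi; simpl; ring).
  replace (Im (expi t - 1)%C) with (sin (2 * PI * t)) by (unfold expi; simpl; ring).
  assert (E := sin2_cos2 (2 * PI * t)); unfold Rsqr in E; simpl; lra.
Qed.

Lemma expi_lipschitz (a b : R) : Cmod (expi a - expi b) <= 2 * PI * Rabs (a - b).
Proof.
  replace (expi a - expi b)%C with (expi b * (expi (a - b) - 1))%C.
  2:{ replace a with (b + (a - b)) at 2 by ring; rewrite expi_plus; ring. }
  rewrite Cmod_mult, Cmod_expi, Rmult_1_l.
  assert (H := Cmod_expi_minus_1 (a - b)).
  assert (Q := cos_quadratic (2 * PI * (a - b))).
  assert (P := PI_RGT_0). assert (A := Rabs_pos (a - b)). assert (M := Cmod_ge_0 (expi (a - b) - 1)).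
  assert (E : Rabs (a - b) * Rabs (a - b) = (a - b) * (a - b)).
  { rewrite <- Rabs_mult; apply Rabs_pos_eq, Rle_0_sqr. }
  apply Rsqr_incr_0; [unfold Rsqr | exact M | apply Rmult_le_pos; [lra | exact A]].
  simpl in H; rewrite Rmult_1_r in H; rewrite H.
  replace (2 * PI * Rabs (a - b) * (2 * PI * Rabs (a - b))) with (4 * (PI * PI) * (Rabs (a - b) * Rabs (a - b))) by ring.
  rewrite E; lra.
Qed.

(** Write sin x = 2 sin(x/2) cos(x/2) with sin(x/2) = (x/2) cos c; both cosines are at least
    cos(pi/4), whose square is 1/2. *)
Lemma sin_ge_half (x : R) : 0 <= x <= PI / 2 -> x / 2 <= sin x.
Proof.
  intro Hx.
  assert (P := PI_RGT_0).
  assert (C4 : cos (PI / 4) * cos (PI / 4) = 1 / 2).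
  { rewrite cos_PI4. assert (S : 0 < sqrt 2) by (apply sqrt_lt_R0; lra).
    assert (E : sqrt 2 * sqrt 2 = 2) by (apply sqrt_sqrt; lra).
    replace (1 / sqrt 2 * (1 / sqrt 2)) with (1 / (sqrt 2 * sqrt 2)) by (field; lra).
    rewrite E; reflexivity. }
  assert (P4 : 0 < cos (PI / 4)) by (apply cos_gt_0; lra).
  destruct (MVT_gen sin 0 (x / 2) cos) as [c [Hc E]].
  { intros t _; auto_derive; [exact I | ring]. }
  { intros t _; apply continuity_sin. }
  rewrite Rmin_left, Rmax_right in Hc by lra.
  rewrite sin_0, !Rminus_0_r in E.
  replace x with (2 * (x / 2)) at 2 by field.
  rewrite sin_2a, E.
  assert (H1 : cos (PI / 4) <= cos c) by (apply cos_decr_1; lra).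
  assert (H2 : cos (PI / 4) <= cos (x / 2)) by (apply cos_decr_1; lra).
  assert (H3 : 1 / 2 <= cos c * cos (x / 2)).
  { rewrite <- C4; apply Rmult_le_compat; lra. }
  nra.
Qed.

Lemma expi_minus_1_lower (t : R) : 0 <= t <= 1 / 2 -> 2 * t <= Cmod (expi t - 1).
Proof.
  intro Ht; assert (H := Cmod_expi_minus_1 t).
  replace (2 * PI * t) with (2 * (PI * t)) in H by ring.
  rewrite cos_2a_sin in H.
  assert (P := PI_RGT_0). assert (P3 := PI2_3_2).
  assert (S : PI * t / 2 <= sin (PI * t)) by (apply sin_ge_half; nra).
  assert (S2 : t <= sin (PI * t)) by nra.
  assert (M := Cmod_ge_0 (expi t - 1)).
  simpl in H. nra.
Qed.

(* With d m = f (m+1) - f m, expi (f m) = (expi (f (m+1)) - expi (f m)) / (expi (d m) - 1);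
   sum by parts, the variation of the last factor being bounded by that of 1 / d. *)
Lemma kusmin_landau (f : nat -> R) (n : nat) (lam : R) : 0 < lam ->
  (forall m, (m <= n)%nat -> lam <= f (S m) - f m <= 1 / 2) ->
  (forall m, (m < n)%nat -> f (S (S m)) - f (S m) <= f (S m) - f m) ->
  Cmod (csum (fun m => expi (f m)) n) <= 3 / lam.
Proof.
  intros Hlam Hd Hmon.
  set (d := fun m => f (S m) - f m) in *.
  set (g := fun m => (/ (expi (d m) - 1))%C).
  assert (L : forall m, (m <= n)%nat -> 2 * d m <= Cmod (expi (d m) - 1)).
  { intros m Hm; apply expi_minus_1_lower; specialize (Hd m Hm); unfold d; lra. }
  assert (Lp : forall m, (m <= n)%nat -> 0 < d m).
  { intros m Hm; specialize (Hd m Hm); unfold d; lra. }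
  assert (Nz : forall m, (m <= n)%nat -> (expi (d m) - 1)%C <> RtoC 0).
  { intros m Hm; apply Cmod_gt_0; specialize (L m Hm); specialize (Lp m Hm); lra. }
  assert (E : forall k, (k <= n)%nat -> csum (fun m => expi (f m)) k =
    (expi (f k) * g k - expi (f 0%nat) * g 0%nat - csum (fun m => expi (f (S m)) * (g (S m) - g m)) k)%C).
  { induction k as [|k IH]; intro Hk; [simpl; ring|].
    change (csum (fun m => expi (f m)) k + expi (f k) = expi (f (S k)) * g (S k) - expi (f 0%nat) * g 0%nat -
     (csum (fun m => expi (f (S m)) * (g (S m) - g m)) k + expi (f (S k)) * (g (S k) - g k)))%C.
    rewrite IH by lia.
    replace (expi (f (S k))) with (expi (f k) * expi (d k))%C.
    2:{ rewrite <- expi_plus; f_equal; unfold d; ring. }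
    assert (X : (g k * (expi (d k) - 1))%C = RtoC 1) by (unfold g; apply Cinv_l, Nz; lia).
    transitivity (expi (f k) * g k - expi (f 0%nat) * g 0%nat -
      csum (fun m => expi (f (S m)) * (g (S m) - g m)) k + expi (f k) * (g k * (expi (d k) - 1)))%C.
    - rewrite X; ring.
    - ring. }
  assert (G : forall m, (m <= n)%nat -> Cmod (g m) <= / (2 * lam)).
  { intros m Hm; unfold g; rewrite Cmod_inv by (apply Nz, Hm).
    apply Rinv_le_contravar; [lra|]; specialize (L m Hm); specialize (Hd m Hm); unfold d in *; lra. }
  assert (T : forall k, (k <= n)%nat ->
    Cmod (csum (fun m => expi (f (S m)) * (g (S m) - g m))%C k) <= 2 * (/ d k - / d 0%nat)).
  { induction k as [|k IH]; intro Hk; [simpl; rewrite Cmod_0; lra|].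
    change (csum ?F (S k)) with (csum F k + F k)%C.
    eapply Rle_trans; [apply Cmod_triangle|].
    assert (H1 := Lp k ltac:(lia)). assert (H2 := Lp (S k) Hk).
    assert (B : Cmod (expi (f (S k)) * (g (S k) - g k)) <= 2 * (/ d (S k) - / d k)).
    { rewrite Cmod_mult, Cmod_expi, Rmult_1_l; unfold g.
      replace (/ (expi (d (S k)) - 1) - / (expi (d k) - 1))%C
        with ((expi (d k) - expi (d (S k))) / ((expi (d (S k)) - 1) * (expi (d k) - 1)))%C.
      2:{ field; split; apply Nz; lia. }
      rewrite Cmod_div by (apply Cmult_neq_0; apply Nz; lia).
      rewrite Cmod_mult.
      assert (Lk := L k ltac:(lia)). assert (Lk1 := L (S k) Hk).
      assert (Hm : d (S k) <= d k) by (apply Hmon; lia).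
      assert (Lip := expi_lipschitz (d k) (d (S k))).
      rewrite Rabs_pos_eq in Lip by lra.
      assert (P4 := PI_4).
      apply Rle_trans with (8 * (d k - d (S k)) / ((2 * d (S k)) * (2 * d k))).
      - apply Rmult_le_compat; [apply Cmod_ge_0 | | |].
        + apply Rlt_le, Rinv_0_lt_compat, Rmult_lt_0_compat; lra.
        + nra.
        + apply Rinv_le_contravar; [nra|]; apply Rmult_le_compat; lra.
      - right; field; lra. }
    specialize (IH ltac:(lia)); lra. }
  rewrite (E n (le_n n)); unfold Cminus.
  eapply Rle_trans; [apply Cmod_triangle|].
  eapply Rle_trans; [apply Rplus_le_compat_r, Cmod_triangle|].
  rewrite !Cmod_opp, !Cmod_mult, !Cmod_expi, !Rmult_1_l.
  assert (G1 := G n (le_n n)). assert (G0 := G 0%nat ltac:(lia)). assert (Tn := T n (le_n n)).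
  assert (Hdn : / d n <= / lam) by (apply Rinv_le_contravar; [lra | apply (Hd n (le_n n))]).
  assert (0 < / d 0%nat) by (apply Rinv_0_lt_compat, Lp; lia).
  replace (/ (2 * lam)) with (/ lam / 2) in * by (field; lra).
  unfold Rdiv at 1; unfold Cminus in Tn; lra.
Qed.

Lemma rsum_nonneg (a : nat -> R) (n : nat) : (forall k, (k < n)%nat -> 0 <= a k) -> 0 <= rsum a n.
Proof.
  intro H; replace 0 with (rsum (fun _ => 0) n) by (rewrite rsum_const; ring).
  apply rsum_le, H.
Qed.

(** Expand the nonnegative sum of the squares (n a_k - s)^2, where s is the sum of the a_k. *)
Lemma cauchy_schwarz_1 (a : nat -> R) (n : nat) :
  rsum a n * rsum a n <= INR n * rsum (fun k => a k * a k) n.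
Proof.
  assert (H : 0 <= rsum (fun k => (INR n * a k - rsum a n) * (INR n * a k - rsum a n)) n).
  { apply rsum_nonneg; intros; apply Rle_0_sqr. }
  rewrite (rsum_ext _ (fun k => (INR n * INR n) * (a k * a k) + (- (2 * INR n * rsum a n) * a k + rsum a n * rsum a n))) in H
    by (intros; ring).
  rewrite !rsum_plus, !rsum_scal, rsum_const in H.
  set (s := rsum a n) in *. set (q := rsum (fun k => a k * a k) n) in *.
  assert (Hn := pos_INR n).
  destruct (Rle_lt_or_eq_dec _ _ Hn) as [Hp|Hz].
  - assert (E : 0 <= INR n * (INR n * q - s * s)) by nra.
    apply Rnot_lt_le; intro Hlt; nra.
  - assert (n = 0)%nat by (apply INR_eq; rewrite <- Hz; reflexivity).
    subst n; unfold s; simpl; lra.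
Qed.

Lemma csum_exchange (a : nat -> nat -> C) (n m : nat) :
  csum (fun i => csum (a i) m) n = csum (fun j => csum (fun i => a i j) n) m.
Proof.
  induction n as [|n IH]; simpl.
  - rewrite csum_zero; reflexivity.
  - rewrite IH, <- csum_plus; reflexivity.
Qed.

Lemma csum_mult (a b : nat -> C) (n m : nat) :
  (csum a n * csum b m)%C = csum (fun i => csum (fun j => a i * b j)%C m) n.
Proof.
  induction n as [|n IH]; simpl; [ring|].
  rewrite <- IH, csum_scal; ring.
Qed.

Lemma csum_conj (a : nat -> C) (n : nat) : Cconj (csum a n) = csum (fun k => Cconj (a k)) n.
Proof.
  induction n as [|n IH]; simpl; [apply injective_projections; simpl; ring|].
  rewrite Cplus_conj, IH; reflexivity.
Qed.

Lemma csum_shift_bound (z : nat -> C) (n h : nat) : (forall m, Cmod (z m) <= 1) ->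
  Cmod (csum (fun m => z (m + h)%nat) n - csum z n) <= 2 * INR h.
Proof.
  intro Hz.
  assert (E : (csum (fun m => z (m + h)%nat) n - csum z n
    = csum (fun k => z (n + k)%nat) h - csum z h)%C).
  { assert (E1 := csum_add z n h). assert (E2 := csum_add z h n).
    rewrite Nat.add_comm, E1 in E2.
    rewrite (csum_ext (fun m => z (m + h)%nat) (fun k => z (h + k)%nat)).
    2:{ intros k _; f_equal; lia. }
    transitivity ((csum z h + csum (fun k => z (h + k)%nat) n) - csum z h - csum z n)%C; [ring|].
    rewrite <- E2; ring. }
  rewrite E; unfold Cminus; eapply Rle_trans; [apply Cmod_triangle|]; rewrite Cmod_opp.
  assert (B : forall u : nat -> C, (forall m, Cmod (u m) <= 1) -> Cmod (csum u h) <= INR h).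
  { intros u Hu; eapply Rle_trans; [apply (csum_Cmod u (fun _ => 1)); auto|].
    rewrite rsum_const; lra. }
  assert (B1 := B z Hz). assert (B2 := B (fun k => z (n + k)%nat) (fun m => Hz _)). lra.
Qed.

Lemma rsum_diag (H h : nat) (d B : R) : 0 <= B -> (h < H)%nat ->
  rsum (fun k => if Nat.eq_dec h k then d else B) H <= Rabs d + INR H * B.
Proof.
  intros HB _; induction H as [|H IH].
  - simpl; generalize (Rabs_pos d); lra.
  - simpl rsum; rewrite S_INR.
    destruct (Nat.eq_dec h H) as [->|Hn]; [|lra].
    rewrite (rsum_ext _ (fun _ => B)), rsum_const.
    + generalize (Rle_abs d); lra.
    + intros k Hk; destruct (Nat.eq_dec H k); [lia | reflexivity].
Qed.

(** H times the sum differs by at most 2 H^2 from the sum of the Z m, each Z m adding up H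
    consecutive shifts. Cauchy-Schwarz and expansion of |Z m|^2 leave a diagonal of size H n and
    correlations bounded by B. *)
Lemma van_der_corput (z : nat -> C) (n H : nat) (B : R) : (1 <= H)%nat -> 0 <= B ->
  (forall m, Cmod (z m) <= 1) ->
  (forall h' h, (h' < h)%nat -> (h < H)%nat ->
     Cmod (csum (fun m => z (m + h)%nat * Cconj (z (m + h')%nat))%C n) <= B) ->
  Cmod (csum z n) <= 2 * INR H + sqrt (INR n * INR n / INR H + INR n * B).
Proof.
  intros HH HB Hz Hc.
  assert (HHp : 0 < INR H) by (apply lt_0_INR; lia).
  assert (Hn := pos_INR n).
  set (S := csum z n). set (Z := fun m => csum (fun h => z (m + h)%nat) H).
  assert (B1 : Cmod (RtoC (INR H) * S - csum Z n) <= 2 * INR H * INR H).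
  { unfold Z; rewrite csum_exchange.
    replace (RtoC (INR H) * S - csum (fun j => csum (fun i => z (i + j)%nat) n) H)%C
      with (csum (fun j => (-RtoC 1) * (csum (fun i => z (i + j)%nat) n - S)) H)%C.
    2:{ rewrite csum_scal; unfold Cminus; rewrite csum_plus.
        assert (E : forall k, csum (fun _ => - S)%C k = (- (RtoC (INR k) * S))%C).
        { induction k as [|k IH]; [simpl; ring|].
          rewrite S_INR, RtoC_plus; simpl; rewrite IH; ring. }
        rewrite E; ring. }
    eapply Rle_trans; [apply (csum_Cmod _ (fun _ => 2 * INR H))|].
    - intros k Hk; rewrite Cmod_mult, Cmod_opp, Cmod_1, Rmult_1_l.
      eapply Rle_trans; [apply csum_shift_bound, Hz|].
      assert (INR k <= INR H) by (apply le_INR; lia). lra.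
    - rewrite rsum_const; lra. }
  assert (B2 : rsum (fun m => Cmod (Z m) * Cmod (Z m)) n <= INR H * INR n + INR H * INR H * B).
  { assert (E : RtoC (rsum (fun m => Cmod (Z m) * Cmod (Z m)) n)
      = csum (fun h => csum (fun h' => csum (fun m => z (m + h)%nat * Cconj (z (m + h')%nat))%C n) H) H).
    { rewrite (csum_ext _ (fun h => csum (fun m => csum (fun h' => z (m + h)%nat * Cconj (z (m + h')%nat)) H) n)%C).
      2:{ intros k _; apply csum_exchange. }
      rewrite csum_exchange.
      assert (EZ : forall k, RtoC (rsum (fun m => Cmod (Z m) * Cmod (Z m)) k) = csum (fun m => Z m * Cconj (Z m))%C k).
      { induction k as [|k IH]; [reflexivity|].
        simpl; rewrite RtoC_plus, IH; f_equal.
        rewrite <- Cmod2_conj; f_equal; simpl; ring. }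
      rewrite EZ; apply csum_ext; intros m _.
      unfold Z; rewrite csum_conj, csum_mult; reflexivity. }
    apply Rle_trans with (Cmod (RtoC (rsum (fun m => Cmod (Z m) * Cmod (Z m)) n))).
    { rewrite Cmod_R; apply Rle_abs. }
    rewrite E.
    eapply Rle_trans; [apply (csum_Cmod _ (fun _ => INR n + INR H * B))|].
    - intros h Hh.
      eapply Rle_trans; [apply (csum_Cmod _ (fun h' => if Nat.eq_dec h h' then INR n else B))|].
      + intros h' Hh'; destruct (Nat.eq_dec h h') as [->|Hne].
        * eapply Rle_trans; [apply (csum_Cmod _ (fun _ => 1))|rewrite rsum_const; lra].
          intros m _; rewrite Cmod_mult, Cmod_conj.
          generalize (Hz (m + h')%nat), (Cmod_ge_0 (z (m + h')%nat)); nra.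
        * destruct (le_lt_dec h h') as [Hl|Hl]; [|apply Hc; assumption].
          rewrite <- Cmod_conj, csum_conj.
          rewrite (csum_ext _ (fun m => z (m + h')%nat * Cconj (z (m + h)%nat))%C).
          -- apply Hc; lia.
          -- intros m _; rewrite Cmult_conj, Cconj_conj; ring.
      + eapply Rle_trans; [apply rsum_diag; assumption | rewrite Rabs_pos_eq by exact Hn; lra].
    - rewrite rsum_const; lra. }
  assert (B3 : Cmod (csum Z n) <= sqrt (INR n * (INR H * INR n + INR H * INR H * B))).
  { apply Rle_trans with (rsum (fun m => Cmod (Z m)) n); [apply csum_Cmod; intros; lra|].
    rewrite <- (sqrt_square (rsum (fun m => Cmod (Z m)) n)).
    2:{ apply rsum_nonneg; intros; apply Cmod_ge_0. }
    apply sqrt_le_1_alt; eapply Rle_trans; [apply cauchy_schwarz_1|].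
    apply Rmult_le_compat_l; [exact Hn | exact B2]. }
  assert (E : sqrt (INR n * (INR H * INR n + INR H * INR H * B))
    = INR H * sqrt (INR n * INR n / INR H + INR n * B)).
  { transitivity (sqrt (INR H * INR H) * sqrt (INR n * INR n / INR H + INR n * B)).
    - rewrite <- sqrt_mult_alt by (apply Rle_0_sqr); f_equal; field; lra.
    - rewrite sqrt_square by lra; reflexivity. }
  rewrite E in B3.
  set (q := sqrt _) in *.
  assert (B4 : INR H * Cmod S <= 2 * INR H * INR H + INR H * q).
  { replace (INR H * Cmod S) with (Cmod (RtoC (INR H) * S)).
    2:{ rewrite Cmod_mult, Cmod_R, Rabs_pos_eq by lra; reflexivity. }
    replace (RtoC (INR H) * S)%C with ((RtoC (INR H) * S - csum Z n) + csum Z n)%C by ring.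
    eapply Rle_trans; [apply Cmod_triangle | lra]. }
  apply (Rmult_le_reg_l (INR H)); [exact HHp | lra].
Qed.

Fixpoint fdiff (k : nat) (f : nat -> R) : nat -> R :=
  match k with O => f | S k => fun m => fdiff k f (S m) - fdiff k f m end.

Lemma fdiff_minus (k : nat) (f : nat -> R) (a b m : nat) :
  fdiff k (fun m => f (m + a)%nat - f (m + b)%nat) m = fdiff k f (m + a)%nat - fdiff k f (m + b)%nat.
Proof.
  revert m; induction k as [|k IH]; intro m; simpl; [reflexivity|].
  rewrite !IH; simpl; ring.
Qed.

(** Adds up j consecutive increments. In [weyl] it converts the conditions on the difference of
    order k+2 of f into those on the difference of order k+1 of the phase f(m+h) - f(m+h'). *)
Lemma increments (u : nat -> R) (X j : nat) (lam c : R) :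
  (forall m, (m < X)%nat -> lam <= u (S m) - u m /\ (u (S m) - u m) * c <= 1 / 2 /\
     u (S (S m)) - u (S m) <= u (S m) - u m) ->
  forall a, (a + j <= X)%nat ->
  INR j * lam <= u (a + j)%nat - u a /\ (u (a + j)%nat - u a) * c <= INR j / 2 /\
  u (S a + j)%nat - u (S a) <= u (a + j)%nat - u a.
Proof.
  intros H a; induction j as [|j IH]; intro Ha.
  - rewrite !Nat.add_0_r; simpl; lra.
  - destruct IH as [I1 [I2 I3]]; [lia|].
    destruct (H (a + j)%nat) as [J1 [J2 J3]]; [lia|].
    rewrite !Nat.add_succ_r, S_INR; simpl Nat.add in *.
    repeat split; lra.
Qed.

(* The same number H = Q^(2^k) of shifts is used at every differencing step; each step
   turns a bound of order N / Q^2 into one of order N / Q. *)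
Lemma weyl (k : nat) : forall (f : nat -> R) (Q N n X : nat) (lam : R),
  let H := (Q ^ (2 ^ k))%nat in
  (1 <= Q)%nat -> (n <= N)%nat -> (n + (k + 1) * H <= X)%nat -> 0 < lam ->
  INR H <= lam * INR N -> (H * H <= N)%nat ->
  (forall m, (m < X)%nat -> lam <= fdiff (S k) f m /\ fdiff (S k) f m * INR H ^ k <= 1 / 2 /\
     fdiff (S k) f (S m) <= fdiff (S k) f m) ->
  Cmod (csum (fun m => expi (f m)) n) <= 6 * INR N / INR Q.
Proof.
  induction k as [|k IH]; intros f Q N n X lam H HQ Hn HX Hlam HlN HHN Hf.
  - simpl in H. assert (EH : H = Q) by (unfold H; lia). rewrite EH in *.
    assert (HQp : 0 < INR Q) by (apply lt_0_INR; lia).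
    eapply Rle_trans; [apply (kusmin_landau f n lam Hlam)|].
    + intros m Hm; destruct (Hf m) as [F1 [F2 _]]; [lia|]; simpl in *; lra.
    + intros m Hm; destruct (Hf m) as [_ [_ F3]]; [lia|]; simpl in *; lra.
    + apply Rle_div_l; [exact Hlam|].
      apply Rle_trans with (6 * (lam * INR N) / INR Q); [|right; field; lra].
      apply Rle_div_r; [exact HQp|]. generalize (pos_INR N); lra.
  - assert (EH : H = ((Q * Q) ^ (2 ^ k))%nat).
    { unfold H; change (2 ^ S k)%nat with (2 * 2 ^ k)%nat.
      rewrite Nat.pow_mul_r; f_equal; simpl; lia. }
    assert (HQ2 : (1 <= Q * Q)%nat) by nia.
    assert (HQH : (Q * Q <= H)%nat).
    { rewrite EH; rewrite <- (Nat.pow_1_r (Q * Q)) at 1; apply Nat.pow_le_mono_r; [lia|].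
      assert (2 ^ k <> 0)%nat by (apply Nat.pow_nonzero; lia); lia. }
    assert (HH1 : (1 <= H)%nat) by lia.
    assert (HQp : 0 < INR Q) by (apply lt_0_INR; lia).
    assert (HHp : 0 < INR H) by (apply lt_0_INR; lia).
    assert (HNn := pos_INR N). assert (Hnn := pos_INR n).
    assert (HnN : INR n <= INR N) by (apply le_INR, Hn).
    assert (EQ2 : INR (Q * Q) = INR Q * INR Q) by apply mult_INR.
    set (B := 6 * INR N / INR (Q * Q)).
    assert (HB : 0 <= B).
    { unfold B; apply Rdiv_le_0_compat; [lra | rewrite EQ2; nra]. }
    eapply Rle_trans; [apply (van_der_corput _ n H B HH1 HB)|].
    + intro m; rewrite Cmod_expi; lra.
    + intros h' h Hh' Hh.
      rewrite (csum_ext _ (fun m => expi (f (m + h)%nat - f (m + h')%nat))).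
      2:{ intros m _; rewrite expi_conj, <- expi_plus; reflexivity. }
      (* The new phase reads f up to H places further on, so the range of validity shrinks from X to
         X - H. *)
      apply (IH (fun m => f (m + h)%nat - f (m + h')%nat) (Q * Q)%nat N n (X - H)%nat lam);
        try assumption; try (rewrite <- EH; assumption).
      * rewrite <- EH; lia.
      * rewrite <- EH; intros m Hm.
        rewrite !fdiff_minus.
        (* Adding h - h' <= H increments enlarges the upper bound by at most H, which uses up one
           factor of H^(k+1). *)
        assert (I := increments (fdiff (S k) f) X (h - h') lam (INR H ^ S k) Hf (m + h') ltac:(lia)).
        replace (m + h' + (h - h'))%nat with (m + h)%nat in I by lia.
        replace (S (m + h') + (h - h'))%nat with (S m + h)%nat in I by lia.
        replace (S (m + h')) with (S m + h')%nat in I by lia.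
        destruct I as [I1 [I2 I3]].
        assert (Hj : 1 <= INR (h - h') <= INR H).
        { split; [apply (le_INR 1); lia | apply le_INR; lia]. }
        split; [nra|]; split; [|exact I3].
        simpl pow in I2.
        apply (Rmult_le_reg_l (INR H)); [exact HHp|]. lra.
    + assert (HH2 : INR H * INR H <= INR N) by (rewrite <- mult_INR; apply le_INR, HHN).
      assert (HQ2R : INR Q * INR Q <= INR H) by (rewrite <- EQ2; apply le_INR, HQH).
      assert (HQ1 : 1 <= INR Q) by (apply (le_INR 1), HQ).
      assert (HQR : INR Q <= INR H) by nra.
      assert (T1 : 2 * INR H <= 2 * INR N / INR Q).
      { apply (proj1 (Rle_div_r _ _ _ HQp)); nra. }
      (* The diagonal contributes at most (N/Q)^2 and the correlations at most 6 (N/Q)^2, in total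
         less than 9 (N/Q)^2. *)
      assert (T2 : sqrt (INR n * INR n / INR H + INR n * B) <= 3 * INR N / INR Q).
      { rewrite <- (sqrt_square (3 * INR N / INR Q)) by (apply Rdiv_le_0_compat; lra).
        apply sqrt_le_1_alt.
        replace (3 * INR N / INR Q * (3 * INR N / INR Q)) with
          (INR N * INR N / (INR Q * INR Q) + INR N * (8 * INR N / (INR Q * INR Q))) by (field; lra).
        apply Rplus_le_compat.
        - apply Rmult_le_compat; [nra | apply Rlt_le, Rinv_0_lt_compat, HHp | nra |].
          apply Rinv_le_contravar; [nra | exact HQ2R].
        - apply Rmult_le_compat; try assumption.
          unfold B; rewrite EQ2; apply Rmult_le_compat_r; [|lra].
          apply Rlt_le, Rinv_0_lt_compat; nra. }
      replace (6 * INR N / INR Q) with (INR N / INR Q + (2 * INR N / INR Q + 3 * INR N / INR Q)) by (field; lra).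
      assert (0 <= INR N / INR Q) by (apply Rdiv_le_0_compat; lra).
      lra.
Qed.

(** * From exponential sums to the sawtooth *)

Lemma frac_part_bounds (x : R) : 0 <= frac_part x < 1.
Proof. destruct (base_fp x); lra. Qed.

Lemma frac_part_floor (x : R) : frac_part x = x - IZR (Zfloor x).
Proof.
  assert (H := frac_part_bounds x); unfold frac_part in *.
  rewrite (Zfloor_eq (Int_part x) x); [reflexivity | lra].
Qed.

Lemma frac_part_plus_le (x t : R) : 0 <= t -> frac_part (x + t) <= frac_part x + t.
Proof.
  intro Ht; rewrite !frac_part_floor.
  assert (H : (Zfloor x <= Zfloor (x + t))%Z) by (apply Zfloor_le; lra).
  apply IZR_le in H; lra.
Qed.

Lemma frac_part_add_Z (x : R) (z : Z) : frac_part (x + IZR z) = frac_part x.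
Proof. rewrite !frac_part_floor, Zfloor_addz, plus_IZR; ring. Qed.

Lemma B1_bounds (x : R) : - (1 / 2) <= B1 x <= 1 / 2.
Proof. unfold B1; generalize (frac_part_bounds x); lra. Qed.

Lemma B1_plus_le (x t : R) : 0 <= t -> B1 (x + t) <= B1 x + t.
Proof. intro Ht; unfold B1; generalize (frac_part_plus_le x t Ht); lra. Qed.

Lemma B1_add_Z (x : R) (z : Z) : B1 (x + IZR z) = B1 x.
Proof. unfold B1; rewrite frac_part_add_Z; reflexivity. Qed.

Lemma expi_frac_part (x : R) : expi x = expi (frac_part x).
Proof.
  rewrite frac_part_floor.
  replace x with ((x - IZR (Zfloor x)) + IZR (Zfloor x)) at 1 by ring.
  rewrite expi_plus, expi_IZR; ring.
Qed.

Lemma expi_minus_1_lower_frac (x d : R) : d <= frac_part x <= 1 - d -> 2 * d <= Cmod (expi x - 1).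
Proof.
  intro H; rewrite expi_frac_part; set (t := frac_part x) in *.
  assert (Ht := frac_part_bounds x); fold t in Ht.
  destruct (Rle_dec t (1 / 2)) as [Hh|Hh].
  - eapply Rle_trans; [|apply expi_minus_1_lower; lra]; lra.
  - assert (E : Cmod (expi t - 1) = Cmod (expi (1 - t) - 1)).
    { rewrite <- Cmod_conj, Cminus_conj, expi_conj.
      replace (Cconj (RtoC 1)) with (RtoC 1) by (apply injective_projections; simpl; ring).
      unfold Rminus; rewrite expi_plus, expi_1; f_equal; ring. }
    rewrite E; eapply Rle_trans; [|apply expi_minus_1_lower; lra]; lra.
Qed.

Definition dirichlet (K : nat) (t : R) : C := csum (fun j => expi (INR j * t)) K.

Lemma dirichlet_geometric (K : nat) (t : R) :
  (dirichlet K t * (expi t - 1))%C = (expi (INR K * t) - 1)%C.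
Proof.
  unfold dirichlet; induction K as [|K IH].
  - simpl; rewrite Rmult_0_l, expi_0; ring.
  - change (csum (fun j => expi (INR j * t)) (S K)) with (csum (fun j => expi (INR j * t)) K + expi (INR K * t))%C.
    rewrite Cmult_plus_distr_r, IH, S_INR.
    replace ((INR K + 1) * t) with (INR K * t + t) by ring; rewrite expi_plus; ring.
Qed.

Lemma dirichlet_bound (K : nat) (t d : R) : 0 < d -> d <= frac_part t <= 1 - d ->
  Cmod (dirichlet K t) <= / d.
Proof.
  intros Hd Ht.
  assert (H := dirichlet_geometric K t); apply (f_equal Cmod) in H.
  rewrite Cmod_mult in H.
  assert (L := expi_minus_1_lower_frac t d Ht).
  assert (U : Cmod (expi (INR K * t) - 1) <= 2).
  { unfold Cminus; eapply Rle_trans; [apply Cmod_triangle|].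
    rewrite Cmod_opp, Cmod_expi, Cmod_1; lra. }
  assert (M := Cmod_ge_0 (dirichlet K t)).
  apply (Rmult_le_reg_r (2 * d)); [lra|].
  replace (/ d * (2 * d)) with 2 by (field; lra). nra.
Qed.

Lemma dirichlet_square (K : nat) (t : R) :
  RtoC (Cmod (dirichlet K t) ^ 2)
  = csum (fun j => csum (fun i => expi ((INR j - INR i) * t)) K) K.
Proof.
  rewrite Cmod2_conj; unfold dirichlet; rewrite csum_conj, csum_mult.
  apply csum_ext; intros j _; apply csum_ext; intros i _.
  rewrite expi_conj, <- expi_plus; f_equal; ring.
Qed.

Lemma csum_RtoC (a : nat -> R) (n : nat) : csum (fun k => RtoC (a k)) n = RtoC (rsum a n).
Proof. induction n as [|n IH]; simpl; [reflexivity | rewrite IH, RtoC_plus; reflexivity]. Qed.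

Lemma csum_delta (K j : nat) (d : C) : (j < K)%nat ->
  csum (fun i => if Nat.eq_dec j i then d else RtoC 0) K = d.
Proof.
  induction K as [|K IH]; intro H; [lia|]; simpl.
  destruct (Nat.eq_dec j K) as [->|Hn].
  - rewrite (csum_ext _ (fun _ => RtoC 0)), csum_zero; [ring|].
    intros k Hk; destruct (Nat.eq_dec K k); [lia | reflexivity].
  - rewrite IH by lia; ring.
Qed.

Lemma csum_const (c : C) (n : nat) : csum (fun _ => c) n = (RtoC (INR n) * c)%C.
Proof.
  induction n as [|n IH]; [simpl; ring|].
  rewrite S_INR, RtoC_plus; simpl; rewrite IH; ring.
Qed.

Lemma expi_neq_1 (K j i : nat) : (j < K)%nat -> (i < j)%nat ->
  (expi ((INR j - INR i) / INR K) - 1)%C <> RtoC 0.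
Proof.
  intros Hj Hi.
  assert (HK : 0 < INR K) by (apply lt_0_INR; lia).
  set (t := (INR j - INR i) / INR K).
  assert (H1 : 1 <= INR j - INR i).
  { rewrite <- minus_INR by lia; apply (le_INR 1); lia. }
  assert (H2 : INR j - INR i <= INR K - 1).
  { rewrite <- minus_INR by lia; change 1 with (INR 1); rewrite <- minus_INR by lia; apply le_INR; lia. }
  assert (Ht : / INR K <= t <= 1 - / INR K).
  { unfold t; split; apply (Rmult_le_reg_r (INR K)); try exact HK.
    - rewrite Rinv_l by lra; unfold Rdiv; rewrite Rmult_assoc, Rinv_l by lra; lra.
    - unfold Rdiv; rewrite Rmult_assoc, Rinv_l by lra.
      replace ((1 - / INR K) * INR K) with (INR K - 1) by (field; lra); lra. }
  assert (Hi0 : 0 < / INR K) by (apply Rinv_0_lt_compat, HK).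
  assert (Ef : frac_part t = t).
  { rewrite frac_part_floor, (Zfloor_eq 0); simpl; lra. }
  apply Cmod_gt_0; eapply Rlt_le_trans; [|apply (expi_minus_1_lower_frac t (/ INR K))]; [lra|].
  rewrite Ef; exact Ht.
Qed.

(** For i < j the sum is a geometric progression whose ratio is a nontrivial K-th root of unity; j <
    i follows by conjugation. *)
Lemma orthogonality (K j i : nat) : (j < K)%nat -> (i < K)%nat ->
  csum (fun a => expi ((INR j - INR i) * (INR a / INR K))) K
  = if Nat.eq_dec j i then RtoC (INR K) else RtoC 0.
Proof.
  intros Hj Hi.
  assert (HK : 0 < INR K) by (apply lt_0_INR; lia).
  assert (Hlt : forall j i, (j < K)%nat -> (i < j)%nat ->
    csum (fun a => expi ((INR j - INR i) * (INR a / INR K))) K = RtoC 0).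
  { clear j i Hj Hi; intros j i Hj Hi.
    assert (G := dirichlet_geometric K ((INR j - INR i) / INR K)).
    replace (INR K * ((INR j - INR i) / INR K)) with (INR j - INR i) in G by (field; lra).
    rewrite <- minus_INR, expi_nat in G by lia.
    replace (RtoC 1 - 1)%C with (RtoC 0) in G by ring.
    rewrite minus_INR in G by lia.
    assert (N := expi_neq_1 K j i Hj Hi).
    rewrite (csum_ext _ (fun a => expi (INR a * ((INR j - INR i) / INR K)))).
    2:{ intros a _; f_equal; field; lra. }
    fold (dirichlet K ((INR j - INR i) / INR K)).
    set (D := dirichlet _ _) in *. set (e := (expi _ - 1)%C) in *.
    replace D with (D * e / e)%C by (field; exact N).
    rewrite G; field; exact N. }
  destruct (Nat.eq_dec j i) as [->|Hn].
  - rewrite (csum_ext _ (fun _ => RtoC 1)).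
    + rewrite csum_const; ring.
    + intros a _; rewrite Rminus_diag, Rmult_0_l; apply expi_0.
  - destruct (lt_dec i j) as [Hl|Hl]; [apply Hlt; assumption|].
    rewrite <- (Cconj_conj (csum _ K)), csum_conj.
    rewrite (csum_ext _ (fun a => expi ((INR i - INR j) * (INR a / INR K)))).
    + rewrite Hlt by lia; apply injective_projections; simpl; ring.
    + intros a _; rewrite expi_conj; f_equal; ring.
Qed.

(** Fejer's kernel, normalised so that its translates by a/K, 0 <= a < K, form a partition of
    unity. *)
Definition fejer (K : nat) (t : R) : R := Cmod (dirichlet K t) ^ 2 / (INR K * INR K).

Lemma fejer_nonneg (K : nat) (t : R) : (1 <= K)%nat -> 0 <= fejer K t.
Proof.
  intro HK; assert (0 < INR K) by (apply lt_0_INR; lia).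
  apply Rdiv_le_0_compat; [apply pow_le, Cmod_ge_0 | nra].
Qed.

(** After the square is expanded, summation over a first leaves only the diagonal by
    [orthogonality]: K terms equal to K. *)
Lemma fejer_partition (K : nat) (x : R) : (1 <= K)%nat ->
  rsum (fun a => fejer K (x - INR a / INR K)) K = 1.
Proof.
  intro HK; assert (HKp : 0 < INR K) by (apply lt_0_INR; lia).
  assert (E : rsum (fun a => Cmod (dirichlet K (x - INR a / INR K)) ^ 2) K = INR K * INR K).
  { apply RtoC_inj; rewrite <- csum_RtoC.
    rewrite (csum_ext _ (fun a => csum (fun j => csum (fun i => expi ((INR j - INR i) * (x - INR a / INR K))) K) K)).
    2:{ intros a _; apply dirichlet_square. }
    rewrite csum_exchange.
    rewrite (csum_ext _ (fun j => RtoC (INR K))).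
    { rewrite csum_const, RtoC_mult; reflexivity. }
    intros j Hj; rewrite csum_exchange.
    rewrite (csum_ext _ (fun i => if Nat.eq_dec j i then RtoC (INR K) else RtoC 0)).
    { apply csum_delta, Hj. }
    intros i Hi.
    rewrite (csum_ext _ (fun a => expi ((INR j - INR i) * x) * expi ((INR i - INR j) * (INR a / INR K)))%C).
    2:{ intros a _; rewrite <- expi_plus; f_equal; ring. }
    rewrite csum_scal, orthogonality by assumption.
    destruct (Nat.eq_dec i j) as [->|Hn].
    - destruct (Nat.eq_dec j j); [|congruence].
      rewrite Rminus_diag, Rmult_0_l, expi_0; ring.
    - destruct (Nat.eq_dec j i); [congruence | ring]. }
  unfold fejer, Rdiv at 1.
  rewrite (rsum_ext _ (fun a => / (INR K * INR K) * Cmod (dirichlet K (x - INR a / INR K)) ^ 2)).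
  2:{ intros a _; ring. }
  rewrite rsum_scal, E; field; lra.
Qed.

(** In the expanded square the diagonal gives the mean n/K, and the terms off it are exponential
    sums of frequency j - i with 1 <= |j - i| < K, each bounded by E. *)
Lemma fejer_mean (K n : nat) (y : nat -> R) (E c : R) : (1 <= K)%nat -> 0 <= E ->
  (forall k, (1 <= k < K)%nat -> Cmod (csum (fun m => expi (INR k * y m)) n) <= E) ->
  Rabs (rsum (fun m => fejer K (y m - c)) n - INR n / INR K) <= E.
Proof.
  intros HK HE H; assert (HKp : 0 < INR K) by (apply lt_0_INR; lia).
  set (s := rsum (fun m => Cmod (dirichlet K (y m - c)) ^ 2) n).
  assert (Es : RtoC s = csum (fun j => csum (fun i => csum (fun m => expi ((INR j - INR i) * (y m - c))) n) K) K).
  { unfold s; rewrite <- csum_RtoC.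
    rewrite (csum_ext _ (fun m => csum (fun j => csum (fun i => expi ((INR j - INR i) * (y m - c))) K) K)).
    2:{ intros m _; apply dirichlet_square. }
    rewrite csum_exchange; apply csum_ext; intros j _; apply csum_exchange. }
  assert (B : Rabs (s - INR K * INR n) <= INR K * INR K * E).
  { rewrite <- Cmod_R, RtoC_minus, Es.
    replace (csum _ K - RtoC (INR K * INR n))%C with
      (csum (fun j => csum (fun i => csum (fun m => expi ((INR j - INR i) * (y m - c))) n
         - (if Nat.eq_dec j i then RtoC (INR n) else RtoC 0))%C K) K).
    - rewrite Rmult_assoc, <- rsum_const; apply csum_Cmod; intros j Hj.
      rewrite <- rsum_const; apply csum_Cmod; intros i Hi.
      assert (Hlt : forall j i, (j < K)%nat -> (i < j)%nat ->
        Cmod (csum (fun m => expi ((INR j - INR i) * (y m - c))) n) <= E).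
      { clear j i Hj Hi; intros j i Hj Hi.
        rewrite (csum_ext _ (fun m => expi (- ((INR j - INR i) * c)) * expi (INR (j - i) * y m))%C).
        2:{ intros m _; rewrite <- expi_plus, minus_INR by lia; f_equal; ring. }
        rewrite csum_scal, Cmod_mult, Cmod_expi, Rmult_1_l; apply H; lia. }
      destruct (Nat.eq_dec j i) as [->|Hn].
      + rewrite (csum_ext _ (fun _ => RtoC 1)).
        * rewrite csum_const.
          replace (RtoC (INR n) * 1 - RtoC (INR n))%C with (RtoC 0) by ring.
          rewrite Cmod_0; exact HE.
        * intros m _; rewrite Rminus_diag, Rmult_0_l; apply expi_0.
      + replace (csum (fun m => expi ((INR j - INR i) * (y m - c))) n - RtoC 0)%C
          with (csum (fun m => expi ((INR j - INR i) * (y m - c))) n) by ring.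
        destruct (lt_dec i j) as [Hl|Hl]; [apply Hlt; assumption|].
        rewrite <- Cmod_conj, csum_conj.
        rewrite (csum_ext _ (fun m => expi ((INR i - INR j) * (y m - c)))); [apply Hlt; lia|].
        intros m _; rewrite expi_conj; f_equal; ring.
    - rewrite RtoC_mult, <- csum_const.
      unfold Cminus at 2.
      replace (- csum (fun _ => RtoC (INR n)) K)%C with (-RtoC 1 * csum (fun _ => RtoC (INR n)) K)%C by ring.
      rewrite <- csum_scal, <- csum_plus; apply csum_ext; intros j Hj.
      transitivity (csum (fun i => csum (fun m => expi ((INR j - INR i) * (y m - c))) n) K
        + - RtoC 1 * csum (fun i => if Nat.eq_dec j i then RtoC (INR n) else RtoC 0) K)%C.
      + rewrite <- csum_scal, <- csum_plus; apply csum_ext; intros i _; ring.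
      + rewrite csum_delta by exact Hj; reflexivity. }
  unfold fejer, Rdiv at 1.
  rewrite (rsum_ext _ (fun m => / (INR K * INR K) * Cmod (dirichlet K (y m - c)) ^ 2)).
  2:{ intros a _; ring. }
  rewrite rsum_scal; fold s.
  replace (/ (INR K * INR K) * s - INR n / INR K) with (/ (INR K * INR K) * (s - INR K * INR n)) by (field; lra).
  rewrite Rabs_mult, Rabs_pos_eq by (apply Rlt_le, Rinv_0_lt_compat; nra).
  apply (Rmult_le_compat_l (/ (INR K * INR K))) in B; [|apply Rlt_le, Rinv_0_lt_compat; nra].
  eapply Rle_trans; [exact B|]; right; field; lra.
Qed.

Lemma fejer_far (K : nat) (t d : R) : (1 <= K)%nat -> 0 < d -> d <= frac_part t <= 1 - d ->
  fejer K t <= / (d * d * (INR K * INR K)).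
Proof.
  intros HK Hd Ht; assert (HKp : 0 < INR K) by (apply lt_0_INR; lia).
  assert (B := dirichlet_bound K t d Hd Ht).
  assert (M := Cmod_ge_0 (dirichlet K t)).
  unfold fejer.
  replace (/ (d * d * (INR K * INR K))) with (/ d * / d / (INR K * INR K)) by (field; lra).
  apply Rmult_le_compat_r; [apply Rlt_le, Rinv_0_lt_compat; nra|].
  simpl; rewrite Rmult_1_r; apply Rmult_le_compat; assumption.
Qed.

Lemma grid_near (x a d : R) : frac_part (x - a) < d \/ 1 - d < frac_part (x - a) ->
  exists z : Z, Rabs (x - (a + IZR z)) < d.
Proof.
  assert (F := frac_part_bounds (x - a)).
  intros [H|H].
  - exists (Zfloor (x - a)); rewrite frac_part_floor in *; apply Rabs_def1; lra.
  - exists (Zfloor (x - a) + 1)%Z; rewrite frac_part_floor in *; rewrite plus_IZR; apply Rabs_def1; lra.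
Qed.

(* The sawtooth never rises faster than with slope 1, so an average of it near x lies
   between its values at x + d and x - d up to 2 d. *)
Lemma fejer_B1_pointwise (K : nat) (x d : R) : (1 <= K)%nat -> 0 < d ->
  rsum (fun a => fejer K (x - INR a / INR K) * B1 (INR a / INR K)) K
    <= B1 (x - d) + 2 * d + / (d * d * INR K) /\
  B1 (x + d) - 2 * d - / (d * d * INR K)
    <= rsum (fun a => fejer K (x - INR a / INR K) * B1 (INR a / INR K)) K.
Proof.
  intros HK Hd; assert (HKp : 0 < INR K) by (apply lt_0_INR; lia).
  set (w := fun a => fejer K (x - INR a / INR K)).
  assert (Hw : rsum w K = 1) by (apply fejer_partition, HK).
  set (tau := / (d * d * (INR K * INR K))).
  assert (Htau : INR K * tau = / (d * d * INR K)) by (unfold tau; field; lra).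
  assert (Ht0 : 0 <= tau) by (unfold tau; apply Rlt_le, Rinv_0_lt_compat; repeat apply Rmult_lt_0_compat; assumption).
  assert (P : forall a, w a * B1 (INR a / INR K) <= (B1 (x - d) + 2 * d) * w a + tau /\
    (B1 (x + d) - 2 * d) * w a - tau <= w a * B1 (INR a / INR K)).
  (* If a/K is within d of x modulo 1, compare [B1] there with its values at x - d and x + d;
     otherwise the weight itself is at most tau. *)
  { intro a; assert (Hwa : 0 <= w a) by (apply fejer_nonneg, HK).
    set (g := INR a / INR K) in *.
    destruct (Rlt_dec (frac_part (x - g)) d) as [Hn|Hf1];
      [|destruct (Rlt_dec (1 - d) (frac_part (x - g))) as [Hn|Hf2]].
    1,2: destruct (grid_near x g d ltac:(auto)) as [z Hz];
      apply Rabs_def2 in Hz;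
      assert (U := B1_plus_le (x - d) (g + IZR z - (x - d)) ltac:(lra));
      assert (L := B1_plus_le (g + IZR z) (x + d - (g + IZR z)) ltac:(lra));
      replace (x - d + (g + IZR z - (x - d))) with (g + IZR z) in U by ring;
      replace (g + IZR z + (x + d - (g + IZR z))) with (x + d) in L by ring;
      rewrite B1_add_Z in U, L; split; nra.
    assert (Hfar : w a <= tau) by (apply fejer_far; [exact HK | exact Hd | fold g; lra]).
    assert (b1 := B1_bounds g). assert (b2 := B1_bounds (x - d)). assert (b3 := B1_bounds (x + d)).
    split; nra. }
  split.
  - eapply Rle_trans; [apply (rsum_le _ (fun a => (B1 (x - d) + 2 * d) * w a + tau)); intros; apply P|].
    rewrite rsum_plus, rsum_scal, rsum_const, Hw, Htau; lra.
  - eapply Rle_trans; [|apply (rsum_le (fun a => (B1 (x + d) - 2 * d) * w a + - tau))].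
    + rewrite rsum_plus, rsum_scal, rsum_const, Hw; lra.
    + intros a _; apply P.
Qed.

(** The sum is not 0 because the sawtooth takes the value -1/2 at the grid point 0; this produces
    the term n/(2K) in [B1_sum_bound]. *)
Lemma B1_grid_sum (K : nat) : (1 <= K)%nat -> rsum (fun a => B1 (INR a / INR K)) K = - (1 / 2).
Proof.
  intro HK; assert (HKp : 0 < INR K) by (apply lt_0_INR; lia).
  rewrite (rsum_ext _ (fun a => / INR K * INR a + - (1 / 2))).
  - rewrite rsum_plus, rsum_scal, rsum_const.
    assert (E : forall n, rsum INR n = INR n * (INR n - 1) / 2).
    { induction n as [|n IH]; [simpl; field|].
      change (rsum INR n + INR n = INR (S n) * (INR (S n) - 1) / 2); rewrite IH, S_INR; field. }
    rewrite E; field; lra.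
  - intros a Ha; unfold B1; rewrite frac_part_floor, (Zfloor_eq 0).
    + simpl; field; lra.
    + assert (INR a < INR K) by (apply lt_INR, Ha).
      simpl; split; [apply Rdiv_le_0_compat; [apply pos_INR | exact HKp]|].
      apply Rlt_div_l; lra.
Qed.

Lemma rsum_exchange (a : nat -> nat -> R) (n m : nat) :
  rsum (fun i => rsum (a i) m) n = rsum (fun j => rsum (fun i => a i j) n) m.
Proof.
  induction n as [|n IH]; simpl.
  - rewrite rsum_const; ring.
  - rewrite IH, <- rsum_plus; reflexivity.
Qed.

(** With d = 1/L, the choice K = L^4 makes the tail 1/(d^2 K) equal to d^2. The averages of the
    sawtooth about y m + d and y m - d bound B1 (y m) from below and above, and their sums over m
    are controlled by [fejer_mean]. *)
Lemma B1_sum_bound (y : nat -> R) (n L : nat) (E : R) : (1 <= L)%nat -> 0 <= E ->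
  (forall k, (1 <= k < L ^ 4)%nat -> Cmod (csum (fun m => expi (INR k * y m)) n) <= E) ->
  Rabs (rsum (fun m => B1 (y m)) n) <= 4 * INR n / INR L + INR (L ^ 4) * E.
Proof.
  intros HL HE H.
  set (K := (L ^ 4)%nat) in *.
  assert (HK : (1 <= K)%nat).
  { unfold K; assert (L ^ 4 <> 0)%nat by (apply Nat.pow_nonzero; lia); lia. }
  assert (HKp : 0 < INR K) by (apply lt_0_INR; lia).
  assert (HLp : 0 < INR L) by (apply lt_0_INR; lia).
  assert (HL1 : 1 <= INR L) by (apply (le_INR 1), HL).
  assert (Hn := pos_INR n).
  assert (EK : INR K = INR L * INR L * (INR L * INR L)) by (unfold K; rewrite pow_INR; ring).
  set (d := / INR L). assert (Hd : 0 < d) by (apply Rinv_0_lt_compat, HLp).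
  assert (Hdd : / (d * d * INR K) = d * d).
  { rewrite EK; unfold d; field; lra. }
  assert (Hd1 : d <= 1) by (unfold d; rewrite <- Rinv_1; apply Rinv_le_contravar; lra).
  assert (M : forall c, Rabs (rsum (fun m => rsum (fun a => fejer K (y m - c - INR a / INR K) * B1 (INR a / INR K)) K) n
     + INR n / (2 * INR K)) <= INR K * E / 2).
  { intro c; rewrite rsum_exchange.
    replace (INR n / (2 * INR K)) with (- (INR n / INR K * rsum (fun a => B1 (INR a / INR K)) K)).
    2:{ rewrite B1_grid_sum by exact HK; field; lra. }
    rewrite <- rsum_scal.
    replace (- rsum (fun a => INR n / INR K * B1 (INR a / INR K)) K)
      with (-1 * rsum (fun a => INR n / INR K * B1 (INR a / INR K)) K) by ring.
    rewrite <- rsum_scal, <- rsum_plus.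
    rewrite <- Cmod_R, <- csum_RtoC.
    replace (INR K * E / 2) with (INR K * (E / 2)) by field; rewrite <- rsum_const.
    apply csum_Cmod; intros a Ha; rewrite Cmod_R.
    assert (F := fejer_mean K n y E (c + INR a / INR K) HK HE H).
    rewrite (rsum_ext _ (fun m => B1 (INR a / INR K) * fejer K (y m - (c + INR a / INR K)))).
    2:{ intros m _; rewrite Rmult_comm; do 2 f_equal; ring. }
    rewrite rsum_scal.
    set (s := rsum _ n) in *.
    replace (B1 (INR a / INR K) * s + -1 * (INR n / INR K * B1 (INR a / INR K)))
      with (B1 (INR a / INR K) * (s - INR n / INR K)) by ring.
    rewrite Rabs_mult.
    assert (Rabs (B1 (INR a / INR K)) <= 1 / 2) by (apply Rabs_le, B1_bounds).
    generalize (Rabs_pos (B1 (INR a / INR K))), (Rabs_pos (s - INR n / INR K)); nra. }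
  assert (Hn2 : 0 <= INR n / (2 * INR K) <= INR n * d).
  { split; [apply Rdiv_le_0_compat; lra|].
    apply Rmult_le_compat_l; [exact Hn|]; unfold d; apply Rinv_le_contravar; [exact HLp|].
    rewrite EK; assert (INR L <= INR L * INR L) by nra.
    assert (INR L * 1 <= INR L * INR L * (INR L * INR L)) by (apply Rmult_le_compat; lra). lra. }
  replace (4 * INR n / INR L) with (4 * (INR n * d)) by (unfold d; field; lra).
  assert (Hdn : INR n * (d * d) <= INR n * d) by (apply Rmult_le_compat_l; [exact Hn | nra]).
  assert (HKE : 0 <= INR K * E) by (apply Rmult_le_pos; lra).
  apply Rabs_le; split.
  - assert (M1 := M (- d)); apply Rabs_le_between in M1.
    assert (rsum (fun m => rsum (fun a => fejer K (y m - - d - INR a / INR K) * B1 (INR a / INR K)) K) n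
      <= rsum (fun m => B1 (y m)) n + INR n * (2 * d + d * d)).
    { rewrite <- rsum_const, <- rsum_plus; apply rsum_le; intros m _.
      destruct (fejer_B1_pointwise K (y m - - d) d HK Hd) as [P _]; rewrite Hdd in P.
      replace (y m - - d - d) with (y m) in P by ring; lra. }
    lra.
  - assert (M1 := M d); apply Rabs_le_between in M1.
    assert (rsum (fun m => B1 (y m)) n + INR n * (- (2 * d + d * d)) <=
      rsum (fun m => rsum (fun a => fejer K (y m - d - INR a / INR K) * B1 (INR a / INR K)) K) n).
    { rewrite <- rsum_const, <- rsum_plus; apply rsum_le; intros m _.
      destruct (fejer_B1_pointwise K (y m - d) d HK Hd) as [_ P]; rewrite Hdd in P.
      replace (y m - d + d) with (y m) in P by ring; lra. }
    lra.
Qed.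

(** * The sawtooth along powers *)

Fixpoint rff (a : R) (k : nat) : R :=
  match k with O => 1 | S j => rff a j * (a - INR j) end.

Lemma rff_front (a : R) (k : nat) : rff a (S k) = a * rff (a - 1) k.
Proof.
  induction k as [|k IH]; [simpl; ring|].
  change (rff a (S k) * (a - INR (S k)) = a * (rff (a - 1) k * (a - 1 - INR k))).
  rewrite IH, S_INR; ring.
Qed.

Lemma rff_pos (a : R) (k : nat) : INR k - 1 < a -> 0 < rff a k.
Proof.
  induction k as [|k IH]; intro H; [simpl; lra|].
  rewrite S_INR in H; simpl; apply Rmult_lt_0_compat; [apply IH|]; lra.
Qed.

Fixpoint rfdiff (k : nat) (g : R -> R) (x : R) : R :=
  match k with O => g x | S j => rfdiff j g (x + 1) - rfdiff j g x end.

Lemma is_derive_Rpower (a x : R) : 0 < x -> is_derive (fun y => Rpower y a) x (a * Rpower x (a - 1)).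
Proof. intro Hx; apply is_derive_Reals, derivable_pt_lim_power, Hx. Qed.

Lemma rfdiff_derive (k : nat) (a x : R) : 0 < x ->
  is_derive (rfdiff k (fun y => Rpower y a)) x (a * rfdiff k (fun y => Rpower y (a - 1)) x).
Proof.
  revert x; induction k as [|k IH]; intros x Hx; [apply is_derive_Rpower, Hx|].
  simpl; rewrite Rmult_minus_distr_l.
  apply (is_derive_minus (V := R_NormedModule) (fun x => rfdiff k (fun y => Rpower y a) (x + 1))); [|apply IH, Hx].
  replace (a * rfdiff k (fun y => Rpower y (a - 1)) (x + 1)) with (1 * (a * rfdiff k (fun y => Rpower y (a - 1)) (x + 1))) by ring.
  apply (is_derive_comp (V := R_NormedModule) (rfdiff k (fun y => Rpower y a)) (fun x => x + 1)).
  - apply IH; lra.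
  - auto_derive; [exact I | ring].
Qed.

(** Mean value theorem for iterated differences. Differentiation commutes with differencing and
    lowers the exponent, so the induction proceeds at exponent a - 1. *)
Lemma rfdiff_Rpower (k : nat) : forall a x, 0 < x ->
  exists c, x <= c <= x + INR k /\ rfdiff k (fun y => Rpower y a) x = rff a k * Rpower c (a - INR k).
Proof.
  induction k as [|k IH]; intros a x Hx.
  - exists x; simpl; rewrite Rminus_0_r; split; lra.
  - destruct (MVT_gen (rfdiff k (fun y => Rpower y a)) x (x + 1) (fun t => a * rfdiff k (fun y => Rpower y (a - 1)) t))
      as [c [Hc E]].
    + rewrite Rmin_left by lra; intros t Ht; apply rfdiff_derive; lra.
    + rewrite Rmin_left by lra; intros t Ht.
      apply continuity_pt_filterlim, (ex_derive_continuous (V := R_NormedModule) (rfdiff k (fun y => Rpower y a))).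
      eexists; apply rfdiff_derive; lra.
    + rewrite Rmin_left, Rmax_right in Hc by lra.
      destruct (IH (a - 1) c) as [c' [Hc' E']]; [lra|].
      exists c'; rewrite S_INR; split; [lra|].
      change (rfdiff k (fun y => Rpower y a) (x + 1) - rfdiff k (fun y => Rpower y a) x
        = rff a (S k) * Rpower c' (a - (INR k + 1))).
      rewrite E, E', rff_front; replace (a - 1 - INR k) with (a - (INR k + 1)) by ring; ring.
Qed.

Lemma fdiff_rfdiff (k : nat) (h : R) (g : R -> R) (N m : nat) :
  fdiff k (fun m => h * g (INR (N + m))) m = h * rfdiff k g (INR (N + m)).
Proof.
  revert m; induction k as [|k IH]; intro m; simpl; [reflexivity|].
  rewrite !IH, Nat.add_succ_r, S_INR; ring.
Qed.

(** L is the integer part of N^(1/A); taking all parameters as powers of L keeps them natural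
    numbers. *)
Lemma integer_root (A N : nat) : (1 <= A)%nat -> (1 <= N)%nat ->
  exists L, (1 <= L)%nat /\ (L ^ A <= N)%nat /\ (N < (L + 1) ^ A)%nat.
Proof.
  intros HA HN; induction N as [|N IH]; [lia|].
  destruct (Nat.eq_dec N 0) as [->|Hz].
  - exists 1%nat; rewrite Nat.pow_1_l; repeat split; try lia.
    change (1 + 1)%nat with 2%nat; assert (2 ^ 1 <= 2 ^ A)%nat by (apply Nat.pow_le_mono_r; lia).
    simpl in *; lia.
  - destruct IH as [L [H1 [H2 H3]]]; [lia|].
    destruct (lt_dec (S N) ((L + 1) ^ A)) as [Hl|Hl].
    + exists L; repeat split; lia.
    + exists (L + 1)%nat; repeat split; try lia.
      assert ((L + 1) ^ A < (L + 1 + 1) ^ A)%nat by (apply Nat.pow_lt_mono_l; lia). lia.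
Qed.

Lemma root_power (A L N p : nat) (t : R) : (1 <= L)%nat -> (L ^ A <= N)%nat -> 0 < t ->
  INR p <= INR A * t -> INR (L ^ p) <= Rpower (INR N) t.
Proof.
  intros HL HN Ht Hp.
  assert (HLp : 1 <= INR L) by (apply (le_INR 1), HL).
  assert (HA : 0 < INR (L ^ A)) by (rewrite pow_INR; apply pow_lt; lra).
  apply Rle_trans with (Rpower (INR (L ^ A)) t).
  - rewrite !pow_INR, <- !Rpower_pow by lra.
    rewrite Rpower_mult; apply Rpower_le_exp; assumption.
  - apply Rle_Rpower_l; [lra|]; split; [exact HA | apply le_INR, HN].
Qed.

(** The sawtooth attached to the ceiling of x = m^alpha: it lies in (-1/2, 1/2] and equals 1/2 when
    x is an integer. *)
Definition psi (alpha : R) (m : nat) : R :=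
  Rpower (INR m) alpha + 1 / 2 - IZR (Zceil (Rpower (INR m) alpha)).

Lemma psi_B1 (alpha : R) (m : nat) : psi alpha m = - B1 (- Rpower (INR m) alpha).
Proof. unfold psi, B1; rewrite frac_part_floor, ZfloorN, opp_IZR; ring. Qed.

Lemma psi_bound (alpha : R) (m : nat) : Rabs (psi alpha m) <= 1 / 2.
Proof. rewrite psi_B1, Rabs_Ropp; apply Rabs_le, B1_bounds. Qed.

Section Block.
Variables (alpha : R) (k : nat).
Hypotheses (Hk : INR k < alpha < INR (S k)).
(** The difference of order k+1 of x^alpha is c y^(-theta) for some y near x, with 0 < theta < 1; q
    is the exponent with H = L^q in [block_exponential]. *)
Let theta := INR (S k) - alpha.
Let c := rff alpha (S k).
Let q := (8 * 2 ^ k)%nat.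

(* Since L^A <= N, the hypotheses on A let N^theta and N^(1-theta) absorb all powers of L. *)
Lemma block_exponential (A L N n h : nat) :
  INR (5 + q * (k + 2)) <= INR A * theta -> INR (5 + q * (k + 2)) <= INR A * (1 - theta) ->
  (1 <= L)%nat -> (k + 1 <= L)%nat -> 2 * c <= INR L -> 5 <= c * INR L ->
  (L ^ A <= N)%nat -> (n <= N)%nat -> (1 <= h < L ^ 4)%nat ->
  Cmod (csum (fun m => expi (INR h * Rpower (INR (N + m)) alpha)) n) <= 6 * INR N / INR (L ^ 8).
Proof.
  intros HA1 HA2 HL HLk HLc HLc5 HN Hn Hh.
  assert (Hth : 0 < theta < 1) by (unfold theta; rewrite S_INR in *; lra).
  assert (Hc : 0 < c) by (apply rff_pos; rewrite S_INR; lra).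
  assert (HL1 : 1 <= INR L) by (apply (le_INR 1), HL).
  assert (HA : (5 + q * (k + 2) <= A)%nat).
  { apply INR_le; generalize (pos_INR A); nra. }
  assert (HLp : forall p r, (p <= r)%nat -> (L ^ p <= L ^ r)%nat) by (intros; apply Nat.pow_le_mono_r; lia).
  set (H := ((L ^ 8) ^ (2 ^ k))%nat).
  assert (EH : H = (L ^ q)%nat) by (unfold H, q; rewrite <- Nat.pow_mul_r; reflexivity).
  assert (Hq : (8 <= q)%nat).
  { unfold q; assert (2 ^ k <> 0)%nat by (apply Nat.pow_nonzero; lia); lia. }
  assert (HN1 : (1 <= N)%nat) by (specialize (HLp 0%nat A ltac:(lia)); simpl in HLp; lia).
  assert (HkH : ((k + 1) * H <= N)%nat).
  { rewrite EH; apply Nat.le_trans with (L * L ^ q)%nat; [apply Nat.mul_le_mono_r, HLk|].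
    rewrite <- Nat.pow_succ_r'; specialize (HLp (S q) A ltac:(nia)); lia. }
  assert (HkN : (k + 1 <= N)%nat).
  { specialize (HLp 0%nat q ltac:(lia)); simpl in HLp; nia. }
  assert (HNp : 0 < INR N) by (apply lt_0_INR; lia).
  assert (Ex : forall j m, exists x, INR (N + m) <= x <= INR (N + m) + INR j /\
     fdiff j (fun m => INR h * Rpower (INR (N + m)) alpha) m = INR h * (rff alpha j * Rpower x (alpha - INR j))).
  { intros j m; destruct (rfdiff_Rpower j alpha (INR (N + m))) as [x [Hx E]].
    { apply lt_0_INR; lia. }
    exists x; split; [exact Hx|].
    rewrite (fdiff_rfdiff j (INR h) (fun y => Rpower y alpha)), E; reflexivity. }
  assert (Hh1 : 1 <= INR h) by (apply (le_INR 1); lia).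
  (* The intermediate points met below lie between N and 5N, because m < 3N and k + 1 <= N. *)
  set (lam := c * Rpower (5 * INR N) (- theta)).
  assert (Hlam : 0 < lam) by (apply Rmult_lt_0_compat; [exact Hc | apply Rpower_pos]).
  apply (weyl k (fun m => INR h * Rpower (INR (N + m)) alpha) (L ^ 8) N n (3 * N) lam); fold H.
  - specialize (HLp 0%nat 8%nat ltac:(lia)); simpl in HLp; simpl; lia.
  - exact Hn.
  - lia.
  - exact Hlam.
  - unfold lam; rewrite <- Rpower_mult_distr by lra.
    assert (G : INR (L ^ (S q)) <= Rpower (INR N) (1 - theta)).
    { apply (root_power A); try assumption; [lra|].
      eapply Rle_trans; [|exact HA2]; apply le_INR; nia. }
    assert (E5 : / 5 <= Rpower 5 (- theta)).
    { rewrite <- (Rpower_1 5) at 1 by lra; rewrite <- Rpower_Ropp; apply Rpower_le_exp; lra. }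
    replace (c * (Rpower 5 (- theta) * Rpower (INR N) (- theta)) * INR N)
      with (c * Rpower 5 (- theta) * Rpower (INR N) (1 - theta)).
    2:{ replace (1 - theta) with (- theta + 1) by ring; rewrite Rpower_plus, Rpower_1 by exact HNp; ring. }
    rewrite Nat.pow_succ_r', mult_INR in G; rewrite EH.
    assert (0 <= INR (L ^ q)) by apply pos_INR.
    apply Rle_trans with (c * / 5 * (INR L * INR (L ^ q))); [nra|].
    apply Rmult_le_compat; [nra | nra | nra | exact G].
  - rewrite EH, <- Nat.pow_add_r; specialize (HLp (q + q)%nat A ltac:(nia)); lia.
  - intros m Hm.
    destruct (Ex (S k) m) as [x [Hx E]]. rewrite E.
    replace (alpha - INR (S k)) with (- theta) by (unfold theta; ring).
    fold c.
    assert (HxN : INR N <= x <= 5 * INR N).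
    { rewrite plus_INR in Hx; assert (0 <= INR m) by apply pos_INR; split; [lra|].
      assert (INR (S k) <= INR N) by (apply le_INR; lia).
      assert (INR m <= 3 * INR N) by (replace 3 with (INR 3) by (simpl; ring); rewrite <- mult_INR; apply le_INR; lia).
      lra. }
    assert (Hpw : Rpower (5 * INR N) (- theta) <= Rpower x (- theta) <= Rpower (INR N) (- theta)).
    { rewrite !Rpower_Ropp; split; apply Rinv_le_contravar; try apply Rpower_pos; apply Rle_Rpower_l; lra. }
    assert (Hxp : 0 < Rpower x (- theta)) by apply Rpower_pos.
    assert (Hcp : 0 < c * Rpower x (- theta)) by (apply Rmult_lt_0_compat; assumption).
    repeat split.
    + unfold lam; apply Rle_trans with (c * Rpower x (- theta)); [apply Rmult_le_compat_l; lra | nra].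
    + assert (G : INR (L ^ (5 + q * k)) <= Rpower (INR N) theta).
      { apply (root_power A); try assumption; [lra|].
        eapply Rle_trans; [|exact HA1]; apply le_INR; nia. }
      assert (Hh4 : INR h <= INR (L ^ 4)) by (apply le_INR; lia).
      rewrite <- pow_INR, EH, <- Nat.pow_mul_r.
      assert (HG0 : 0 < INR (L ^ (5 + q * k))) by (rewrite pow_INR; apply pow_lt; lra).
      assert (Hpi : Rpower x (- theta) <= / INR (L ^ (5 + q * k))).
      { eapply Rle_trans; [apply Hpw|]; rewrite Rpower_Ropp; apply Rinv_le_contravar; assumption. }
      apply Rle_trans with (INR (L ^ 4) * (c * / INR (L ^ (5 + q * k))) * INR (L ^ (q * k))).
      * apply Rmult_le_compat_r; [apply pos_INR|].
        apply Rmult_le_compat; [lra | lra | exact Hh4 | apply Rmult_le_compat_l; lra].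
      * replace (5 + q * k)%nat with (1 + (4 + q * k))%nat by lia.
        rewrite (Nat.pow_add_r L 1 (4 + q * k)), (Nat.pow_add_r L 4 (q * k)), !mult_INR, Nat.pow_1_r.
        assert (0 < INR (L ^ 4)) by (rewrite pow_INR; apply pow_lt; lra).
        assert (0 < INR (L ^ (q * k))) by (rewrite pow_INR; apply pow_lt; lra).
        replace (INR (L ^ 4) * (c * / (INR L * (INR (L ^ 4) * INR (L ^ (q * k))))) * INR (L ^ (q * k)))
          with (c / INR L) by (field; lra).
        apply Rle_div_l; lra.
    (* The difference of order k+2 carries the factor alpha - (k+1) = -theta < 0, so the one of
       order k+1 decreases. *)
    + destruct (Ex (S (S k)) m) as [y [Hy E2]].
      assert (Es : forall f j m, fdiff (S j) f m = fdiff j f (S m) - fdiff j f m) by reflexivity.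
      rewrite Es, E in E2.
      replace (alpha - INR (S k)) with (- theta) in E2 by (unfold theta; ring).
      fold c in E2.
      assert (R2 : rff alpha (S (S k)) = c * - theta) by (unfold c, theta; change (rff alpha (S (S k))) with (rff alpha (S k) * (alpha - INR (S k))); ring).
      rewrite R2 in E2.
      assert (Yp : 0 < Rpower y (alpha - INR (S (S k)))) by apply Rpower_pos.
      assert (0 <= c * theta * Rpower y (alpha - INR (S (S k)))).
      { apply Rmult_le_pos; [apply Rmult_le_pos; lra | lra]. }
      assert (0 <= INR h * (c * theta * Rpower y (alpha - INR (S (S k))))) by (apply Rmult_le_pos; lra).
      lra.
Qed.

(** [B1_sum_bound] with L the integer part of N^(1/A) saves a factor L, hence d = 1/A; its two terms
    contribute 8 X and 12 X, which gives the 20. For L below the threshold L0 the trivial bound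
    suffices, as N <= 2 L X; this accounts for 2 L0. *)
Lemma block_psi : exists C d, 0 < d <= 1 / 2 /\ 0 <= C /\ forall N n, (1 <= N)%nat -> (n <= N)%nat ->
  Rabs (rsum (fun m => psi alpha (N + m)) n) <= C * Rpower (INR N) (1 - d).
Proof.
  assert (Hth : 0 < theta < 1) by (unfold theta; rewrite S_INR in *; lra).
  assert (Hc : 0 < c) by (apply rff_pos; rewrite S_INR; lra).
  set (P := INR (5 + q * (k + 2))).
  assert (HP : 0 <= P) by apply pos_INR.
  (* Exceeding the sum, A exceeds each quotient, so it satisfies both hypotheses of
     [block_exponential]. *)
  destruct (INR_unbounded (P / theta + P / (1 - theta))) as [A HA].
  assert (Q1 : 0 <= P / theta) by (apply Rdiv_le_0_compat; lra).
  assert (Q2 : 0 <= P / (1 - theta)) by (apply Rdiv_le_0_compat; lra).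
  assert (HA1 : P <= INR A * theta).
  { apply Rle_trans with (P / theta * theta); [right; field; lra | nra]. }
  assert (HA2 : P <= INR A * (1 - theta)).
  { apply Rle_trans with (P / (1 - theta) * (1 - theta)); [right; field; lra | nra]. }
  assert (HAn : (5 <= A)%nat).
  { apply INR_le; apply Rle_trans with P; [apply le_INR; lia | nra]. }
  assert (HAp : 0 < INR A) by (apply lt_0_INR; lia).
  destruct (INR_unbounded (2 * c + 5 / c)) as [L1 HL1].
  set (L0 := (L1 + k + 1)%nat).
  exists (20 + 2 * INR L0), (/ INR A); split; [|split].
  - split; [apply Rinv_0_lt_compat, HAp|].
    replace (1 / 2) with (/ 2) by field; apply Rinv_le_contravar; [lra|].
    apply (le_INR 2); lia.
  - generalize (pos_INR L0); lra.
  - intros N n HN Hn.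
    destruct (integer_root A N) as [L [HL [HLN HNL]]]; [lia | exact HN|].
    assert (HNp : 0 < INR N) by (apply lt_0_INR; lia).
    assert (HLp : 1 <= INR L) by (apply (le_INR 1), HL).
    assert (HnN : INR n <= INR N) by (apply le_INR, Hn).
    set (X := Rpower (INR N) (1 - / INR A)).
    assert (HX : 0 < X) by apply Rpower_pos.
    assert (HNX : INR N <= X * (2 * INR L)).
    { replace (INR N) with (X * Rpower (INR N) (/ INR A)).
      2:{ unfold X; rewrite <- Rpower_plus; replace (1 - / INR A + / INR A) with 1 by ring.
          apply Rpower_1, HNp. }
      apply Rmult_le_compat_l; [lra|].
      apply Rle_trans with (Rpower (Rpower (2 * INR L) (INR A)) (/ INR A)).
      - apply Rle_Rpower_l; [apply Rlt_le, Rinv_0_lt_compat, HAp|].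
        split; [exact HNp|].
        rewrite Rpower_pow by lra.
        apply Rle_trans with (INR ((L + 1) ^ A)); [apply le_INR; lia|].
        rewrite pow_INR; apply pow_incr; rewrite plus_INR; simpl; lra.
      - rewrite Rpower_mult, Rinv_r, Rpower_1 by lra; lra. }
    destruct (le_lt_dec L0 L) as [Hbig|Hsmall].
    + assert (HL0 : INR L0 <= INR L) by (apply le_INR, Hbig).
      assert (HL01 : INR L1 <= INR L) by (apply le_INR; unfold L0 in Hbig; lia).
      assert (C5 : 0 < 5 / c) by (apply Rdiv_lt_0_compat; lra).
      set (E := 6 * INR N / INR (L ^ 8)).
      assert (Hpw : forall p, 0 < INR (L ^ p)) by (intro p; rewrite pow_INR; apply pow_lt; lra).
      assert (HE : 0 <= E) by (apply Rdiv_le_0_compat; [lra | apply Hpw]).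
      assert (B := B1_sum_bound (fun m => - Rpower (INR (N + m)) alpha) n L E HL HE).
      assert (E1 : rsum (fun m => psi alpha (N + m)) n = - rsum (fun m => B1 (- Rpower (INR (N + m)) alpha)) n).
      { replace (- rsum (fun m => B1 (- Rpower (INR (N + m)) alpha)) n)
          with (-1 * rsum (fun m => B1 (- Rpower (INR (N + m)) alpha)) n) by ring.
        rewrite <- rsum_scal; apply rsum_ext; intros m _; rewrite psi_B1; ring. }
      rewrite E1, Rabs_Ropp.
      eapply Rle_trans; [apply B|].
      * intros h Hh.
        rewrite <- Cmod_conj, csum_conj.
        rewrite (csum_ext _ (fun m => expi (INR h * Rpower (INR (N + m)) alpha))).
        2:{ intros m _; rewrite expi_conj; f_equal; ring. }
        apply (block_exponential A); try assumption.
        -- unfold L0 in Hbig; lia.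
        -- lra.
        -- apply Rle_trans with (c * (5 / c)); [right; field; lra | apply Rmult_le_compat_l; lra].
      * assert (T1 : 4 * INR n / INR L <= 8 * X).
        { apply Rle_div_l; lra. }
        assert (T2 : INR (L ^ 4) * E <= 12 * X).
        { unfold E; change 8%nat with (4 + 4)%nat; rewrite Nat.pow_add_r, mult_INR.
          replace (INR (L ^ 4) * (6 * INR N / (INR (L ^ 4) * INR (L ^ 4)))) with (6 * INR N / INR (L ^ 4)).
          2:{ specialize (Hpw 4%nat); field; lra. }
          apply Rle_div_l; [apply Hpw|].
          assert (INR L <= INR (L ^ 4)).
          { rewrite <- (Nat.pow_1_r L) at 1; apply le_INR, Nat.pow_le_mono_r; lia. }
          nra. }
        generalize (pos_INR L0); nra.
    + assert (HL0 : INR L <= INR L0) by (apply le_INR; lia).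
      apply Rle_trans with (INR n * (1 / 2)).
      * rewrite <- rsum_const, <- Cmod_R, <- csum_RtoC.
        apply csum_Cmod; intros m _; rewrite Cmod_R; apply psi_bound.
      * nra.
Qed.
End Block.

Lemma rsum_add (a : nat -> R) (n m : nat) :
  rsum a (n + m) = rsum a n + rsum (fun k => a (n + k)%nat) m.
Proof.
  induction m as [|m IH]; [rewrite Nat.add_0_r; simpl; ring|].
  rewrite Nat.add_succ_r; simpl; rewrite IH; ring.
Qed.

(** Halving induction. Since d <= 1/2, passing from M to M/2 multiplies the bound by at most
    2^(-1/2) <= 3/4, so the constant 4C reproduces itself as 3C + C. *)
Lemma psi_sum_from_1 (alpha : R) (k : nat) : INR k < alpha < INR (S k) ->
  exists C d, 0 < d <= 1 / 2 /\ 0 <= C /\ forall M,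
  Rabs (rsum (fun m => psi alpha (S m)) M) <= C * Rpower (INR M) (1 - d).
Proof.
  intro Hk; destruct (block_psi alpha k Hk) as [C [d [Hd [HC H]]]].
  exists (4 * C), d; split; [exact Hd|]; split; [lra|].
  induction M as [M IH] using lt_wf_ind.
  destruct (Nat.eq_dec M 0) as [->|HM].
  { simpl; rewrite Rabs_R0; apply Rmult_le_pos; [lra | apply Rlt_le, Rpower_pos]. }
  set (N := (M / 2)%nat).
  assert (HN : (2 * N <= M < 2 * N + 2)%nat).
  { unfold N; generalize (Nat.div_mod_eq M 2), (Nat.mod_upper_bound M 2); lia. }
  assert (HMp : 0 < INR M) by (apply lt_0_INR; lia).
  assert (E : rsum (fun m => psi alpha (S m)) M =
    rsum (fun m => psi alpha (S m)) N + rsum (fun m => psi alpha (S N + m)) (M - N)).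
  { assert (E := rsum_add (fun m => psi alpha (S m)) N (M - N)).
    replace (N + (M - N))%nat with M in E by lia; exact E. }
  assert (B := H (S N) (M - N)%nat ltac:(lia) ltac:(lia)).
  assert (B2 : Rpower (INR (S N)) (1 - d) <= Rpower (INR M) (1 - d)).
  { apply Rle_Rpower_l; [lra|]; split; [apply lt_0_INR; lia | apply le_INR; lia]. }
  assert (B3 : Rabs (rsum (fun m => psi alpha (S m)) N) <= 3 * C * Rpower (INR M) (1 - d)).
  { destruct (Nat.eq_dec N 0) as [HN0|HN0].
    - rewrite HN0; simpl; rewrite Rabs_R0; apply Rmult_le_pos; [lra | apply Rlt_le, Rpower_pos].
    - eapply Rle_trans; [apply IH; lia|].
      assert (HNp : 0 < INR N) by (apply lt_0_INR; lia).
      assert (HNM : 2 * INR N <= INR M).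
      { replace 2 with (INR 2) by (simpl; ring); rewrite <- mult_INR; apply le_INR; lia. }
      assert (B4 : Rpower 2 (1 / 2) * Rpower (INR N) (1 - d) <= Rpower (INR M) (1 - d)).
      { apply Rle_trans with (Rpower (2 * INR N) (1 - d)); [|apply Rle_Rpower_l; lra].
        rewrite <- Rpower_mult_distr by lra; apply Rmult_le_compat_r; [apply Rlt_le, Rpower_pos|].
        apply Rpower_le_exp; lra. }
      assert (S2 : 4 / 3 <= Rpower 2 (1 / 2)).
      { replace (1 / 2) with (/ 2) by field; rewrite Rpower_sqrt by lra.
        rewrite <- (sqrt_square (4 / 3)) by lra; apply sqrt_le_1_alt; lra. }
      assert (0 < Rpower (INR N) (1 - d)) by apply Rpower_pos.
      assert (B5 : 4 / 3 * Rpower (INR N) (1 - d) <= Rpower (INR M) (1 - d)) by nra.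
      apply (Rmult_le_compat_l C) in B5; [lra | exact HC]. }
  rewrite E; eapply Rle_trans; [apply Rabs_triang|].
  nra.
Qed.

Lemma psi_1 (alpha : R) : psi alpha 1 = 1 / 2.
Proof.
  unfold psi; simpl INR; rewrite Rpower_1_base, (Zceil_eq 1); simpl; lra.
Qed.

(** Starts at n = 2, like the sum obtained by partial summation; the term psi(1) = 1/2 is absorbed
    into the constant. *)
Lemma psi_sum (alpha : R) (k : nat) : INR k < alpha < INR (S k) ->
  exists C d, 0 < d <= 1 / 2 /\ 0 <= C /\ forall M,
  Rabs (rsum (fun m => psi alpha (S (S m))) M) <= C * Rpower (INR (S M)) (1 - d).
Proof.
  intro Hk; destruct (psi_sum_from_1 alpha k Hk) as [C [d [Hd [HC H]]]].
  exists (C + 1), d; split; [exact Hd|]; split; [lra|]; intro M.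
  assert (E : rsum (fun m => psi alpha (S m)) (S M) = 1 / 2 + rsum (fun m => psi alpha (S (S m))) M).
  { change (S M) with (1 + M)%nat; rewrite rsum_add; simpl; rewrite psi_1; ring. }
  specialize (H (S M)); rewrite E in H.
  assert (P : 1 <= Rpower (INR (S M)) (1 - d)).
  { rewrite <- (Rpower_1_base (1 - d)) at 1; apply Rle_Rpower_l; [lra|]; split; [lra | apply INR_S_ge_1]. }
  apply Rabs_le_between in H; apply Rabs_le; lra.
Qed.

(** * The Gamma function *)

Definition gamma_fun (x t : R) : R := Rpower t (x - 1) * exp (- t).

Lemma gamma_fun_cont (x t : R) : 0 < t -> continuous (gamma_fun x) t.
Proof.
  intro Ht; apply (ex_derive_continuous (V := R_NormedModule)).
  unfold gamma_fun, Rpower; auto_derive; exact Ht.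
Qed.

Lemma gamma_fun_pos (x t : R) : 0 < gamma_fun x t.
Proof. apply Rmult_lt_0_compat; apply exp_pos. Qed.

Lemma ex_RInt_gamma (x a b : R) : 0 < a -> 0 < b -> ex_RInt (gamma_fun x) a b.
Proof.
  intros Ha Hb; apply (ex_RInt_continuous (V := R_CompleteNormedModule)).
  intros t Ht; apply gamma_fun_cont; unfold Rmin in Ht; destruct (Rle_dec a b); lra.
Qed.

Lemma RInt_gamma_nonneg (x a b : R) : 0 < a -> a <= b -> 0 <= RInt (gamma_fun x) a b.
Proof.
  intros Ha Hab; apply RInt_ge_0; [exact Hab | apply ex_RInt_gamma; lra|].
  intros t _; apply Rlt_le, gamma_fun_pos.
Qed.

Lemma RInt_gamma_Chasles (x a b c : R) : 0 < a -> 0 < b -> 0 < c ->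
  RInt (gamma_fun x) a c = RInt (gamma_fun x) a b + RInt (gamma_fun x) b c.
Proof.
  intros Ha Hb Hc; symmetry; apply (RInt_Chasles (V := R_CompleteNormedModule) (gamma_fun x) a b c);
    apply ex_RInt_gamma; assumption.
Qed.

Definition improper_limit (V : R -> R -> R) (l : R) : Prop := forall eps, 0 < eps ->
  exists d, 0 < d /\ exists B, forall a b, 0 < a < d -> B < b -> Rabs (V a b - l) < eps.

Lemma improper_limit_RInt_gen (x l : R) : improper_limit (RInt (gamma_fun x)) l ->
  is_RInt_gen (gamma_fun x) (at_right 0) (Rbar_locally p_infty) l.
Proof.
  intros H P [eps HP].
  destruct (H eps (cond_pos eps)) as [d [Hd [B HB]]].
  exists (fun a => 0 < a < d) (fun b => Rmax 1 B < b).
  - exists (mkposreal d Hd); intros a Ha Hpos.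
    unfold ball in Ha; simpl in Ha; unfold AbsRing_ball, abs, minus, plus, opp in Ha; simpl in Ha.
    apply Rabs_def2 in Ha; lra.
  - exists (Rmax 1 B); auto.
  - intros a b Ha Hb; exists (RInt (gamma_fun x) a b); split.
    + apply (RInt_correct (V := R_CompleteNormedModule)), ex_RInt_gamma; [lra|].
      generalize (Rmax_l 1 B); simpl; lra.
    + apply HP, HB; [exact Ha|]. generalize (Rmax_r 1 B); simpl in *; lra.
Qed.

Lemma power_exp_bound (p : R) : exists C, 0 < C /\ forall t, 1 <= t -> Rpower t p * exp (- t) <= C * exp (- t / 2).
Proof.
  set (q := Rabs p + 1). assert (Hq : 0 < q) by (unfold q; generalize (Rabs_pos p); lra).
  exists (exp (q * ln (2 * q))); split; [apply exp_pos|]; intros t Ht.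
  apply Rle_trans with (Rpower t q * exp (- t)).
  { apply Rmult_le_compat_r; [apply Rlt_le, exp_pos|]; apply Rpower_le_exp; [exact Ht|].
    unfold q; generalize (Rle_abs p); lra. }
  unfold Rpower; rewrite <- !exp_plus.
  (* The logarithm is bounded at t/(2q), so that multiplying by q produces t/2 plus a constant. *)
  assert (L : ln t <= t / (2 * q) + ln (2 * q)).
  { assert (H := exp_ineq1_le (ln (t / (2 * q)))).
    rewrite exp_ln in H by (apply Rdiv_lt_0_compat; lra).
    unfold Rdiv in H; rewrite ln_mult, ln_Rinv in H by (try apply Rinv_0_lt_compat; lra).
    unfold Rdiv; lra. }
  apply (Rmult_le_compat_l q) in L; [|lra].
  replace (q * (t / (2 * q) + ln (2 * q))) with (t / 2 + q * ln (2 * q)) in L by (field; lra).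
  destruct (Rle_lt_or_eq_dec (q * ln t + - t) (q * ln (2 * q) + - t / 2)) as [Hl|He]; [lra | |rewrite He; lra].
  apply Rlt_le, exp_increasing, Hl.
Qed.

Lemma RInt_gamma_upper (x : R) : exists M, forall b, 1 <= b -> RInt (gamma_fun x) 1 b <= M.
Proof.
  destruct (power_exp_bound (x - 1)) as [C [HC H]].
  exists (2 * C); intros b Hb.
  set (F := fun t : R => - (2 * C) * exp (- t / 2)).
  assert (HF : is_RInt (V := R_NormedModule) (fun t => C * exp (- t / 2)) 1 b (minus (F b) (F 1))).
  { apply (is_RInt_derive (V := R_CompleteNormedModule) F); unfold F.
    - intros t _; auto_derive; [exact I | unfold Rdiv; field].
    - intros t _; apply (ex_derive_continuous (V := R_NormedModule)); auto_derive; exact I. }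
  apply Rle_trans with (RInt (fun t => C * exp (- t / 2)) 1 b).
  - apply RInt_le; [exact Hb | apply ex_RInt_gamma; lra | eexists; exact HF|].
    intros t Ht; apply H; lra.
  - rewrite (is_RInt_unique _ _ _ _ HF); unfold minus, plus, opp, F; simpl.
    assert (E1 : 0 < exp (- b / 2)) by apply exp_pos.
    assert (E2 : exp (- (1) / 2) <= 1).
    { apply Rle_trans with (exp 0); [apply Rlt_le, exp_increasing; lra | rewrite exp_0; lra]. }
    nra.
Qed.

Lemma RInt_gamma_lower (x : R) : 0 < x -> forall a, 0 < a <= 1 -> RInt (gamma_fun x) a 1 <= / x.
Proof.
  intros Hx a Ha.
  set (F := fun t : R => / x * Rpower t x).
  assert (HF : is_RInt (V := R_NormedModule) (fun t => Rpower t (x - 1)) a 1 (minus (F 1) (F a))).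
  { apply (is_RInt_derive (V := R_CompleteNormedModule) F); unfold F.
    - rewrite Rmin_left, Rmax_right by lra; intros t Ht.
      replace (Rpower t (x - 1)) with (/ x * (x * Rpower t (x - 1))) by (field; lra).
      apply (is_derive_scal (fun t => Rpower t x)), is_derive_Reals, derivable_pt_lim_power; lra.
    - rewrite Rmin_left, Rmax_right by lra; intros t Ht.
      apply (ex_derive_continuous (V := R_NormedModule)); unfold Rpower; auto_derive; lra. }
  apply Rle_trans with (RInt (fun t => Rpower t (x - 1)) a 1).
  - apply RInt_le; [lra | apply ex_RInt_gamma; lra | eexists; exact HF|].
    intros t Ht; unfold gamma_fun.
    assert (exp (- t) <= 1) by (rewrite <- exp_0; apply Rlt_le, exp_increasing; lra).
    generalize (Rpower_pos t (x - 1)); nra.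
  - rewrite (is_RInt_unique _ _ _ _ HF); unfold minus, plus, opp, F; simpl.
    rewrite Rpower_1_base.
    assert (0 < / x) by (apply Rinv_0_lt_compat, Hx).
    generalize (Rpower_pos a x); nra.
Qed.

(** The integrand is positive, so the pieces on either side of 1 grow as the interval widens, and
    the limit is the sum of two suprema. *)
Lemma improper_limit_gamma_exists (x : R) : 0 < x -> exists l, improper_limit (RInt (gamma_fun x)) l /\ 0 < l.
Proof.
  intro Hx.
  destruct (RInt_gamma_upper x) as [M HM].
  destruct (completeness (fun y => exists b, 1 <= b /\ y = RInt (gamma_fun x) 1 b)) as [l1 [U1 V1]].
  { exists M; intros y [b [Hb ->]]; apply HM, Hb. }
  { exists (RInt (gamma_fun x) 1 1), 1; split; [lra | reflexivity]. }
  destruct (completeness (fun y => exists a, 0 < a <= 1 /\ y = RInt (gamma_fun x) a 1)) as [l0 [U0 V0]].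
  { exists (/ x); intros y [a [Ha ->]]; apply RInt_gamma_lower; assumption. }
  { exists (RInt (gamma_fun x) 1 1), 1; split; [lra | reflexivity]. }
  exists (l0 + l1); split.
  - intros eps Heps.
    destruct (classic (exists b, 1 <= b /\ l1 - eps / 2 < RInt (gamma_fun x) 1 b)) as [[b0 [Hb0 Hb1]]|Hn].
    2:{ exfalso; assert (l1 <= l1 - eps / 2); [|lra].
        apply V1; intros y [b [Hb ->]]; apply Rnot_lt_le; intro Hc; apply Hn; eauto. }
    destruct (classic (exists a, 0 < a <= 1 /\ l0 - eps / 2 < RInt (gamma_fun x) a 1)) as [[a0 [Ha0 Ha1]]|Hn].
    2:{ exfalso; assert (l0 <= l0 - eps / 2); [|lra].
        apply V0; intros y [b [Hb ->]]; apply Rnot_lt_le; intro Hc; apply Hn; eauto. }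
    exists a0; split; [lra|]; exists b0; intros a b Ha Hb.
    rewrite (RInt_gamma_Chasles x a 1 b) by lra.
    assert (A1 : RInt (gamma_fun x) a 1 <= l0) by (apply U0; exists a; split; [lra | reflexivity]).
    assert (A2 : RInt (gamma_fun x) 1 b <= l1) by (apply U1; exists b; split; [lra | reflexivity]).
    assert (A3 := RInt_gamma_nonneg x a a0 ltac:(lra) ltac:(lra)).
    assert (A4 := RInt_gamma_nonneg x b0 b ltac:(lra) ltac:(lra)).
    rewrite (RInt_gamma_Chasles x a a0 1) in * by lra.
    rewrite (RInt_gamma_Chasles x 1 b0 b) in * by lra.
    apply Rabs_def1; lra.
  - assert (L0 : 0 <= l0).
    { eapply Rle_trans; [|apply U0; exists 1; split; [lra | reflexivity]].
      apply RInt_gamma_nonneg; lra. }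
    assert (L1 : RInt (gamma_fun x) 1 2 <= l1) by (apply U1; exists 2; split; [lra | reflexivity]).
    assert (L2 : 0 < RInt (gamma_fun x) 1 2).
    { apply RInt_gt_0; [lra | intros; apply gamma_fun_pos|].
      intros t Ht; apply gamma_fun_cont; lra. }
    lra.
Qed.

Lemma Gamma_improper_limit (x l : R) : improper_limit (RInt (gamma_fun x)) l -> Gamma x = l.
Proof. intro H; apply (is_RInt_gen_unique (gamma_fun x)), improper_limit_RInt_gen, H. Qed.

Lemma Gamma_pos (x : R) : 0 < x -> 0 < Gamma x.
Proof.
  intro Hx; destruct (improper_limit_gamma_exists x Hx) as [l [H Hl]].
  rewrite (Gamma_improper_limit x l H); exact Hl.
Qed.

Lemma RInt_gamma_parts (x a b : R) : 0 < a -> 0 < b ->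
  RInt (gamma_fun (x + 1)) a b
  = Rpower a x * exp (- a) - Rpower b x * exp (- b) + x * RInt (gamma_fun x) a b.
Proof.
  intros Ha Hb.
  assert (Hm : forall t, Rmin a b <= t <= Rmax a b -> 0 < t).
  { intros t Ht; unfold Rmin in Ht; destruct (Rle_dec a b); lra. }
  set (F := fun t : R => - (Rpower t x * exp (- t))).
  assert (HF : is_RInt (V := R_NormedModule) (fun t => gamma_fun (x + 1) t + - x * gamma_fun x t) a b (minus (F b) (F a))).
  { apply (is_RInt_derive (V := R_CompleteNormedModule) F); unfold F, gamma_fun.
    - intros t Ht; specialize (Hm t Ht).
      replace (x + 1 - 1) with x by ring.
      replace (Rpower t (x - 1)) with (Rpower t x / t).
      2:{ unfold Rminus; rewrite Rpower_plus, Rpower_Ropp, Rpower_1 by exact Hm; reflexivity. }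
      unfold Rpower; auto_derive; [exact Hm | field; lra].
    - intros t Ht; specialize (Hm t Ht).
      apply (ex_derive_continuous (V := R_NormedModule)); unfold Rpower; auto_derive; auto. }
  assert (E : RInt (fun t => gamma_fun (x + 1) t + - x * gamma_fun x t) a b
    = RInt (gamma_fun (x + 1)) a b + - x * RInt (gamma_fun x) a b).
  { rewrite <- (RInt_scal (V := R_CompleteNormedModule)) by (apply ex_RInt_gamma; assumption).
    apply (RInt_plus (V := R_CompleteNormedModule) (gamma_fun (x + 1)) (fun t => - x * gamma_fun x t)).
    - apply ex_RInt_gamma; assumption.
    - apply (ex_RInt_scal (V := R_NormedModule)), ex_RInt_gamma; assumption. }
  rewrite (is_RInt_unique _ _ _ _ HF) in E.
  unfold minus, plus, opp, F in E; simpl in E; lra.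
Qed.

Lemma Gamma_succ (x : R) : 0 < x -> Gamma (x + 1) = x * Gamma x.
Proof.
  intro Hx; destruct (improper_limit_gamma_exists x Hx) as [l [H Hl]].
  rewrite (Gamma_improper_limit x l H); apply Gamma_improper_limit; intros eps Heps.
  destruct (H (eps / (2 * x))) as [d [Hd [B HB]]]; [apply Rdiv_lt_0_compat; lra|].
  destruct (power_exp_bound x) as [C [HC HP]].
  set (e4 := eps / 4). assert (He4 : 0 < e4) by (unfold e4; lra).
  (* These thresholds make each boundary term of the integration by parts smaller than eps/4; the
     remaining eps/2 goes to the integral. *)
  exists (Rmin (Rmin d 1) (Rpower e4 (/ x))); split.
  { repeat apply Rmin_glb_lt; [exact Hd | lra | apply Rpower_pos]. }
  exists (Rmax (Rmax B 1) (2 * (C / e4))).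
  intros a b [Ha0 Ha] Hb.
  assert (a1 := Rmin_l (Rmin d 1) (Rpower e4 (/ x))). assert (a2 := Rmin_r (Rmin d 1) (Rpower e4 (/ x))).
  assert (a3 := Rmin_l d 1). assert (a4 := Rmin_r d 1).
  assert (b1 := Rmax_l (Rmax B 1) (2 * (C / e4))). assert (b2 := Rmax_r (Rmax B 1) (2 * (C / e4))).
  assert (b3 := Rmax_l B 1). assert (b4 := Rmax_r B 1).
  rewrite RInt_gamma_parts by lra.
  assert (X1 : 0 < Rpower a x * exp (- a) < e4).
  { split; [apply Rmult_lt_0_compat; apply exp_pos|].
    assert (Rpower a x < e4).
    { replace e4 with (Rpower (Rpower e4 (/ x)) x).
      - apply Rlt_Rpower_l; lra.
      - rewrite Rpower_mult, Rinv_l, Rpower_1 by lra; reflexivity. }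
    assert (exp (- a) <= 1) by (rewrite <- exp_0; apply Rlt_le, exp_increasing; lra).
    generalize (Rpower_pos a x), (exp_pos (- a)); nra. }
  assert (X2 : 0 < Rpower b x * exp (- b) < e4).
  { split; [apply Rmult_lt_0_compat; apply exp_pos|].
    eapply Rle_lt_trans; [apply HP; lra|].
    assert (Q := exp_ineq1_le (b / 2)).
    replace (- b / 2) with (- (b / 2)) by field; rewrite exp_Ropp.
    apply (Rlt_div_l C e4 (exp (b / 2))); [apply exp_pos|].
    assert (C / e4 < exp (b / 2)) by lra.
    apply (Rmult_lt_compat_l e4) in H0; [|exact He4].
    replace (e4 * (C / e4)) with C in H0 by (field; lra). exact H0. }
  specialize (HB a b ltac:(lra) ltac:(lra)).
  set (I := RInt (gamma_fun x) a b) in *.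
  assert (X3 : Rabs (x * I - x * l) < eps / 2).
  { rewrite <- Rmult_minus_distr_l, Rabs_mult, Rabs_pos_eq by lra.
    apply (Rmult_lt_compat_l x) in HB; [|exact Hx].
    replace (x * (eps / (2 * x))) with (eps / 2) in HB by (field; lra). exact HB. }
  apply Rabs_def2 in X3; unfold e4 in *; apply Rabs_def1; lra.
Qed.

(** * Counting and poles *)

Lemma Rpower_inv_le (x y a : R) : 0 < x -> 0 < y -> 0 < a -> (Rpower x a <= y <-> x <= Rpower y (/ a)).
Proof.
  intros Hx Hy Ha.
  assert (Hi : 0 < / a) by (apply Rinv_0_lt_compat, Ha).
  split; intro H.
  - replace x with (Rpower (Rpower x a) (/ a)).
    + apply Rle_Rpower_l; [lra | split; [apply Rpower_pos | exact H]].
    + rewrite Rpower_mult, Rinv_r, Rpower_1 by lra; reflexivity.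
  - replace y with (Rpower (Rpower y (/ a)) a).
    + apply Rle_Rpower_l; [lra | split; assumption].
    + rewrite Rpower_mult, Rinv_l, Rpower_1 by lra; reflexivity.
Qed.

Lemma Zceil_le_iff (x : R) (z : Z) : (Zceil x <= z)%Z <-> x <= IZR z.
Proof.
  destruct (Zceil_bound x) as [H1 H2]; split; intro H.
  - apply IZR_le in H; lra.
  - assert (IZR (Zceil x) < IZR (z + 1)) by (rewrite plus_IZR; lra).
    apply lt_IZR in H0; lia.
Qed.

(* The number of n >= 1 with n^kappa < m is ceil_pow alpha m - 1. *)
Definition ceil_pow (alpha : R) (m : nat) : nat := Z.to_nat (Zceil (Rpower (INR m) alpha)).

Lemma ceil_pow_le_iff (alpha : R) (m j : nat) : (ceil_pow alpha m <= j)%nat <-> Rpower (INR m) alpha <= INR j.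
Proof.
  assert (H0 : (0 <= Zceil (Rpower (INR m) alpha))%Z).
  { apply le_IZR; generalize (Zceil_bound (Rpower (INR m) alpha)), (Rpower_pos (INR m) alpha); lra. }
  rewrite (INR_IZR_INZ j), <- Zceil_le_iff; unfold ceil_pow; lia.
Qed.

Lemma INR_ceil_pow (alpha : R) (m : nat) : INR (ceil_pow alpha m) = IZR (Zceil (Rpower (INR m) alpha)).
Proof.
  unfold ceil_pow; rewrite (INR_IZR_INZ (Z.to_nat _)), Z2Nat.id; [reflexivity|].
  apply le_IZR; generalize (Zceil_bound (Rpower (INR m) alpha)), (Rpower_pos (INR m) alpha); lra.
Qed.

Lemma ceil_pow_bounds (alpha : R) (m : nat) : Rpower (INR m) alpha <= INR (ceil_pow alpha m) <= Rpower (INR m) alpha + 1.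
Proof. rewrite INR_ceil_pow; generalize (Zceil_bound (Rpower (INR m) alpha)); lra. Qed.

Lemma ceil_pow_pos (alpha : R) (m : nat) : (1 <= ceil_pow alpha m)%nat.
Proof.
  destruct (le_lt_dec 1 (ceil_pow alpha m)) as [H|H]; [exact H|exfalso].
  assert (H' : (ceil_pow alpha m <= 0)%nat) by lia.
  apply ceil_pow_le_iff in H'; simpl in H'; generalize (Rpower_pos (INR m) alpha); lra.
Qed.

Lemma ceil_pow_1 (alpha : R) : ceil_pow alpha 1 = 1%nat.
Proof.
  assert (H : (ceil_pow alpha 1 <= 1)%nat) by (apply ceil_pow_le_iff; simpl; rewrite Rpower_1_base; lra).
  generalize (ceil_pow_pos alpha 1); lia.
Qed.

Lemma ceil_pow_mono (alpha : R) (m n : nat) : 0 < alpha -> (1 <= m <= n)%nat -> (ceil_pow alpha m <= ceil_pow alpha n)%nat.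
Proof.
  intros Ha Hmn; apply ceil_pow_le_iff.
  apply Rle_trans with (Rpower (INR n) alpha); [|apply ceil_pow_bounds].
  apply Rle_Rpower_l; [lra|]; split; [apply lt_0_INR; lia | apply le_INR; lia].
Qed.

Definition PS_base (kappa : R) (j : nat) : R := IZR (Zfloor (Rpower (INR j) kappa)).

(** floor(j^kappa) = m means m^alpha <= j < (m+1)^alpha, and for an integer j such inequalities may
    be stated with ceilings. *)
Lemma PS_base_block (kappa alpha : R) (m j : nat) : 0 < kappa -> alpha = 1 / kappa -> (1 <= m)%nat ->
  (ceil_pow alpha m <= j < ceil_pow alpha (S m))%nat -> PS_base kappa j = INR m.
Proof.
  intros Hk Ha Hm [H1 H2].
  assert (Hap : 0 < alpha) by (rewrite Ha; apply Rdiv_lt_0_compat; lra).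
  assert (Hia : / alpha = kappa) by (rewrite Ha; field; lra).
  assert (Hj : (1 <= j)%nat) by (generalize (ceil_pow_pos alpha m); lia).
  assert (Hjp : 0 < INR j) by (apply lt_0_INR; lia).
  apply ceil_pow_le_iff in H1; apply Rpower_inv_le in H1; try assumption; [|apply lt_0_INR; lia].
  assert (H3 : ~ Rpower (INR (S m)) alpha <= INR j) by (intro H; apply ceil_pow_le_iff in H; lia).
  rewrite Rpower_inv_le in H3; try assumption; [|apply lt_0_INR; lia].
  rewrite Hia in *; rewrite S_INR in H3.
  unfold PS_base; rewrite (Zfloor_eq (Z.of_nat m)), <- INR_IZR_INZ; [reflexivity|].
  rewrite <- INR_IZR_INZ; lra.
Qed.

Lemma ceil_pow_locate (alpha : R) (j : nat) : 0 < alpha -> (1 <= j)%nat ->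
  exists M, (ceil_pow alpha (S M) <= j < ceil_pow alpha (S (S M)))%nat.
Proof.
  intros Ha Hj.
  assert (Hex : exists m, (j < ceil_pow alpha (S m))%nat).
  { destruct (INR_unbounded (Rpower (INR j + 1) (/ alpha))) as [m Hm].
    exists m; destruct (le_lt_dec (ceil_pow alpha (S m)) j) as [H|H]; [exfalso|exact H].
    apply ceil_pow_le_iff in H; apply Rpower_inv_le in H; [|apply lt_0_INR; lia | apply lt_0_INR; lia | exact Ha].
    assert (Rpower (INR j) (/ alpha) <= Rpower (INR j + 1) (/ alpha)).
    { apply Rle_Rpower_l; [apply Rlt_le, Rinv_0_lt_compat, Ha|]; split; [apply lt_0_INR; lia | lra]. }
    rewrite S_INR in H; lra. }
  destruct Hex as [m Hm]; induction m as [|m IH].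
  - rewrite ceil_pow_1 in Hm; lia.
  - destruct (le_lt_dec (ceil_pow alpha (S m)) j) as [H|H]; [exists m; lia | exact (IH H)].
Qed.

(** The series of zeta_kappa grouped by the value m = i + 1 of the base, with its multiplicity. *)
Definition Wsum (alpha : R) (s : C) (M : nat) : C :=
  csum (fun i => cpow (INR (S i)) (- s) * RtoC (INR (ceil_pow alpha (S (S i))) - INR (ceil_pow alpha (S i))))%C M.

Lemma csum_block (a : nat -> C) (N n : nat) (v : C) :
  (forall k, (N <= k < N + n)%nat -> a k = v) -> csum a (N + n) = (csum a N + RtoC (INR n) * v)%C.
Proof.
  intro H; rewrite csum_add; f_equal.
  rewrite (csum_ext _ (fun _ => v)) by (intros k Hk; apply H; lia).
  induction n as [|n IH]; [simpl; ring|].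
  rewrite S_INR, RtoC_plus; simpl; rewrite IH by (intros; apply H; lia); ring.
Qed.

Lemma PS_partial_sum (kappa alpha : R) (s : C) (M : nat) : 0 < kappa -> alpha = 1 / kappa ->
  csum (fun k => cpow (PS_base kappa (S k)) (- s)) (ceil_pow alpha (S M) - 1) = Wsum alpha s M.
Proof.
  intros Hk Ha.
  assert (Hap : 0 < alpha) by (rewrite Ha; apply Rdiv_lt_0_compat; lra).
  induction M as [|M IH]; [rewrite ceil_pow_1; reflexivity|].
  assert (H1 := ceil_pow_mono alpha (S M) (S (S M)) Hap ltac:(lia)).
  assert (H2 := ceil_pow_pos alpha (S M)).
  replace (ceil_pow alpha (S (S M)) - 1)%nat with ((ceil_pow alpha (S M) - 1) + (ceil_pow alpha (S (S M)) - ceil_pow alpha (S M)))%nat by lia.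
  rewrite (csum_block _ _ _ (cpow (INR (S M)) (- s))).
  - rewrite IH, minus_INR by exact H1; unfold Wsum; cbn [csum]; ring.
  - intros k Hk'; f_equal; apply (PS_base_block kappa alpha); try assumption; lia.
Qed.

(** Tends to 0 for Re s > alpha. It dominates both the incomplete last group of the series and the
    boundary term of the first summation by parts. *)
Lemma boundary_term_bound (alpha : R) (s : C) (M : nat) : 0 < alpha ->
  Cmod (RtoC (INR (ceil_pow alpha (S (S M)))) * cpow (INR (S M)) (- s))%C
  <= (Rpower 2 alpha + 1) * Rpower (INR (S M)) (- (Re s - alpha)).
Proof.
  intro Ha; rewrite Cmod_mult, Cmod_R, Rabs_pos_eq, Cmod_cpow by apply pos_INR.
  assert (Hm := INR_S_ge_1 M).
  assert (B : INR (ceil_pow alpha (S (S M))) <= (Rpower 2 alpha + 1) * Rpower (INR (S M)) alpha).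
  { eapply Rle_trans; [apply ceil_pow_bounds|].
    assert (Rpower (INR (S (S M))) alpha <= Rpower 2 alpha * Rpower (INR (S M)) alpha).
    { rewrite Rpower_mult_distr by lra; apply Rle_Rpower_l; [lra|].
      split; [apply INR_S_pos | rewrite (S_INR (S M)); lra]. }
    assert (1 <= Rpower (INR (S M)) alpha).
    { rewrite <- (Rpower_1_base alpha) at 1; apply Rle_Rpower_l; lra. }
    lra. }
  replace (Re (- s)%C) with (- Re s) by (destruct s; reflexivity).
  replace (- (Re s - alpha)) with (alpha + - Re s) by ring.
  rewrite Rpower_plus, <- Rmult_assoc.
  apply Rmult_le_compat_r; [apply Rlt_le, Rpower_pos | exact B].
Qed.

(** Convergence of [Wsum] concerns only the partial sums that end with a complete group; for the
    others the incomplete group is bounded by [boundary_term_bound]. *)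
Lemma PS_zeta_of_limit (kappa alpha : R) (s l : C) : 0 < kappa -> alpha = 1 / kappa ->
  alpha < Re s -> Ccv (Wsum alpha s) l -> is_PS_zeta kappa s l.
Proof.
  intros Hk Ha Hs HW; apply is_Cseries_csum.
  assert (Hap : 0 < alpha) by (rewrite Ha; apply Rdiv_lt_0_compat; lra).
  change (Ccv (csum (fun k => cpow (PS_base kappa (S k)) (- s))) l).
  intros eps Heps.
  destruct (HW (eps / 2)) as [M1 H1]; [lra|].
  assert (Hlim : is_lim_seq (fun M => (Rpower 2 alpha + 1) * Rpower (INR (S M)) (- (Re s - alpha))) 0).
  { replace (Finite 0) with (Rbar_mult (Rpower 2 alpha + 1) 0) by (simpl; f_equal; ring).
    apply is_lim_seq_scal_l, Rpower_neg_lim; lra. }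
  apply is_lim_seq_spec in Hlim.
  assert (He2 : 0 < eps / 2) by lra.
  destruct (Hlim (mkposreal _ He2)) as [M2 H2]; simpl in H2.
  set (M0 := (M1 + M2)%nat).
  exists (ceil_pow alpha (S M0)); intros N HN.
  destruct (ceil_pow_locate alpha (S N)) as [M HM]; [exact Hap | lia|].
  assert (HM0 : (M0 <= M)%nat).
  { destruct (le_lt_dec M0 M) as [H|H]; [exact H|exfalso].
    assert (ceil_pow alpha (S (S M)) <= ceil_pow alpha (S M0))%nat by (apply ceil_pow_mono; [exact Hap | lia]). lia. }
  assert (H3 := ceil_pow_pos alpha (S M)).
  replace N with ((ceil_pow alpha (S M) - 1) + (S N - ceil_pow alpha (S M)))%nat by lia.
  rewrite (csum_block _ _ _ (cpow (INR (S M)) (- s))).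
  2:{ intros k Hk'; f_equal; apply (PS_base_block kappa alpha); try assumption; lia. }
  rewrite PS_partial_sum by assumption.
  specialize (H1 M ltac:(unfold M0 in HM0; lia)). specialize (H2 M ltac:(unfold M0 in HM0; lia)).
  rewrite Rminus_0_r in H2; apply Rabs_def2 in H2.
  set (r := (RtoC (INR (S N - ceil_pow alpha (S M))) * cpow (INR (S M)) (- s))%C).
  assert (Hr : Cmod r < eps / 2).
  { eapply Rle_lt_trans; [|apply H2].
    eapply Rle_trans; [|apply boundary_term_bound, Hap].
    unfold r; rewrite !Cmod_mult; apply Rmult_le_compat_r; [apply Cmod_ge_0|].
    rewrite !Cmod_R, !Rabs_pos_eq by apply pos_INR; apply le_INR; lia. }
  replace (Wsum alpha s M + r - l)%C with ((Wsum alpha s M - l) + r)%C by ring.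
  eapply Rle_lt_trans; [apply Cmod_triangle | lra].
Qed.

(** zeta0(s-p+1) is xi(s-p+1)/(s-p), and [divided_difference] applied to A(s) xi(s-p+1) at p splits
    off the principal part, with residue A(p) because xi(1) = 1. *)
Lemma simple_pole_of_zeta0 (Z A B : C -> C) (p res : C) (r : R) : 0 < r ->
  (forall s, Cmod (s - p) < r -> Z s = (A s * zeta0 (s - p + 1) + B s)%C) ->
  (forall s, cdiff A s) -> (forall s, Cmod (s - p) < r -> cdiff B s) ->
  A p = res -> res <> RtoC 0 -> simple_pole_residue Z p res.
Proof.
  intros Hr HZ HA HB Hres Hnz; split; [exact Hnz|].
  set (F := fun s => (A s * xi (s - p + 1))%C).
  assert (HF : forall s, cdiff F s).
  { intro s; apply (cdiff_mult A); [apply HA|].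
    apply (cdiff_comp xi (fun s => s - p + 1)%C); [apply cdiff_xi|].
    apply (cdiff_plus (fun s => s - p)%C); [|apply cdiff_const].
    apply cdiff_minus; [apply cdiff_id | apply cdiff_const]. }
  destruct (divided_difference F p r Hr (fun z _ => HF z)) as [Q [HQ1 HQ2]].
  exists (fun s => Q s + B s)%C; split.
  - apply locally_C; exists (mkposreal r Hr); intros s Hs.
    change (Cmod (s - p) < r) in Hs.
    apply cder_differentiable, cdiff_plus; auto.
  - apply locally_C; exists (mkposreal r Hr); intros s Hs Hsp.
    change (Cmod (s - p) < r) in Hs.
    rewrite HZ by exact Hs.
    assert (Hn : (s - p)%C <> RtoC 0) by (apply Cminus_eq_contra; exact Hsp).
    assert (E := HQ2 s Hs); unfold F in E.
    replace (p - p + 1)%C with (RtoC 1) in E by ring.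
    rewrite xi_1, Hres in E.
    unfold zeta0; replace (s - p + 1 - 1)%C with (s - p)%C by ring.
    transitivity (A s * xi (s - p + 1) / (s - p) + B s)%C; [field; exact Hn|].
    rewrite E; field; exact Hn.
Qed.

(** * Abel summation *)

(** Rising factorial; [qcoef j] below is the coefficient of x^j in (1 - x)^(-s). *)
Fixpoint rise (s : C) (j : nat) : C :=
  match j with O => RtoC 1 | S k => (rise s k * (s + RtoC (INR k)))%C end.

Lemma rise_front (s : C) (j : nat) : rise s (S j) = (s * rise (s + 1) j)%C.
Proof.
  induction j as [|j IH]; [simpl; ring|].
  change (rise s (S (S j))) with (rise s (S j) * (s + RtoC (INR (S j))))%C.
  rewrite IH, S_INR, RtoC_plus; simpl; ring.
Qed.

Lemma cff_opp (s : C) (j : nat) : (cff (- s) j * RtoC ((-1) ^ j))%C = rise s j.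
Proof.
  induction j as [|j IH]; [simpl; ring|].
  simpl; rewrite <- IH, RtoC_mult; ring.
Qed.

Lemma Cmod_cff_opp (s : C) (j : nat) : Cmod (cff (- s) j) = Cmod (rise s j).
Proof. rewrite <- cff_opp, Cmod_mult, Cmod_R, pow_1_abs; ring. Qed.

Lemma rise_bound (s : C) (j : nat) : Cmod (rise s j) <= (Cmod s + INR j) ^ j.
Proof.
  rewrite <- Cmod_cff_opp; eapply Rle_trans; [apply cff_bound|]; rewrite Cmod_opp; lra.
Qed.

Lemma rise_growth (s : C) (j : nat) :
  Cmod (rise s (S j)) <= INR (S j) ^ j * (Cmod s * (Cmod s + 1) ^ j).
Proof.
  rewrite rise_front, Cmod_mult.
  assert (H := rise_bound (s + 1) j). assert (P := Cmod_ge_0 s).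
  assert (T := Cmod_triangle s 1); rewrite Cmod_1 in T.
  assert (B : (Cmod (s + 1) + INR j) ^ j <= (INR (S j) * (Cmod s + 1)) ^ j).
  { apply pow_incr; rewrite S_INR; generalize (Cmod_ge_0 (s + 1)), (pos_INR j); intros.
    split; [lra | nra]. }
  rewrite Rpow_mult_distr in B.
  replace (INR (S j) ^ j * (Cmod s * (Cmod s + 1) ^ j)) with (Cmod s * (INR (S j) ^ j * (Cmod s + 1) ^ j)) by ring.
  apply Rmult_le_compat_l; lra.
Qed.

Lemma cdiff_rise (j : nat) (s : C) : cdiff (fun s => rise s j) s.
Proof.
  induction j as [|j IH]; simpl; [apply cdiff_const|].
  apply (cdiff_mult (fun s => rise s j)); [exact IH|].
  apply cdiff_plus; [apply cdiff_id | apply cdiff_const].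
Qed.

Lemma rise_1 (j : nat) : rise (RtoC 1) j = RtoC (INR (fact j)).
Proof.
  induction j as [|j IH]; [simpl; reflexivity|].
  rewrite fact_simpl, mult_INR, RtoC_mult, S_INR, RtoC_plus; simpl; rewrite IH; ring.
Qed.

Definition qcoef (j : nat) (s : C) : C := (rise s j / RtoC (INR (fact j)))%C.

Lemma cbin_opp (s : C) (x : R) (j : nat) :
  (cbin (- s) j * RtoC ((- x) ^ j))%C = (qcoef j s * RtoC (x ^ j))%C.
Proof.
  unfold qcoef, cbin; rewrite <- cff_opp.
  replace (- x) with (-1 * x) by ring; rewrite Rpow_mult_distr, RtoC_mult.
  field; apply fact_neq_C.
Qed.

Lemma cdiff_qcoef (j : nat) (s : C) : cdiff (qcoef j) s.
Proof. apply (cdiff_mult (fun s => rise s j)); [apply cdiff_rise | apply cdiff_const]. Qed.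

Lemma qcoef_0 (j : nat) : qcoef (S j) (RtoC 0) = RtoC 0.
Proof. unfold qcoef; rewrite rise_front; unfold Cdiv; ring. Qed.

(** One factor is s and the others take the value j! at 0, so the derivative is j!/(j+1)!: the
    coefficients of (1 - x)^(-s) differentiate to those of -log(1 - x). *)
Lemma cder_qcoef_0 (j : nat) : cder (qcoef (S j)) (RtoC 0) (/ RtoC (INR (S j)))%C.
Proof.
  assert (Hc : cdiff (fun s => rise (s + 1)%C j) (RtoC 0)).
  { apply (cdiff_comp (fun s => rise s j) (fun s => s + 1)%C); [apply cdiff_rise|].
    apply cdiff_plus; [apply cdiff_id | apply cdiff_const]. }
  destruct Hc as [l Hl].
  apply cder_ext with (fun s => / RtoC (INR (fact (S j))) * (s * rise (s + 1) j))%C.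
  { intro s; unfold qcoef; rewrite rise_front; unfold Cdiv; ring. }
  eapply cder_eq; [|apply cder_scal, (cder_mult (fun s => s)); [apply cder_id | exact Hl]].
  cbv beta; rewrite Cplus_0_l, rise_1, fact_simpl, mult_INR, RtoC_mult.
  field; split; first [apply fact_neq_C | apply INR_S_neq_C].
Qed.

(* Indexing: with n = i + 2, [dw i s] is (n-1)^-s - n^-s. *)
Definition pw (i : nat) (s : C) : C := cpow (INR (S i)) (- s).
Definition dw (i : nat) (s : C) : C := (pw i s - pw (S i) s)%C.

Lemma INR_S_split (i : nat) : INR (S i) = INR (S (S i)) * (1 + - / INR (S (S i))).
Proof. rewrite (S_INR (S i)); generalize (INR_S_pos i); intro; field; lra. Qed.

Lemma inv_SS_bound (i : nat) : 0 < / INR (S (S i)) <= 1 / 2.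
Proof.
  assert (H : 2 <= INR (S (S i))) by (rewrite !S_INR; generalize (pos_INR i); lra).
  split; [apply Rinv_0_lt_compat; lra|].
  replace (1 / 2) with (/ 2) by field; apply Rinv_le_contravar; lra.
Qed.

Lemma dw_rho (i : nat) (s : C) :
  dw i s = (cpow (INR (S (S i))) (- s) * rho 1 (- s) (- / INR (S (S i))))%C.
Proof.
  unfold dw, pw; rewrite (INR_S_split i).
  assert (H := inv_SS_bound i).
  rewrite cpow_mult_base by (try apply INR_S_pos; lra).
  unfold rho; cbn [csum]; rewrite cbin_0; simpl pow; ring.
Qed.

Lemma cbin_1 (a : C) : cbin a 1 = a.
Proof. unfold cbin; simpl; field; exact C1_nz. Qed.

(** Second difference of n^(-s) centred at n = i + 2: the linear terms at 1/n and -1/n cancel,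
    leaving remainders of order 2. *)
Lemma ddw_rho (i : nat) (s : C) :
  (dw i s - dw (S i) s)%C = (cpow (INR (S (S i))) (- s) *
    (rho 2 (- s) (- / INR (S (S i))) + rho 2 (- s) (/ INR (S (S i)))))%C.
Proof.
  unfold dw, pw; rewrite (INR_S_split i) at 1.
  assert (H := inv_SS_bound i). assert (P := INR_S_pos (S i)).
  replace (INR (S (S (S i)))) with (INR (S (S i)) * (1 + / INR (S (S i)))).
  2:{ rewrite (S_INR (S (S i))); field; lra. }
  rewrite !cpow_mult_base by lra.
  unfold rho; cbn [csum]; rewrite cbin_0, cbin_1; cbn [pow]; rewrite !Rmult_1_r, RtoC_opp; ring.
Qed.

(** Both bounds are stated in i + 1 = n - 1. At x = -1/n the maximum in [rho_bound] is a power of 1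
    - 1/n, which turns n into n - 1; at x = 1/n it is 1. *)
Lemma scaled_rho_bound (i k : nat) (s : C) : 0 <= Re s + INR k ->
  Rpower (INR (S (S i))) (- Re s) * Cmod (rho k (- s) (- / INR (S (S i))))
    <= 2 ^ k * Cmod (rise s k) * Rpower (INR (S i)) (- (Re s + INR k)) /\
  Rpower (INR (S (S i))) (- Re s) * Cmod (rho k (- s) (/ INR (S (S i))))
    <= 2 ^ k * Cmod (rise s k) * Rpower (INR (S i)) (- (Re s + INR k)).
Proof.
  intro Hs.
  assert (Hx := inv_SS_bound i). assert (Hn := INR_S_pos (S i)). assert (Hm := INR_S_pos i).
  set (n := INR (S (S i))) in *.
  assert (Ere : Re (- s)%C = - Re s) by (destruct s; reflexivity).
  assert (HA : 0 <= 2 ^ k * Cmod (rise s k)).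
  { apply Rmult_le_pos; [apply pow_le; lra | apply Cmod_ge_0]. }
  assert (En : (/ n) ^ k = Rpower n (- INR k)).
  { rewrite Rpower_Ropp, Rpower_pow, pow_inv by exact Hn; reflexivity. }
  assert (Main : forall x X, 0 < 1 + x -> Rabs x = / n ->
    Rpower n (- (Re s + INR k)) * Rmax 1 (Rpower (1 + x) (- (Re s + INR k))) <= X ->
    Rpower n (- Re s) * Cmod (rho k (- s) x) <= 2 ^ k * Cmod (rise s k) * X).
  { intros x X Hx1 Hx2 HX.
    assert (B := rho_bound k (- s) x Hx1); rewrite Hx2, En, Cmod_cff_opp, Ere in B.
    eapply Rle_trans; [apply Rmult_le_compat_l; [apply Rlt_le, Rpower_pos | exact B]|].
    replace (Rpower n (- Re s) * (2 ^ k * Cmod (rise s k) * Rpower n (- INR k) *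
       Rmax 1 (Rpower (1 + x) (- Re s - INR k)))) with
      (2 ^ k * Cmod (rise s k) * (Rpower n (- Re s) * Rpower n (- INR k) *
       Rmax 1 (Rpower (1 + x) (- Re s - INR k)))) by ring.
    rewrite <- Rpower_plus.
    replace (- Re s + - INR k) with (- (Re s + INR k)) by ring.
    replace (- Re s - INR k) with (- (Re s + INR k)) by ring.
    apply Rmult_le_compat_l; assumption. }
  split; apply Main; try lra.
  - rewrite Rabs_Ropp, Rabs_pos_eq; lra.
  - assert (E : INR (S i) = n * (1 + - / n)) by apply INR_S_split.
    rewrite Rmax_right.
    + rewrite Rpower_mult_distr by lra; rewrite <- E; lra.
    + rewrite Rpower_Ropp; apply Rle_trans with (/ 1); [lra|].
      apply Rinv_le_contravar; [apply Rpower_pos|].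
      apply Rle_trans with (Rpower 1 (Re s + INR k)); [apply Rle_Rpower_l; lra | rewrite Rpower_1_base; lra].
  - rewrite Rabs_pos_eq; lra.
  - rewrite Rmax_left by (apply Rpower_le_1; lra).
    rewrite Rmult_1_r, !Rpower_Ropp; apply Rinv_le_contravar; [apply Rpower_pos|].
    apply Rle_Rpower_l; [exact Hs|]; split; [exact Hm | unfold n; rewrite (S_INR (S i)); lra].
Qed.

Lemma dw_bound (i : nat) (s : C) : -1 <= Re s ->
  Cmod (dw i s) <= 2 * Cmod s * Rpower (INR (S i)) (- (Re s + 1)).
Proof.
  intro Hs; rewrite dw_rho, Cmod_mult, Cmod_cpow.
  replace (Re (- s)%C) with (- Re s) by (destruct s; reflexivity).
  destruct (scaled_rho_bound i 1 s) as [B _]; [simpl; lra|].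
  eapply Rle_trans; [exact B|]; simpl.
  replace (RtoC 1 * (s + RtoC 0))%C with s by ring; lra.
Qed.

Lemma ddw_bound (i : nat) (s : C) : -2 <= Re s ->
  Cmod (dw i s - dw (S i) s) <= 8 * Cmod (rise s 2) * Rpower (INR (S i)) (- (Re s + 2)).
Proof.
  intro Hs; rewrite ddw_rho, Cmod_mult, Cmod_cpow.
  replace (Re (- s)%C) with (- Re s) by (destruct s; reflexivity).
  destruct (scaled_rho_bound i 2 s) as [B1 B2]; [simpl; lra|].
  eapply Rle_trans; [apply Rmult_le_compat_l; [apply Rlt_le, Rpower_pos | apply Cmod_triangle]|].
  replace (INR 2) with 2 in * by (simpl; ring).
  replace (2 ^ 2) with 4 in * by ring.
  lra.
Qed.

Lemma cdiff_pw (i : nat) (s : C) : cdiff (pw i) s.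
Proof. apply (cdiff_cpow (INR (S i)) (fun s => - s)%C), cdiff_opp, cdiff_id. Qed.

Lemma cdiff_dw (i : nat) (s : C) : cdiff (dw i) s.
Proof. apply cdiff_minus; apply cdiff_pw. Qed.

Lemma csum_dw (s : C) (M : nat) : csum (fun i => dw i s) M = (1 - pw M s)%C.
Proof.
  induction M as [|M IH].
  - unfold pw; simpl; rewrite cpow_1; ring.
  - simpl; rewrite IH; unfold dw; ring.
Qed.

(** Common to [main_term] and [psi_term]. The bound is required for every b up to Re s, so that a
    single exponent serves a whole neighbourhood, as [weierstrass_M_test] demands. *)
Lemma series_family (t : nat -> C -> C) (e b0 : R) (G : C -> R) (s : C) :
  (forall i s, cdiff (t i) s) ->
  (forall b s i, b0 < b -> b <= Re s -> Cmod (t i s) <= G s * Rpower (INR (S i)) (- (b + e))) ->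
  1 <= b0 + e -> (forall r, exists B, forall s, Cmod s <= r -> G s <= B) -> b0 < Re s ->
  Ccv (csum (fun i => t i s)) (CSeries (fun i => t i s)) /\
  (forall i, cder (t i) s (C_derive (t i) s)) /\
  Ccv (csum (fun i => C_derive (t i) s)) (CSeries (fun i => C_derive (t i) s)) /\
  cder (fun z => CSeries (fun i => t i z)) s (CSeries (fun i => C_derive (t i) s)).
Proof.
  intros Hd Hb He HG Hs.
  split.
  - apply (CSeries_dominated _ (fun i => G s * Rpower (INR (S i)) (- (Re s + e)))).
    + intro i; apply Hb; lra.
    + apply ex_series_scal_R, ex_pseries; lra.
  - set (r := (Re s - b0) / 2). assert (Hr : 0 < r) by (unfold r; lra).
    destruct (HG (Cmod s + 2 * r)) as [B HB].
    apply (weierstrass_M_test t s r (fun i => B * Rpower (INR (S i)) (- (Re s - r + e)))); [exact Hr | | |].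
    + intros i z _; apply Hd.
    + intros i z Hz.
      eapply Rle_trans; [apply (Hb (Re s - r)); [unfold r in *; lra | apply in_sq_Re in Hz; lra]|].
      apply Rmult_le_compat_r; [apply Rlt_le, Rpower_pos | apply HB, in_sq_norm, Hz].
    + apply ex_series_scal_R, ex_pseries; unfold r; lra.
Qed.

Lemma series_family_bound (t : nat -> C -> C) (e b0 : R) (G : C -> R) (b : R) :
  (forall b s i, b0 < b -> b <= Re s -> Cmod (t i s) <= G s * Rpower (INR (S i)) (- (b + e))) ->
  1 <= b0 + e -> b0 < b ->
  exists K, 0 <= K /\ forall s, b <= Re s -> Cmod (CSeries (fun i => t i s)) <= K * G s.
Proof.
  intros Hb He Hbb.
  exists (Series (fun i => Rpower (INR (S i)) (- (b + e)))); split.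
  - eapply Rle_trans; [|apply (rsum_le_Series _ 0)].
    + simpl; lra.
    + intro; apply Rlt_le, Rpower_pos.
    + apply ex_pseries; lra.
  - intros s Hs; rewrite Rmult_comm, <- Series_scal_R.
    apply (CSeries_dominated _ (fun i => G s * Rpower (INR (S i)) (- (b + e)))).
    + intro i; apply Hb; assumption.
    + apply ex_series_scal_R, ex_pseries; lra.
Qed.

(** Replaces psi by its partial sums in exchange for second differences of n^(-s), which are smaller
    by a factor n. *)
Lemma abel_psi (psi : nat -> R) (s : C) (M : nat) :
  csum (fun i => RtoC (psi i) * dw i s)%C M =
  (RtoC (rsum psi M) * dw M s + csum (fun i => RtoC (rsum psi (S i)) * (dw i s - dw (S i) s)) M)%C.
Proof.
  induction M as [|M IH]; [simpl; ring|].
  cbn [csum]; rewrite IH; cbn [rsum]; rewrite !RtoC_plus; ring.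
Qed.

(** The first summation by parts; the -1 is the lower boundary term c(1) 1^(-s). *)
Lemma abel_Wsum (alpha : R) (s : C) (M : nat) :
  Wsum alpha s M = (RtoC (INR (ceil_pow alpha (S M))) * pw M s - 1 +
    csum (fun i => RtoC (INR (ceil_pow alpha (S (S i)))) * dw i s) M)%C.
Proof.
  unfold Wsum; induction M as [|M IH].
  - simpl csum; rewrite ceil_pow_1; unfold pw; simpl; rewrite cpow_1; ring.
  - cbn [csum]; rewrite IH, RtoC_minus; unfold dw, pw; ring.
Qed.

Lemma csum_csum_Ccv (f : nat -> nat -> C) (l : nat -> C) (n : nat) :
  (forall j, (j < n)%nat -> Ccv (f j) (l j)) -> Ccv (fun M => csum (fun j => f j M) n) (csum l n).
Proof.
  induction n as [|n IH]; intro H; simpl; [apply Ccv_const|].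
  apply Ccv_plus; [apply IH; intros; apply H; lia | apply H; lia].
Qed.

Lemma csum_split (f : nat -> C) (n h : nat) : (h < n)%nat ->
  csum f n = (f h + csum (fun j => if Nat.eq_dec j h then RtoC 0 else f j) n)%C.
Proof.
  induction n as [|n IH]; intro Hh; [lia|]; simpl.
  destruct (Nat.eq_dec n h) as [->|Hn].
  - rewrite (csum_ext f (fun j => if Nat.eq_dec j h then RtoC 0 else f j)); [ring|].
    intros j Hj; destruct (Nat.eq_dec j h); [lia | reflexivity].
  - rewrite IH by lia; ring.
Qed.

(** From alpha - h upwards, h + 1 factors run through those of the falling factorial of alpha; this
    evaluates the residue. *)
Lemma rise_rff (h : nat) : forall a, rise (RtoC (a - INR h)) (S h) = RtoC (rff a (S h)).
Proof.
  induction h as [|h IH]; intro a.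
  - simpl; rewrite Rminus_0_r; apply injective_projections; simpl; ring.
  - change (rise (RtoC (a - INR (S h))) (S (S h))) with
      (rise (RtoC (a - INR (S h))) (S h) * (RtoC (a - INR (S h)) + RtoC (INR (S h))))%C.
    rewrite rff_front, <- RtoC_plus.
    replace (a - INR (S h)) with ((a - 1) - INR h) at 1 by (rewrite S_INR; ring).
    rewrite IH, RtoC_mult; replace (a - INR (S h) + INR (S h)) with a by ring; ring.
Qed.

Lemma csum_Dir_tail (v : C) (M : nat) :
  csum (fun i => cpow (INR (S (S i))) (- v)) M = (csum (fun i => cpow (INR (S i)) (- v)) (S M) - 1)%C.
Proof.
  rewrite (csum_shift (fun i => cpow (INR (S i)) (- v))).
  change (INR 1) with 1; rewrite cpow_1; ring.
Qed.

Lemma pw_lim (s : C) : 0 < Re s -> Ccv (fun M => pw M s) (RtoC 0).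
Proof.
  intro Hs; apply Ccv_squeeze with (fun n => Rpower (INR (S n)) (- Re s)); [|apply Rpower_neg_lim, Hs].
  intro n; replace (pw n s - RtoC 0)%C with (pw n s) by ring.
  unfold pw; rewrite Cmod_cpow; apply Req_le; f_equal.
Qed.

(** Derivative of [dw i] at 0, written as -log E_0(1/n) with n = i + 2. *)
Definition ldiff (i : nat) : R := - ln (1 - / INR (S (S i))).

Lemma ldiff_ln (i : nat) : ldiff i = ln (INR (S (S i))) - ln (INR (S i)).
Proof.
  unfold ldiff; rewrite (INR_S_split i).
  assert (H := inv_SS_bound i).
  rewrite ln_mult by (try apply INR_S_pos; lra).
  unfold Rminus; ring.
Qed.

Lemma ldiff_bound (i : nat) : 0 <= ldiff i <= / INR (S i).
Proof.
  rewrite ldiff_ln; assert (H := INR_S_pos i).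
  assert (E : INR (S (S i)) = INR (S i) * (1 + / INR (S i))) by (rewrite (S_INR (S i)); field; lra).
  assert (Hi : 0 < / INR (S i)) by (apply Rinv_0_lt_compat, H).
  rewrite E, ln_mult by lra.
  assert (L1 : 0 < ln (1 + / INR (S i))) by (rewrite <- ln_1; apply ln_increasing; lra).
  assert (L2 := exp_ineq1_le (ln (1 + / INR (S i)))); rewrite exp_ln in L2 by lra.
  lra.
Qed.

Lemma cder_pw_0 (i : nat) : cder (pw i) (RtoC 0) (RtoC (- ln (INR (S i)))).
Proof.
  unfold pw; eapply cder_eq; [|apply (cder_comp (cpow (INR (S i))) (fun s => - s)%C);
    [apply cder_cpow | apply cder_opp, cder_id]].
  rewrite Copp_0, cpow_0, RtoC_opp; ring.
Qed.

Lemma cder_dw_0 (i : nat) : cder (dw i) (RtoC 0) (RtoC (ldiff i)).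
Proof.
  eapply cder_eq; [|apply cder_minus; apply cder_pw_0].
  rewrite ldiff_ln, !RtoC_minus, !RtoC_opp; ring.
Qed.

Lemma cder_csum (u : nat -> C -> C) (v : nat -> C) (n : nat) (z : C) :
  (forall j, (j < n)%nat -> cder (u j) z (v j)) -> cder (fun w => csum (fun j => u j w) n) z (csum v n).
Proof.
  induction n as [|n IH]; intro H; simpl; [apply cder_const|].
  apply (cder_plus (fun w => csum (fun j => u j w) n)); [apply IH; intros; apply H; lia | apply H; lia].
Qed.

(** The theorem asks for a real sum, whereas the limit is found as a complex number. *)
Lemma Ccv_real (a : nat -> R) (l : C) : Ccv (csum (fun i => RtoC (a i))) l ->
  is_series a (Re l) /\ l = RtoC (Re l).
Proof.
  intro H.
  assert (HN : forall eps, 0 < eps -> exists N, forall n, (N <= n)%nat -> Rabs (rsum a n - Re l) < eps /\ Rabs (Im l) < eps).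
  { intros eps Heps; destruct (H eps Heps) as [N HN]; exists N; intros n Hn; specialize (HN n Hn).
    rewrite csum_RtoC in HN; split.
    - eapply Rle_lt_trans; [|exact HN].
      change (rsum a n - Re l) with (Re (RtoC (rsum a n) - l)%C); apply re_le_Cmod.
    - eapply Rle_lt_trans; [|exact HN].
      replace (Rabs (Im l)) with (Rabs (Im (RtoC (rsum a n) - l)%C)); [apply im_le_Cmod|].
      rewrite <- (Rabs_Ropp (Im l)); f_equal; destruct l; simpl; ring. }
  split.
  - assert (Hs : is_lim_seq (sum_n a) (Re l)); [|exact Hs].
    apply is_lim_seq_ext with (fun n => rsum a (S n)); [intro n; symmetry; apply rsum_sum_n|].
    apply is_lim_seq_spec; intro eps; destruct (HN eps (cond_pos eps)) as [N H1].
    exists N; intros n Hn; apply H1; lia.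
  - apply injective_projections; [reflexivity|]; simpl.
    change (Im l = 0).
    destruct (Req_dec (Im l) 0) as [E|E]; [exact E|exfalso].
    destruct (HN (Rabs (Im l)) (Rabs_pos_lt _ E)) as [N H1].
    destruct (H1 N (le_n N)); lra.
Qed.

(** * Non-integer exponents *)

Lemma bounded_rise (K : R) (n : nat) (r : R) : 0 <= K ->
  exists B, forall s, Cmod s <= r -> K * Cmod (rise s n) <= B.
Proof.
  intro HK; exists (K * (r + INR n) ^ n); intros s Hs.
  apply Rmult_le_compat_l; [exact HK|].
  eapply Rle_trans; [apply rise_bound|]; apply pow_incr.
  generalize (Cmod_ge_0 s), (pos_INR n); lra.
Qed.

Section NonInteger.
Variables (alpha : R) (k : nat) (Cpsi delta : R).
Hypotheses (Hk : INR k < alpha < INR (S k)) (Hdelta : 0 < delta <= 1 / 2) (HCpsi : 0 <= Cpsi)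
  (Hpsi : forall M, Rabs (rsum (fun m => psi alpha (S (S m))) M) <= Cpsi * Rpower (INR (S M)) (1 - delta)).

Let J := S k.

Definition sumpsi (M : nat) : R := rsum (fun m => psi alpha (S (S m))) M.

(** n^alpha times what is left of (n-1)^(-s) - n^(-s) after J = ceil(alpha) terms of the expansion
    in 1/n. It is O(n^(alpha - Re s - J - 1)), summable for Re s > alpha - J. *)
Definition main_term (i : nat) (s : C) : C :=
  (cpow (INR (S (S i))) (RtoC alpha - s) * rho (S J) (- s) (- / INR (S (S i))))%C.

(* What remains of sum psi(n) dw after a summation by parts. *)
Definition psi_term (i : nat) (s : C) : C :=
  (RtoC (sumpsi (S i)) * (dw i s - dw (S i) s))%C.

(** The 1 is subtracted because the sum starts at n = 2. *)
Definition zeta_term (j : nat) (s : C) : C :=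
  (qcoef (S j) s * (zeta0 (s + RtoC (INR (S j) - alpha)) - 1))%C.

(** The constant is -1 + 1/2: the boundary term of [abel_Wsum], and the summand 1/2 of c(n) against
    the telescoping sum of [dw]. *)
Definition Znon (s : C) : C :=
  (- RtoC (1 / 2) + csum (fun j => zeta_term j s) J + CSeries (fun i => main_term i s) - CSeries (fun i => psi_term i s))%C.

Lemma alpha_pos : 0 < alpha.
Proof. generalize (pos_INR k); lra. Qed.

Lemma main_term_bound (b : R) (s : C) (i : nat) : alpha - INR J < b -> b <= Re s ->
  Cmod (main_term i s) <= Rpower 2 alpha * 2 ^ (S J) * Cmod (rise s (S J))
    * Rpower (INR (S i)) (- (b + (INR J + 1 - alpha))).
Proof.
  intros Hb Hs; assert (Ha := alpha_pos).
  unfold main_term; rewrite Cmod_mult, Cmod_cpow.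
  replace (Re (RtoC alpha - s)%C) with (alpha + - Re s) by (destruct s; simpl; ring).
  rewrite Rpower_plus, Rmult_assoc.
  assert (HJ := pos_INR J).
  destruct (scaled_rho_bound i (S J) s) as [B _]; [rewrite S_INR; lra|].
  assert (H1 : Rpower (INR (S (S i))) alpha <= Rpower 2 alpha * Rpower (INR (S i)) alpha).
  { rewrite Rpower_mult_distr by (try apply INR_S_pos; lra); apply Rle_Rpower_l; [lra|].
    split; [apply INR_S_pos | rewrite (S_INR (S i)); generalize (INR_S_ge_1 i); lra]. }
  eapply Rle_trans; [apply Rmult_le_compat; [apply Rlt_le, Rpower_pos | | exact H1 | exact B]|].
  { apply Rmult_le_pos; [apply Rlt_le, Rpower_pos | apply Cmod_ge_0]. }
  replace (Rpower 2 alpha * Rpower (INR (S i)) alpha * (2 ^ S J * Cmod (rise s (S J)) *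
     Rpower (INR (S i)) (- (Re s + INR (S J))))) with
    (Rpower 2 alpha * 2 ^ S J * Cmod (rise s (S J)) *
      (Rpower (INR (S i)) alpha * Rpower (INR (S i)) (- (Re s + INR (S J))))) by ring.
  rewrite <- Rpower_plus.
  apply Rmult_le_compat_l.
  - apply Rmult_le_pos; [apply Rmult_le_pos; [apply Rlt_le, Rpower_pos | apply pow_le; lra] | apply Cmod_ge_0].
  - apply Rpower_le_exp; [apply INR_S_ge_1 | rewrite (S_INR J); lra].
Qed.

Lemma sumpsi_bound (i : nat) : Rabs (sumpsi (S i)) <= 2 * Cpsi * Rpower (INR (S i)) (1 - delta).
Proof.
  eapply Rle_trans; [apply Hpsi|].
  replace (2 * Cpsi * Rpower (INR (S i)) (1 - delta)) with (Cpsi * (2 * Rpower (INR (S i)) (1 - delta))) by ring.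
  apply Rmult_le_compat_l; [exact HCpsi|].
  apply Rle_trans with (Rpower 2 (1 - delta) * Rpower (INR (S i)) (1 - delta)).
  - rewrite Rpower_mult_distr by (try apply INR_S_pos; lra); apply Rle_Rpower_l; [lra|].
    split; [apply INR_S_pos | rewrite (S_INR (S i)); generalize (INR_S_ge_1 i); lra].
  - apply Rmult_le_compat_r; [apply Rlt_le, Rpower_pos|].
    rewrite <- (Rpower_1 2) at 2 by lra; apply Rpower_le_exp; lra.
Qed.

Lemma psi_term_bound (b : R) (s : C) (i : nat) : - delta < b -> b <= Re s ->
  Cmod (psi_term i s) <= 16 * Cpsi * Cmod (rise s 2) * Rpower (INR (S i)) (- (b + (1 + delta))).
Proof.
  intros Hb Hs; unfold psi_term; rewrite Cmod_mult, Cmod_R.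
  assert (B1 := sumpsi_bound i). assert (B2 := ddw_bound i s ltac:(lra)).
  eapply Rle_trans; [apply Rmult_le_compat; [apply Rabs_pos | apply Cmod_ge_0 | exact B1 | exact B2]|].
  replace (2 * Cpsi * Rpower (INR (S i)) (1 - delta) * (8 * Cmod (rise s 2) * Rpower (INR (S i)) (- (Re s + 2))))
    with (16 * Cpsi * Cmod (rise s 2) * (Rpower (INR (S i)) (1 - delta) * Rpower (INR (S i)) (- (Re s + 2)))) by ring.
  rewrite <- Rpower_plus; apply Rmult_le_compat_l.
  - apply Rmult_le_pos; [lra | apply Cmod_ge_0].
  - apply Rpower_le_exp; [apply INR_S_ge_1 | lra].
Qed.

Lemma cdiff_main_term (i : nat) (s : C) : cdiff (main_term i) s.
Proof.
  apply (cdiff_mult (fun s => cpow (INR (S (S i))) (RtoC alpha - s))).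
  - apply (cdiff_cpow _ (fun s => RtoC alpha - s)%C), cdiff_minus; [apply cdiff_const | apply cdiff_id].
  - apply (cdiff_rho (S J) (fun s => - s)%C), cdiff_opp, cdiff_id.
Qed.

Lemma cdiff_psi_term (i : nat) (s : C) : cdiff (psi_term i) s.
Proof.
  apply (cdiff_mult (fun _ => RtoC (sumpsi (S i)))); [apply cdiff_const|].
  apply cdiff_minus; apply cdiff_dw.
Qed.

Lemma main_term_family (s : C) : alpha - INR J < Re s ->
  Ccv (csum (fun i => main_term i s)) (CSeries (fun i => main_term i s)) /\
  (forall i, cder (main_term i) s (C_derive (main_term i) s)) /\
  Ccv (csum (fun i => C_derive (main_term i) s)) (CSeries (fun i => C_derive (main_term i) s)) /\
  cder (fun z => CSeries (fun i => main_term i z)) s (CSeries (fun i => C_derive (main_term i) s)).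
Proof.
  intro Hs.
  apply (series_family main_term (INR J + 1 - alpha) (alpha - INR J)
    (fun s => Rpower 2 alpha * 2 ^ (S J) * Cmod (rise s (S J)))); try assumption.
  - apply cdiff_main_term.
  - intros; apply main_term_bound; assumption.
  - lra.
  - intro r; apply (bounded_rise (Rpower 2 alpha * 2 ^ S J)).
    apply Rmult_le_pos; [apply Rlt_le, Rpower_pos | apply pow_le; lra].
Qed.

Lemma psi_term_family (s : C) : - delta < Re s ->
  Ccv (csum (fun i => psi_term i s)) (CSeries (fun i => psi_term i s)) /\
  (forall i, cder (psi_term i) s (C_derive (psi_term i) s)) /\
  Ccv (csum (fun i => C_derive (psi_term i) s)) (CSeries (fun i => C_derive (psi_term i) s)) /\
  cder (fun z => CSeries (fun i => psi_term i z)) s (CSeries (fun i => C_derive (psi_term i) s)).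
Proof.
  intro Hs.
  apply (series_family psi_term (1 + delta) (- delta)
    (fun s => 16 * Cpsi * Cmod (rise s 2))); try assumption.
  - apply cdiff_psi_term.
  - intros; apply psi_term_bound; assumption.
  - lra.
  - intro r; apply (bounded_rise (16 * Cpsi)); lra.
Qed.

Lemma power_dw_expansion (i : nat) (s : C) :
  (RtoC (Rpower (INR (S (S i))) alpha) * dw i s)%C =
  (csum (fun j => qcoef (S j) s * cpow (INR (S (S i))) (- (s + RtoC (INR (S j) - alpha)))) J + main_term i s)%C.
Proof.
  rewrite dw_rho; unfold main_term.
  set (n := INR (S (S i))). assert (Hn : 0 < n) by apply INR_S_pos.
  assert (E : rho 1 (- s) (- / n) = (csum (fun j => qcoef (S j) s * RtoC ((/ n) ^ (S j))) J + rho (S J) (- s) (- / n))%C).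
  { unfold rho; rewrite (csum_shift _ J), (csum_ext (fun j => cbin (- s) (S j) * RtoC ((- / n) ^ S j))%C
      (fun j => qcoef (S j) s * RtoC ((/ n) ^ (S j)))%C).
    - cbn [csum]; rewrite cbin_0; cbn [pow]; ring.
    - intros j _; apply cbin_opp. }
  rewrite E, <- cpow_real.
  replace (cpow n (RtoC alpha - s)) with (cpow n (RtoC alpha) * cpow n (- s))%C
    by (rewrite <- cpow_add; f_equal).
  rewrite (csum_ext (fun j => qcoef (S j) s * cpow n (- (s + RtoC (INR (S j) - alpha))))%C
    (fun j => (cpow n (RtoC alpha) * cpow n (- s)) * (qcoef (S j) s * RtoC ((/ n) ^ (S j))))%C).
  - rewrite csum_scal; ring.
  - intros j _.
    replace (- (s + RtoC (INR (S j) - alpha)))%C with ((RtoC alpha + - s) - RtoC (INR (S j)))%C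
      by (rewrite RtoC_minus; ring).
    rewrite <- cpow_shift_nat, cpow_add by exact Hn; ring.
Qed.

Lemma ceil_pow_psi (i : nat) :
  INR (ceil_pow alpha (S (S i))) = Rpower (INR (S (S i))) alpha + 1 / 2 - psi alpha (S (S i)).
Proof. rewrite INR_ceil_pow; unfold psi; ring. Qed.

Lemma sumpsi_dw_lim (s : C) : 0 < Re s -> Ccv (fun M => RtoC (sumpsi M) * dw M s)%C (RtoC 0).
Proof.
  intro Hs.
  apply Ccv_squeeze with (fun n => Cpsi * (2 * Cmod s) * Rpower (INR (S n)) (- (Re s + delta))).
  - intro n; replace (RtoC (sumpsi n) * dw n s - RtoC 0)%C with (RtoC (sumpsi n) * dw n s)%C by ring.
    rewrite Cmod_mult, Cmod_R.
    eapply Rle_trans; [apply Rmult_le_compat; [apply Rabs_pos | apply Cmod_ge_0 | apply Hpsi | apply dw_bound; lra]|].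
    right; replace (- (Re s + delta)) with ((1 - delta) + - (Re s + 1)) by ring.
    rewrite Rpower_plus; ring.
  - replace (Finite 0) with (Rbar_mult (Cpsi * (2 * Cmod s)) 0) by (simpl; f_equal; ring).
    apply is_lim_seq_scal_l, Rpower_neg_lim; lra.
Qed.

Lemma Wsum_Znon (s : C) : alpha < Re s -> Ccv (Wsum alpha s) (Znon s).
Proof.
  intro Hs; assert (Ha := alpha_pos).
  (* Both summations by parts with cutoff M; each piece now has its own limit, and the boundary
     terms at M tend to 0. *)
  apply Ccv_ext with (fun M => RtoC (INR (ceil_pow alpha (S M))) * pw M s - 1
    + (csum (fun j => qcoef (S j) s * (csum (fun i => cpow (INR (S i)) (- (s + RtoC (INR (S j) - alpha)))) (S M) - 1)) J
       + csum (fun i => main_term i s) M) + RtoC (1 / 2) * (1 - pw M s)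
    - (RtoC (sumpsi M) * dw M s + csum (fun i => psi_term i s) M))%C.
  { intro M; rewrite abel_Wsum.
    rewrite (csum_ext (fun i => RtoC (INR (ceil_pow alpha (S (S i)))) * dw i s)%C
      (fun i => (RtoC (Rpower (INR (S (S i))) alpha) * dw i s + RtoC (1 / 2) * dw i s)
        + (- RtoC 1) * (RtoC (psi alpha (S (S i))) * dw i s))%C).
    2:{ intros i _; rewrite ceil_pow_psi, RtoC_minus, RtoC_plus; ring. }
    rewrite !csum_plus, !csum_scal, csum_dw, (abel_psi (fun m => psi alpha (S (S m)))).
    rewrite (csum_ext (fun i => RtoC (Rpower (INR (S (S i))) alpha) * dw i s)%C _ M (fun i _ => power_dw_expansion i s)).
    rewrite csum_plus, csum_exchange.
    rewrite (csum_ext (fun j => csum (fun i => qcoef (S j) s * cpow (INR (S (S i))) (- (s + RtoC (INR (S j) - alpha))))%C M)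
      (fun j => qcoef (S j) s * (csum (fun i => cpow (INR (S i)) (- (s + RtoC (INR (S j) - alpha)))) (S M) - 1))%C J).
    2:{ intros j _; rewrite csum_scal, csum_Dir_tail; reflexivity. }
    unfold psi_term, sumpsi; ring. }
  replace (Znon s) with ((RtoC 0 - 1) + (csum (fun j => zeta_term j s) J + CSeries (fun i => main_term i s))
    + RtoC (1 / 2) * (1 - RtoC 0) - (RtoC 0 + CSeries (fun i => psi_term i s)))%C.
  2:{ unfold Znon. replace (RtoC 1) with (RtoC (1 / 2) + RtoC (1 / 2))%C at 1 by (rewrite <- RtoC_plus; f_equal; lra). ring. }
  apply Ccv_minus; [apply Ccv_plus; [apply Ccv_plus; [apply Ccv_minus; [|apply Ccv_const]|apply Ccv_plus]|]|].
  - apply Ccv_squeeze with (fun n => (Rpower 2 alpha + 1) * Rpower (INR (S n)) (- (Re s - alpha))).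
    + intro n; eapply Rle_trans; [|apply boundary_term_bound, Ha].
      replace (RtoC (INR (ceil_pow alpha (S n))) * pw n s - RtoC 0)%C with (RtoC (INR (ceil_pow alpha (S n))) * pw n s)%C by ring.
      rewrite !Cmod_mult, !Cmod_R, !Rabs_pos_eq by apply pos_INR.
      apply Rmult_le_compat_r; [apply Cmod_ge_0|].
      apply le_INR, ceil_pow_mono; [exact Ha | lia].
    + replace (Finite 0) with (Rbar_mult (Rpower 2 alpha + 1) 0) by (simpl; f_equal; ring).
      apply is_lim_seq_scal_l, Rpower_neg_lim; lra.
  - apply (csum_csum_Ccv (fun j M => qcoef (S j) s *
      (csum (fun i => cpow (INR (S i)) (- (s + RtoC (INR (S j) - alpha)))) (S M) - 1))%C).
    intros j Hj; unfold zeta_term; apply Ccv_scal, Ccv_minus; [|apply Ccv_const].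
    assert (Hre : 1 < Re (s + RtoC (INR (S j) - alpha))%C).
    { replace (Re (s + RtoC (INR (S j) - alpha))%C) with (Re s + (INR (S j) - alpha)) by (destruct s; reflexivity).
      generalize (INR_S_ge_1 j); lra. }
    rewrite zeta0_Dir by exact Hre.
    apply (Ccv_ext (fun M => csum (fun i => cpow (INR (S i)) (- (s + RtoC (INR (S j) - alpha)))) (M + 1)%nat)).
    { intro n; f_equal; lia. }
    apply (Ccv_shift (csum (fun i => cpow (INR (S i)) (- (s + RtoC (INR (S j) - alpha)))))), Dir_correct, Hre.
  - apply main_term_family; unfold J in *; lra.
  - apply Ccv_scal, Ccv_minus; [apply Ccv_const | apply pw_lim; lra].
  - apply Ccv_plus; [apply sumpsi_dw_lim; lra | apply psi_term_family; lra].
Qed.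

Lemma cdiff_zeta_term (j : nat) (s : C) : s <> RtoC (alpha - INR j) -> cdiff (zeta_term j) s.
Proof.
  intro Hs; apply (cdiff_mult (qcoef (S j))); [apply cdiff_qcoef|].
  apply cdiff_minus; [|apply cdiff_const].
  apply (cdiff_comp zeta0 (fun s => s + RtoC (INR (S j) - alpha))%C).
  - apply cdiff_zeta0; intro E; apply Hs.
    replace s with ((s + RtoC (INR (S j) - alpha)) - RtoC (INR (S j) - alpha))%C by ring.
    rewrite E, <- RtoC_minus, S_INR; f_equal; ring.
  - apply cdiff_plus; [apply cdiff_id | apply cdiff_const].
Qed.

Lemma cdiff_Znon (s : C) : - delta < Re s -> alpha - INR J < Re s ->
  (forall h, (h < J)%nat -> s <> RtoC (alpha - INR h)) -> cdiff Znon s.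
Proof.
  intros H1 H2 H3; unfold Znon.
  apply cdiff_minus; [apply cdiff_plus; [apply cdiff_plus; [apply cdiff_const|]|]|].
  - apply (cdiff_csum zeta_term); intros j Hj; apply cdiff_zeta_term, H3, Hj.
  - eexists; apply main_term_family, H2.
  - eexists; apply psi_term_family, H1.
Qed.

(** At alpha - h only [zeta_term h] is singular, and its zeta factor is zeta(s - p + 1); everything
    else goes into the holomorphic part B. *)
Lemma pole_Znon (h : nat) : (h < J)%nat ->
  simple_pole_residue Znon (RtoC (alpha - INR h)) (RtoC (rff alpha (S h) / INR (fact (S h)))).
Proof.
  intro Hh.
  assert (HhR : INR h <= INR k) by (apply le_INR; unfold J in Hh; lia).
  set (p := alpha - INR h). assert (Hp : 0 < p) by (unfold p; lra).
  set (B := fun s => (- qcoef (S h) s + (- RtoC (1 / 2) + csum (fun j => if Nat.eq_dec j h then RtoC 0 else zeta_term j s) J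
     + CSeries (fun i => main_term i s) - CSeries (fun i => psi_term i s)))%C).
  (* The poles are at distance at least 1 from one another, so 1/2 excludes the others; p/2 keeps Re
     s > 0, where both series converge. *)
  set (r := Rmin (1 / 2) (p / 2)).
  assert (Hr : 0 < r /\ r <= 1 / 2 /\ r <= p / 2).
  { unfold r; repeat split; [apply Rmin_glb_lt; lra | apply Rmin_l | apply Rmin_r]. }
  assert (Hre : forall s, Cmod (s - RtoC p) < r -> p / 2 <= Re s).
  { intros s Hs; assert (H := re_le_Cmod (s - RtoC p)%C).
    replace (Re (s - RtoC p)%C) with (Re s - p) in H by (destruct s; reflexivity).
    apply Rabs_le_between in H; lra. }
  apply (simple_pole_of_zeta0 Znon (qcoef (S h)) B (RtoC p) _ r).
  - lra.
  - intros s _; unfold Znon, B; rewrite (csum_split (fun j => zeta_term j s) J h Hh).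
    unfold zeta_term at 1.
    replace (s + RtoC (INR (S h) - alpha))%C with (s - RtoC p + 1)%C.
    2:{ unfold p; rewrite S_INR, !RtoC_minus, RtoC_plus; ring. }
    ring.
  - intro s; apply cdiff_qcoef.
  - intros s Hs; specialize (Hre s Hs); unfold B.
    apply cdiff_plus; [apply cdiff_opp, cdiff_qcoef|].
    apply cdiff_minus; [apply cdiff_plus; [apply cdiff_plus; [apply cdiff_const|]|]|].
    + apply (cdiff_csum (fun j s => if Nat.eq_dec j h then RtoC 0 else zeta_term j s)); intros j Hj.
      destruct (Nat.eq_dec j h) as [E|E]; [apply cdiff_const|].
      apply cdiff_zeta_term; intro Es; rewrite Es in Hs.
      rewrite <- RtoC_minus, Cmod_R in Hs; unfold p in Hs.
      replace (alpha - INR j - (alpha - INR h)) with (INR h - INR j) in Hs by ring.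
      apply Rabs_def2 in Hs.
      destruct (lt_dec j h) as [Hl|Hl].
      * assert (H : INR (S j) <= INR h) by (apply le_INR; lia); rewrite S_INR in H; lra.
      * assert (H : INR (S h) <= INR j) by (apply le_INR; lia); rewrite S_INR in H; lra.
    + eexists; apply main_term_family; unfold J; lra.
    + eexists; apply psi_term_family; lra.
  - unfold qcoef, p; rewrite rise_rff, RtoC_div by apply INR_fact_neq_0; reflexivity.
  - intro E; apply RtoC_inj in E.
    assert (0 < rff alpha (S h) / INR (fact (S h))); [|lra].
    apply Rdiv_lt_0_compat; [|apply INR_fact_lt_0].
    apply rff_pos; rewrite S_INR; lra.
Qed.

(** In [zeta_term n] the coefficient is O(|s| (|s|+1)^n), and zeta, taken where the real part is at
    least eps - (k - n), has degree k - n + 1. The total degree does not depend on n. *)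
Lemma Znon_growth (eps : R) : 0 < eps ->
  exists K, forall s, eps - Rmin delta (INR J - alpha) <= Re s -> 1 <= Rabs (Im s) ->
    Cmod (Znon s) <= K * (Cmod s * (Cmod s + 1) ^ (k + 1)).
Proof.
  intro Heps; assert (Ha := alpha_pos).
  set (sg := Rmin delta (INR J - alpha)).
  assert (Hs1 : sg <= delta) by apply Rmin_l. assert (Hs2 : sg <= INR J - alpha) by apply Rmin_r.
  assert (HQ : forall n, (n <= J)%nat -> exists K, forall s, eps - sg <= Re s -> 1 <= Rabs (Im s) ->
    Cmod (csum (fun j => zeta_term j s) n) <= K * (Cmod s * (Cmod s + 1) ^ (k + 1))).
  { induction n as [|n IH]; intro Hn.
    - exists 0; intros s _ _; simpl csum; rewrite Cmod_0; lra.
    - destruct IH as [K1 H1]; [lia|].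
      destruct (zeta0_growth (k - n) eps Heps) as [K2 [HK2 H2]].
      set (A := INR (S n) ^ n). assert (HA : 0 <= A) by apply pow_le, pos_INR.
      set (m := INR (S (S n)) + alpha). assert (Hm : 0 <= m) by (unfold m; generalize (pos_INR (S (S n))); lra).
      set (D := m ^ (k - n + 1)). assert (HD : 0 <= D) by apply pow_le, Hm.
      exists (K1 + A * (K2 * D + 1)); intros s Hs Him; cbn [csum].
      specialize (H1 s Hs Him).
      eapply Rle_trans; [apply Cmod_triangle|].
      assert (Hc := Cmod_ge_0 s).
      set (w := (s + RtoC (INR (S n) - alpha))%C).
      assert (HwI : Im w = Im s) by (unfold w; destruct s; apply Rplus_0_r).
      assert (HwR : Re w = Re s + (INR (S n) - alpha)) by (unfold w; destruct s; reflexivity).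
      assert (Hz : Cmod (zeta0 w) <= K2 * (1 + Cmod w) ^ (k - n + 1)).
      { apply H2; [|rewrite HwI; exact Him].
        rewrite HwR, minus_INR by (unfold J in Hn; lia). unfold J in *; rewrite !S_INR in *; lra. }
      assert (Hw : 1 + Cmod w <= m * (Cmod s + 1)).
      { assert (T := Cmod_triangle s (RtoC (INR (S n) - alpha))); fold w in T; rewrite Cmod_R in T.
        assert (Rabs (INR (S n) - alpha) <= INR (S n) + alpha).
        { apply Rabs_le; generalize (pos_INR (S n)); lra. }
        unfold m; rewrite (S_INR (S n)); assert (P := pos_INR (S n)). nra. }
      assert (Hz2 : Cmod (zeta0 w - 1) <= (K2 * D + 1) * (Cmod s + 1) ^ (k - n + 1)).
      { unfold Cminus; eapply Rle_trans; [apply Cmod_triangle|]; rewrite Cmod_opp, Cmod_1.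
        assert (X1 : (1 + Cmod w) ^ (k - n + 1) <= D * (Cmod s + 1) ^ (k - n + 1)).
        { unfold D; rewrite <- Rpow_mult_distr; apply pow_incr; generalize (Cmod_ge_0 w); lra. }
        assert (X2 : 1 <= (Cmod s + 1) ^ (k - n + 1)) by (apply pow_R1_Rle; lra).
        apply (Rmult_le_compat_l K2) in X1; [lra | exact HK2]. }
      assert (Hq : Cmod (qcoef (S n) s) <= A * (Cmod s * (Cmod s + 1) ^ n)).
      { unfold qcoef; rewrite Cmod_div by apply fact_neq_C.
        assert (F := fact_INR_ge_1 (S n)); rewrite Cmod_R, Rabs_pos_eq by lra.
        apply Rle_trans with (Cmod (rise s (S n))); [|apply rise_growth].
        apply Rle_div_l; [lra|]; generalize (Cmod_ge_0 (rise s (S n))); nra. }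
      unfold zeta_term; fold w; rewrite Cmod_mult, Rmult_plus_distr_r.
      apply Rplus_le_compat; [exact H1|].
      eapply Rle_trans; [apply Rmult_le_compat; [apply Cmod_ge_0 | apply Cmod_ge_0 | exact Hq | exact Hz2]|].
      right; replace (k + 1)%nat with (n + (k - n + 1))%nat by (unfold J in Hn; lia).
      rewrite (pow_add _ n (k - n + 1)); ring. }
  destruct (HQ J (le_n _)) as [K1 H1].
  destruct (series_family_bound main_term (INR J + 1 - alpha) (alpha - INR J)
    (fun s => Rpower 2 alpha * 2 ^ (S J) * Cmod (rise s (S J))) (eps - sg)) as [K2 [HK2 H2]].
  { intros; apply main_term_bound; assumption. }
  { lra. }
  { lra. }
  destruct (series_family_bound psi_term (1 + delta) (- delta)
    (fun s => 16 * Cpsi * Cmod (rise s 2)) (eps - sg)) as [K3 [HK3 H3]].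
  { intros; apply psi_term_bound; assumption. }
  { lra. }
  { lra. }
  set (A2 := Rpower 2 alpha * 2 ^ (S J)).
  assert (HA2 : 0 <= A2) by (apply Rmult_le_pos; [apply Rlt_le, Rpower_pos | apply pow_le; lra]).
  exists (1 + K1 + K2 * (A2 * INR (S J) ^ J) + K3 * (16 * Cpsi * INR 2 ^ 1)).
  intros s Hs Him.
  specialize (H1 s Hs Him); specialize (H2 s Hs); specialize (H3 s Hs).
  set (Y := Cmod s * (Cmod s + 1) ^ (k + 1)) in *.
  assert (Hc : 1 <= Cmod s) by (eapply Rle_trans; [exact Him | apply im_le_Cmod]).
  assert (HY1 : 1 <= Y).
  { unfold Y; assert (1 <= (Cmod s + 1) ^ (k + 1)) by (apply pow_R1_Rle; lra). nra. }
  assert (R1 : Cmod (rise s (S J)) <= INR (S J) ^ J * Y).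
  { unfold Y; replace (k + 1)%nat with J by (unfold J; lia); apply rise_growth. }
  assert (R2 : Cmod (rise s 2) <= INR 2 ^ 1 * Y).
  { eapply Rle_trans; [apply rise_growth|]; apply Rmult_le_compat_l; [apply pow_le, pos_INR|].
    unfold Y; apply Rmult_le_compat_l; [lra|]; apply Rle_pow; [lra | lia]. }
  unfold Znon, Cminus.
  eapply Rle_trans; [apply Cmod_triangle|].
  eapply Rle_trans; [apply Rplus_le_compat_r, Cmod_triangle|].
  eapply Rle_trans; [apply Rplus_le_compat_r, Rplus_le_compat_r, Cmod_triangle|].
  rewrite !Cmod_opp, Cmod_R, Rabs_pos_eq by lra.
  assert (B2 : Cmod (CSeries (fun i => main_term i s)) <= K2 * (A2 * INR (S J) ^ J) * Y).
  { eapply Rle_trans; [exact H2|]; fold A2.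
    replace (K2 * (A2 * INR (S J) ^ J) * Y) with (K2 * (A2 * (INR (S J) ^ J * Y))) by ring.
    apply Rmult_le_compat_l; [exact HK2 | apply Rmult_le_compat_l; [exact HA2 | exact R1]]. }
  assert (B3 : Cmod (CSeries (fun i => psi_term i s)) <= K3 * (16 * Cpsi * INR 2 ^ 1) * Y).
  { eapply Rle_trans; [exact H3|].
    replace (K3 * (16 * Cpsi * INR 2 ^ 1) * Y) with (K3 * (16 * Cpsi * (INR 2 ^ 1 * Y))) by ring.
    apply Rmult_le_compat_l; [exact HK3 | apply Rmult_le_compat_l; [lra | exact R2]]. }
  lra.
Qed.

Lemma Znon_0 : Znon (RtoC 0) = (- RtoC (1 / 2))%C.
Proof.
  destruct (main_term_family (RtoC 0)) as [T _]; [unfold J; simpl Re; lra|].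
  destruct (psi_term_family (RtoC 0)) as [V _]; [simpl; lra|].
  assert (E1 : CSeries (fun i => main_term i (RtoC 0)) = RtoC 0).
  { apply (Ccv_unique _ _ _ T), Ccv_ext with (fun _ => RtoC 0); [|apply Ccv_const].
    intro n; rewrite (csum_ext _ (fun _ => RtoC 0)), csum_zero; [reflexivity|].
    intros i _; unfold main_term, rho.
    rewrite (csum_shift _ J), (csum_ext _ (fun _ => RtoC 0)), csum_zero.
    - rewrite Copp_0, cpow_0, cbin_0; cbn [pow]; ring.
    - intros j _; rewrite cbin_opp, qcoef_0; ring. }
  assert (E2 : CSeries (fun i => psi_term i (RtoC 0)) = RtoC 0).
  { apply (Ccv_unique _ _ _ V), Ccv_ext with (fun _ => RtoC 0); [|apply Ccv_const].
    intro n; rewrite (csum_ext _ (fun _ => RtoC 0)), csum_zero; [reflexivity|].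
    intros i _; unfold psi_term, dw, pw; rewrite Copp_0, !cpow_0; ring. }
  unfold Znon; rewrite E1, E2, (csum_ext _ (fun _ => RtoC 0)), csum_zero; [ring|].
  intros j _; unfold zeta_term; rewrite qcoef_0; ring.
Qed.

(** This is log E_J(x) with J = ceil(alpha). *)
Definition log_tail (x : R) : R := ln (1 - x) + rsum (fun j => x ^ (S j) / INR (S j)) J.

(** Factor [main_term] as n^(alpha - s) g(s). As g(0) = 0, only the derivative of g at 0 counts, and
    there the binomial coefficients become those of the logarithm. *)
Lemma cder_main_term_0 (i : nat) :
  cder (main_term i) (RtoC 0) (RtoC (- (Rpower (INR (S (S i))) alpha * log_tail (/ INR (S (S i)))))).
Proof.
  set (n := INR (S (S i))). assert (H := inv_SS_bound i). fold n in H.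
  set (g := fun s => (cpow (1 - / n) (- s) - 1 - csum (fun j => RtoC ((/ n) ^ S j) * qcoef (S j) s) J)%C).
  assert (Hg : cder g (RtoC 0) (RtoC (- log_tail (/ n)))).
  { unfold g; eapply cder_eq; [|apply cder_minus; [apply cder_minus; [|apply cder_const]|]].
    2:{ apply (cder_comp (cpow (1 - / n)) (fun s => - s)%C); [apply cder_cpow | apply cder_opp, cder_id]. }
    2:{ instantiate (1 := csum (fun j => RtoC ((/ n) ^ S j / INR (S j))) J).
        generalize J; intro m; induction m as [|m IH]; cbn [csum]; [apply cder_const|].
        apply cder_plus; [exact IH|].
        eapply cder_eq; [|apply cder_scal, cder_qcoef_0].
        rewrite RtoC_div; [reflexivity | apply not_0_INR; lia]. }
    rewrite Copp_0, cpow_0, csum_RtoC; unfold log_tail.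
    rewrite RtoC_opp, RtoC_plus; ring. }
  assert (Hg0 : g (RtoC 0) = RtoC 0).
  { unfold g; rewrite Copp_0, cpow_0, (csum_ext _ (fun _ => RtoC 0)), csum_zero; [ring|].
    intros j _; rewrite qcoef_0; ring. }
  apply cder_ext with (fun s => cpow n (RtoC alpha - s) * g s)%C.
  { intro s; unfold main_term, g, rho; fold n; f_equal.
    rewrite (csum_shift _ J), (csum_ext (fun j => cbin (- s) (S j) * RtoC ((- / n) ^ S j))%C
      (fun j => RtoC ((/ n) ^ S j) * qcoef (S j) s)%C).
    - rewrite cbin_0; cbn [pow]; unfold Rminus; ring.
    - intros j _; rewrite cbin_opp; ring. }
  assert (Hc : cdiff (fun s => cpow n (RtoC alpha - s)) (RtoC 0)).
  { apply (cdiff_cpow n (fun s => RtoC alpha - s)%C), cdiff_minus; [apply cdiff_const | apply cdiff_id]. }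
  destruct Hc as [l Hl].
  eapply cder_eq; [|apply (cder_mult (fun s => cpow n (RtoC alpha - s))); [exact Hl | exact Hg]].
  cbv beta; rewrite Hg0.
  replace (RtoC alpha - RtoC 0)%C with (RtoC alpha) by ring.
  rewrite cpow_real, !RtoC_opp, RtoC_mult; ring.
Qed.

Lemma cder_zeta_term_0 (j : nat) : (j < J)%nat ->
  cder (zeta_term j) (RtoC 0) ((zeta0 (RtoC (INR (S j) - alpha)) - 1) / RtoC (INR (S j)))%C.
Proof.
  intro Hj; unfold zeta_term.
  assert (Hc : cdiff (fun s => zeta0 (s + RtoC (INR (S j) - alpha)) - 1)%C (RtoC 0)).
  { apply cdiff_minus; [|apply cdiff_const].
    apply (cdiff_comp zeta0 (fun s => s + RtoC (INR (S j) - alpha))%C).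
    - apply cdiff_zeta0; rewrite Cplus_0_l; intro E; apply RtoC_inj in E.
      assert (INR j <= INR k) by (apply le_INR; unfold J in Hj; lia).
      rewrite S_INR in E; lra.
    - apply cdiff_plus; [apply cdiff_id | apply cdiff_const]. }
  destruct Hc as [l Hl].
  eapply cder_eq; [|apply (cder_mult (qcoef (S j))); [apply cder_qcoef_0 | exact Hl]].
  cbv beta; rewrite qcoef_0, Cplus_0_l; field; apply INR_S_neq_C.
Qed.

(** Termwise differentiation yields a series in the partial sums of psi. At s = 0 the second
    summation by parts is undone to recover psi itself; its boundary term [sumpsi M * ldiff M] is
    O(M^(-delta)). *)
Lemma is_derive_Znon_0 : exists L : R,
  is_series (fun i => - psi alpha (S (S i)) * ldiff i
    - Rpower (INR (S (S i))) alpha * log_tail (/ INR (S (S i)))) L /\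
  cder Znon (RtoC 0) (csum (fun j => (zeta0 (RtoC (INR (S j) - alpha)) - 1) / RtoC (INR (S j)))%C J + RtoC L)%C.
Proof.
  destruct (main_term_family (RtoC 0)) as [_ [T1 [T2 T3]]]; [unfold J; simpl Re; lra|].
  destruct (psi_term_family (RtoC 0)) as [_ [V1 [V2 V3]]]; [simpl; lra|].
  set (dT := CSeries (fun i => C_derive (main_term i) (RtoC 0))) in *.
  set (dV := CSeries (fun i => C_derive (psi_term i) (RtoC 0))) in *.
  assert (HV : Ccv (csum (fun i => RtoC (psi alpha (S (S i)) * ldiff i))) dV).
  { replace dV with (RtoC 0 + dV)%C by ring.
    apply Ccv_ext with (fun M => RtoC (sumpsi M * ldiff M) + csum (fun i => C_derive (psi_term i) (RtoC 0)) M)%C.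
    - assert (EV : forall i, C_derive (psi_term i) (RtoC 0) = RtoC (sumpsi (S i) * (ldiff i - ldiff (S i)))).
      { intro i; apply cder_C_derive; unfold psi_term.
        rewrite RtoC_mult, RtoC_minus; apply cder_scal, cder_minus; apply cder_dw_0. }
      induction n as [|n IH].
      + unfold sumpsi; simpl; rewrite Rmult_0_l; ring.
      + cbn [csum]; rewrite <- IH, EV; unfold sumpsi; cbn [rsum].
        rewrite !RtoC_mult, !RtoC_plus, RtoC_minus; ring.
    - apply Ccv_plus; [|exact V2].
      apply Ccv_squeeze with (fun n => Cpsi * Rpower (INR (S n)) (- delta)).
      + intro n; replace (RtoC (sumpsi n * ldiff n) - RtoC 0)%C with (RtoC (sumpsi n * ldiff n)) by ring.
        rewrite Cmod_R, Rabs_mult.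
        assert (L := ldiff_bound n). rewrite (Rabs_pos_eq (ldiff n)) by lra.
        eapply Rle_trans; [apply Rmult_le_compat; [apply Rabs_pos | lra | apply Hpsi | apply L]|].
        right; replace (- delta) with ((1 - delta) + - (1)) by ring.
        rewrite Rpower_plus, Rpower_Ropp, Rpower_1 by apply INR_S_pos; ring.
      + replace (Finite 0) with (Rbar_mult Cpsi 0) by (simpl; f_equal; ring).
        apply is_lim_seq_scal_l, Rpower_neg_lim; lra. }
  assert (HL : Ccv (csum (fun i => RtoC (- psi alpha (S (S i)) * ldiff i
    - Rpower (INR (S (S i))) alpha * log_tail (/ INR (S (S i)))))) (dT - dV)%C).
  { apply Ccv_ext with (fun M => csum (fun i => C_derive (main_term i) (RtoC 0)) M
      - csum (fun i => RtoC (psi alpha (S (S i)) * ldiff i)) M)%C; [|apply Ccv_minus; assumption].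
    induction n as [|n IH]; [simpl; ring|].
    cbn [csum]; rewrite <- IH, (cder_C_derive _ _ _ (cder_main_term_0 n)).
    rewrite !RtoC_minus, !RtoC_opp, !RtoC_mult, !RtoC_opp; ring. }
  destruct (Ccv_real _ _ HL) as [S1 S2].
  exists (Re (dT - dV)%C); split; [exact S1|].
  rewrite <- S2.
  replace (csum (fun j => (zeta0 (RtoC (INR (S j) - alpha)) - 1) / RtoC (INR (S j)))%C J + (dT - dV))%C
    with (RtoC 0 + csum (fun j => (zeta0 (RtoC (INR (S j) - alpha)) - 1) / RtoC (INR (S j)))%C J + dT - dV)%C by ring.
  unfold Znon; apply cder_minus; [apply cder_plus; [apply cder_plus; [apply cder_const|]|exact T3]|exact V3].
  apply (cder_csum zeta_term); intros j Hj; apply cder_zeta_term_0, Hj.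
Qed.

End NonInteger.

(** * Integer exponents *)

Lemma cff_real (a : R) (j : nat) : cff (RtoC a) j = RtoC (rff a j).
Proof.
  induction j as [|j IH]; [reflexivity|].
  simpl; rewrite IH, RtoC_mult, RtoC_minus; reflexivity.
Qed.

Lemma rff_fact (a j : nat) : (j <= a)%nat -> rff (INR a) j * INR (fact (a - j)) = INR (fact a).
Proof.
  induction j as [|j IH]; intro Hj; [rewrite Nat.sub_0_r; simpl; ring|].
  rewrite <- IH by lia; cbn [rff].
  replace (a - j)%nat with (S (a - S j)) by lia.
  rewrite fact_simpl, mult_INR.
  replace (INR (S (a - S j))) with (INR a - INR j); [ring|].
  rewrite <- minus_INR by lia; f_equal; lia.
Qed.

Lemma binom_rff (a j : nat) : (j <= a)%nat -> Binomial.C a j = rff (INR a) j / INR (fact j).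
Proof.
  intro Hj; unfold Binomial.C; rewrite <- (rff_fact a j Hj); field.
  split; apply INR_fact_neq_0.
Qed.

Lemma binom_sym (a j : nat) : (j <= a)%nat -> Binomial.C a (a - j) = Binomial.C a j.
Proof.
  intro Hj; unfold Binomial.C; replace (a - (a - j))%nat with j by lia.
  rewrite (Rmult_comm (INR (fact (a - j)))); reflexivity.
Qed.

Lemma binom_diag (a : nat) : Binomial.C a a = 1.
Proof. unfold Binomial.C; rewrite Nat.sub_diag; simpl; field; apply INR_fact_neq_0. Qed.

Lemma cbin_binom (a j : nat) : (j <= a)%nat -> cbin (RtoC (INR a)) j = RtoC (Binomial.C a j).
Proof.
  intro Hj; unfold cbin; rewrite cff_real, binom_rff by exact Hj.
  rewrite RtoC_div by apply INR_fact_neq_0; reflexivity.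
Qed.

Lemma cbin_beyond (a : nat) : cbin (RtoC (INR a)) (S a) = RtoC 0.
Proof. unfold cbin; cbn [cff]; unfold Cdiv; ring. Qed.

Lemma binomial_rsum (a : nat) (x : R) : (1 + x) ^ a = rsum (fun j => Binomial.C a j * x ^ j) (S a).
Proof.
  rewrite Rplus_comm, binomial.
  rewrite <- sum_n_Reals, rsum_sum_n; apply rsum_ext; intros j _; rewrite pow1; ring.
Qed.

(** The binomial series ends at order a. One further coefficient, which is 0, is included to match
    the order that [Rem_nat] meets. *)
Lemma rho_nat (a : nat) (x : R) : 0 < 1 + x -> rho (S (S a)) (RtoC (INR a)) x = RtoC 0.
Proof.
  intro Hx; unfold rho; rewrite cpow_real, Rpower_pow, binomial_rsum by exact Hx.
  change (csum ?f (S (S a))) with (csum f (S a) + f (S a))%C.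
  cbv beta; rewrite cbin_beyond, <- csum_RtoC.
  rewrite (csum_ext (fun j => cbin (RtoC (INR a)) j * RtoC (x ^ j))%C (fun j => RtoC (Binomial.C a j * x ^ j))).
  - ring.
  - intros j Hj; rewrite cbin_binom, RtoC_mult by lia; reflexivity.
Qed.

Lemma csum_rev (f : nat -> C) (n : nat) : csum f n = csum (fun i => f (n - 1 - i)%nat) n.
Proof.
  induction n as [|n IH]; [reflexivity|].
  rewrite (csum_shift (fun i => f (S n - 1 - i)%nat)); cbn [csum]; rewrite IH.
  replace (S n - 1 - 0)%nat with n by lia.
  rewrite (csum_ext (fun k => f (S n - 1 - S k)%nat) (fun i => f (n - 1 - i)%nat)); [ring|].
  intros k Hk; f_equal; lia.
Qed.

Lemma xi_zeta0 (w : C) : w <> RtoC 1 -> xi w = ((w - 1) * zeta0 w)%C.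
Proof. intro H; unfold zeta0; field; apply Cminus_eq_contra, H. Qed.

Lemma Rem_nat (b : nat) : Rem (b + 3) (RtoC (1 - INR (S b))) = RtoC 0.
Proof.
  assert (HA : (1 - RtoC (1 - INR (S b)))%C = RtoC (INR (S b))) by (rewrite <- RtoC_minus; f_equal; ring).
  apply (Ccv_unique (csum (rem_term (b + 3) (RtoC (1 - INR (S b)))))).
  - apply (Rem_correct (b + 3) _ (1 - INR (S b))); [rewrite plus_INR, (S_INR b); simpl (INR 3); lra | apply Rle_refl].
  - apply Ccv_ext with (fun _ => RtoC 0); [|apply Ccv_const].
    intro n; rewrite (csum_ext _ (fun _ => RtoC 0)), csum_zero; [reflexivity|].
    intros i _; unfold rem_term; rewrite HA.
    replace (b + 3)%nat with (S (S (S b))) by lia.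
    rewrite rho_nat; [ring|].
    generalize (Rinv_0_lt_compat _ (INR_S_pos i)); lra.
Qed.

Section Integer.
Variable b : nat.
Let a := S b.
Let alpha := INR a.

(** For integer alpha = a the base m occurs (m+1)^a - m^a times; the binomial theorem makes each
    power m^h shift zeta by h. *)
Definition Zint (s : C) : C :=
  csum (fun h => RtoC (Binomial.C a h) * zeta0 (s - RtoC (INR h)))%C a.

Lemma ceil_pow_nat (m : nat) : (1 <= m)%nat -> ceil_pow alpha m = (m ^ a)%nat.
Proof.
  intro Hm.
  assert (E : Rpower (INR m) alpha = INR (m ^ a)).
  { unfold alpha; rewrite Rpower_pow by (apply lt_0_INR; lia); symmetry; apply pow_INR. }
  assert (H1 : (ceil_pow alpha m <= m ^ a)%nat) by (apply ceil_pow_le_iff; rewrite E; lra).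
  assert (H2 : (m ^ a <= ceil_pow alpha m)%nat) by (apply INR_le; rewrite <- E; apply ceil_pow_bounds).
  lia.
Qed.

Lemma Wsum_Zint (s : C) : alpha < Re s -> Ccv (Wsum alpha s) (Zint s).
Proof.
  intro Hs.
  apply Ccv_ext with (fun M => csum (fun h => RtoC (Binomial.C a h)
    * csum (fun i => cpow (INR (S i)) (- (s - RtoC (INR h)))) M)%C a).
  - intro M; unfold Wsum.
    rewrite (csum_ext (fun h => RtoC (Binomial.C a h) * csum (fun i => cpow (INR (S i)) (- (s - RtoC (INR h)))) M)%C
      (fun h => csum (fun i => RtoC (Binomial.C a h) * cpow (INR (S i)) (- (s - RtoC (INR h))))%C M)).
    2:{ intros h _; rewrite csum_scal; reflexivity. }
    rewrite csum_exchange; apply csum_ext; intros i _.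
    rewrite !ceil_pow_nat by lia; rewrite !pow_INR.
    assert (Hp := INR_S_pos i).
    rewrite (S_INR (S i)), (Rplus_comm (INR (S i)) 1), binomial_rsum; cbn [rsum]; rewrite binom_diag.
    replace (rsum (fun j => Binomial.C a j * INR (S i) ^ j) a + 1 * INR (S i) ^ a - INR (S i) ^ a)
      with (rsum (fun j => Binomial.C a j * INR (S i) ^ j) a) by ring.
    rewrite <- csum_RtoC, <- csum_scal; apply csum_ext; intros h _.
    replace (- (s - RtoC (INR h)))%C with (- s + RtoC (INR h))%C by ring.
    rewrite cpow_add, cpow_real, Rpower_pow, RtoC_mult by exact Hp; ring.
  - unfold Zint; apply (csum_csum_Ccv (fun h M => RtoC (Binomial.C a h)
      * csum (fun i => cpow (INR (S i)) (- (s - RtoC (INR h)))) M)%C).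
    intros h Hh; apply Ccv_scal.
    assert (Hre : 1 < Re (s - RtoC (INR h))%C).
    { replace (Re (s - RtoC (INR h))%C) with (Re s - INR h) by (destruct s; reflexivity).
      assert (INR h + 1 <= alpha) by (unfold alpha; rewrite <- S_INR; apply le_INR; lia). lra. }
    rewrite zeta0_Dir by exact Hre; apply Dir_correct, Hre.
Qed.

Lemma cdiff_zeta0_shift (h : nat) (s : C) : s <> RtoC (1 + INR h) ->
  cdiff (fun s => RtoC (Binomial.C a h) * zeta0 (s - RtoC (INR h)))%C s.
Proof.
  intro Hs; apply (cdiff_mult (fun _ => RtoC (Binomial.C a h))); [apply cdiff_const|].
  apply (cdiff_comp zeta0 (fun s => s - RtoC (INR h))%C).
  - apply cdiff_zeta0; intro E; apply Hs.
    replace s with ((s - RtoC (INR h)) + RtoC (INR h))%C by ring; rewrite E, <- RtoC_plus; reflexivity.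
  - apply cdiff_minus; [apply cdiff_id | apply cdiff_const].
Qed.

Lemma cdiff_Zint (s : C) : (forall h, (h < a)%nat -> s <> RtoC (alpha - INR h)) -> cdiff Zint s.
Proof.
  intro H; apply (cdiff_csum (fun h s => RtoC (Binomial.C a h) * zeta0 (s - RtoC (INR h)))%C).
  intros h Hh; apply cdiff_zeta0_shift.
  replace (1 + INR h) with (alpha - INR (a - 1 - h)); [apply H; lia|].
  unfold alpha; rewrite <- minus_INR by lia.
  replace (a - (a - 1 - h))%nat with (S h) by lia; rewrite S_INR; ring.
Qed.

Lemma pole_Zint (h : nat) : (h < a)%nat ->
  simple_pole_residue Zint (RtoC (alpha - INR h)) (RtoC (rff alpha (S h) / INR (fact (S h)))).
Proof.
  (* The summand zeta0(s - g) has its pole at 1 + g = alpha - h; its coefficient C(a, g) equals C(a,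
     h+1) by symmetry. *)
  intro Hh; set (g := (a - 1 - h)%nat).
  assert (Eg : alpha - INR h = 1 + INR g).
  { unfold alpha, g; rewrite <- minus_INR by lia.
    replace (a - h)%nat with (S (a - 1 - h)) by lia; rewrite S_INR; ring. }
  set (B := fun s => csum (fun j => if Nat.eq_dec j g then RtoC 0
     else RtoC (Binomial.C a j) * zeta0 (s - RtoC (INR j)))%C a).
  apply (simple_pole_of_zeta0 Zint (fun _ => RtoC (Binomial.C a g)) B _ _ (1 / 2)).
  - lra.
  - intros s _; unfold Zint; rewrite (csum_split _ a g) by (unfold g; lia).
    unfold B; do 3 f_equal; rewrite Eg, RtoC_plus; ring.
  - intro s; apply cdiff_const.
  - intros s Hs; apply (cdiff_csum (fun j s => if Nat.eq_dec j g then RtoC 0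
     else RtoC (Binomial.C a j) * zeta0 (s - RtoC (INR j)))%C).
    intros j Hj; destruct (Nat.eq_dec j g) as [E|E]; [apply cdiff_const|].
    apply cdiff_zeta0_shift; intro Es; rewrite Es, Eg, <- RtoC_minus, Cmod_R in Hs.
    replace (1 + INR j - (1 + INR g)) with (INR j - INR g) in Hs by ring.
    apply Rabs_def2 in Hs.
    destruct (lt_dec j g) as [Hl|Hl].
    + assert (H : INR (S j) <= INR g) by (apply le_INR; lia); rewrite S_INR in H; lra.
    + assert (H : INR (S g) <= INR j) by (apply le_INR; lia); rewrite S_INR in H; lra.
  - unfold alpha; rewrite <- binom_rff by lia; f_equal.
    replace g with (a - S h)%nat by (unfold g; lia); apply binom_sym; lia.
  - intro E; apply RtoC_inj in E.
    assert (0 < rff alpha (S h) / INR (fact (S h))); [|lra].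
    apply Rdiv_lt_0_compat; [|apply INR_fact_lt_0].
    apply rff_pos; rewrite S_INR.
    assert (INR h + 1 <= alpha) by (unfold alpha; rewrite <- S_INR; apply le_INR; lia). lra.
Qed.

(** The shift by n moves the real part to at least eps - (n + 1), so zeta has degree at most n + 2
    <= a + 1; the extra factor |s| is at least 1. *)
Lemma Zint_growth (eps : R) : 0 < eps ->
  exists K, forall s, eps - 1 <= Re s -> 1 <= Rabs (Im s) ->
    Cmod (Zint s) <= K * (Cmod s * (Cmod s + 1) ^ (a + 1)).
Proof.
  intro Heps.
  assert (HQ : forall n, (n <= a)%nat -> exists K, forall s, eps - 1 <= Re s -> 1 <= Rabs (Im s) ->
    Cmod (csum (fun h => RtoC (Binomial.C a h) * zeta0 (s - RtoC (INR h)))%C n)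
      <= K * (Cmod s * (Cmod s + 1) ^ (a + 1))).
  { induction n as [|n IH]; intro Hn.
    - exists 0; intros s _ _; simpl csum; rewrite Cmod_0; lra.
    - destruct IH as [K1 H1]; [lia|].
      destruct (zeta0_growth (S n) eps Heps) as [K2 [HK2 H2]].
      set (A := Rabs (Binomial.C a n)). assert (HA : 0 <= A) by apply Rabs_pos.
      set (D := INR (S n) ^ (S n + 1)). assert (HD : 0 <= D) by apply pow_le, pos_INR.
      exists (K1 + A * (K2 * D)); intros s Hs Him; cbn [csum].
      specialize (H1 s Hs Him).
      eapply Rle_trans; [apply Cmod_triangle|].
      assert (Hc : 1 <= Cmod s) by (eapply Rle_trans; [exact Him | apply im_le_Cmod]).
      set (w := (s - RtoC (INR n))%C).
      assert (HwI : Im w = Im s) by (unfold w; destruct s; simpl; ring).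
      assert (HwR : Re w = Re s - INR n) by (unfold w; destruct s; reflexivity).
      assert (Hz : Cmod (zeta0 w) <= K2 * (1 + Cmod w) ^ (S n + 1)).
      { apply H2; [rewrite HwR, S_INR; lra | rewrite HwI; exact Him]. }
      assert (Hw : 1 + Cmod w <= INR (S n) * (Cmod s + 1)).
      { assert (T := Cmod_triangle s (- RtoC (INR n))); rewrite Cmod_opp, Cmod_R, Rabs_pos_eq in T by apply pos_INR.
        unfold w, Cminus; rewrite S_INR; generalize (pos_INR n); nra. }
      assert (X1 : (1 + Cmod w) ^ (S n + 1) <= D * (Cmod s * (Cmod s + 1) ^ (a + 1))).
      { apply Rle_trans with (D * (Cmod s + 1) ^ (S n + 1)).
        - unfold D; rewrite <- Rpow_mult_distr; apply pow_incr; generalize (Cmod_ge_0 w); lra.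
        - apply Rmult_le_compat_l; [exact HD|].
          apply Rle_trans with ((Cmod s + 1) ^ (a + 1)); [apply Rle_pow; [lra | lia]|].
          assert (0 <= (Cmod s + 1) ^ (a + 1)) by (apply pow_le; lra). nra. }
      rewrite Rmult_plus_distr_r; apply Rplus_le_compat; [exact H1|].
      rewrite Cmod_mult, Cmod_R; fold A.
      rewrite !Rmult_assoc; apply Rmult_le_compat_l; [exact HA|].
      eapply Rle_trans; [exact Hz|]; apply Rmult_le_compat_l; [exact HK2 | exact X1]. }
  exact (HQ a (le_n _)).
Qed.

(* [xi_rec] at w = 1 - a: the binomial series terminates and its last term is xi 1 = 1. *)
Lemma Zint_0 : Zint (RtoC 0) = RtoC (- (INR a / (INR a + 1))).
Proof.
  set (w := RtoC (1 - INR a)).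
  assert (HA : (1 - w)%C = RtoC (INR a)) by (unfold w; rewrite <- RtoC_minus; f_equal; ring).
  assert (Hw : forall i, (w + RtoC (INR i))%C = RtoC (1 - INR a + INR i)) by (intro i; unfold w; rewrite <- RtoC_plus; reflexivity).
  assert (E := xi_rec b w); rewrite HA in E.
  assert (Hc : - INR (S b) < Re w) by (change (Re w) with (1 - INR (S b)); lra).
  specialize (E Hc).
  assert (ER : Rem (b + 3) w = RtoC 0) by apply Rem_nat.
  rewrite ER in E; clear ER; cbn [csum] in E.
  replace (w + RtoC (INR (S b)))%C with (RtoC 1) in E by (rewrite Hw; unfold a; f_equal; ring).
  rewrite xi_1, (cbin_binom a (S b)), binom_diag in E by (unfold a; lia).
  (* The factor w + i + 1 - 1 in [xi] is absorbed by [cbin_S] into the next binomial coefficient,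
     which leaves values of zeta with the coefficients of [Zint] in reverse order. *)
  rewrite (csum_ext _ (fun i => - RtoC 1 * (cbin (RtoC (INR a)) (S (S i)) * zeta0 (w + RtoC (INR (S i)))))%C) in E.
  2:{ intros i Hi.
      assert (HiR : INR (S i) < INR a) by (apply lt_INR; unfold a; lia).
      rewrite xi_zeta0.
      2:{ rewrite Hw; intro E1; apply RtoC_inj in E1; lra. }
      replace (w + RtoC (INR (S i)) - 1)%C with (- (RtoC (INR a) - RtoC (INR (S i))))%C by (rewrite <- HA; ring).
      transitivity (- ((cbin (RtoC (INR a)) (S i) * (RtoC (INR a) - RtoC (INR (S i)))) / RtoC (INR (S (S i)))
        * zeta0 (w + RtoC (INR (S i)))))%C; [field; apply INR_S_neq_C|].
      rewrite <- cbin_S; field; apply INR_S_neq_C. }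
  rewrite csum_scal, xi_zeta0 in E.
  2:{ unfold w; intro E1; apply RtoC_inj in E1.
      assert (0 < INR a) by apply INR_S_pos; lra. }
  assert (Hsum : csum (fun j => cbin (RtoC (INR a)) (S j) * zeta0 (w + RtoC (INR j)))%C a
    = (- RtoC 1 + RtoC 1 / RtoC (INR (S (S b))))%C).
  { unfold a at 2; rewrite csum_shift, cbin_1.
    replace (w + RtoC (INR 0))%C with w by (simpl; ring).
    replace (w - 1)%C with (- RtoC (INR a))%C in E by (rewrite <- HA; ring).
    assert (E2 : (RtoC (INR a) * zeta0 w = - (- RtoC (INR a) * zeta0 w))%C) by ring.
    rewrite E2, E; field; apply INR_S_neq_C. }
  transitivity (csum (fun j => cbin (RtoC (INR a)) (S j) * zeta0 (w + RtoC (INR j)))%C a).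
  - unfold Zint; rewrite csum_rev; apply csum_ext; intros j Hj.
    rewrite (cbin_binom a (S j)) by lia.
    replace (a - 1 - j)%nat with (a - S j)%nat by lia.
    rewrite binom_sym by lia; do 2 f_equal.
    rewrite Hw, minus_INR, S_INR by lia; rewrite <- RtoC_minus; f_equal; ring.
  - rewrite Hsum; unfold a.
    assert (P := INR_S_pos (S b)).
    rewrite <- RtoC_div, <- RtoC_opp, <- RtoC_plus by lra; f_equal.
    rewrite (S_INR (S b)) in *; field; lra.
Qed.

Lemma cder_Zint_0 : cder Zint (RtoC 0)
  (csum (fun h => RtoC (Binomial.C a h) * C_derive zeta0 (RtoC (- INR h)))%C a).
Proof.
  apply (cder_csum (fun h s => RtoC (Binomial.C a h) * zeta0 (s - RtoC (INR h)))%C); intros h Hh.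
  apply cder_scal.
  assert (Hc : cdiff zeta0 (RtoC (- INR h))).
  { apply cdiff_zeta0; intro E; apply RtoC_inj in E; generalize (pos_INR h); lra. }
  destruct Hc as [l Hl]; rewrite (cder_C_derive _ _ _ Hl).
  eapply cder_eq; [|apply (cder_comp zeta0 (fun s => s - RtoC (INR h))%C)].
  2:{ replace (RtoC 0 - RtoC (INR h))%C with (RtoC (- INR h)) by (rewrite RtoC_opp; ring); exact Hl. }
  2:{ apply cder_minus; [apply cder_id | apply cder_const]. }
  ring.
Qed.
End Integer.

(** * The theorem *)

Lemma Gamma_falling (alpha : R) (h : nat) : INR h < alpha ->
  Gamma (alpha + 1) = rff alpha (S h) * Gamma (alpha - INR h).
Proof.
  induction h as [|h IH]; intro H.
  - simpl in *; rewrite !Rminus_0_r, Gamma_succ by lra; ring.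
  - assert (Hs := S_INR h).
    rewrite IH by lra.
    replace (alpha - INR h) with ((alpha - INR (S h)) + 1) at 1 by lra.
    rewrite Gamma_succ by lra.
    change (rff alpha (S (S h))) with (rff alpha (S h) * (alpha - INR (S h))); ring.
Qed.

Lemma residue_Gamma (alpha : R) (h : nat) : INR h < alpha ->
  Gamma (alpha + 1) / (INR (fact (h + 1)) * Gamma (alpha - INR h)) = rff alpha (S h) / INR (fact (S h)).
Proof.
  intro H; rewrite (Gamma_falling alpha h H), Nat.add_1_r.
  assert (G : 0 < Gamma (alpha - INR h)) by (apply Gamma_pos; lra).
  field; split; [apply INR_fact_neq_0 | lra].
Qed.

(** The indicator lifts the sawtooth from -1/2 to 1/2 when n^alpha is an integer; otherwise the
    ceiling exceeds the floor by 1. Thus the exponent of E_0 in the theorem is psi(n). *)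
Lemma B1_indicator_psi (alpha : R) (n : nat) :
  B1 (Rpower (INR n) alpha) + indicator (in_N (Rpower (INR n) alpha)) = psi alpha n.
Proof.
  unfold psi; set (x := Rpower (INR n) alpha). assert (Hx : 0 < x) by apply Rpower_pos.
  unfold B1, indicator; rewrite frac_part_floor.
  assert (F := Zfloor_bound x).
  destruct (excluded_middle_informative (in_N x)) as [[m [_ Hm]]|Hn].
  - rewrite Hm, INR_IZR_INZ, ZfloorZ, (Zceil_eq (Z.of_nat m)) by lra; lra.
  - rewrite (Zceil_eq (Zfloor x + 1) x), plus_IZR; [lra|].
    rewrite plus_IZR; split; [|lra].
    destruct (Rle_lt_or_eq_dec _ _ (proj1 F)) as [Hl|He]; [lra|exfalso; apply Hn].
    assert (Hz : (0 < Zfloor x)%Z) by (apply lt_IZR; lra).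
    exists (Z.to_nat (Zfloor x)); split; [lia|].
    rewrite INR_IZR_INZ, Z2Nat.id by lia; lra.
Qed.

Lemma sum_n_m_from_1 (f : nat -> R) (n : nat) : sum_n_m f 1 n = rsum (fun j => f (S j)) n.
Proof.
  induction n as [|n IH]; [rewrite sum_n_m_zero by lia; reflexivity|].
  rewrite sum_n_Sm by lia; rewrite IH; reflexivity.
Qed.

Lemma csum_n_m_from_1 (f : nat -> C) (n : nat) :
  sum_n_m (G := C_AbelianMonoid) f 1 n = csum (fun j => f (S j)) n.
Proof.
  induction n as [|n IH]; [rewrite sum_n_m_zero by lia; reflexivity|].
  rewrite sum_n_Sm by lia; rewrite IH; reflexivity.
Qed.

Lemma log_term_expansion (alpha : R) (k i : nat) : ceiln alpha = S k ->
  log_term alpha (i + 2) = - psi alpha (S (S i)) * ldiff i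
    - Rpower (INR (S (S i))) alpha * log_tail k (/ INR (S (S i))).
Proof.
  intro Hc; replace (i + 2)%nat with (S (S i)) by lia.
  assert (H := inv_SS_bound i).
  unfold log_term; rewrite B1_indicator_psi, Hc.
  set (n := INR (S (S i))) in *.
  replace (1 / n) with (/ n) by (unfold Rdiv; ring).
  rewrite ln_div by apply Rpower_pos.
  assert (LR : forall x y, ln (Rpower x y) = y * ln x) by (intros; apply ln_exp).
  rewrite !LR; unfold Eprim, ldiff, log_tail; fold n.
  rewrite ln_mult, ln_exp by (try apply exp_pos; lra).
  rewrite sum_n_m_from_1; ring.
Qed.

Lemma ceil_floor_between (alpha : R) (k : nat) : INR k < alpha < INR (S k) ->
  ceiln alpha = S k /\ floorn alpha = k.
Proof.
  intro H; unfold ceiln, floorn; rewrite INR_IZR_INZ in H; rewrite (INR_IZR_INZ (S k)) in H.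
  rewrite (Zceil_eq (Z.of_nat (S k))), (Zfloor_eq (Z.of_nat k)), !Nat2Z.id; [auto| |];
    rewrite Nat2Z.inj_succ, succ_IZR in *; lra.
Qed.

Lemma ceil_floor_nat (n : nat) : ceiln (INR n) = n /\ floorn (INR n) = n.
Proof.
  unfold ceiln, floorn; rewrite INR_IZR_INZ, ZfloorZ, (Zceil_eq (Z.of_nat n)) by lra.
  rewrite !Nat2Z.id; auto.
Qed.

Lemma indicator_true (P : Prop) : P -> indicator P = 1.
Proof. intro H; unfold indicator; destruct (excluded_middle_informative P); tauto. Qed.

Lemma indicator_false (P : Prop) : ~ P -> indicator P = 0.
Proof. intro H; unfold indicator; destruct (excluded_middle_informative P); tauto. Qed.

Lemma not_in_N_between (alpha : R) (k : nat) : INR k < alpha < INR (S k) -> ~ in_N alpha.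
Proof.
  intros H [n [_ E]]; rewrite E in H; destruct H as [H1 H2].
  apply INR_lt in H1; apply INR_lt in H2; lia.
Qed.

Lemma in_N_or_between (alpha : R) : 0 < alpha ->
  (exists b, alpha = INR (S b)) \/ (exists k, INR k < alpha < INR (S k)).
Proof.
  intro H; destruct (nfloor_ex alpha) as [k [[H1|H1] H2]]; [lra | |].
  - right; exists k; rewrite S_INR; lra.
  - left; destruct k as [|b]; [simpl in H1; lra|]; exists b; auto.
Qed.

Theorem proposition1p1 (kappa alpha : R)
    (kappa_pos : 0 < kappa) (alpha_def : alpha = 1 / kappa) :
  exists sigma : R, 0 < sigma <= 1 /\
  exists Z : C -> C,
    (forall s : C, alpha < Re s -> is_PS_zeta kappa s (Z s)) /\
    holomorphic_on
      (fun s => - sigma < Re s /\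
                forall h : nat, (h < ceiln alpha)%nat -> s <> RtoC (alpha - INR h)) Z /\
    (forall h : nat, (h < ceiln alpha)%nat ->
       simple_pole_residue Z (RtoC (alpha - INR h))
         (RtoC (Gamma (alpha + 1) / (INR (fact (h + 1)) * Gamma (alpha - INR h))))) /\
    (forall eps : R, 0 < eps ->
       exists K : R, forall s : C, eps - sigma <= Re s -> 1 <= Rabs (Im s) ->
         Cmod (Z s) <= K * (Cmod s * (Cmod s + 1) ^ (floorn alpha + 1))) /\
    Z (RtoC 0) =
      RtoC (- (indicator (~ in_N alpha) / 2) - indicator (in_N alpha) / (1 + kappa)) /\
    (forall a : nat, (1 <= a)%nat -> alpha = INR a ->
       is_derive (K := C_AbsRing) (V := C_NormedModule) Z (RtoC 0)
         (sum_n_m (G := C_AbelianMonoid)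
            (fun h => RtoC (Binomial.C a h) * C_derive zeta (RtoC (- INR h)))%C
            0 (a - 1))) /\
    (~ in_N alpha ->
       exists L : R,
         is_series (fun k => log_term alpha (k + 2)) L /\
         is_derive (K := C_AbsRing) (V := C_NormedModule) Z (RtoC 0)
           (sum_n_m (G := C_AbelianMonoid)
              (fun h => (zeta (RtoC (INR h - alpha)) - RtoC 1) / RtoC (INR h))%C
              1 (ceiln alpha)
            + RtoC L)%C).
Proof.
  assert (Ha : 0 < alpha) by (rewrite alpha_def; apply Rdiv_lt_0_compat; lra).
  destruct (in_N_or_between alpha Ha) as [[b Eb]|[k Hk]].
  - destruct (ceil_floor_nat (S b)) as [Ec Ef]; rewrite <- Eb in Ec, Ef.
    assert (HN : in_N alpha) by (exists (S b); split; [lia | exact Eb]).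
    (* [Zint] is meromorphic in the whole plane, so sigma is the largest value that the statement
       allows. *)
    exists 1; split; [lra|]; exists (Zint b); rewrite Ec, Ef; split; [|split; [|split; [|split; [|split; [|split]]]]].
    + intros s Hs; apply (PS_zeta_of_limit kappa alpha); try assumption.
      rewrite Eb in *; apply Wsum_Zint, Hs.
    + intros s [_ Hs]; apply cder_differentiable, cdiff_Zint; rewrite Eb in Hs; exact Hs.
    + intros h Hh; rewrite residue_Gamma; [|rewrite Eb; apply lt_INR, Hh].
      rewrite Eb; apply pole_Zint, Hh.
    + intros eps Heps; exact (Zint_growth b eps Heps).
    + rewrite Zint_0, (indicator_true (in_N alpha)), (indicator_false (~ in_N alpha)) by tauto; f_equal.
      assert (Ek : kappa = / alpha) by (rewrite alpha_def; field; lra).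
      rewrite Ek, Eb; assert (P := INR_S_pos b); field; lra.
    + intros a Ha1 Ea; assert (E : a = S b) by (apply INR_eq; rewrite <- Ea; exact Eb); subst a.
      replace (S b - 1)%nat with b by lia.
      change (sum_n_m ?f 0 b) with (sum_n (G := C_AbelianMonoid) f b); rewrite csum_sum_n.
      apply cder_is_derive.
      eapply cder_eq; [|apply cder_Zint_0].
      apply csum_ext; intros h _; f_equal; symmetry; apply zeta_zeta0_real.
      generalize (pos_INR h); lra.
    + intro HN'; contradiction.
  - destruct (ceil_floor_between alpha k Hk) as [Ec Ef].
    assert (HN : ~ in_N alpha) by exact (not_in_N_between alpha k Hk).
    destruct (psi_sum alpha k Hk) as [Cp [d [Hd [HCp Hpsi]]]].
    assert (Hsg1 := Rmin_l d (INR (S k) - alpha)). assert (Hsg2 := Rmin_r d (INR (S k) - alpha)).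
    (* The bound d is what the series of [psi_term] permits, and ceil(alpha) - alpha what that of
       [main_term] permits. *)
    exists (Rmin d (INR (S k) - alpha)); split.
    { split; [apply Rmin_glb_lt; lra | lra]. }
    exists (Znon alpha k); rewrite Ec, Ef; split; [|split; [|split; [|split; [|split; [|split]]]]].
    + intros s Hs; apply (PS_zeta_of_limit kappa alpha); try assumption.
      apply (Wsum_Znon alpha k Cp d); assumption.
    + intros s [Hs1 Hs2]; apply cder_differentiable, (cdiff_Znon alpha k Cp d); try assumption; lra.
    + intros h Hh; rewrite residue_Gamma.
      * apply (pole_Znon alpha k Cp d); assumption.
      * assert (INR h <= INR k) by (apply le_INR; lia); lra.
    + intros eps Heps; apply (Znon_growth alpha k Cp d); assumption.
    + rewrite (Znon_0 alpha k Cp d) by assumption.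
      rewrite (indicator_true (~ in_N alpha)), (indicator_false (in_N alpha)) by assumption.
      rewrite <- RtoC_opp; f_equal; field; lra.
    + intros a Ha1 Ea; exfalso; apply HN; exists a; auto.
    + intros _; destruct (is_derive_Znon_0 alpha k Cp d Hk Hd HCp Hpsi) as [L [HL1 HL2]].
      exists L; split.
      * apply (is_series_ext (K := R_AbsRing) (V := R_NormedModule) _ _ _ (fun i => eq_sym (log_term_expansion alpha k i Ec))).
        exact HL1.
      * rewrite csum_n_m_from_1; apply cder_is_derive.
        eapply cder_eq; [|exact HL2].
        f_equal; apply csum_ext; intros j Hj; do 2 f_equal; symmetry; apply zeta_zeta0_real.
        assert (INR j <= INR k) by (apply le_INR; lia); rewrite S_INR; lra.
Qed.
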